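(* Let $\varphi\colon R\to S$ be a homomorphism of rings with $\operatorname{fd}\varphi$ finite. If $S$ is noetherian and admits a dualizing complex, then the following hold: (a) If $\tilde B$ is a Gorenstein injective $S$-module and $F$ is a flat $R$-module, then $\tilde B\otimes_R F$ is Gorenstein injective over $S$. (b) If $P$ is a projective $R$-module and $\tilde A$ is a Gorenstein flat $S$-module, then $\mathrm{Hom}_R(P,\tilde A)$ is Gorenstein flat over $S$. (c) If $\tilde B$ is a Gorenstein injective $S$-module and $I$ is an injective $R$-module, then $\mathrm{Hom}_R(\tilde B,I)$ is Gorenstein flat over $S$.
   Context: All rings are commutative, unital and non-zero. $S$-modules are viewed as $R$-modules via $\varphi$, and $\tilde B\otimes_RF$, $\mathrm{Hom}_R(P,\tilde A)$, $\mathrm{Hom}_R(\tilde B,I)$ carry the $S$-structure coming from the $S$-module argument. $\operatorname{fd}\varphi:=\operatorname{fd}_RS$ is the flat dimension of $S$ as an $R$-module. A dualizing complex for a noetherian ring $S$ is a complex $D$ of $S$-modules with bounded, degreewise finitely generated homology, of finite injective dimension, such that the homothety morphism $S\to\mathbf R\mathrm{Hom}_S(D,D)$ is an isomorphism in the derived category $\mathsf D(S)$. An $S$-module $B$ is Gorenstein injective if there is an exact complex $\mathbf I$ of injective $S$-modules with $B\cong\mathrm{Ker}(I_0\to I_{-1})$ such that $\mathrm{Hom}_S(J,\mathbf I)$ is exact for every injective $S$-module $J$. An $S$-module $A$ is Gorenstein flat if there is an exact complex $\mathbf F$ of flat $S$-modules with $A\cong\mathrm{Coker}(F_1\to F_0)$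 such that $J\otimes_S\mathbf F$ is exact for every injective $S$-module $J$. *)

(* Defs.v *)
From HB Require Import structures.
From mathcomp Require Import all_boot all_order all_algebra.
From mathcomp Require Import boolp.

Set Implicit Arguments.
Unset Strict Implicit.
Unset Printing Implicit Defensive.

Import GRing.Theory.
Local Open Scope ring_scope.
Local Open Scope quotient_scope.

Definition lin_of (R : comNzRingType) (M N : lmodType R) (f : M -> N)
    (fL : linear f) : {linear M -> N} :=
  HB.pack f (GRing.isLinear.Build R M N *:%R f fL).

(* phi only serves to select the R-module structure on M.                     *)
Definition restr (R S : comNzRingType) (phi : {rmorphism R -> S})
  (M : lmodType S) : Type := M.

Section Restriction.
Variables (R S : comNzRingType) (phi : {rmorphism R -> S}) (M : lmodType S).
HB.instance Definition _ := GRing.Zmodule.copy (restr phi M) M.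

Let scale (r : R) (m : restr phi M) : restr phi M := phi r *: (m : M).

Fact restr_scaleA a b m : scale a (scale b m) = scale (a * b) m.
Proof. by rewrite /scale scalerA rmorphM. Qed.
Fact restr_scale1 : left_id 1 scale.
Proof. by move=> m; rewrite /scale rmorph1 scale1r. Qed.
Fact restr_scaleDr : right_distributive scale +%R.
Proof. by move=> a m n; rewrite /scale scalerDr. Qed.
Fact restr_scaleDl m : {morph scale^~ m : a b / a + b}.
Proof. by move=> a b; rewrite /scale rmorphD scalerDl. Qed.

HB.instance Definition _ := GRing.Zmodule_isLmodule.Build R (restr phi M)
  restr_scaleA restr_scale1 restr_scaleDr restr_scaleDl.
End Restriction.

Definition hom (R : comNzRingType) (M N : lmodType R) : Type :=
  {linear M -> N}.

Section Hom.
Variable R : comNzRingType.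

Lemma homP (M N : lmodType R) (f g : hom M N) : f =1 g -> f = g.
Proof.
case: f g => [f [[fD] [fZ]]] [g [[gD] [gZ]]] /= /funext fg.
case: _ / fg gD gZ => gD gZ.
by rewrite (Prop_irrelevance fD gD) (Prop_irrelevance fZ gZ).
Qed.

Variables M N : lmodType R.
Implicit Types f g h : hom M N.

HB.instance Definition _ := gen_eqMixin (hom M N).
HB.instance Definition _ := gen_choiceMixin (hom M N).

Fact hom_zero_linear : linear (fun _ : M => 0 : N).
Proof. by move=> a x y; rewrite scaler0 addr0. Qed.
Definition hom_zero : hom M N := lin_of hom_zero_linear.

Fact hom_opp_linear f : linear (fun x => - f x).
Proof. by move=> a x y; rewrite linearP opprD scalerN. Qed.
Definition hom_opp f : hom M N := lin_of (hom_opp_linear f).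

Fact hom_add_linear f g : linear (fun x => f x + g x).
Proof. by move=> a x y; rewrite !linearP scalerDr addrACA. Qed.
Definition hom_add f g : hom M N := lin_of (hom_add_linear f g).

Fact hom_scale_linear a f : linear (fun x => a *: f x).
Proof. by move=> b x y; rewrite linearP scalerDr !scalerA mulrC. Qed.
Definition hom_scale a f : hom M N := lin_of (hom_scale_linear a f).

Fact hom_addA : associative hom_add.
Proof. by move=> f g h; apply: homP => x /=; rewrite addrA. Qed.
Fact hom_addC : commutative hom_add.
Proof. by move=> f g; apply: homP => x /=; rewrite addrC. Qed.
Fact hom_add0 : left_id hom_zero hom_add.
Proof. by move=> f; apply: homP => x /=; rewrite add0r. Qed.
Fact hom_addN : left_inverse hom_zero hom_opp hom_add.
Proof. by move=> f; apply: homP => x /=; rewrite addNr. Qed.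

HB.instance Definition _ :=
  GRing.isZmodule.Build (hom M N) hom_addA hom_addC hom_add0 hom_addN.

Fact hom_scaleA a b f : hom_scale a (hom_scale b f) = hom_scale (a * b) f.
Proof. by apply: homP => x /=; rewrite scalerA. Qed.
Fact hom_scale1 : left_id 1 hom_scale.
Proof. by move=> f; apply: homP => x /=; rewrite scale1r. Qed.
Fact hom_scaleDr : right_distributive hom_scale +%R.
Proof. by move=> a f g; apply: homP => x /=; rewrite scalerDr. Qed.
Fact hom_scaleDl f : {morph hom_scale^~ f : a b / a + b}.
Proof. by move=> a b; apply: homP => x /=; rewrite scalerDl. Qed.

HB.instance Definition _ := GRing.Zmodule_isLmodule.Build R (hom M N)
  hom_scaleA hom_scale1 hom_scaleDr hom_scaleDl.
End Hom.

Definition hom_comp (R : comNzRingType) (L M N : lmodType R)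
  (g : hom M N) (f : hom L M) : hom L N := g \o f.

Fact hom_post_linear (R : comNzRingType) (J M N : lmodType R) (g : hom M N) :
  linear (fun f : hom J M => hom_comp g f).
Proof. by move=> a f f'; apply: homP => x /=; rewrite linearP. Qed.

Definition hom_post (R : comNzRingType) (J M N : lmodType R) (g : hom M N) :
  {linear hom J M -> hom J N} := lin_of (@hom_post_linear R J M N g).

(* [hom_cod phi P A] is Hom_R(P, A) with S acting through the S-module A;     *)
(* [hom_dom phi B I] is Hom_R(B, I) with S acting through the S-module B.     *)
Section HomChange.
Variables (R S : comNzRingType) (phi : {rmorphism R -> S}).

Definition hom_cod (P : lmodType R) (A : lmodType S) : Type :=
  hom P (restr phi A).
Definition hom_dom (B : lmodType S) (I : lmodType R) : Type :=
  hom (restr phi B) I.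

Section Cod.
Variables (P : lmodType R) (A : lmodType S).
HB.instance Definition _ := GRing.Zmodule.copy (hom_cod P A)
  (hom P (restr phi A)).

Fact cod_scale_linear (s : S) (f : hom P (restr phi A)) :
  linear (fun p => s *: (f p : A) : restr phi A).
Proof.
move=> a x y; rewrite linearP [LHS]scalerDr; congr (_ + _).
by rewrite [LHS]scalerA mulrC -scalerA.
Qed.
Definition cod_scale (s : S) (f : hom_cod P A) : hom_cod P A :=
  lin_of (cod_scale_linear s f).

Fact cod_scaleA a b f : cod_scale a (cod_scale b f) = cod_scale (a * b) f.
Proof. by apply: homP => x; rewrite /= scalerA. Qed.
Fact cod_scale1 : left_id 1 cod_scale.
Proof. by move=> f; apply: homP => x; rewrite /= scale1r. Qed.
Fact cod_scaleDr : right_distributive cod_scale +%R.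
Proof.
by move=> a f g; apply: homP => x; exact: (scalerDr a (f x : A) (g x : A)).
Qed.
Fact cod_scaleDl f : {morph cod_scale^~ f : a b / a + b}.
Proof.
by move=> a b; apply: homP => x; exact: (scalerDl (f x : A) a b).
Qed.

HB.instance Definition _ := GRing.Zmodule_isLmodule.Build S (hom_cod P A)
  cod_scaleA cod_scale1 cod_scaleDr cod_scaleDl.
End Cod.

Section Dom.
Variables (B : lmodType S) (I : lmodType R).
HB.instance Definition _ := GRing.Zmodule.copy (hom_dom B I)
  (hom (restr phi B) I).

Fact dom_scale_linear (s : S) (f : hom (restr phi B) I) :
  linear (fun b : restr phi B => f (s *: (b : B) : restr phi B)).
Proof.
move=> a x y; rewrite -linearP; congr (f _).
rewrite [LHS]scalerDr; congr (_ + _).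
by rewrite [LHS]scalerA mulrC -scalerA.
Qed.
Definition dom_scale (s : S) (f : hom_dom B I) : hom_dom B I :=
  lin_of (dom_scale_linear s f).

Fact dom_scaleA a b f : dom_scale a (dom_scale b f) = dom_scale (a * b) f.
Proof. by apply: homP => x; rewrite /= scalerA mulrC. Qed.
Fact dom_scale1 : left_id 1 dom_scale.
Proof. by move=> f; apply: homP => x; rewrite /= scale1r. Qed.
Fact dom_scaleDr : right_distributive dom_scale +%R.
Proof. by move=> a f g; apply: homP. Qed.
Fact dom_scaleDl f : {morph dom_scale^~ f : a b / a + b}.
Proof.
move=> a b; apply: homP => x /=; rewrite (scalerDl (x : B) a b).
exact: (raddfD f (a *: (x : B) : restr phi B)).
Qed.

HB.instance Definition _ := GRing.Zmodule_isLmodule.Build S (hom_dom B I)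
  dom_scaleA dom_scale1 dom_scaleDr dom_scaleDl.
End Dom.
End HomChange.

(* [tensor phi M N] is M (x)_R N with S acting through the S-module M, by     *)
(* generators and relations: a sequence [:: (m1, n1); ...] stands for         *)
(* m1 (x) n1 + ..., and [tens_eq] is the congruence generated by biadditivity *)
(* and (r m) (x) n = m (x) (r n). No generator is needed for inverses, since  *)
(* - (m (x) n) is (- m) (x) n.                                                *)
Section Tensor.
Variables (R S : comNzRingType) (phi : {rmorphism R -> S}).
Variables (M : lmodType S) (N : lmodType R).

Inductive tens_eq : seq (M * N) -> seq (M * N) -> Prop :=
| tens_refl s : tens_eq s s
| tens_sym s t : tens_eq s t -> tens_eq t s
| tens_trans t s u : tens_eq s t -> tens_eq t u -> tens_eq s u
| tens_cat s s' t t' : tens_eq s s' -> tens_eq t t' ->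
    tens_eq (s ++ t) (s' ++ t')
| tens_catC s t : tens_eq (s ++ t) (t ++ s)
| tens_0l n : tens_eq [:: (0, n)] [::]
| tens_Dl m m' n : tens_eq [:: (m + m', n)] [:: (m, n); (m', n)]
| tens_Dr m n n' : tens_eq [:: (m, n + n')] [:: (m, n); (m, n')]
| tens_bal (r : R) m n :
    tens_eq [:: (r *: (m : restr phi M) : M, n)] [:: (m, r *: n)].

Definition tens_eqb s t := `[< tens_eq s t >].
Fact tens_eqb_equiv : equiv_class_of tens_eqb.
Proof.
split=> [s|s t|t s u]; first exact/asboolP/tens_refl.
  by apply/asboolP/asboolP => /tens_sym.
by move=> /asboolP st /asboolP tu; apply/asboolP/(tens_trans st tu).
Qed.
Canonical tens_equiv := EquivRelPack tens_eqb_equiv.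

Definition tensor := {eq_quot tens_eqb}.
HB.instance Definition _ := Choice.on tensor.
HB.instance Definition _ := EqQuotient.on tensor.

Implicit Types (x y z : tensor) (s t : seq (M * N)).

Lemma tensP s t : tens_eq s t <-> \pi_tensor s = \pi_tensor t.
Proof.
by split=> [st|/eqmodP/asboolP//]; apply/eqmodP/asboolP.
Qed.

Lemma tens_repr s : tens_eq (repr (\pi_tensor s)) s.
Proof. by apply/tensP; rewrite reprK. Qed.

Let act (a : S) s := [seq (a *: p.1, p.2) | p <- s].

Fact tens_act a s t : tens_eq s t -> tens_eq (act a s) (act a t).
Proof.
elim=> {s t} [s|s t _|t s u _ st _|s s' t t' _ ss _ tt|s t|n|m m' n|m n n'|r m n].
- exact: tens_refl.
- exact: tens_sym.
- exact: tens_trans.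
- by rewrite /act !map_cat; exact: tens_cat.
- by rewrite /act !map_cat; exact: tens_catC.
- by rewrite /act /= scaler0; exact: tens_0l.
- by rewrite /act /= scalerDr; exact: tens_Dl.
- exact: tens_Dr.
- rewrite /act /= [X in (X, n)](_ : _ = r *: (a *: m : restr phi M)).
    exact: tens_bal.
  by rewrite [LHS]scalerA mulrC -scalerA.
Qed.

Definition tens_zero : tensor := \pi_tensor [::].
Definition tens_add x y : tensor := \pi_tensor (repr x ++ repr y).
Definition tens_scale a x : tensor := \pi_tensor (act a (repr x)).
Definition tens_opp x : tensor := tens_scale (-1) x.

Lemma tens_addE s t :
  tens_add (\pi_tensor s) (\pi_tensor t) = \pi_tensor (s ++ t).
Proof. by apply/tensP/tens_cat; apply: tens_repr. Qed.
Lemma tens_scaleE a s : tens_scale a (\pi_tensor s) = \pi_tensor (act a s).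
Proof. exact/tensP/tens_act/tens_repr. Qed.

Lemma tensor_ind (P : tensor -> Prop) :
  (forall s, P (\pi_tensor s)) -> forall x, P x.
Proof. by move=> Ps x; rewrite -[x]reprK. Qed.

Fact tens_addA : associative tens_add.
Proof.
elim/tensor_ind=> s; elim/tensor_ind=> t; elim/tensor_ind=> u.
by rewrite !tens_addE catA.
Qed.
Fact tens_addC : commutative tens_add.
Proof.
elim/tensor_ind=> s; elim/tensor_ind=> t.
by rewrite !tens_addE; apply/tensP/tens_catC.
Qed.
Fact tens_add0 : left_id tens_zero tens_add.
Proof. by elim/tensor_ind=> s; rewrite tens_addE. Qed.
Fact tens_scaleDl x : {morph tens_scale^~ x : a b / a + b >-> tens_add a b}.
Proof.
elim/tensor_ind: x => s a b; rewrite !tens_scaleE tens_addE; apply/tensP.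
elim: s => [|[m n] s IHs] /=; first exact: tens_refl.
rewrite scalerDl; apply: tens_trans (tens_cat (tens_Dl _ _ _) IHs) _.
have := tens_cat (tens_refl [:: (a *: m, n)])
  (tens_cat (tens_catC [:: (b *: m, n)] (act a s)) (tens_refl (act b s))).
by rewrite -[(act a s ++ _) ++ _]catA.
Qed.
Fact tens_scale0 x : tens_scale 0 x = tens_zero.
Proof.
elim/tensor_ind: x => s; rewrite tens_scaleE; apply/tensP.
elim: s => [|[m n] s IHs] /=; first exact: tens_refl.
by rewrite scale0r -cat1s; apply: (tens_cat (tens_0l n) IHs).
Qed.
Fact tens_scale1 : left_id 1 tens_scale.
Proof.
elim/tensor_ind=> s; rewrite tens_scaleE; congr \pi_tensor.
by elim: s => [|[m n] s /= ->] //=; rewrite scale1r.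
Qed.
Fact tens_addN : left_inverse tens_zero tens_opp tens_add.
Proof.
move=> x; rewrite -{2}[x]tens_scale1 -tens_scaleDl addNr; exact: tens_scale0.
Qed.

HB.instance Definition _ :=
  GRing.isZmodule.Build tensor tens_addA tens_addC tens_add0 tens_addN.

Fact tens_scaleA a b x : tens_scale a (tens_scale b x) = tens_scale (a * b) x.
Proof.
elim/tensor_ind: x => s; rewrite !tens_scaleE; congr \pi_tensor.
by rewrite /act -map_comp; apply: eq_map => -[m n] /=; rewrite scalerA.
Qed.
Fact tens_scaleDr : right_distributive tens_scale +%R.
Proof.
move=> a; elim/tensor_ind=> s; elim/tensor_ind=> t.
rewrite -[LHS]/(tens_scale a (tens_add _ _)) -[RHS]/(tens_add _ _).
by rewrite !(tens_addE, tens_scaleE) /act map_cat.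
Qed.

HB.instance Definition _ := GRing.Zmodule_isLmodule.Build S tensor
  tens_scaleA tens_scale1 tens_scaleDr tens_scaleDl.
End Tensor.

Section TensorMap.
Variables (R S : comNzRingType) (phi : {rmorphism R -> S}).
Variables (M : lmodType S) (N N' : lmodType R) (g : hom N N').

Let mapr (s : seq (M * N)) := [seq (p.1, g p.2) | p <- s].

Fact tens_mapr s t : tens_eq phi s t -> tens_eq phi (mapr s) (mapr t).
Proof.
elim=> {s t} [s|s t _|t s u _ st _|s s' t t' _ ss _ tt|s t|n|m m' n|m n n'|r m n].
- exact: tens_refl.
- exact: tens_sym.
- exact: tens_trans.
- by rewrite /mapr !map_cat; exact: tens_cat.
- by rewrite /mapr !map_cat; exact: tens_catC.
- exact: tens_0l.
- exact: tens_Dl.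
- by rewrite /mapr /= linearD; exact: tens_Dr.
- by rewrite /mapr /= linearZ; exact: tens_bal.
Qed.

Definition tens_map_fun (x : tensor phi M N) : tensor phi M N' :=
  \pi_(tensor phi M N') (mapr (repr x)).

Lemma tens_map_funE s :
  tens_map_fun (\pi_(tensor phi M N) s) = \pi_(tensor phi M N') (mapr s).
Proof. exact/tensP/tens_mapr/tens_repr. Qed.

Fact tens_map_linear : linear tens_map_fun.
Proof.
move=> a; elim/tensor_ind=> s; elim/tensor_ind=> t.
rewrite -[X in tens_map_fun X]/(tens_add (tens_scale _ _) _).
rewrite -[RHS]/(tens_add (tens_scale _ _) _).
rewrite !(tens_addE, tens_scaleE, tens_map_funE) /mapr map_cat -!map_comp.
by congr (\pi_(tensor phi M N') _).
Qed.

Definition tens_map : {linear tensor phi M N -> tensor phi M N'} :=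
  lin_of tens_map_linear.

Lemma tens_map0 : (forall n, g n = 0) -> forall x, tens_map x = 0.
Proof.
move=> g0; elim/tensor_ind=> s; rewrite [LHS]tens_map_funE.
apply: (tensP phi _ [::]).1; elim: s => [|[m n] s IHs] /=.
  exact: tens_refl.
apply: (tens_cat (s := [:: _]) (s' := [::])) IHs.
rewrite g0 -(scale0r (0 : N')).
apply: tens_trans (tens_sym (@tens_bal _ _ phi _ _ 0 m 0)) _.
rewrite scale0r; exact: tens_0l.
Qed.
End TensorMap.

Definition tens (R : comNzRingType) (M N : lmodType R) : lmodType R :=
  tensor (idfun : {rmorphism R -> R}) M N.

Section Modules.
Variable R : comNzRingType.
Implicit Types L M N F I P : lmodType R.

Definition injective_module I := forall M N (f : {linear M -> N})
  (g : {linear M -> I}), injective f ->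
  exists h : {linear N -> I}, forall x, h (f x) = g x.

Definition projective_module P := forall M N (f : {linear M -> N})
  (g : {linear P -> N}), (forall y, exists x, f x = y) ->
  exists h : {linear P -> M}, forall x, f (h x) = g x.

Definition flat_module F := forall M N (f : {linear M -> N}), injective f ->
  injective (tens_map idfun F f : tens F M -> tens F N).

Definition is_zero M := forall x : M, x = 0.

Definition is_kernel L M N (f : {linear M -> N}) := exists i : {linear L -> M},
  injective i /\ forall x, f x = 0 <-> exists y, i y = x.

Definition is_cokernel L M N (f : {linear M -> N}) :=
  exists p : {linear N -> L}, (forall z, exists y, p y = z) /\
  forall y, p y = 0 <-> exists x, f x = y.

Definition noetherian := forall a : {pred R^o}, submod_closed a ->
  exists s : seq R, {subset s <= a} /\
  forall x, x \in a -> exists c : nat -> R, x = \sum_(k < size s) c k * s`_k.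
End Modules.

(* Homological grading. Only the components [diff i j] with i = j + 1 carry   *)
(* information; the others vanish. This avoids transports between X (i + 1)   *)
(* and X j.                                                                   *)
Record complex (R : comNzRingType) := Complex {
  cmod :> int -> lmodType R;
  diff : forall i j, {linear cmod i -> cmod j};
  diff_shape : forall i j, i != j + 1 -> forall x, diff i j x = 0;
  diff_diff : forall i j k x, diff j k (diff i j x) = 0 }.
Arguments diff {R} c i j.
Arguments diff_shape {R} c {i j} _ x.
Arguments diff_diff {R} c i j k x.

Section Complexes.
Variable R : comNzRingType.
Implicit Types X Y E : complex R.

Definition is_cycle X i (x : X i) := diff X i (i - 1) x = 0.
Definition is_boundary X i (x : X i) := exists y, diff X (i + 1) i y = x.
Definition exact_at X i := forall x : X i, is_cycle x -> is_boundary x.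
Definition exact_complex X := forall i, exact_at X i.

Definition bounded_homology X :=
  exists N : nat, forall i : int, (N < absz i)%N -> exact_at X i.

Definition fg_homology X := forall i, exists s : seq (X i),
  (forall z, z \in s -> is_cycle z) /\
  forall x : X i, is_cycle x ->
  exists c : nat -> R, is_boundary (x - \sum_(k < size s) c k *: s`_k).

Section ModuleComplex.
Variables (J : lmodType R) (X : complex R).

Fact hom_modC_shape i j : i != j + 1 ->
  forall f : hom J (X i), hom_post J (diff X i j) f = 0.
Proof. by move=> ij f; apply: homP => x; apply: diff_shape. Qed.
Fact hom_modC_diff i j k (f : hom J (X i)) :
  hom_post J (diff X j k) (hom_post J (diff X i j) f) = 0.
Proof. by apply: homP => x; apply: diff_diff. Qed.
Definition hom_module_complex : complex R :=
  @Complex R (fun i => hom J (X i)) (fun i j => hom_post J (diff X i j))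
    hom_modC_shape hom_modC_diff.

Fact tens_modC_shape i j : i != j + 1 ->
  forall x : tens J (X i), tens_map idfun J (diff X i j) x = 0.
Proof.
by move=> ij; apply: tens_map0; apply: diff_shape.
Qed.
Fact tens_modC_diff i j k (x : tens J (X i)) :
  tens_map idfun J (diff X j k) (tens_map idfun J (diff X i j) x) = 0.
Proof.
rewrite -[LHS]/(tens_map_fun _ (tens_map_fun _ x)).
elim/tensor_ind: x => s; rewrite !tens_map_funE -map_comp.
rewrite (@eq_map _ _ _ (fun p => (p.1, hom_zero (X i) (X k) p.2))); last first.
  by move=> [m n] /=; rewrite diff_diff.
rewrite -tens_map_funE; exact: (tens_map0 (g := hom_zero (X i) (X k))).
Qed.
Definition tens_module_complex : complex R :=
  @Complex R (fun i => tens J (X i))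
    (fun i j => tens_map idfun J (diff X i j)) tens_modC_shape tens_modC_diff.
End ModuleComplex.

(* The degree n part of the complex Hom_R(X, Y): families of maps             *)
(* X i -> Y (i + n), again doubly indexed with vanishing other components.    *)
Section HomComplex.
Variables X Y : complex R.

Record ghom (n : int) := GHom {
  gmap :> forall i j, hom (X i) (Y j);
  gmap_shape : forall i j, j != i + n -> gmap i j = 0 }.

Lemma ghomP n (f g : ghom n) : (forall i j, f i j =1 g i j) -> f = g.
Proof.
case: f g => [f fs] [g gs] /= fg.
have {}fg : f = g.
  by apply: functional_extensionality_dep => i;
    apply: functional_extensionality_dep => j; exact: homP (fg i j).
by case: _ / fg gs => gs; rewrite (Prop_irrelevance fs gs).
Qed.

Section Degree.
Variable n : int.
Implicit Types f g h : ghom n.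

HB.instance Definition _ := gen_eqMixin (ghom n).
HB.instance Definition _ := gen_choiceMixin (ghom n).

Definition ghom_zero : ghom n := @GHom n (fun i j => 0) (fun _ _ _ => erefl).

Fact ghom_opp_shape f i j : j != i + n -> - f i j = 0.
Proof. by move=> ij; rewrite gmap_shape // oppr0. Qed.
Definition ghom_opp f := GHom (ghom_opp_shape f).

Fact ghom_add_shape f g i j : j != i + n -> f i j + g i j = 0.
Proof. by move=> ij; rewrite !gmap_shape // addr0. Qed.
Definition ghom_add f g := GHom (ghom_add_shape f g).

Fact ghom_scale_shape a f i j : j != i + n -> a *: f i j = 0.
Proof. by move=> ij; rewrite gmap_shape // scaler0. Qed.
Definition ghom_scale a f := GHom (ghom_scale_shape a f).

Fact ghom_addA : associative ghom_add.
Proof. by move=> f g h; apply: ghomP => i j x; rewrite /= addrA. Qed.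
Fact ghom_addC : commutative ghom_add.
Proof. by move=> f g; apply: ghomP => i j x; rewrite /= addrC. Qed.
Fact ghom_add0 : left_id ghom_zero ghom_add.
Proof. by move=> f; apply: ghomP => i j x; rewrite /= add0r. Qed.
Fact ghom_addN : left_inverse ghom_zero ghom_opp ghom_add.
Proof. by move=> f; apply: ghomP => i j x; rewrite /= addNr. Qed.

HB.instance Definition _ :=
  GRing.isZmodule.Build (ghom n) ghom_addA ghom_addC ghom_add0 ghom_addN.

Fact ghom_scaleA a b f : ghom_scale a (ghom_scale b f) = ghom_scale (a * b) f.
Proof. by apply: ghomP => i j x; rewrite /= scalerA. Qed.
Fact ghom_scale1 : left_id 1 ghom_scale.
Proof. by move=> f; apply: ghomP => i j x; rewrite /= scale1r. Qed.
Fact ghom_scaleDr : right_distributive ghom_scale +%R.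
Proof. by move=> a f g; apply: ghomP => i j x; rewrite /= scalerDr. Qed.
Fact ghom_scaleDl f : {morph ghom_scale^~ f : a b / a + b}.
Proof. by move=> a b; apply: ghomP => i j x; rewrite /= scalerDl. Qed.

HB.instance Definition _ := GRing.Zmodule_isLmodule.Build R (ghom n)
  ghom_scaleA ghom_scale1 ghom_scaleDr ghom_scaleDl.
End Degree.

(* The differential f |-> d f - (-1)^n f d, from degree n to degree m;        *)
(* it vanishes unless n = m + 1.                                              *)
Definition ghom_diff_map n m (f : ghom n) i j : hom (X i) (Y j) :=
  if n == m + 1 then
    hom_comp (diff Y (j + 1) j) (f i (j + 1))
    - (-1) ^+ absz n *: hom_comp (f (i - 1) j) (diff X i (i - 1))
  else 0.

Fact ghom_diff_map_shape n m (f : ghom n) i j :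
  j != i + m -> ghom_diff_map m f i j = 0.
Proof.
rewrite /ghom_diff_map => ij; case: eqP => [nm|_]; last by [].
have f1 : f i (j + 1) = 0.
  by apply: gmap_shape; rewrite nm addrA (inj_eq (addIr _)).
have f2 : f (i - 1) j = 0.
  by apply: gmap_shape; rewrite nm addrACA addNr addr0.
by rewrite f1 f2; apply: homP => x /=; rewrite linear0 scaler0 subr0.
Qed.

Definition ghom_diff_fun n m (f : ghom n) : ghom m :=
  GHom (@ghom_diff_map_shape n m f).

Fact ghom_diff_linear n m : linear (@ghom_diff_fun n m).
Proof.
move=> a f g; apply: ghomP => i j x /=; rewrite /ghom_diff_map.
case: eqP => _ /=; last by rewrite scaler0 addr0.
rewrite linearP scalerDr opprD scalerDr addrACA scalerN.
by rewrite [in RHS]scalerA [a * _]mulrC -[in RHS]scalerA.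
Qed.

Definition ghom_diff n m : {linear ghom n -> ghom m} :=
  lin_of (@ghom_diff_linear n m).

Fact ghom_diff_shape n m : n != m + 1 -> forall f, ghom_diff n m f = 0.
Proof.
move=> /negPf nm f; apply: ghomP => i j x /=.
by rewrite /ghom_diff_map nm.
Qed.

Fact sign_succ (n : int) : (-1) ^+ absz (n + 1) = - (-1) ^+ absz n :> R.
Proof.
case: n => [k|[|k]]; first by rewrite -PoszD [absz _]addn1 exprS mulN1r.
  by rewrite expr0 expr1 opprK.
have -> : Negz k.+1 + 1 = Negz k.
  by rewrite !NegzE -[k.+2]addn1 PoszD opprD addrNK.
by rewrite -[absz (Negz k.+1)]/k.+2 -[absz _]/k.+1 [in RHS]exprS mulN1r opprK.
Qed.

Fact ghom_diff_diff n m p f : ghom_diff m p (ghom_diff n m f) = 0.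
Proof.
apply: ghomP => i j x /=; rewrite /ghom_diff_map /= /ghom_diff_map.
case: (m =P p + 1) => [_|_]; last by [].
case: (n =P m + 1) => [nm|_]; last first.
  by rewrite /= linear0 scaler0 subr0.
rewrite /= linearB /= diff_diff diff_diff linear0 scaler0 subr0 sub0r.
have -> : (-1) ^+ absz n = - (-1) ^+ absz m :> R by rewrite nm sign_succ.
by rewrite linearZ /= scaleNr opprK subrr.
Qed.

Definition hom_complex : complex R :=
  @Complex R ghom ghom_diff ghom_diff_shape ghom_diff_diff.
End HomComplex.

(* The components f i j with i <> j vanish, so f is given by the f i i.       *)
Definition chain_map X Y (f : ghom X Y 0) :=
  forall i j x, f j j (diff X i j x) = diff Y i j (f i i x).

Definition quasi_iso X Y (f : ghom X Y 0) := chain_map f /\ forall i,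
  (forall x : X i, is_cycle x -> is_boundary (f i i x) -> is_boundary x) /\
  (forall y : Y i, is_cycle y ->
     exists x : X i, is_cycle x /\ is_boundary (y - f i i x)).

Definition semi_injective Y := (forall i, injective_module (Y i)) /\
  forall E, exact_complex E -> exact_complex (hom_complex E Y).

Definition semi_injective_resolution X Y (eta : ghom X Y 0) :=
  semi_injective Y /\ quasi_iso eta.

Definition finite_injective_dimension X := exists (Y : complex R)
  (eta : ghom X Y 0), semi_injective_resolution eta /\
  exists n : nat, forall i : int, i < - n%:Z -> is_zero (Y i).

(* RHom_R(X, X) is Hom_R(X, Y) for a semi-injective resolution eta : X -> Y,  *)
(* and the homothety morphism from R, placed in degree 0, is r |-> r eta. It  *)
(* is an isomorphism in the derived category when it is bijective in          *)
(* homology: H_n Hom_R(X, Y) = 0 for n <> 0, and R -> H_0 Hom_R(X, Y) is      *)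
(* surjective and injective.                                                  *)
Definition homothety_iso X := exists (Y : complex R) (eta : ghom X Y 0),
  [/\ semi_injective_resolution eta,
      forall n, n != 0 -> exact_at (hom_complex X Y) n,
      forall f : hom_complex X Y 0, is_cycle f ->
        exists r : R, is_boundary (f - r *: (eta : hom_complex X Y 0)) &
      forall r : R, is_boundary (r *: (eta : hom_complex X Y 0)) -> r = 0].

Definition dualizing X :=
  [/\ bounded_homology X, fg_homology X,
      finite_injective_dimension X & homothety_iso X].

Definition finite_flat_dimension (M : lmodType R) :=
  exists (n : nat) (F : complex R),
  [/\ forall i, flat_module (F i),
      forall i : int, (i < 0) || (n%:Z < i) -> is_zero (F i),
      forall i, i != 0 -> exact_at F i &
      is_cokernel M (diff F 1 0)].

Definition gorenstein_injective (B : lmodType R) := exists I : complex R,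
  [/\ exact_complex I, forall i, injective_module (I i),
      is_kernel B (diff I 0 (-1)) &
      forall J, injective_module J -> exact_complex (hom_module_complex J I)].

Definition gorenstein_flat (A : lmodType R) := exists F : complex R,
  [/\ exact_complex F, forall i, flat_module (F i),
      is_cokernel A (diff F 1 0) &
      forall J, injective_module J -> exact_complex (tens_module_complex J F)].
End Complexes.

(* Main.v *)
From HB Require Import structures.
Require Import Defs.
From mathcomp Require Import all_boot all_order all_algebra.
From mathcomp Require Import boolp classical_sets zify ring.
Import Defs.

Set Implicit Arguments.
Unset Strict Implicit.
Unset Printing Implicit Defensive.

Import GRing.Theory.
Local Open Scope ring_scope.

(* A dualizing complex is replaced by a bounded
   complex D of injective S-modules for which S -> Hom(D, D) is a homology
   isomorphism, together with a finitely generated subcomplex N such that D / N is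
   exact.  For an injective module T put G = Hom(D, T), a flat complex.  The
   evaluation D (x) G -> T is split by a cycle-valued map: over N the cone of the
   evaluation is dual to the exact cone of S -> Hom(N, D).  So T is a retract of
   D (x) G, and statements about T reduce to D, then to N, where Hom_R(P, -),
   Hom_R(-, I) and - (x)_R F commute with the functors of finitely presented
   modules.  For (b) and (c) this gives exactness of T (x) X directly.  For (a) it
   gives that maps from D into the totally acyclic complex are null-homotopic; a
   noetherian induction on the ideal of locally nilpotent elements carries this
   from D to every injective T, the prime step comparing T with
   (Gamma_p D)_p (x) G. *)

(** * Submodules, quotients and linear relations *)

(** The obstacle in (a) is that being a retract of D (x) G is not enough: Hom(D (x) G, Y) is Hom(G,
    Hom(D, Y)), and G is flat but in general not projective, so exactness of Hom(D, Y) does not pass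
    to it. Torsion and localization remove the difficulty. If every element of U is killed by powers
    of the elements of a prime p, and the elements outside p act bijectively on U, then a flat G
    behaves over U like a free module, and homotopies on U (x) G can be chosen one basis element at
    a time. In (b) and (c) exactness of D (x) X survives tensoring with the flat G, and no
    localization arises.

    Finiteness of N serves the commutation of functors; boundedness of D serves the filtration
    arguments, in which null-homotopies and exactness of total complexes are obtained degree by
    degree along a finite grading. An exact bounded complex has only null-homotopic maps into an
    injective module with a square-zero endomorphism. This makes the passage between D and N
    harmless, and it is why the targets may be totalized to injective modules without any
    grading. *)

Section Submodules.
Variable S : comNzRingType.

Record submodule (M : lmodType S) := Submodule {
  smem :> M -> Prop;
  sm0 : smem 0;
  smP : forall a x y, smem x -> smem y -> smem (a *: x + y) }.

Section Ops.
Variables (M : lmodType S) (P : submodule M).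
Lemma smD x y : P x -> P y -> P (x + y).
Proof. by move=> Px Py; rewrite -[x]scale1r; apply: smP. Qed.
Lemma smZ a x : P x -> P (a *: x).
Proof. by move=> Px; rewrite -[_ *: _]addr0; apply: smP => //; apply: sm0. Qed.
Lemma smN x : P x -> P (- x).
Proof. by rewrite -scaleN1r; apply: smZ. Qed.
Lemma smB x y : P x -> P y -> P (x - y).
Proof. by move=> Px Py; apply/smD/smN. Qed.
Lemma sm_sum (I : eqType) (r : seq I) (Q : pred I) (F : I -> M) :
  (forall i, i \in r -> Q i -> P (F i)) -> P (\sum_(i <- r | Q i) F i).
Proof.
move=> PF; rewrite big_seq_cond.
apply: (big_ind (fun x : M => P x)); [exact: sm0 | exact: smD |].
by move=> i /andP[]; apply: PF.
Qed.
End Ops.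

Definition subm (M : lmodType S) (P : submodule M) : Type := {x : M | P x}.

Section Sub.
Variables (M : lmodType S) (P : submodule M).
HB.instance Definition _ := gen_eqMixin (subm P).
HB.instance Definition _ := gen_choiceMixin (subm P).
Implicit Types x y z : subm P.

Definition sval' x : M := let: exist m _ := x in m.
Lemma sval'P x : P (sval' x). Proof. by case: x. Qed.
Lemma sval'_inj : injective sval'.
Proof. by move=> [x Px] [y Py] /= xy; apply: eq_exist. Qed.

Definition subm_zero : subm P := exist _ 0 (sm0 P).
Definition subm_add x y : subm P := exist _ _ (smD (sval'P x) (sval'P y)).
Definition subm_opp x : subm P := exist _ _ (smN (sval'P x)).
Definition subm_scale a x : subm P := exist _ _ (smZ a (sval'P x)).

Fact subm_addA : associative subm_add.
Proof. by move=> x y z; apply: sval'_inj; rewrite /= addrA. Qed.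
Fact subm_addC : commutative subm_add.
Proof. by move=> x y; apply: sval'_inj; rewrite /= addrC. Qed.
Fact subm_add0 : left_id subm_zero subm_add.
Proof. by move=> x; apply: sval'_inj; rewrite /= add0r. Qed.
Fact subm_addN : left_inverse subm_zero subm_opp subm_add.
Proof. by move=> x; apply: sval'_inj; rewrite /= addNr. Qed.
HB.instance Definition _ :=
  GRing.isZmodule.Build (subm P) subm_addA subm_addC subm_add0 subm_addN.

Fact subm_scaleA a b x : subm_scale a (subm_scale b x) = subm_scale (a * b) x.
Proof. by apply: sval'_inj; rewrite /= scalerA. Qed.
Fact subm_scale1 : left_id 1 subm_scale.
Proof. by move=> x; apply: sval'_inj; rewrite /= scale1r. Qed.
Fact subm_scaleDr : right_distributive subm_scale +%R.
Proof. by move=> a x y; apply: sval'_inj; rewrite /= scalerDr. Qed.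
Fact subm_scaleDl x : {morph subm_scale^~ x : a b / a + b}.
Proof. by move=> a b; apply: sval'_inj; rewrite /= scalerDl. Qed.
HB.instance Definition _ := GRing.Zmodule_isLmodule.Build S (subm P)
  subm_scaleA subm_scale1 subm_scaleDr subm_scaleDl.

Fact sval'_linear : linear sval'. Proof. by []. Qed.
(** Taken from an opaque existence proof, so that [incl] never unfolds during unification; [inclE]
    is its only computation rule. The keys of [proj], [comp_at], [tmap] and others follow the same
    pattern. *)
Fact incl_key : {f : {linear subm P -> M} | f =1 sval'}.
Proof. by exists (lin_of sval'_linear). Qed.
Definition incl : {linear subm P -> M} := sval incl_key.

Lemma inclE x : incl x = sval' x. Proof. exact: (svalP incl_key). Qed.
Lemma incl_inj : injective incl.
Proof. by move=> x y; rewrite !inclE => /sval'_inj. Qed.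
Lemma inclP x : P (incl x). Proof. by rewrite inclE; apply: sval'P. Qed.
Lemma incl_ex m : P m -> exists x, incl x = m.
Proof. by move=> Pm; exists (exist _ m Pm); rewrite inclE. Qed.
End Sub.

Section Quot.
Variables (M : lmodType S) (P : submodule M).

Definition quot_rel (x y : M) := `[< P (x - y) >].
Fact quot_rel_equiv : equiv_class_of quot_rel.
Proof.
split=> [x|x y|y x z]; first by apply/asboolP; rewrite subrr; apply: sm0.
  by apply/asboolP/asboolP => /smN; rewrite opprB.
move=> /asboolP xy /asboolP yz; apply/asboolP.
by rewrite -(subrK y x) -addrA; apply: smD.
Qed.
Canonical quot_equiv := EquivRelPack quot_rel_equiv.
Local Open Scope quotient_scope.
Definition quot := {eq_quot quot_rel}.
HB.instance Definition _ := Choice.on quot.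
HB.instance Definition _ := EqQuotient.on quot.

Lemma quotP x y : P (x - y) <-> \pi_quot x = \pi_quot y.
Proof.
by split=> [h|/eqmodP/asboolP//]; apply/eqmodP/asboolP.
Qed.
Definition quot_zero : quot := \pi_quot 0.
Definition quot_add (x y : quot) : quot := \pi_quot (repr x + repr y).
Definition quot_opp (x : quot) : quot := \pi_quot (- repr x).
Definition quot_scale a (x : quot) : quot := \pi_quot (a *: repr x).
Lemma quot_repr x : P (repr (\pi_quot x) - x).
Proof. by apply/quotP; rewrite reprK. Qed.
Lemma quot_addE x y : quot_add (\pi_quot x) (\pi_quot y) = \pi_quot (x + y).
Proof.
by apply/quotP; rewrite opprD addrACA; apply: smD; apply: quot_repr.
Qed.
Lemma quot_oppE x : quot_opp (\pi_quot x) = \pi_quot (- x).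
Proof. by apply/quotP; rewrite -opprD; apply/smN/quot_repr. Qed.
Lemma quot_scaleE a x : quot_scale a (\pi_quot x) = \pi_quot (a *: x).
Proof. by apply/quotP; rewrite -scalerBr; apply/smZ/quot_repr. Qed.
Lemma quot_ind (T : quot -> Prop) : (forall x, T (\pi_quot x)) -> forall x, T x.
Proof. by move=> h x; rewrite -[x]reprK. Qed.

Fact quot_addA : associative quot_add.
Proof.
by elim/quot_ind=> x; elim/quot_ind=> y; elim/quot_ind=> z;
  rewrite !quot_addE addrA.
Qed.
Fact quot_addC : commutative quot_add.
Proof. by elim/quot_ind=> x; elim/quot_ind=> y; rewrite !quot_addE addrC. Qed.
Fact quot_add0 : left_id quot_zero quot_add.
Proof. by elim/quot_ind=> x; rewrite quot_addE add0r. Qed.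
Fact quot_addN : left_inverse quot_zero quot_opp quot_add.
Proof. by elim/quot_ind=> x; rewrite quot_oppE quot_addE addNr. Qed.
HB.instance Definition _ :=
  GRing.isZmodule.Build quot quot_addA quot_addC quot_add0 quot_addN.

Fact quot_scaleA a b x : quot_scale a (quot_scale b x) = quot_scale (a * b) x.
Proof. by elim/quot_ind: x => x; rewrite !quot_scaleE scalerA. Qed.
Fact quot_scale1 : left_id 1 quot_scale.
Proof. by elim/quot_ind=> x; rewrite quot_scaleE scale1r. Qed.
Fact quot_scaleDr : right_distributive quot_scale +%R.
Proof.
move=> a; elim/quot_ind=> x; elim/quot_ind=> y.
rewrite -[_ + _ in LHS]/(quot_add _ _) -[RHS]/(quot_add _ _).
by rewrite !(quot_addE, quot_scaleE) scalerDr.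
Qed.
Fact quot_scaleDl x : {morph quot_scale^~ x : a b / a + b}.
Proof.
elim/quot_ind: x => x a b; rewrite -[RHS]/(quot_add _ _).
by rewrite !(quot_addE, quot_scaleE) scalerDl.
Qed.
HB.instance Definition _ := GRing.Zmodule_isLmodule.Build S quot
  quot_scaleA quot_scale1 quot_scaleDr quot_scaleDl.

Fact proj_linear : linear (fun x : M => \pi_quot x : quot).
Proof.
move=> a x y; rewrite -[RHS]/(quot_add (quot_scale _ _) _).
by rewrite !(quot_addE, quot_scaleE).
Qed.
Fact proj_key : {f : {linear M -> quot} | f =1 fun x => \pi_quot x : quot}.
Proof. by exists (lin_of proj_linear). Qed.
Definition proj : {linear M -> quot} := sval proj_key.
Lemma projE x : proj x = \pi_quot x.
Proof. exact: (svalP proj_key). Qed.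
Lemma proj_surj y : exists x, proj x = y.
Proof. by exists (repr y); rewrite projE; apply: reprK. Qed.
Lemma proj_eq x y : proj x = proj y <-> P (x - y).
Proof. by rewrite !projE; split=> /quotP. Qed.
Lemma proj0 x : proj x = 0 <-> P x.
Proof. rewrite projE; by have := quotP x 0; rewrite subr0 => h; split=> /h. Qed.
End Quot.

Section LinearRelations.
Variables A B : lmodType S.

(** Many maps below are easier to describe as relations, in particular the maximal partial solutions
    supplied by Zorn's lemma. Choice extracts a function, and the second hypothesis makes its values
    unique, hence the function linear. *)
Lemma lin_rel (R : submodule (A * B)%type) :
  (forall a, exists b, R (a, b)) -> (forall b, R (0, b) -> b = 0) ->
  exists f : {linear A -> B}, forall a b, R (a, b) <-> f a = b.
Proof.
move=> tot uni; have [f fR] := choice tot.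
have fU a b : R (a, b) -> f a = b.
  move=> Rab; apply/eqP; rewrite -subr_eq0; apply/eqP/uni.
  by rewrite -(subrr a); apply: (smB (fR a) Rab).
have fL : linear f by move=> a x y; apply/fU/(smP a (fR x) (fR y)).
by exists (lin_of fL) => a b; split=> [/fU|<-] //; apply: fR.
Qed.
End LinearRelations.
End Submodules.
Arguments proj {S M} P.
Arguments incl {S M} P.

Section LinearTools.
Variable S : comNzRingType.
Implicit Types A B C L M N I J : lmodType S.

Definition sm_top M : submodule M := @Submodule S M (fun=> True) I (fun _ _ _ _ _ => I).

Fact ker_smP A B (f : {linear A -> B}) a x y :
  f x = 0 -> f y = 0 -> f (a *: x + y) = 0.
Proof. by rewrite linearP => -> ->; rewrite scaler0 addr0. Qed.
Definition sm_ker A B (f : {linear A -> B}) : submodule A :=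
  @Submodule S A (fun x => f x = 0) (linear0 f) (ker_smP (f := f)).

Fact im_smP A B (f : {linear A -> B}) a x y :
  (exists u, f u = x) -> (exists u, f u = y) -> exists u, f u = a *: x + y.
Proof. by case=> u <- [v <-]; exists (a *: u + v); rewrite linearP. Qed.
Fact im_sm0 A B (f : {linear A -> B}) : exists u, f u = 0.
Proof. by exists 0; rewrite linear0. Qed.
Definition sm_im A B (f : {linear A -> B}) : submodule B :=
  @Submodule S B (fun x => exists u, f u = x) (im_sm0 f) (im_smP (f := f)).

Fact cap_smP M (P Q : submodule M) a x y :
  P x /\ Q x -> P y /\ Q y -> P (a *: x + y) /\ Q (a *: x + y).
Proof. by case=> ? ? [? ?]; split; apply: smP. Qed.
Definition sm_cap M (P Q : submodule M) : submodule M :=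
  @Submodule S M (fun x => P x /\ Q x) (conj (sm0 P) (sm0 Q)) (@cap_smP M P Q).

Lemma linear_ex A B (f : A -> B) : linear f -> exists g : {linear A -> B}, g =1 f.
Proof. by move=> fL; exists (lin_of fL). Qed.

Lemma corestr A B (f : {linear A -> B}) (P : submodule B) :
  (forall a, P (f a)) ->
  exists g : {linear A -> subm P}, forall a, incl P (g a) = f a.
Proof.
move=> Pf; have [g gE] := choice (fun a => incl_ex (Pf a)).
have [|h hE] := @linear_ex A (subm P) g; last by exists h => a; rewrite hE.
by move=> a x y; apply: incl_inj; rewrite linearP !gE linearP.
Qed.

Lemma factor A B C (q : {linear A -> B}) (f : {linear A -> C}) :
  (forall b, exists a, q a = b) -> (forall a, q a = 0 -> f a = 0) ->
  exists g : {linear B -> C}, forall a, g (q a) = f a.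
Proof.
move=> qs qf.
pose T (p : B * C) := exists a, q a = p.1 /\ f a = p.2.
have TP a x y : T x -> T y -> T (a *: x + y).
  case: x y => [x1 x2] [y1 y2] [u /= [<- <-]] [v /= [<- <-]].
  by exists (a *: u + v); rewrite !linearP.
pose R := Submodule (ex_intro _ 0 (conj (linear0 q) (linear0 f)) : T 0) TP.
have [||g gR] := @lin_rel S B C R.
- by move=> b; have [a <-] := qs b; exists (f a); exists a.
- by move=> c [a /= [qa <-]]; apply: qf.
by exists g => a; apply/gR; exists a.
Qed.

Lemma lin_inv A B (f : {linear A -> B}) :
  injective f -> (forall b, exists a, f a = b) ->
  exists g : {linear B -> A}, cancel f g /\ cancel g f.
Proof.
move=> fI fs; have [|g fg] := @factor A B A f idfun fs.
  by move=> a /= fa; apply: fI; rewrite fa linear0.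
exists g; split=> // b; have [a <-] := fs b; by rewrite fg.
Qed.

Lemma inj0 A B (f : {linear A -> B}) :
  (forall x, f x = 0 -> x = 0) -> injective f.
Proof.
move=> f0 x y /eqP; rewrite -subr_eq0 -linearB => /eqP /f0 /eqP.
by rewrite subr_eq0 => /eqP.
Qed.

(** The projection of [R] to [A] is a submodule on which [R] is the graph of a linear map;
    injectivity extends that map. Partial maps are thus given by their graphs alone, without naming
    a domain. *)
Lemma inj_ext A I (R : submodule (A * I)%type) : injective_module I ->
  (forall b, R (0, b) -> b = 0) ->
  exists f : {linear A -> I}, forall a b, R (a, b) -> f a = b.
Proof.
move=> Iinj uni.
have DP a x y : (exists b, R (x, b)) -> (exists b, R (y, b)) ->
    exists b, R (a *: x + y, b).
  by case=> b Rx [c Ry]; exists (a *: b + c); apply: (smP a Rx Ry).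
have D0 : exists b, R (0, b) by exists 0; apply: (sm0 R).
pose D := @Submodule S A (fun a => exists b, R (a, b)) D0 DP.
have RP a (x y : subm D * I) : R (incl D x.1, x.2) -> R (incl D y.1, y.2) ->
  R (incl D (a *: x + y).1, (a *: x + y).2).
  by move=> Rx Ry; have := smP a Rx Ry; rewrite linearP.
have R0 : R (incl D 0, 0) by rewrite linear0; apply: (sm0 R).
pose R' := @Submodule S (subm D * I)%type
  (fun p => R (incl D p.1, p.2)) R0 RP.
have [||g gR] := @lin_rel S _ _ R'.
- by move=> x; have [b Rb] := inclP x; exists b.
- by move=> b; rewrite /R' /= linear0; apply: uni.
have [f fg] := Iinj _ _ (incl D) g (@incl_inj _ _ D).
exists f => a b Rab.
have Da : D a by exists b.
have [x xa] := incl_ex Da; rewrite -xa in Rab *.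
by rewrite fg; apply/gR.
Qed.

(** [f] descends to the image of [q], a submodule of [B], and then extends. *)
Lemma inj_fact A B I (q : {linear A -> B}) (f : {linear A -> I}) :
  injective_module I -> (forall a, q a = 0 -> f a = 0) ->
  exists g : {linear B -> I}, forall a, g (q a) = f a.
Proof.
move=> Iinj qf.
have [|q' q'E] := @corestr _ _ q (sm_im q); first by move=> a; exists a.
have [||g gE] := @factor A (subm (sm_im q)) I q' f.
- move=> b; have [a qa] := inclP b; exists a.
  by apply: incl_inj; rewrite q'E.
- by move=> a /(congr1 (incl _)); rewrite q'E linear0 => /qf.
have [h hE] := Iinj _ _ (incl (sm_im q)) g (@incl_inj _ _ _).
by exists h => a; rewrite -gE -hE q'E.
Qed.

Lemma inj_retract I J (i : {linear I -> J}) (r : {linear J -> I}) :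
  injective_module J -> (forall x, r (i x) = x) -> injective_module I.
Proof.
move=> Jinj ri M N f g fI; have [h hE] := Jinj _ _ f (i \o g) fI.
by exists (r \o h) => x; rewrite /= hE /= ri.
Qed.

Lemma inj_split I M (i : {linear I -> M}) : injective_module I ->
  injective i -> exists r : {linear M -> I}, forall x, r (i x) = x.
Proof.
by move=> Iinj iI; have [r rE] := Iinj _ _ i idfun iI; exists r.
Qed.

(** An injective kernel splits off, so [N] is a retract of [M]: the section of [q] is induced by
    [idfun] minus [i \o r]. *)
Lemma inj_quot L M N (i : {linear L -> M}) (q : {linear M -> N}) :
  injective_module L -> injective_module M -> injective i ->
  (forall y, exists x, q x = y) -> (forall x, q x = 0 <-> exists y, i y = x) ->
  injective_module N.
Proof.
move=> Linj Minj iI qs ker; have [r ri] := inj_split Linj iI.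
have [|s sE] := @factor M N M q (GRing.sub_fun idfun (i \o r)) qs.
  by move=> _ /ker [y <-] /=; rewrite ri subrr.
apply: (@inj_retract _ _ s q) => // y; have [x <-] := qs y.
by rewrite sE /= linearB -[RHS]subr0; congr (_ - _); apply/ker; exists (r x).
Qed.
End LinearTools.

(** * Direct products and coordinate inclusions *)

Section Products.
Variables (S : comNzRingType) (T : Type) (M : T -> lmodType S).

Definition prodm : Type := forall i, M i.
HB.instance Definition _ := gen_eqMixin prodm.
HB.instance Definition _ := gen_choiceMixin prodm.
Implicit Types x y z : prodm.
Lemma prodmP x y : (forall i, x i = y i) -> x = y.
Proof. exact: functional_extensionality_dep. Qed.
Fact prodm_addA : associative (fun x y i => x i + y i : M i).
Proof. by move=> x y z; apply: prodmP => i; rewrite addrA. Qed.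
Fact prodm_addC : commutative (fun x y i => x i + y i : M i).
Proof. by move=> x y; apply: prodmP => i; rewrite addrC. Qed.
Fact prodm_add0 : left_id (fun i => 0) (fun x y i => x i + y i : M i).
Proof. by move=> x; apply: prodmP => i; rewrite add0r. Qed.
Fact prodm_addN :
  left_inverse (fun i => 0) (fun x i => - x i) (fun x y i => x i + y i : M i).
Proof. by move=> x; apply: prodmP => i; rewrite addNr. Qed.
HB.instance Definition _ := GRing.isZmodule.Build prodm
  prodm_addA prodm_addC prodm_add0 prodm_addN.
Let sc (a : S) x : prodm := fun i => a *: x i.
Fact prodm_scaleA a b x : sc a (sc b x) = sc (a * b) x.
Proof. by apply: prodmP => i; rewrite /sc scalerA. Qed.
Fact prodm_scale1 : left_id 1 sc.
Proof. by move=> x; apply: prodmP => i; rewrite /sc scale1r. Qed.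
Fact prodm_scaleDr : right_distributive sc +%R.
Proof. by move=> a x y; apply: prodmP => i; rewrite /sc scalerDr. Qed.
Fact prodm_scaleDl x : {morph sc^~ x : a b / a + b}.
Proof. by move=> a b; apply: prodmP => i; rewrite /sc scalerDl. Qed.
HB.instance Definition _ := GRing.Zmodule_isLmodule.Build S prodm
  prodm_scaleA prodm_scale1 prodm_scaleDr prodm_scaleDl.

Fact comp_linear i : linear (fun x : prodm => x i).
Proof. by []. Qed.
Fact comp_key i : {f : {linear prodm -> M i} | forall x, f x = x i}.
Proof. by exists (lin_of (comp_linear i)). Qed.
Definition comp_at i : {linear prodm -> M i} := sval (comp_key i).
Lemma comp_atE i x : comp_at i x = x i.
Proof. exact: (svalP (comp_key i)). Qed.

Lemma prodm_lin (A : lmodType S) (f : forall i, {linear A -> M i}) :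
  exists g : {linear A -> prodm}, forall a i, g a i = f i a.
Proof.
have [|g gE] := @linear_ex S A prodm (fun a i => f i a).
  by move=> a x y; apply: prodmP => i; rewrite linearP.
by exists g => a i; rewrite gE.
Qed.

Lemma prodm_inj : (forall i, injective_module (M i)) -> injective_module prodm.
Proof.
move=> Minj A B f g fI.
pose h i := cid (Minj i _ _ f (comp_at i \o g) fI).
have [k kE] := prodm_lin (fun i => projT1 (h i)).
by exists k => x; apply: prodmP => i; rewrite kE (projT2 (h i)) /= comp_atE.
Qed.
End Products.

Section InjAt.
Variables (S : comNzRingType) (T : eqType) (M : T -> lmodType S).
Lemma inj_at_ex i : exists f : {linear M i -> prodm M},
  (forall x, f x i = x) /\ forall x j, i != j -> f x j = 0.
Proof.
have [|f fE] := @linear_ex S (M i) (prodm M) (fun x => dfwith (fun j => 0 : M j) x).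
  move=> a x y; apply: prodmP => j.
  rewrite -[RHS]/(a *: dfwith _ x j + dfwith _ y j).
  have [<-|ij] := eqVneq i j; last by rewrite !dfwith_out // scaler0 addr0.
  by rewrite !dfwith_in.
by exists f; split=> [x|x j ij]; rewrite fE ?dfwith_in ?dfwith_out.
Qed.
Definition inj_at i : {linear M i -> prodm M} := projT1 (cid (inj_at_ex i)).
Lemma inj_at_in i x : inj_at i x i = x.
Proof. by case: (projT2 (cid (inj_at_ex i))) => h _; apply: h. Qed.
Lemma inj_at_out i x j : i != j -> inj_at i x j = 0.
Proof. by case: (projT2 (cid (inj_at_ex i))) => _ h; apply: h. Qed.
End InjAt.

Lemma Zorn_from (T : Type) (P : set (set T)) (A0 : set T) : P A0 ->
  (forall F : set (set T), (exists A, F A) -> (forall A, F A -> P A) ->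
     total_on F subset -> P (\bigcup_(X in F) X)%classic) ->
  exists A, [/\ P A, (A0 `<=` A)%classic & forall B, P B -> (A `<=` B)%classic ->
    (B `<=` A)%classic].
Proof.
move=> PA0 chain.
(* The chain hypothesis concerns nonempty families only, whereas [Zorn_bigcup] also tests the empty
   one, whose union is empty. Hence the extra case [set0], resolved again once a maximal set is
   found. *)
pose Q : set (set T) := fun A => A = set0 \/ P A /\ (A0 `<=` A)%classic.
have [|A [QA Amax]] := @Zorn_bigcup T Q.
  move=> F FQ tot.
  have [[X [FX X0]]|no] := pselect (exists X, F X /\ X <> set0); last first.
    left; apply/seteqP; split=> // t [X FX Xt]; exfalso; apply: no.
    by exists X; split=> // X0; rewrite X0 in Xt.
  right; pose F' := [set X | F X /\ X <> set0]%classic.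
  have -> : (\bigcup_(X in F) X = \bigcup_(X in F') X)%classic.
    apply/seteqP; split=> t [Y FY Yt]; exists Y => //; last by case: FY.
    by split=> // Y0; rewrite Y0 in Yt.
  split.
    apply: chain => [|Y [FY Y0]|Y Z [FY _] [FZ _]].
    - by exists X.
    - by case: (FQ _ FY) => // -[].
    - exact: tot.
  by move=> t A0t; exists X => //; case: (FQ _ FX) => // -[_]; apply.
have PA : P A /\ (A0 `<=` A)%classic.
  case: QA => // A_0; have [A00|A0n] := pselect (A0 = set0).
    by rewrite A_0 -A00; split.
  exfalso; apply: (Amax A0); last by right; split.
  by rewrite A_0; split=> // h; apply: A0n; apply/seteqP; split.
case: PA => PA A0A; exists A; split=> // B PB AB t Bt.
apply: contrapT => nAt; apply: (Amax B).
  by split=> // BA; apply/nAt/BA.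
by right; split=> //; apply: subset_trans AB.
Qed.

(** * Finite generation and finite presentation *)

Section Span.
Variables (S : comNzRingType).

Section Def.
Variable M : lmodType S.
(** Recursion on the list keeps coefficient families out of the inductions; [spnP] gives the usual
    linear combinations. *)
Fixpoint spn_pred (s : seq M) (x : M) : Prop :=
  if s is y :: s' then exists a, spn_pred s' (x - a *: y) else x = 0.
Fact spn_0 s : spn_pred s 0.
Proof. by elim: s => //= y s IHs; exists 0; rewrite scale0r subr0. Qed.
Fact spn_P s a x y : spn_pred s x -> spn_pred s y -> spn_pred s (a *: x + y).
Proof.
elim: s x y => [|z s IHs] x y /=; first by move=> -> ->; rewrite scaler0 addr0.
move=> [b xb] [c yc]; exists (a * b + c).
have -> : a *: x + y - (a * b + c) *: z = a *: (x - b *: z) + (y - c *: z).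
  by rewrite scalerBr scalerA scalerDl opprD addrACA.
exact: IHs.
Qed.
Definition spn s : submodule M := @Submodule S M (spn_pred s) (spn_0 s) (@spn_P s).

Lemma spn_mem s x : x \in s -> spn s x.
Proof.
elim: s => //= y s IHs; rewrite inE => /orP[/eqP->|xs].
  by exists 1; rewrite scale1r subrr; apply: spn_0.
by exists 0; rewrite scale0r subr0; apply: IHs.
Qed.
Lemma spn_min s (P : submodule M) : (forall x, x \in s -> P x) ->
  forall x, spn s x -> P x.
Proof.
elim: s => [|y s IHs] Ps x /=; first by move=> ->; apply: sm0.
case=> a /IHs Px; rewrite -[x](subrK (a *: y)); apply: smD.
  by apply: Px => z zs; apply: Ps; rewrite inE zs orbT.
by apply/smZ/Ps; rewrite mem_head.
Qed.
Lemma spn_sub s t : {subset s <= t} -> forall x, spn s x -> spn t x.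
Proof. by move=> st; apply: spn_min => x /st; apply: spn_mem. Qed.
Lemma spnP s x :
  spn s x <-> exists c : nat -> S, x = \sum_(k < size s) c k *: s`_k.
Proof.
split=> [|[c ->]]; last first.
  apply: sm_sum => i _ _; apply/smZ/spn_mem/mem_nth/ltn_ord.
elim: s x => [|y s IHs] x /=; first by move=> ->; exists (fun=> 0); rewrite big_ord0.
case=> a /IHs [c cE]; exists (fun k => if k is k'.+1 then c k' else a).
by rewrite big_ord_recl /= -cE addrC subrK.
Qed.
End Def.

Definition noeth := forall a : submodule S^o, exists s : seq S^o,
  (forall x, x \in s -> a x) /\ forall x, a x -> spn s x.

Lemma noetherianE : noetherian S -> noeth.
Proof.
move=> nS a; have [|s [sa as_]] := nS (fun x => `[< a x >]).
  split; first by apply/asboolP/sm0.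
  by move=> r x y /asboolP ax /asboolP ay; apply/asboolP/smP.
exists s; split=> [x /sa /asboolP //|x ax].
by apply/spnP; apply: as_; apply/asboolP.
Qed.

Lemma spn_lift (M N : lmodType S) (f : {linear M -> N}) (P : submodule M)
  (s : seq N) : (forall y, y \in s -> exists x, P x /\ f x = y) ->
  exists t : seq M, (forall x, x \in t -> P x) /\ map f t = s.
Proof.
elim: s => [|y s IHs] h; first by exists [::].
have [x [Px xy]] := h y (mem_head _ _).
have [z zs|t [tP ts]] := IHs; first by apply: h; rewrite inE zs orbT.
exists (x :: t); split; last by rewrite /= xy ts.
by move=> z; rewrite inE => /orP[/eqP->|/tP].
Qed.

Lemma spn_map (M N : lmodType S) (f : {linear M -> N}) (s : seq M) y :
  spn (map f s) y <-> exists x, spn s x /\ f x = y.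
Proof.
split=> [|[x [sx <-]]].
  have smh : forall a x y, (exists u, spn s u /\ f u = x) ->
     (exists u, spn s u /\ f u = y) -> exists u, spn s u /\ f u = a *: x + y.
    move=> a x z [u [su <-]] [v [sv <-]]; exists (a *: u + v).
    by rewrite linearP; split=> //; apply: smP.
  pose P := @Submodule S N (fun y => exists x, spn s x /\ f x = y)
    (ex_intro _ 0 (conj (sm0 _) (linear0 f))) smh.
  apply: (@spn_min _ _ P) => _ /mapP[x xs ->]; exists x; split=> //.
  exact: spn_mem.
have smh : forall a x y, spn (map f s) (f x) -> spn (map f s) (f y) ->
    spn (map f s) (f (a *: x + y)) by move=> *; rewrite linearP; apply: smP.
have sm0' : spn (map f s) (f 0) by rewrite linear0; apply: sm0.
pose P := @Submodule S M (fun x => spn (map f s) (f x)) sm0' smh.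
by apply: (@spn_min _ s P) => // z zs; apply/spn_mem/map_f.
Qed.

Section Coef.
Variables (M : lmodType S) (P Q : submodule M) (y : M).
Let T (r : S^o) := exists p, P p /\ Q (p - r *: y).
Fact sm_coef0 : T 0.
Proof. by exists 0; rewrite scale0r subr0; split; apply: sm0. Qed.
Fact sm_coefP a r t : T r -> T t -> T (a *: r + t).
Proof.
move=> [p [Pp ps]] [q [Pq qs]]; exists (a *: p + q); split; first exact: smP.
have -> : a *: p + q - (a *: r + t) *: y = a *: (p - r *: y) + (q - t *: y).
  by rewrite scalerBr scalerA scalerDl opprD addrACA.
exact: smP.
Qed.
(** The colon ideal (P + Q : y). In [noeth_sub] it plays the role of the ideal of leading
    coefficients in Hilbert's basis theorem. *)
Definition sm_coef : submodule S^o := Submodule sm_coef0 sm_coefP.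
End Coef.

(** Induction on the generators of the ambient module: the coefficients of [y] occurring in [P] form
    an ideal, finitely many elements [ps] of [P] realize its generators, and subtracting a
    combination of them moves an element of [P] into the span of the remaining generators. *)
Lemma noeth_sub (M : lmodType S) (s0 : seq M) (P : submodule M) : noeth ->
  (forall x, P x -> spn s0 x) ->
  exists s : seq M, (forall x, x \in s -> P x) /\ forall x, P x -> spn s x.
Proof.
move=> nS; elim: s0 P => [|y s0 IHs] P Ps0.
  by exists [::].
pose Id := sm_coef P (spn s0) y.
have [rs [rsI Irs]] := nS Id.
have [ps psP] : exists ps : seq M, (forall x, x \in ps -> P x) /\
    forall r, r \in rs -> exists p, p \in ps /\ spn s0 (p - r *: y).
  elim: (rs) rsI => [|r rs' IHr] h; first by exists [::].
  have [p [Pp pr]] := h r (mem_head _ _).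
  have [z zs|ps [psP psr]] := IHr; first by apply: h; rewrite inE zs orbT.
  exists (p :: ps); split=> [x|r'].
    by rewrite inE => /orP[/eqP->|/psP].
  rewrite inE => /orP[/eqP->|/psr [q [qps qr]]].
    by exists p; rewrite mem_head.
  by exists q; rewrite inE qps orbT.
pose Id' := sm_coef (spn ps) (spn s0) y.
have Id_Id' r : spn rs r -> Id' r.
  apply: spn_min => x /(psP.2) [p [pps pr]]; exists p; split=> //.
  exact: spn_mem.
have [x [Px //]|s' [s'P Ps']] := IHs (sm_cap P (spn s0)).
exists (ps ++ s'); split=> [x|x Px].
  by rewrite mem_cat => /orP[/(psP.1)//|/s'P[]].
have [r rE] := Ps0 x Px.
have /Irs/Id_Id' [p [pps pr]] : Id r by exists x.
rewrite -[x](subrK p); apply: smD.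
  apply: (@spn_sub _ s'); first by move=> z; rewrite mem_cat orbC => ->.
  apply: Ps'; split; first apply: smB => //.
    exact: (spn_min psP.1 pps).
  have -> : x - p = (x - r *: y) - (p - r *: y) by rewrite opprB addrA subrK.
  exact: smB.
by apply: (@spn_sub _ ps) => // z; rewrite mem_cat => ->.
Qed.

Definition fgen (M : lmodType S) := exists s : seq M, forall x, spn s x.

Lemma rV_spn k : exists s : seq 'rV[S]_k, forall x, spn s x.
Proof.
exists [seq delta_mx 0 i | i : 'I_k] => x.
rewrite (row_sum_delta x); apply: sm_sum => i _ _.
by apply/smZ/spn_mem/map_f; rewrite mem_enum.
Qed.

Lemma fgen_cover (M : lmodType S) (s : seq M) :
  exists p : {linear 'rV[S]_(size s) -> M},
    (forall i, p (delta_mx 0 i) = s`_i) /\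
    forall y, spn s y <-> exists x, p x = y.
Proof.
have [|p pE] := @linear_ex S 'rV[S]_(size s) M (fun x => \sum_i x 0 i *: s`_i).
  move=> a x y; rewrite scaler_sumr -big_split /=; apply: eq_bigr => i _.
  by rewrite !mxE scalerDl scalerA.
exists p; split=> [i|y].
  rewrite pE (bigD1 i) //= big1 ?addr0 => [|j ji].
    by rewrite mxE !eqxx scale1r.
  by rewrite mxE (negPf ji) andbF scale0r.
split=> [/spnP[c ->]|[x <-]].
  by exists (\row_i c i); rewrite pE; apply: eq_bigr => i _; rewrite mxE.
by rewrite pE; apply: sm_sum => i _ _; apply/smZ/spn_mem/mem_nth/ltn_ord.
Qed.

Lemma fpres (M : lmodType S) : noeth -> fgen M ->
  exists (k l : nat) (q : {linear 'rV[S]_l -> 'rV[S]_k})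
    (p : {linear 'rV[S]_k -> M}), (forall y, exists x, p x = y) /\
    forall x, p x = 0 <-> exists y, q y = x.
Proof.
move=> nS [s sM]; have [p [_ ps]] := fgen_cover s.
have [t0 t0P] := rV_spn (size s).
have [//|t [tP Pt]] := @noeth_sub _ t0 (sm_ker p) nS.
have [q [_ qs]] := fgen_cover t.
exists (size s), (size t), q, p; split=> [y|x]; first exact/ps/sM.
split=> [px|/qs tx]; first exact/qs/Pt.
exact: (spn_min tP tx).
Qed.
End Span.

(** * Injective modules over a noetherian ring *)

Section Baer.
Variable S : comNzRingType.
Implicit Types A B E I M N : lmodType S.

Definition univ A B (R : submodule (A * B)%type) :=
  forall b, R (0, b) -> b = 0.

(** [B] is the graph of a map from an ideal to [P], and the condition says that it is multiplication
    by an element of [P]. It concerns a subset of a fixed [E], so that directed unions are handled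
    without passing to submodule types. *)
Definition baer_in E (P : E -> Prop) := forall B : submodule (S^o * E)%type,
  univ B -> (forall r y, B (r, y) -> P y) ->
  exists t, P t /\ forall r y, B (r, y) -> y = r *: t.

Lemma inj_baer I : injective_module I -> @baer_in I (fun=> True).
Proof.
move=> Iinj B uB _; have [f fB] := inj_ext Iinj uB.
exists (f 1); split=> // r y /fB <-.
by rewrite -linearZ /= -[r in LHS]mulr1.
Qed.

Lemma baer_inj I : @baer_in I (fun=> True) -> injective_module I.
Proof.
move=> baer M N f g fI.
pose T : set (N * I) := fun p => exists x, f x = p.1 /\ g x = p.2.
have T0 : T 0 by exists 0; rewrite !linear0.
have TP a x y : T x -> T y -> T (a *: x + y).
  case: x y => [x1 x2] [y1 y2] [u /= [<- <-]] [v /= [<- <-]].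
  by exists (a *: u + v); rewrite !linearP.
pose ok (A : set (N * I)) := [/\ A 0, forall a x y, A x -> A y -> A (a *: x + y) &
  forall b, A (0, b) -> b = 0].
have okT : ok T.
  by split=> // b [x [/= fx <-]]; rewrite (fI x 0) ?linear0.
have [|A [[A0 AP Au] TA Amax]] := @Zorn_from _ ok T okT.
  move=> F [A0 FA0] Fok tot; split.
  - by exists A0 => //; case: (Fok _ FA0).
  - move=> a x y [X FX Xx] [Y FY Yy].
    have [XY|YX] := tot _ _ FX FY.
      by exists Y => //; case: (Fok _ FY) => _ h _; apply: h => //; apply: XY.
    by exists X => //; case: (Fok _ FX) => _ h _; apply: h => //; apply: YX.
  - by move=> b [X FX Xb]; case: (Fok _ FX) => _ _; apply.
pose R := Submodule A0 AP.
have tot n : exists b, R (n, b).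
  have B0 : A (((0 : S^o) *: n), 0) by rewrite scale0r; apply: A0.
  have BP (a : S) (x y : S^o * I) : A (x.1 *: n, x.2) -> A (y.1 *: n, y.2) ->
      A ((a *: x + y).1 *: n, (a *: x + y).2).
    move=> Ax Ay; have := AP a _ _ Ax Ay.
    by rewrite scalerDl -scalerA.
  (* The ideal of all r with r n in the current domain, mapped by the current partial map; Baer's
     condition supplies the value [t] at [n]. *)
  pose B := @Submodule S (S^o * I)%type (fun p => A (p.1 *: n, p.2)) B0 BP.
  have [||t [_ tB]] := baer B.
  - by move=> b; rewrite /B /= scale0r => /Au.
  - by [].
  pose A' : set (N * I) := fun p => exists2 x : N * I, A x & exists s : S,
    p = (x.1 + s *: n, x.2 + s *: t).
  have AA' : (A `<=` A')%classic.
    by move=> [x y] Axy; exists (x, y) => //; exists 0; rewrite !scale0r !addr0.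
  have A'n : A' (n, t).
    by exists 0 => //; exists 1; rewrite !scale1r !add0r.
  exists t; apply: (Amax A') => //; split; first exact/AA'.
    move=> a _ _ [x Ax [s ->]] [y Ay [r ->]].
    exists (a *: x + y); first exact: (AP a _ _ Ax Ay).
    exists (a * s + r).
    have E (V : lmodType S) (u v w : V) :
        a *: (u + s *: w) + (v + r *: w) = (a *: u + v) + (a * s + r) *: w.
      by rewrite scalerDr scalerA addrACA -scalerDl.
    exact: (congr2 pair (E _ _ _ _) (E _ _ _ _)).
  move=> b [[x y] Axy [s /= [xs ->]]].
  have/tB -> : B (- s, y).
    by rewrite /B /= scaleNr; move/eqP: xs; rewrite eq_sym addr_eq0 => /eqP <-.
  by rewrite scaleNr addNr.
have [h hR] := lin_rel tot Au.
by exists h => x; apply/hR/TA; exists x.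
Qed.

Lemma baer_subm E (P : submodule E) : baer_in P -> injective_module (subm P).
Proof.
move=> baer; apply: baer_inj => B uB _.
pose T (p : S^o * E) := exists y, B (p.1, y) /\ incl P y = p.2.
have T0 : T 0 by exists 0; split; [exact: (sm0 B)|exact: linear0].
have TP a x y : T x -> T y -> T (a *: x + y).
  case: x y => [x1 x2] [y1 y2] [u /= [Bu <-]] [v /= [Bv <-]].
  by exists (a *: u + v); split; [exact: (smP a Bu Bv)|exact: linearP].
have [||t [Pt tT]] := baer (Submodule T0 TP).
- by by move=> b [y [/= By <-]]; rewrite (uB _ By) linear0.
- by move=> r y [z [_ /= <-]]; apply: inclP.
have [t' t'E] := incl_ex Pt; exists t'; split=> // r y Bry.
apply: (@incl_inj _ _ P); rewrite linearZ t'E; apply: tT.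
by exists y.
Qed.

Lemma subm_baer E (P : submodule E) : injective_module (subm P) -> baer_in P.
Proof.
move=> /inj_baer baer B uB BP.
have B0 : B (0, incl P 0) by rewrite (linear0 (incl P)); apply: (sm0 B).
have BL (a : S) (x y : S^o * subm P) : B (x.1, incl P x.2) -> B (y.1, incl P y.2) ->
    B ((a *: x + y).1, incl P (a *: x + y).2).
  by move=> Bx By; rewrite (linearP (incl P) a x.2 y.2); apply: (smP a Bx By).
have [||t [_ tB]] :=
  baer (@Submodule S (S^o * subm P)%type (fun p => B (p.1, incl P p.2)) B0 BL).
- by move=> b /= /uB; rewrite -(linear0 (incl P)) => /incl_inj.
- by [].
exists (incl P t); split; first exact: inclP.
move=> r y Bry; have [y' y'E] := incl_ex (BP _ _ Bry).
by rewrite -y'E -linearZ; congr (incl P _); apply: tB; rewrite /= y'E.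
Qed.

Hypothesis nS : noeth S.

(** Univalence makes the projection of [B] to [S] injective, and its image is an ideal. *)
Lemma univ_fg E (B : submodule (S^o * E)%type) : univ B ->
  exists bs, (forall p, p \in bs -> B p) /\ forall p, B p -> spn bs p.
Proof.
move=> uB.
have [|f fE] := @linear_ex S (S^o * E)%type S^o fst; first by [].
have imf0 : exists p, B p /\ f p = 0 by exists 0; rewrite linear0; split=> //; apply: sm0.
have imfP a x y : (exists p, B p /\ f p = x) -> (exists p, B p /\ f p = y) ->
  exists p, B p /\ f p = a *: x + y.
  move=> [p [Bp <-]] [q [Bq <-]]; exists (a *: p + q); rewrite linearP.
  by split=> //; apply: smP.
have [s [sI Is]] := nS (@Submodule S S^o (fun r => exists p, B p /\ f p = r) imf0 imfP).
have [bs [bsB bss]] := @spn_lift _ _ _ f B s sI.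
exists bs; split=> // p Bp.
have /spn_map [q [bq qp]] : spn (map f bs) (f p) by rewrite bss; apply: Is; exists p.
suff -> : p = q by [].
have Bq : B q by apply: spn_min bq.
apply/eqP; rewrite -subr_eq0; apply/eqP.
have := smB Bp Bq; rewrite (surjective_pairing (p - q)).
have -> : (p - q).1 = 0 by rewrite -[_.1]fE linearB /= qp subrr.
by move=> /uB ->.
Qed.

(** By [univ_fg] finitely many values determine the partial map, and directedness puts them into one
    [F k]. Over a noetherian ring directed unions of injective submodules are therefore
    injective. *)
Lemma baer_dir E (K : Type) (F : K -> submodule E) (P : E -> Prop) :
  inhabited K ->
  (forall i j, exists k, forall x, F i x \/ F j x -> F k x) ->
  (forall x, P x <-> exists i, F i x) ->
  (forall i, baer_in (F i)) -> baer_in P.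
Proof.
move=> [i0] dir PF bF B uB BP.
have [bs [bsB Bbs]] := univ_fg uB.
have [k Fk] : exists k, forall p, p \in bs -> F k p.2.
  elim: (bs) bsB => [|p l IHl] h; first by exists i0.
  have [q ql|i Fi] := IHl; first by apply: h; rewrite inE ql orbT.
  have /PF [j Fj] : P p.2.
    by apply: (BP p.1); rewrite -surjective_pairing; apply: h; apply: mem_head.
  have [k Fk] := dir i j; exists k => q.
  by rewrite inE => /orP[/eqP->|/Fi h']; apply: Fk; [right|left].
have [//||t [Ft tB]] := bF k B.
  move=> r y /Bbs sp.
  have snd0 : F k (0 : S^o * E).2 by apply: sm0.
  have sndP (a : S) (x z : S^o * E) : F k x.2 -> F k z.2 -> F k (a *: x + z).2.
    exact: (@smP _ _ (F k) a x.2 z.2).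
  exact: (@spn_min _ _ bs (@Submodule S (S^o * E)%type (fun p => F k p.2) snd0 sndP) Fk _ sp).
by exists t; split=> //; apply/PF; exists k.
Qed.

(** * Torsion with respect to one element *)

Section Torsion.
Variables (c : S) (E : lmodType S).
Definition tors_pred (x : E) := exists n, c ^+ n *: x = 0.
Fact tors0 : tors_pred 0. Proof. by exists 0; rewrite scaler0. Qed.
Fact torsP a x y : tors_pred x -> tors_pred y -> tors_pred (a *: x + y).
Proof.
move=> [n nx] [m my]; exists (n + m)%N.
have xx : c ^+ (n + m) *: x = 0 by rewrite addnC exprD -scalerA nx scaler0.
have yy : c ^+ (n + m) *: y = 0 by rewrite exprD -scalerA my scaler0.
by rewrite scalerDr yy addr0 scalerA mulrC -scalerA xx scaler0.
Qed.
Definition tors : submodule E := Submodule tors0 torsP.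

Lemma tors_le n m (x : E) : (n <= m)%N -> c ^+ n *: x = 0 -> c ^+ m *: x = 0.
Proof.
by move=> nm nx; rewrite -(subnK nm) exprD -scalerA nx scaler0.
Qed.

(** An Artin-Rees argument in disguise: the map extends by zero to the ideal generated by a high
    power of [c], so the element provided by injectivity of [E] is itself killed by that power. *)
Lemma baer_tors : injective_module E -> baer_in tors.
Proof.
move=> Einj B uB BT.
have [bs [bsB Bbs]] := univ_fg uB.
have [n nB] : exists n, forall r y, B (r, y) -> c ^+ n *: y = 0.
  have [n nbs] : exists n, forall p, p \in bs -> c ^+ n *: p.2 = 0.
    elim: (bs) bsB => [|p l IHl] h; first by exists 0.
    have [q ql|n nl] := IHl; first by apply: h; rewrite inE ql orbT.
    have [m mp] : tors p.2.
      by apply: (BT p.1); rewrite -surjective_pairing; apply: h; apply: mem_head.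
    exists (n + m)%N => q; rewrite inE => /orP[/eqP->|/nl qn].
      by apply: tors_le mp; apply: leq_addl.
    by apply: tors_le qn; apply: leq_addr.
  exists n => r y /Bbs sp.
  have k0 : c ^+ n *: (0 : S^o * E).2 = 0 by rewrite scaler0.
  have kP (a : S) (x z : S^o * E) : c ^+ n *: x.2 = 0 -> c ^+ n *: z.2 = 0 ->
      c ^+ n *: (a *: x + z).2 = 0.
    by move=> x0 z0; rewrite scalerDr scalerA mulrC -scalerA x0 z0 scaler0 addr0.
  exact: (@spn_min _ _ bs (@Submodule S (S^o * E)%type _ k0 kP) nbs _ sp).
(* The ideals of those q with c^m q in the domain increase with m; at [m0] the chain has become
   stationary. *)
have [m0 m0J] : exists m0, forall m q, (exists y, B (c ^+ m * q, y)) ->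
    exists y, B (c ^+ m0 * q, y).
  pose J (q : S^o) := exists m y, B (c ^+ m * q, y).
  have Jle m m' (q : S) : (m <= m')%N -> (exists y, B (c ^+ m * q, y)) ->
      exists y, B (c ^+ m' * q, y).
    move=> mm' [y By]; exists (c ^+ (m' - m) *: y).
    by rewrite -(subnK mm') exprD -mulrA addnK; apply: (smZ (c ^+ (m' - m)) By).
  have J0 : J 0 by exists 0, 0; rewrite mulr0; apply: (sm0 B).
  have JP a q r : J q -> J r -> J (a *: q + r).
    move=> [m Bm] [m' Bm']; exists (m + m')%N.
    have [y By] := Jle _ (m + m')%N _ (leq_addr _ _) Bm.
    have [z Bz] := Jle _ (m + m')%N _ (leq_addl _ _) Bm'.
    exists (a *: y + z).
    have -> : c ^+ (m + m') * (a *: q + r) =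
       a *: (c ^+ (m + m') * q : S^o) + c ^+ (m + m') * r.
      by rewrite mulrDr; congr (_ + _); rewrite mulrCA.
    exact: (smP a By Bz).
  have [s [sJ Js]] := nS (Submodule J0 JP).
  have [m0 m0s] : exists m0, forall q, q \in s -> exists y, B (c ^+ m0 * q, y).
    elim: (s) sJ => [|q l IHl] h; first by exists 0.
    have [r rl|m ml] := IHl; first by apply: h; rewrite inE rl orbT.
    have [m' Bm'] := h q (mem_head _ _).
    exists (m + m')%N => r; rewrite inE => /orP[/eqP->|/ml]; apply: Jle.
    - exact: leq_addl.
    - exact: Bm'.
    - exact: leq_addr.
  exists m0 => m q Bq; have {Bq}/Js sq : J q by exists m.
  have k0 : exists y, B (c ^+ m0 * (0 : S^o), y).
    by exists 0; rewrite mulr0; apply: (sm0 B).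
  have kP (a : S) (x z : S^o) : (exists y, B (c ^+ m0 * x, y)) ->
     (exists y, B (c ^+ m0 * z, y)) -> exists y, B (c ^+ m0 * (a *: x + z), y).
    move=> [y By] [w Bw]; exists (a *: y + w).
    have -> : c ^+ m0 * (a *: x + z) = a *: (c ^+ m0 * x : S^o) + c ^+ m0 * z.
      by rewrite mulrDr; congr (_ + _); rewrite mulrCA.
    exact: (smP a By Bw).
  exact: (@spn_min _ _ s (@Submodule S S^o _ k0 kP) m0s _ sq).
(* The exponent is [m0 + n]: if c^(m0 + n) q lies in the domain, so does c^m0 q, and the remaining
   factor c^n kills its image. This makes the extension by zero well defined. *)
pose T (p : S^o * E) := exists r q, B (r, p.2) /\ p.1 = r + c ^+ (m0 + n) * q.
have T0 : T 0 by exists 0, 0; rewrite mulr0 addr0; split=> //; apply: (sm0 B).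
have TP a x y : T x -> T y -> T (a *: x + y).
  case: x y => [x1 x2] [y1 y2] [r [q /= [Br ->]]] [t [w /= [Bt ->]]].
  exists (a *: r + t), (a * q + w); split; first exact: (smP a Br Bt).
  have eqk (k : S) : a * (r + k * q) + (t + k * w) = (a * r + t) + k * (a * q + w).
    by rewrite !mulrDr addrACA (mulrCA k).
  exact: eqk.
have [||t [_ tT]] := inj_baer Einj (B := Submodule T0 TP).
- move=> y [r [q /= [Br r0]]].
  have Bq : B (c ^+ (m0 + n) * - q, y).
    by rewrite mulrN; move/eqP: r0; rewrite eq_sym addr_eq0 => /eqP <-.
  have [z Bz] := m0J _ _ (ex_intro (fun y => B (_, y)) y Bq).
  have Bz' : B (c ^+ (m0 + n) * - q, c ^+ n *: z).
    by rewrite addnC exprD -mulrA; apply: (smZ (c ^+ n) Bz).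
  rewrite -(nB _ _ Bz); apply/eqP; rewrite -subr_eq0; apply/eqP/uB.
  by have := smB Bq Bz'; rewrite -[_ - _]/(_ - _, _ - _) subrr.
- by [].
exists t; split=> [|r y Bry].
  exists (m0 + n)%N; rewrite -[LHS](tT (c ^+ (m0 + n)) 0) //.
  by exists 0, 1; rewrite mulr1 add0r; split=> //; apply: (sm0 B).
by apply: tT; exists r, 0; rewrite mulr0 addr0.
Qed.

Lemma inj_tors : injective_module E -> injective_module (subm tors).
Proof. by move/baer_tors/baer_subm. Qed.
End Torsion.

(** The union of a nonempty chain of ideals is finitely generated, hence a member of the chain, so a
    counterexample could be chosen maximal. *)
Lemma noeth_ind (P : submodule S^o -> Prop) :
  (forall a : submodule S^o, (forall b : submodule S^o,
     (forall x, a x -> b x) -> (exists x, b x /\ ~ a x) -> P b) -> P a) ->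
  forall a, P a.
Proof.
move=> IH a0; apply: contrapT => nPa0.
pose ok (A : set S^o) := exists2 a, ~ P a & A = smem a.
have [|| A [[a nPa ->] _ amax]] := @Zorn_from _ ok (smem a0).
- by exists a0.
- move=> F [A0 FA0] Fok tot.
  pose U : set S^o := (\bigcup_(X in F) X)%classic.
  have U0 : U 0 by exists A0 => //; case: (Fok _ FA0) => a _ ->; apply: sm0.
  have UP a x y : U x -> U y -> U (a *: x + y).
    move=> [X FX Xx] [Y FY Yy].
    have [XY|YX] := tot _ _ FX FY.
      exists Y => //; case: (Fok _ FY) Yy XY => b _ -> Yy XY.
      by apply: smP => //; apply: XY.
    exists X => //; case: (Fok _ FX) Xx YX => b _ -> Xx YX.
    by apply: smP => //; apply: YX.
  have [s [sU Us]] := nS (Submodule U0 UP).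
  have [X FX sX] : exists2 X, F X & forall x, x \in s -> X x.
    elim: (s) sU => [|x l IHl] h; first by exists A0.
    have [z zl|X FX Xl] := IHl; first by apply: h; rewrite inE zl orbT.
    have [Y FY Yx] := h x (mem_head _ _).
    have [XY|YX] := tot _ _ FX FY.
      by exists Y => // z; rewrite inE => /orP[/eqP->|/Xl /XY].
    by exists X => // z; rewrite inE => /orP[/eqP->|/Xl //]; apply: YX.
  suff UX : U = X by rewrite -[X in ok X]/U UX; apply: Fok.
  apply/seteqP; split=> x; last by exists X.
  case: (Fok _ FX) sX => b _ -> sb /Us; exact: spn_min.
apply: nPa; apply: IH => b ab [x [bx nax]]; apply: contrapT => nPb.
by apply: nax; apply: (amax (smem b)) => //; exists b.
Qed.
End Baer.

Local Open Scope quotient_scope.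

(** * Tensor products and flatness *)

Lemma add_idem0 (V : zmodType) (x : V) : x = x + x -> x = 0.
Proof. by move/(congr1 (fun z => z - x)); rewrite addrK subrr. Qed.

Lemma add_map0 (U V : zmodType) (h : U -> V) :
  (forall x y, h (x + y) = h x + h y) -> h 0 = 0.
Proof. by move=> hD; apply: add_idem0; rewrite -hD addr0. Qed.

Section Pure.
Variables (R S : comNzRingType) (phi : {rmorphism R -> S}).

Section One.
Variables (M : lmodType S) (N : lmodType R).
Local Notation T := (tensor phi M N).

Definition pt (m : M) (n : N) : T := \pi_T [:: (m, n)].

Lemma pi_pt s : \pi_T s = \sum_(p <- s) pt p.1 p.2.
Proof.
elim: s => [|[m n] s IHs]; first by rewrite big_nil.
rewrite big_cons -IHs -[RHS]/(tens_add _ _) tens_addE //.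
Qed.
Lemma ptDl m m' n : pt (m + m') n = pt m n + pt m' n.
Proof. by rewrite -[RHS]/(tens_add _ _) tens_addE; apply/tensP/tens_Dl. Qed.
Lemma ptDr m n n' : pt m (n + n') = pt m n + pt m n'.
Proof. by rewrite -[RHS]/(tens_add _ _) tens_addE; apply/tensP/tens_Dr. Qed.
Lemma pt_bal r m n : pt (phi r *: m) n = pt m (r *: n).
Proof. exact/tensP/(@tens_bal _ _ phi). Qed.
Lemma ptZ a m n : a *: pt m n = pt (a *: m) n.
Proof. by rewrite -[LHS]/(tens_scale _ _) tens_scaleE. Qed.
Lemma pt0l n : pt 0 n = 0.
Proof. exact/tensP/tens_0l. Qed.
Lemma pt0r m : pt m 0 = 0.
Proof. by rewrite -(scale0r (0 : N)) -pt_bal rmorph0 scale0r pt0l. Qed.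
Lemma ptNl m n : pt (- m) n = - pt m n.
Proof. by rewrite -scaleN1r -ptZ scaleN1r. Qed.
Lemma ptBl m m' n : pt (m - m') n = pt m n - pt m' n.
Proof. by rewrite ptDl ptNl. Qed.
Lemma ptNr m n : pt m (- n) = - pt m n.
Proof. by apply/eqP; rewrite -addr_eq0 -ptDr addNr pt0r. Qed.
Lemma pt_suml (I : Type) (r : seq I) (P : pred I) (F : I -> M) n :
  pt (\sum_(i <- r | P i) F i) n = \sum_(i <- r | P i) pt (F i) n.
Proof. by apply: (big_morph (pt^~ n)) => [x y|]; rewrite (ptDl, pt0l). Qed.
Lemma pt_sumr (I : Type) (r : seq I) (P : pred I) (F : I -> N) m :
  pt m (\sum_(i <- r | P i) F i) = \sum_(i <- r | P i) pt m (F i).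
Proof. by apply: (big_morph (pt m)) => [x y|]; rewrite (ptDr, pt0r). Qed.

Lemma pt_sum (x : T) : exists s : seq (M * N), x = \sum_(p <- s) pt p.1 p.2.
Proof. by elim/tensor_ind: x => s; exists s; apply: pi_pt. Qed.

Lemma pt_ind (P : T -> Prop) : P 0 -> (forall m n x, P x -> P (pt m n + x)) ->
  forall x, P x.
Proof.
move=> P0 PD x; have [s ->] := pt_sum x.
elim: s => [|p s IHs]; first by rewrite big_nil.
by rewrite big_cons; apply: PD.
Qed.

(** The target is only an abelian group, because [swap_ex] compares an S-module with an R-module. *)
Lemma tens_rec_add (V : zmodType) (b : M -> N -> V) :
  (forall m m' n, b (m + m') n = b m n + b m' n) ->
  (forall m n n', b m (n + n') = b m n + b m n') ->
  (forall r m n, b (phi r *: m) n = b m (r *: n)) ->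
  exists f : T -> V, (forall x y, f (x + y) = f x + f y) /\
    forall m n, f (pt m n) = b m n.
Proof.
move=> bDl bDr bb; pose ev (s : seq (M * N)) := \sum_(p <- s) b p.1 p.2.
have b0 n : b 0 n = 0.
  by apply: add_idem0; rewrite -bDl addr0.
have evP s t : tens_eq phi s t -> ev s = ev t.
  rewrite /ev.
  elim=> {s t} [//|s t _ -> //|s t u _ -> _ -> //|s s' t t' _ ss _ tt|s t|n|m m' n|m n n'|r m n].
  - by rewrite !big_cat ss tt.
  - by rewrite !big_cat /= addrC.
  - by rewrite big_cons !big_nil b0 addr0.
  - by rewrite !big_cons !big_nil bDl addrA.
  - by rewrite !big_cons !big_nil bDr addrA.
  - by rewrite !big_cons !big_nil bb.
have evE s : ev (repr (\pi_T s)) = ev s by apply/evP/tens_repr.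
exists (fun x => ev (repr x)); split=> [x y|m n]; last first.
  by rewrite evE /ev big_cons big_nil addr0.
elim/tensor_ind: x => s; elim/tensor_ind: y => t.
by rewrite -[X in repr X]/(tens_add _ _) tens_addE !evE /ev big_cat.
Qed.

Lemma tens_rec (V : lmodType S) (b : M -> N -> V) :
  (forall m m' n, b (m + m') n = b m n + b m' n) ->
  (forall m n n', b m (n + n') = b m n + b m n') ->
  (forall r m n, b (phi r *: m) n = b m (r *: n)) ->
  (forall a m n, b (a *: m) n = a *: b m n) ->
  exists f : {linear T -> V}, forall m n, f (pt m n) = b m n.
Proof.
move=> bDl bDr bb bZ; have [f [fD fE]] := tens_rec_add bDl bDr bb.
have f0 := add_map0 fD.
have [|g gE] := @linear_ex S T V f; last by exists g => m n; rewrite gE.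
move=> a x y; rewrite fD; congr (_ + _); elim/pt_ind: x => [|m n x IHx].
  by rewrite scaler0 f0 scaler0.
by rewrite scalerDr !fD scalerDr IHx ptZ !fE bZ.
Qed.

Lemma tens_ext (V : lmodType S) (f g : {linear T -> V}) :
  (forall m n, f (pt m n) = g (pt m n)) -> f =1 g.
Proof.
move=> fg; elim/pt_ind=> [|m n x IHx]; first by rewrite !linear0.
by rewrite !linearD fg IHx.
Qed.
End One.

Section Map.
Variables (M M' : lmodType S) (N N' : lmodType R).
Variables (f : {linear M -> M'}) (g : {linear N -> N'}).
Fact tmap_key : {h : {linear tensor phi M N -> tensor phi M' N'} |
  forall m n, h (pt m n) = pt (f m) (g n)}.
Proof.
apply: cid; apply: (tens_rec (b := fun m n => pt (f m) (g n))) => *.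
- by rewrite linearD ptDl.
- by rewrite linearD ptDr.
- by rewrite !linearZ pt_bal.
- by rewrite !linearZ -ptZ.
Qed.
Definition tmap := sval tmap_key.
Lemma tmapE m n : tmap (pt m n) = pt (f m) (g n).
Proof. exact: (svalP tmap_key). Qed.
End Map.

Lemma tens_map_pt (M : lmodType S) (N N' : lmodType R) (g : {linear N -> N'}) m n :
  tens_map phi M g (pt m n) = pt m (g n).
Proof. exact: tens_map_funE. Qed.

Lemma tmap_comp (M M' M'' : lmodType S) (N N' N'' : lmodType R)
  (f : {linear M -> M'}) (g : {linear N -> N'})
  (f' : {linear M' -> M''}) (g' : {linear N' -> N''})
  (h : {linear M -> M''}) (k : {linear N -> N''}) :
  (forall m, f' (f m) = h m) -> (forall n, g' (g n) = k n) ->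
  forall x, tmap f' g' (tmap f g x) = tmap h k x.
Proof.
move=> fh gk; apply: (@tens_ext _ _ _ (tmap f' g' \o tmap f g)) => m n /=.
by rewrite !tmapE fh gk.
Qed.

Lemma tmap_id (M : lmodType S) (N : lmodType R)
  (f : {linear M -> M}) (g : {linear N -> N}) :
  (forall m, f m = m) -> (forall n, g n = n) -> forall x, tmap f g x = x.
Proof.
by move=> fh gk; apply: (@tens_ext _ _ _ _ idfun) => m n /=; rewrite tmapE fh gk.
Qed.

Lemma tens_mapE (M : lmodType S) (N N' : lmodType R) (g : {linear N -> N'}) x :
  tens_map phi M g x = tmap idfun g x.
Proof. by move: x; apply: tens_ext => m n; rewrite tens_map_pt tmapE. Qed.

(** Right exactness through an explicit inverse: m (x) n goes to the class of l m (x) n modulo the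
    image of [tmap q idfun], where [l] chooses preimages under [p]; the class does not depend on the
    choice. *)
Lemma tens_exactl (L M M' : lmodType S) (N : lmodType R)
  (q : {linear L -> M}) (p : {linear M -> M'}) :
  (forall y, exists x, p x = y) ->
  (forall x, p x = 0 -> exists y, q y = x) ->
  forall z : tensor phi M N, tmap p idfun z = 0 -> exists y, tmap q idfun y = z.
Proof.
move=> ps pq; have [l lE] := choice ps.
pose P := sm_im (tmap q (idfun : {linear N -> N})).
have Pp x y n : p x = p y -> proj P (pt x n) = proj P (pt y n).
  move=> xy; apply/proj_eq.
  have [|u qu] := pq (x - y); first by rewrite linearB xy subrr.
  by exists (pt u n); rewrite tmapE /= qu ptBl.
have [||||f fE] := @tens_rec M' N (quot P) (fun m n => proj P (pt (l m) n)).
- by move=> m m' n; rewrite -linearD -ptDl; apply: Pp; rewrite linearD !lE.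
- by move=> m n n'; rewrite ptDr linearD.
- by move=> r m n; rewrite -pt_bal; apply: Pp; rewrite linearZ !lE.
- by move=> a m n; rewrite -linearZ /= ptZ; apply: Pp; rewrite linearZ !lE.
have fp z : f (tmap p idfun z) = proj P z.
  move: z; apply: (@tens_ext _ _ _ (f \o tmap p idfun)) => m n /=.
  by rewrite tmapE fE; apply: Pp; rewrite lE.
by move=> z pz; apply/(proj0 P); rewrite -fp pz linear0.
Qed.

Lemma tens_exactr (M : lmodType S) (L N N' : lmodType R)
  (q : {linear L -> N}) (p : {linear N -> N'}) :
  (forall y, exists x, p x = y) ->
  (forall x, p x = 0 -> exists y, q y = x) ->
  forall z : tensor phi M N, tmap idfun p z = 0 -> exists y, tmap idfun q y = z.
Proof.
move=> ps pq; have [l lE] := choice ps.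
pose P := sm_im (tmap (idfun : {linear M -> M}) q).
have Pp m x y : p x = p y -> proj P (pt m x) = proj P (pt m y).
  move=> xy; apply/proj_eq.
  have [|u qu] := pq (x - y); first by rewrite linearB xy subrr.
  by exists (pt m u); rewrite tmapE /= qu ptDr ptNr.
have [||||f fE] := @tens_rec M N' (quot P) (fun m n => proj P (pt m (l n))).
- by move=> m m' n; rewrite ptDl linearD.
- by move=> m n n'; rewrite -linearD -ptDr; apply: Pp; rewrite linearD !lE.
- by move=> r m n; rewrite pt_bal; apply: Pp; rewrite linearZ !lE.
- by move=> a m n; rewrite -ptZ linearZ.
have fp z : f (tmap idfun p z) = proj P z.
  move: z; apply: (@tens_ext _ _ _ (f \o tmap idfun p)) => m n /=.
  by rewrite tmapE fE; apply: Pp; rewrite lE.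
by move=> z pz; apply/(proj0 P); rewrite -fp pz linear0.
Qed.

Lemma tmap_surj (M M' : lmodType S) (N N' : lmodType R)
  (f : {linear M -> M'}) (g : {linear N -> N'}) :
  (forall y, exists x, f x = y) -> (forall y, exists x, g x = y) ->
  forall z, exists y, tmap f g y = z.
Proof.
move=> fs gs; elim/pt_ind => [|m n z [y <-]]; first by exists 0; rewrite linear0.
have [u <-] := fs m; have [v <-] := gs n.
by exists (pt u v + y); rewrite linearD tmapE.
Qed.
End Pure.

Section Swap.
Variables (R S : comNzRingType) (phi : {rmorphism R -> S}).
Variables (M : lmodType S) (N : lmodType R).

Lemma swap_ex : exists (f : tensor phi M N -> tens N (restr phi M))
  (g : tens N (restr phi M) -> tensor phi M N),
  [/\ (forall x y, f (x + y) = f x + f y) /\ (forall x y, g (x + y) = g x + g y),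
     (forall m n, f (pt phi m n) = @pt R R idfun N (restr phi M) n m) /\
     (forall m n, g (@pt R R idfun N (restr phi M) n m) = pt phi m n), cancel f g & cancel g f].
Proof.
have [|||f [fD fE]] := @tens_rec_add _ _ phi M N (tens N (restr phi M))
  (fun m n => @pt R R idfun N (restr phi M) n m).
- by move=> m m' n; rewrite -ptDr.
- by move=> m n n'; rewrite -ptDl.
- by move=> r m n; rewrite -[r *: n]/((idfun r) *: n) pt_bal.
have [|||g [gD gE]] := @tens_rec_add _ _ idfun N (restr phi M) (tensor phi M N)
  (fun n m => pt phi (m : M) n).
- by move=> m m' n; rewrite -ptDr.
- by move=> m n n'; rewrite -ptDl.
- by move=> r m n /=; rewrite -pt_bal.
exists f, g; split=> //.
  elim/pt_ind=> [|m n x IHx]; first by rewrite (add_map0 fD) (add_map0 gD).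
  by rewrite fD gD fE gE IHx.
elim/pt_ind=> [|m n x IHx]; first by rewrite (add_map0 gD) (add_map0 fD).
by rewrite gD fD gE fE IHx.
Qed.
End Swap.

Section Flat.
Variables (R S : comNzRingType) (phi : {rmorphism R -> S}).

Section RestrMap.
Variables (M M' : lmodType S) (f : {linear M -> M'}).
Fact restr_map_linear :
  linear (fun x : restr phi M => f x : restr phi M').
Proof. by move=> a x y; apply: (linearP f (phi a)). Qed.
Definition restr_map : {linear restr phi M -> restr phi M'} :=
  lin_of restr_map_linear.
End RestrMap.

(** [flat_module] concerns R-linear maps with [F] as left factor; the swap transports it to S-linear
    maps with [F] on the right. *)
Lemma flatl (F : lmodType R) (M M' : lmodType S) (f : {linear M -> M'}) :
  flat_module F -> injective f ->
  injective (tmap phi f (idfun : {linear F -> F})).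
Proof.
move=> Fflat fI.
have [s [t [[sD tD] [sE tE] st ts]]] := swap_ex phi M F.
have [s' [t' [[sD' tD'] [sE' tE'] st' ts']]] := swap_ex phi M' F.
have E x : s' (tmap phi f idfun x) = tens_map idfun F (restr_map f) (s x).
  elim/pt_ind: x => [|m n x IHx].
    by rewrite linear0 (add_map0 sD') (add_map0 sD) linear0.
  by rewrite linearD sD' IHx tmapE sE' sD linearD sE tens_map_pt.
apply: inj0 => x fx; rewrite -(st x).
suff -> : s x = 0 by rewrite (add_map0 tD).
have fI' : injective (restr_map f) by [].
apply: (Fflat _ _ (restr_map f) fI').
by rewrite -E fx (add_map0 sD') linear0.
Qed.

Lemma flat_exact (F : lmodType R) (L M N : lmodType S) (f : {linear L -> M})
  (g : {linear M -> N}) : flat_module F ->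
  (forall x, g x = 0 -> exists y, f y = x) ->
  forall z : tensor phi M F, tmap phi g idfun z = 0 ->
    exists y, tmap phi f idfun y = z.
Proof.
move=> Fflat ex z gz.
have [|g' g'E] := @corestr _ _ _ g (sm_im g); first by move=> a; exists a.
apply: (@tens_exactl _ _ _ _ _ (subm (sm_im g)) F f g').
- move=> y; have [x gx] := inclP y; exists x.
  by apply: (@incl_inj _ _ (sm_im g)); rewrite g'E.
- by move=> x /(congr1 (incl (sm_im g))); rewrite g'E linear0; apply: ex.
apply: (flatl (f := incl (sm_im g)) Fflat (@incl_inj _ _ _)).
by rewrite linear0 -gz; apply: tmap_comp.
Qed.

(** The equational criterion of flatness. Let [h] send the basis of R^k to the [m i]. By flatness
    the tensor with components [x i] already vanishes over R^k / ker h, hence comes from F (x) ker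
    h; the coordinates of elements of ker h are the coefficients [c]. *)
Lemma flat_eq (F : lmodType R) (M : lmodType S) (k : nat) (m : 'I_k -> M)
  (x : 'I_k -> F) : flat_module F -> \sum_i pt phi (m i) (x i) = 0 ->
  exists (l : nat) (y : 'I_l -> F) (c : 'I_k -> 'I_l -> R),
    (forall i, x i = \sum_j c i j *: y j) /\
    forall j, \sum_i phi (c i j) *: m i = 0.
Proof.
move=> Fflat sum0.
have [s [t [[sD tD] [sE tE] st ts]]] := swap_ex phi M F.
have [|h hE] := @linear_ex R 'rV[R]_k (restr phi M) (fun v => \sum_i phi (v 0 i) *: m i).
  move=> a u v; rewrite scaler_sumr -big_split /=; apply: eq_bigr => i _.
  by rewrite !mxE rmorphD rmorphM scalerDl -scalerA.
pose e i : 'rV[R]_k := delta_mx 0 i.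
have he i : h (e i) = m i.
  rewrite hE (bigD1 i) //= big1 ?addr0 => [|j ji].
    by rewrite mxE !eqxx rmorph1 scale1r.
  by rewrite mxE (negPf ji) andbF rmorph0 scale0r.
have [|h' h'E] := @factor _ _ _ _ (proj (sm_ker h)) h (@proj_surj _ _ _).
  by move=> a /proj0.
have h'I : injective h'.
  apply: inj0 => y; have [u <-] := proj_surj y.
  by rewrite h'E => hu; apply/proj0.
pose z : tens F 'rV[R]_k := \sum_i pt idfun (x i) (e i).
have z0 : tmap idfun idfun (proj (sm_ker h)) z = 0.
  apply: (Fflat _ _ h' h'I); rewrite linear0 tens_mapE.
  rewrite (tmap_comp (h := idfun) (k := h)) //.
  have -> : tmap idfun idfun h z = s (\sum_i pt phi (m i) (x i)).
    rewrite linear_sum /= (big_morph s sD (add_map0 sD)).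
    by apply: eq_bigr => i _; rewrite tmapE sE he.
  by rewrite sum0 (add_map0 sD).
have [||y yE] := tens_exactr (q := incl (sm_ker h)) _ _ z0.
- exact: proj_surj.
- by move=> v /proj0 hv; apply: incl_ex.
have [l lE] := pt_sum y.
exists (size l), (fun j => (tnth (in_tuple l) j).1),
  (fun i j => (incl (sm_ker h) (tnth (in_tuple l) j).2) 0 i); split; last first.
  move=> j; have := inclP (tnth (in_tuple l) j).2.
  by rewrite -[X in X -> _]/(_ = _) hE.
move=> i.
have [||||g gE] := @tens_rec R R idfun F 'rV[R]_k F (fun f v => v 0 i *: f).
- by move=> *; rewrite scalerDr.
- by move=> *; rewrite mxE scalerDl.
- by move=> r f v /=; rewrite mxE !scalerA mulrC.
- by move=> *; rewrite !scalerA mulrC.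
have -> : x i = g z.
  rewrite linear_sum (bigD1 i) //= big1 ?addr0 => [|j ji].
    by rewrite gE mxE !eqxx scale1r.
  by rewrite gE mxE eq_sym (negPf ji) andbF scale0r.
rewrite -yE lE !linear_sum big_tnth; apply: eq_bigr => j _.
by rewrite tmapE gE.
Qed.

(** [flat_eq] is applied to the vectors of the [m a i] in a product of copies of [M], so that one
    matrix [c] serves all relations. *)
Lemma flat_eqs (Q : finType) (F : lmodType R) (M : lmodType S) (k : nat)
  (m : Q -> 'I_k -> M) (x : 'I_k -> F) : flat_module F ->
  (forall a, \sum_i pt phi (m a i) (x i) = 0) ->
  exists (l : nat) (y : 'I_l -> F) (c : 'I_k -> 'I_l -> R),
    (forall i, x i = \sum_j c i j *: y j) /\
    forall a j, \sum_i phi (c i j) *: m a i = 0.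
Proof.
move=> Fflat sum0; pose v i : prodm (fun _ : Q => M) := fun a => m a i.
have vE i : v i = \sum_a inj_at (fun _ : Q => M) a (m a i).
  apply: prodmP => a; rewrite -[RHS]comp_atE linear_sum (bigD1 a) //= big1 => [|b ba].
    by rewrite addr0 comp_atE inj_at_in.
  by rewrite comp_atE inj_at_out.
have [|l [y [c [xE cE]]]] := @flat_eq F _ k v x Fflat.
  under eq_bigr => i _ do rewrite vE pt_suml.
  rewrite exchange_big big1 //= => a _.
  have := congr1 (tmap phi (inj_at (fun _ : Q => M) a) idfun) (sum0 a).
  rewrite linear_sum linear0 => h; rewrite -[RHS]h.
  by apply: eq_bigr => i _; rewrite tmapE.
exists l, y, c; split=> // a j; rewrite -[RHS](congr1 (fun z => z a) (cE j)).
rewrite -[RHS]comp_atE linear_sum; apply: eq_bigr => i _.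
by rewrite linearZ comp_atE.
Qed.

(** Again a product of copies of [M]: expanding one tensor over it expands all [z a] with the same
    right factors. *)
Lemma common_sum (Q : finType) (F : lmodType R) (M : lmodType S)
  (z : Q -> tensor phi M F) :
  exists (k : nat) (x : 'I_k -> F) (m : Q -> 'I_k -> M),
    forall a, z a = \sum_i pt phi (m a i) (x i).
Proof.
pose V := prodm (fun _ : Q => M).
have [s sE] := pt_sum (\sum_a tmap phi (inj_at (fun _ : Q => M) a) idfun (z a)).
exists (size s), (fun i => (tnth (in_tuple s) i).2),
  (fun a i => (tnth (in_tuple s) i).1 a) => a.
have := congr1 (tmap phi (comp_at (fun _ : Q => M) a) idfun) sE.
rewrite !linear_sum (bigD1 a) //= big1 => [|b ba].
  rewrite addr0 (tmap_comp (h := idfun) (k := idfun)) => [|u|//]; last first.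
    by rewrite comp_atE inj_at_in.
  rewrite tmap_id // => ->; rewrite big_tnth; apply: eq_bigr => i _.
  by rewrite tmapE comp_atE.
rewrite (tmap_comp (h := \0) (k := idfun)) => [|u|//]; last first.
  by rewrite comp_atE inj_at_out.
by elim/pt_ind: (z b) => [|m n w IHw]; rewrite ?linear0 // linearD IHw tmapE pt0l addr0.
Qed.
End Flat.

Lemma rV_ext (S : comNzRingType) (V : lmodType S) k (f g : {linear 'rV[S]_k -> V}) :
  (forall i, f (delta_mx 0 i) = g (delta_mx 0 i)) -> f =1 g.
Proof.
move=> fg v; rewrite (row_sum_delta v) !linear_sum.
by apply: eq_bigr => i _; rewrite !linearZ fg.
Qed.

(** * Maps from finitely generated modules into tensor products with flat modules *)

Section Factor.
Variables (R S : comNzRingType) (phi : {rmorphism R -> S}).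
Hypothesis nS : noeth S.

(** In the spirit of Lazard's theorem. On generators of [N], [f] is written with common right
    factors [x i]; its coordinates respect the relations of [N] and the endomorphisms only after
    tensoring. These are finitely many conditions, and the equational criterion makes them hold
    coordinatewise after passing to new factors [y j]. *)
Lemma flat_factor (F : lmodType R) (M N : lmodType S) (dN : {linear N -> N})
  (dM : {linear M -> M}) (f : {linear N -> tensor phi M F}) :
  flat_module F -> fgen N -> (forall n, f (dN n) = tmap phi dM idfun (f n)) ->
  exists (l : nat) (y : 'I_l -> F) (g : 'I_l -> {linear N -> M}),
    (forall n, f n = \sum_j pt phi (g j n) (y j)) /\
    forall j n, g j (dN n) = dM (g j n).
Proof.
move=> Fflat /(fpres nS) [k [l0 [q [p [ps pq]]]]] fd.
have [K [x [m mE]]] := common_sum (fun a : 'I_k => f (p (delta_mx 0 a))).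
have Lex i : exists L : {linear 'rV[S]_k -> M}, forall v, L v = \sum_a v 0 a *: m a i.
  apply: linear_ex => a u v; rewrite scaler_sumr -big_split /=.
  by apply: eq_bigr => b _; rewrite !mxE scalerDl scalerA.
have [L LE] := choice Lex.
have fp v : f (p v) = \sum_i pt phi (L i v) (x i).
  transitivity (\sum_i \sum_a v 0 a *: pt phi (m a i) (x i)).
    rewrite [in LHS](row_sum_delta v) !linear_sum exchange_big.
    by apply: eq_bigr => a _; rewrite !linearZ /= mE scaler_sumr.
  apply: eq_bigr => i _; rewrite LE pt_suml; apply: eq_bigr => a _.
  by rewrite ptZ.
have [u uE] := choice (fun a : 'I_k => ps (dN (p (delta_mx 0 a)))).
(* [inl] collects the values on the relations of [N], [inr] the defects of commutation on its
   generators. *)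
pose mm (b : 'I_l0 + 'I_k) i := match b with
  | inl b => L i (q (delta_mx 0 b))
  | inr a => dM (L i (delta_mx 0 a)) - L i (u a) end.
have [|l [y [c [xE cE]]]] := @flat_eqs _ _ phi _ F M K mm x Fflat.
  case=> [b|a] /=; first by rewrite -fp (_ : p _ = 0) ?linear0 //; apply/pq; eexists.
  under eq_bigr => i _ do rewrite ptBl.
  rewrite sumrB -fp uE fd fp linear_sum /=.
  by apply/eqP; rewrite subr_eq0; apply/eqP/eq_bigr => i _; rewrite tmapE.
have L'ex j : exists L' : {linear 'rV[S]_k -> M},
    forall v, L' v = \sum_i phi (c i j) *: L i v.
  apply: linear_ex => a v w; rewrite scaler_sumr -big_split /=.
  by apply: eq_bigr => i _; rewrite linearP scalerDr !scalerA mulrC.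
have [L' L'E] := choice L'ex.
have gex j : exists g : {linear N -> M}, forall v, g (p v) = L' j v.
  apply: factor => // v /pq [w <-].
  move: w; apply: (@rV_ext _ _ _ (L' j \o q) \0) => b /=.
  by rewrite L'E; apply: (cE (inl b)).
have [g gE] := choice gex.
exists l, y, g; split=> [n|j n]; have [v <-] := ps n.
  rewrite fp; transitivity (\sum_i \sum_j pt phi (phi (c i j) *: L i v) (y j)).
    by apply: eq_bigr => i _; rewrite xE pt_sumr; apply: eq_bigr => j _; rewrite pt_bal.
  by rewrite exchange_big; apply: eq_bigr => j _; rewrite gE L'E pt_suml.
move: v; apply: (@rV_ext _ _ _ (g j \o dN \o p) (dM \o g j \o p)) => a /=.
rewrite -uE !gE !L'E linear_sum; apply/eqP; rewrite eq_sym -subr_eq0; apply/eqP.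
rewrite -[RHS](cE (inr a) j) -sumrB; apply: eq_bigr => i _.
by rewrite linearZ -scalerBr.
Qed.

(** By [flat_factor] with zero endomorphisms, a map from an ideal to J (x) F is a finite sum of maps
    g_j (x) y_j, and each g_j extends to [S]. *)
Lemma inj_tens_flat (F : lmodType R) (J : lmodType S) :
  flat_module F -> injective_module J -> injective_module (tensor phi J F).
Proof.
move=> Fflat Jinj; apply: baer_inj => B uB _.
have domP a x y : (exists z, B (x, z)) -> (exists z, B (y, z)) ->
    exists z, B ((a *: x : S^o) + y, z).
  by move=> [z Bz] [w Bw]; exists (a *: z + w); apply: (smP a Bz Bw).
have dom0 : exists z, B (0, z) by exists 0; apply: (sm0 B).
pose D := @Submodule S S^o (fun r => exists z, B (r, z)) dom0 domP.
have B'0 : B (incl D 0, 0) by rewrite linear0; apply: (sm0 B).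
have B'P (a : S) (x y : subm D * tensor phi J F) : B (incl D x.1, x.2) ->
    B (incl D y.1, y.2) -> B (incl D (a *: x + y).1, (a *: x + y).2).
  by move=> Bx By; rewrite (linearP (incl D) a x.1 y.1); apply: (smP a Bx By).
have [||f fB] := @lin_rel S (subm D) (tensor phi J F)
    (@Submodule S _ (fun p => B (incl D p.1, p.2)) B'0 B'P).
- by move=> x; apply: (inclP x).
- by move=> b; rewrite /= linear0; apply: uB.
have fgD : fgen (subm D).
  have [s [sD Ds]] := nS D.
  have [|t [_ ts]] := @spn_lift _ _ _ (incl D) (sm_top (subm D)) s.
    by move=> y /sD /incl_ex [x xy]; exists x.
  exists t => x; have /spn_map [z [tz zx]] : spn (map (incl D) t) (incl D x).
    by rewrite ts; apply/Ds/inclP.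
  by rewrite -(incl_inj zx).
have [|l [y [g [fE _]]]] := @flat_factor F J (subm D) \0 \0 f Fflat fgD.
  move=> n; rewrite /= linear0; elim/pt_ind: (f n) => [|a b w IHw].
    by rewrite linear0.
  by rewrite linearD tmapE -IHw pt0l addr0.
have [h hE] := choice (fun j => Jinj _ _ (incl D) (g j) (@incl_inj _ _ _)).
exists (\sum_j pt phi (h j 1) (y j)); split=> // r z Brz.
have [|r' r'E] := @incl_ex _ _ D r; first by exists z.
have <- : f r' = z by apply/fB; rewrite /= r'E.
rewrite fE scaler_sumr; apply: eq_bigr => j _.
apply: etrans (esym (ptZ phi r (h j 1) (y j))).
rewrite -hE r'E -linearZ; congr (pt phi (h j _) _).
by rewrite -[RHS]/(r * 1) mulr1.
Qed.
End Factor.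

(** * Testing flatness on finitely generated modules *)

Section FlatCriterion.
Variable S : comNzRingType.
Implicit Types A B M N V : lmodType S.
Local Notation id1 := (idfun : {rmorphism S -> S}).

Lemma swap1_ex M N : exists (f : tens M N -> tens N M) (g : tens N M -> tens M N),
  [/\ (forall x y, f (x + y) = f x + f y) /\ (forall x y, g (x + y) = g x + g y),
     (forall m n, f (pt id1 m n) = pt id1 n m) /\
     (forall m n, g (pt id1 n m) = pt id1 m n), cancel f g & cancel g f].
Proof.
have [|||f [fD fE]] := @tens_rec_add _ _ id1 M N (tens N M) (fun m n => pt id1 n m).
- by move=> m m' n; rewrite -ptDr.
- by move=> m n n'; rewrite -ptDl.
- by move=> r m n; rewrite -[r *: n]/(id1 r *: n) pt_bal.
have [|||g [gD gE]] := @tens_rec_add _ _ id1 N M (tens M N) (fun n m => pt id1 m n).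
- by move=> m m' n; rewrite -ptDr.
- by move=> m n n'; rewrite -ptDl.
- by move=> r m n; rewrite -[r *: n]/(id1 r *: n) pt_bal.
exists f, g; split=> //.
  elim/pt_ind=> [|m n x IHx]; first by rewrite (add_map0 fD) (add_map0 gD).
  by rewrite fD gD fE gE IHx.
elim/pt_ind=> [|m n x IHx]; first by rewrite (add_map0 gD) (add_map0 fD).
by rewrite gD fD gE fE IHx.
Qed.

Lemma fgen_subm M (P : submodule M) (s : seq M) :
  (forall x, x \in s -> P x) -> (forall x, P x -> spn s x) -> fgen (subm P).
Proof.
move=> sP Ps.
have [|t [_ ts]] := @spn_lift _ _ _ (incl P) (sm_top (subm P)) s.
  by move=> y /sP /incl_ex [x xy]; exists x.
exists t => x; have /spn_map [z [tz zx]] : spn (map (incl P) t) (incl P x).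
  by rewrite ts; apply/Ps/inclP.
by rewrite -(incl_inj zx).
Qed.

(** Total, with default value 0 outside [P], so that a whole list of tensors can be moved into [P]
    before membership is known. *)
Definition sm_lift M (P : submodule M) (x : M) : subm P :=
  if pselect (P x) is left Px then exist _ x Px else 0.
Lemma sm_liftE M (P : submodule M) x : P x -> incl P (sm_lift P x) = x.
Proof.
by rewrite /sm_lift => Px; case: pselect => // Px'; rewrite inclE.
Qed.
Lemma sm_lift_incl M (P : submodule M) x : sm_lift P (incl P x) = x.
Proof. by apply: incl_inj; rewrite sm_liftE //; apply: inclP. Qed.

(** A derivation of the congruence mentions finitely many elements of [M]; it remains valid over any
    submodule containing them. *)
Lemma tens_eq_fin M N (s t : seq (M * N)) : tens_eq id1 s t ->
  exists L : seq M, forall P : submodule M, (forall x, x \in L -> P x) ->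
    \sum_(p <- s) pt id1 (sm_lift P p.1) p.2 =
    \sum_(p <- t) pt id1 (sm_lift P p.1) p.2.
Proof.
elim=> {s t} [s|s t _ [L LE]|t s u _ [L LE] _ [L' LE']|s s' t t' _ [L LE] _ [L' LE']
  |s t|n|m m' n|m n n'|r m n].
- by exists [::].
- by exists L => P /LE.
- exists (L ++ L') => P PL; rewrite LE ?LE' // => x xL; apply: PL;
    by rewrite mem_cat xL ?orbT.
- exists (L ++ L') => P PL; rewrite !big_cat LE ?LE' // => x xL; apply: PL;
    by rewrite mem_cat xL ?orbT.
- by exists [::] => P _; rewrite !big_cat /= addrC.
- exists [::] => P _; rewrite big_cons !big_nil /= addr0.
  by rewrite -[X in sm_lift P X](linear0 (incl P)) sm_lift_incl pt0l.
- exists [:: m; m'] => P PL; rewrite !big_cons !big_nil /= !addr0.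
  have Pm : P m by apply: PL; rewrite mem_head.
  have Pm' : P m' by apply: PL; rewrite !inE eqxx orbT.
  rewrite -ptDl; congr pt; apply: incl_inj.
  by rewrite linearD !sm_liftE //; apply: smD.
- by exists [::] => P _; rewrite !big_cons !big_nil /= !addr0 ptDr.
- exists [:: m] => P PL; rewrite !big_cons !big_nil /= !addr0.
  have Pm : P m by apply: PL; rewrite mem_head.
  rewrite -pt_bal; congr pt; apply: incl_inj.
  rewrite linearZ !sm_liftE //; exact: smZ.
Qed.

(** A tensor in the kernel is a finite sum, and its vanishing in the target has a finite derivation;
    both live over finitely generated submodules [A] of [M] and [B] of [N]. *)
Lemma flat_criterion V :
  (forall A B (f : {linear A -> B}), fgen A -> fgen B -> injective f ->
     injective (tmap id1 f (idfun : {linear V -> V}))) -> flat_module V.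
Proof.
move=> crit M N f fI.
have [s [t [[sD tD] [sE tE] st ts]]] := swap1_ex M V.
have [s' [t' [[sD' tD'] [sE' tE'] st' ts']]] := swap1_ex N V.
apply: inj0 => x; have [l lE] := pt_sum (t x).
move=> fx.
have tx z : tmap id1 f idfun (t z) = t' (tens_map id1 V f z).
  elim/pt_ind: z => [|m n z IHz].
    by rewrite (add_map0 tD) !linear0 (add_map0 tD').
  rewrite linearD tD tD' linearD -IHz; congr (_ + _).
  by rewrite tE tmapE tens_map_pt; apply: (esym (tE' _ _)).
have := tx x; rewrite fx (add_map0 tD') lE linear_sum.
under eq_bigr => p _ do rewrite tmapE.
move=> sum0; pose l' := [seq (f p.1, p.2) | p <- l].
have [|L LE] := @tens_eq_fin N V l' [::].
  apply/tensP; rewrite !pi_pt big_nil big_map; exact: sum0.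
pose A := spn [seq p.1 | p <- l]; pose B := spn (L ++ [seq p.1 | p <- l']).
have [|g gE] := @corestr _ _ _ (f \o incl A) B.
  move=> a /=; have := inclP a; move: (incl A a) => b.
  have h0 : B (f 0) by rewrite linear0; apply: sm0.
  have hP r u v : B (f u) -> B (f v) -> B (f (r *: u + v)).
    by move=> *; rewrite linearP; apply: smP.
  apply: (@spn_min _ _ _ (@Submodule S M (fun b => B (f b)) h0 hP)) => y /mapP[p pl ->].
  by apply: spn_mem; rewrite mem_cat -map_comp; apply/orP; right; apply/mapP; exists p.
have gI : injective g.
  by move=> a b /(congr1 (incl B)); rewrite !gE /= => /fI /incl_inj.
have Al p : p \in l -> A p.1 by move=> pl; apply/spn_mem/map_f.
pose z := \sum_(p <- l) pt id1 (sm_lift A p.1) p.2.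
suff z0 : z = 0.
  suff tx0 : t x = 0 by rewrite -(ts x) tx0 (add_map0 sD).
  have := congr1 (tmap id1 (incl A) idfun) z0; rewrite linear0 linear_sum => h.
  rewrite -[RHS]h lE; apply: eq_big_seq => p pl.
  rewrite tmapE sm_liftE; [by []|exact: Al].
apply: (crit _ _ g _ _ gI).
- by apply: fgen_subm => [y|y]; [apply: spn_mem|apply].
- by apply: fgen_subm => [y|y]; [apply: spn_mem|apply].
rewrite linear0 linear_sum.
have := LE B; rewrite big_nil big_map => h; rewrite -[RHS]h => [|y yL]; last first.
  by apply: spn_mem; rewrite mem_cat yL.
apply: eq_big_seq => p pl.
rewrite tmapE; congr pt; apply: (@incl_inj _ _ B); rewrite gE /= (sm_liftE (Al _ pl)).
rewrite sm_liftE //; apply/spn_mem; rewrite mem_cat -map_comp; apply/orP; right.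
by apply/mapP; exists p.
Qed.
End FlatCriterion.

(** * Direct sums and their tensor products *)

Section DirectSum.
Variables (S : comNzRingType) (T : eqType) (F : T -> lmodType S).
Local Notation id1 := (idfun : {rmorphism S -> S}).

Definition fsupp (x : prodm F) := exists s : seq T, forall i, i \notin s -> x i = 0.
Fact fsupp0 : fsupp 0. Proof. by exists [::]. Qed.
Fact fsuppP a x y : fsupp x -> fsupp y -> fsupp (a *: x + y).
Proof.
move=> [s sx] [t ty]; exists (s ++ t) => i; rewrite mem_cat negb_or => /andP[si ti].
by rewrite -[LHS]/(a *: x i + y i) sx // ty // scaler0 addr0.
Qed.
Definition dsum := subm (Submodule fsupp0 fsuppP).
HB.instance Definition _ := GRing.Lmodule.on dsum.

Fact ds_in_ex i : exists f : {linear F i -> dsum},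
  forall x, incl (Submodule fsupp0 fsuppP) (f x) = inj_at F i x.
Proof.
apply: corestr => x; exists [:: i] => j; rewrite inE => ij.
by rewrite inj_at_out // eq_sym.
Qed.
Definition ds_in i : {linear F i -> dsum} := projT1 (cid (ds_in_ex i)).
Fact ds_pr_key i : {f : {linear dsum -> F i} |
  forall x, f x = incl (Submodule fsupp0 fsuppP) x i}.
Proof. by exists (comp_at F i \o incl _) => x /=; rewrite comp_atE. Qed.
Definition ds_pr i : {linear dsum -> F i} := sval (ds_pr_key i).
Lemma ds_prE i x : ds_pr i x = incl (Submodule fsupp0 fsuppP) x i.
Proof. exact: (svalP (ds_pr_key i)). Qed.
Lemma ds_pr_in i x : ds_pr i (ds_in i x) = x.
Proof. by rewrite ds_prE (projT2 (cid (ds_in_ex i))) inj_at_in. Qed.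
Lemma ds_pr_out i j x : i != j -> ds_pr j (ds_in i x) = 0.
Proof. by move=> ij; rewrite ds_prE (projT2 (cid (ds_in_ex i))) inj_at_out. Qed.
Lemma ds_ext x y : (forall i, ds_pr i x = ds_pr i y) -> x = y.
Proof.
move=> h; apply: incl_inj; apply: prodmP => i.
by have := h i; rewrite !ds_prE.
Qed.
Lemma ds_fin x : exists s : seq T, forall i, i \notin s -> ds_pr i x = 0.
Proof. by have [s sx] := inclP x; exists s => i /sx h; rewrite ds_prE. Qed.

(** The list [s] is not canonical; allowing every larger list without repetitions lets the supports
    of several elements be merged. *)
Lemma ds_sum x : exists s : seq T, forall t : seq T, uniq t -> {subset s <= t} ->
  x = \sum_(i <- t) ds_in i (ds_pr i x).
Proof.
have [s sx] := ds_fin x; exists s => t ut st; apply: ds_ext => i.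
rewrite linear_sum; have [it|it] := boolP (i \in t).
  rewrite (bigD1_seq i) //= big1 => [|j ji]; first by rewrite ds_pr_in addr0.
  by rewrite ds_pr_out.
rewrite sx; last by apply: contra it => /st.
rewrite big_seq big1 // => j jt; rewrite ds_pr_out //.
by apply: contraNneq it => <-.
Qed.

Lemma ds_map (A : lmodType S) (f : forall i, {linear A -> F i}) :
  (forall a, exists s : seq T, forall i, i \notin s -> f i a = 0) ->
  exists g : {linear A -> dsum}, forall a i, ds_pr i (g a) = f i a.
Proof.
move=> fin; have [g gE] := prodm_lin f.
have [|h hE] := @corestr _ _ _ g (Submodule fsupp0 fsuppP).
  by move=> a; have [s sa] := fin a; exists s => i /sa; rewrite gE.
by exists h => a i; rewrite ds_prE hE gE.
Qed.

Lemma ds_tensr (A : lmodType S) (z : tens A dsum) : exists s : seq T, forall t : seq T, uniq t ->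
  {subset s <= t} ->
  z = \sum_(i <- t) tmap id1 idfun (ds_in i) (tmap id1 idfun (ds_pr i) z).
Proof.
elim/pt_ind: z => [|a x z [s sE]].
  by exists [::] => t _ _; rewrite big1 // => i _; rewrite !linear0.
have [s' s'E] := ds_sum x; exists (s ++ s') => t ut st.
rewrite [in LHS](sE t) //; last by move=> i si; apply: st; rewrite mem_cat si.
rewrite [in LHS](s'E t) //; last by move=> i si; apply: st; rewrite mem_cat si orbT.
rewrite pt_sumr -big_split; apply: eq_bigr => i _.
by rewrite !linearD !tmapE.
Qed.

Lemma ds_tensl (A : lmodType S) (z : tens dsum A) : exists s : seq T, forall t : seq T, uniq t ->
  {subset s <= t} ->
  z = \sum_(i <- t) tmap id1 (ds_in i) idfun (tmap id1 (ds_pr i) idfun z).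
Proof.
elim/pt_ind: z => [|x a z [s sE]].
  by exists [::] => t _ _; rewrite big1 // => i _; rewrite !linear0.
have [s' s'E] := ds_sum x; exists (s ++ s') => t ut st.
rewrite [in LHS](sE t) //; last by move=> i si; apply: st; rewrite mem_cat si.
rewrite [in LHS](s'E t) //; last by move=> i si; apply: st; rewrite mem_cat si orbT.
rewrite pt_suml -big_split; apply: eq_bigr => i _.
by rewrite !linearD !tmapE.
Qed.

Lemma ds_flat : (forall i, flat_module (F i)) -> flat_module dsum.
Proof.
move=> Fflat M N f fI; apply: inj0 => x fx.
have [s sE] := ds_tensl x; rewrite (sE (undup s)) ?undup_uniq //; last first.
  by move=> i; rewrite mem_undup.
rewrite big1 // => i _; suff -> : tmap id1 (ds_pr i) idfun x = 0 by rewrite linear0.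
apply: (Fflat i _ _ f fI); rewrite linear0 tens_mapE.
rewrite (tmap_comp (h := ds_pr i) (k := f)) //.
rewrite -[RHS](linear0 (tmap id1 (ds_pr i) (idfun : {linear N -> N}))) -fx tens_mapE.
by rewrite (tmap_comp (h := ds_pr i) (k := f)).
Qed.
End DirectSum.

(** * Right exact functors on finitely generated modules *)

Section Watts.
Variable S : comNzRingType.
Local Notation id1 := (idfun : {rmorphism S -> S}).
Variables (V : lmodType S) (Phi : lmodType S -> lmodType S).
Variable Phim : forall M N : lmodType S, {linear M -> N} -> {linear Phi M -> Phi N}.
Variable w : forall M : lmodType S, {linear tens M V -> Phi M}.
Hypothesis Phi_comp : forall (L M N : lmodType S) (f : {linear L -> M})
  (g : {linear M -> N}) (h : {linear L -> N}), (forall x, g (f x) = h x) ->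
  forall x, Phim g (Phim f x) = Phim h x.
Hypothesis Phi_lin : forall (M N : lmodType S) (f g h : {linear M -> N}) a,
  (forall x, h x = a *: f x + g x) ->
  forall x, Phim h x = a *: Phim f x + Phim g x.
Hypothesis Phi_id : forall M x, @Phim M M idfun x = x.
Hypothesis Phi_exact : forall (L M N : lmodType S) (f : {linear L -> M})
  (g : {linear M -> N}), (forall y, exists x, g x = y) ->
  (forall x, g x = 0 <-> exists y, f y = x) ->
  (forall y, exists x, Phim g x = y) /\
  (forall x, Phim g x = 0 -> exists y, Phim f y = x).
Hypothesis w_nat : forall (M N : lmodType S) (f : {linear M -> N}) m v,
  Phim f (w M (pt id1 m v)) = w N (pt id1 (f m) v).
Hypothesis w_surj : forall y, exists v, w S^o (pt id1 (1 : S^o) v) = y.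
Hypothesis w_inj : forall v, w S^o (pt id1 (1 : S^o) v) = 0 -> v = 0.

Lemma w_natE (M N : lmodType S) (f : {linear M -> N}) x :
  Phim f (w M x) = w N (tmap id1 f idfun x).
Proof.
move: x; apply: (@tens_ext _ _ _ _ _ _ (Phim f \o w M) (w N \o tmap id1 f idfun)) => m v /=.
by rewrite w_nat tmapE.
Qed.

Lemma Phi_sum (M N : lmodType S) (k : nat) (f : 'I_k -> {linear M -> N})
  (h : {linear M -> N}) : (forall x, h x = \sum_i f i x) ->
  forall x, Phim h x = \sum_i Phim (f i) x.
Proof.
elim: k f h => [|k IHk] f h hE x.
  rewrite big_ord0; apply: add_idem0; rewrite -[X in _ = X + _]scale1r.
  by apply: Phi_lin => y; rewrite hE big_ord0 scaler0 addr0.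
have [|g gE] := @linear_ex S M N (fun x => \sum_(i < k) f (lift ord0 i) x).
  move=> a y z; rewrite scaler_sumr -big_split; apply: eq_bigr => i _.
  by rewrite linearP.
rewrite (Phi_lin (f := f ord0) (g := g) (a := 1)) => [|y]; last first.
  by rewrite hE big_ord_recl gE scale1r.
by rewrite (IHk (fun i => f (lift ord0 i)) g) // scale1r big_ord_recl.
Qed.

(** Finite free case: the identity is the sum of the [inn i \o pr i], and [Phi_sum] carries this
    decomposition through [Phi]. *)
Lemma w_rV k : (forall y, exists x, w 'rV_k x = y) /\
  (forall x, w 'rV_k x = 0 -> x = 0).
Proof.
have inex i : exists f : {linear S^o -> 'rV[S]_k}, forall a, f a = a *: delta_mx 0 i.
  by apply: linear_ex => a x y; rewrite scalerDl scalerA.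
have [inn innE] := choice inex.
have prex i : exists f : {linear 'rV[S]_k -> S^o}, forall v, f v = v 0 i.
  by apply: linear_ex => a x y; rewrite !mxE.
have [pr prE] := choice prex.
have idE (x : 'rV[S]_k) : x = \sum_i inn i (pr i x).
  by rewrite [LHS]row_sum_delta; apply: eq_bigr => i _; rewrite innE prE.
have pr_in i j a : pr j (inn i a) = if i == j then a else 0.
  rewrite prE innE !mxE eqxx /= eq_sym.
  by case: eqP => _; rewrite /= ?mulr1 ?mulr0.
split=> [y|x wx].
  have [v vE] := choice (fun i => w_surj (Phim (pr i) y)).
  exists (\sum_i pt id1 (delta_mx 0 i) (v i)); rewrite linear_sum.
  rewrite -[RHS]Phi_id (@Phi_sum _ _ k (fun i => inn i \o pr i)) //.
  apply: eq_bigr => i _; rewrite -(Phi_comp (f := pr i) (g := inn i)) // -vE w_nat.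
  by rewrite innE scale1r.
have xE : exists v, x = \sum_i pt id1 (delta_mx 0 i) (v i).
  elim/pt_ind: x {wx} => [|m u x [v vE]].
    by exists (fun=> 0); rewrite big1 // => i _; rewrite pt0r.
  exists (fun i => m 0 i *: u + v i); rewrite vE [in LHS](row_sum_delta m) pt_suml.
  rewrite -big_split; apply: eq_bigr => i _.
  by rewrite ptDr -[m 0 i *: delta_mx 0 i]/(id1 (m 0 i) *: delta_mx 0 i) pt_bal.
case: xE wx => v -> wx; rewrite big1 // => i _.
suff -> : v i = 0 by rewrite pt0r.
apply: w_inj; rewrite -[RHS](linear0 (Phim (pr i))) -wx linear_sum linear_sum.
rewrite (bigD1 i) //= big1 => [|j ji]; rewrite w_nat prE !mxE eqxx.
  by rewrite eqxx addr0.
by rewrite eq_sym (negPf ji) pt0l linear0.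
Qed.

(** The Eilenberg-Watts argument: both functors are right exact, so bijectivity at finite free
    modules passes to cokernels of maps between them. *)
Lemma watts (M : lmodType S) : noeth S -> fgen M ->
  (forall y, exists x, w M x = y) /\ (forall x, w M x = 0 -> x = 0).
Proof.
move=> nS /(fpres nS) [k [l [q [p [ps pq]]]]].
have [Ps Pq] := Phi_exact ps pq.
have [ws wi] := w_rV k; have [ws' _] := w_rV l.
split=> [y|x wx].
  have [u <-] := Ps y; have [z <-] := ws u.
  by exists (tmap id1 p idfun z); rewrite w_natE.
have [//|z zx] := tmap_surj (phi := id1) (g := (idfun : {linear V -> V})) ps _ x.
  by move=> v; exists v.
have [|u uE] := Pq (w _ z); first by rewrite w_natE zx.
have [z' z'E] := ws' u.
have zz : z = tmap id1 q idfun z'.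
  apply/eqP; rewrite -subr_eq0; apply/eqP/wi.
  by rewrite linearB -w_natE z'E uE subrr.
rewrite -zx zz (tmap_comp (h := \0) (k := idfun)) // => [|v]; last first.
  by apply/pq; exists v.
by elim/pt_ind: z' {zz z'E} => [|m n y IHy]; rewrite ?linear0 // linearD IHy tmapE pt0l addr0.
Qed.

(** The second half uses the first: on finitely generated modules [Phi] is tensoring with [V], and
    [flat_criterion] tests flatness on these. *)
Lemma watts_flat : noeth S -> (forall M : lmodType S, fgen M ->
    (forall y, exists x, w M x = y) /\ (forall x, w M x = 0 -> x = 0)) /\
  ((forall (A B : lmodType S) (f : {linear A -> B}), injective f ->
     injective (Phim f)) -> flat_module V).
Proof.
move=> nS; split=> [M|PhiI]; first exact: watts.
apply: flat_criterion => A B f fgA fgB fI; apply: inj0 => x fx.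
have [_ wA] := watts nS fgA; apply: wA; apply: (PhiI _ _ f fI).
by rewrite linear0 w_natE fx linear0.
Qed.
End Watts.

(** * Differential modules *)

Section DiffModules.
Variable S : comNzRingType.
Implicit Types A B C E M Y : lmodType S.

Definition sqz M (d : {linear M -> M}) := forall x, d (d x) = 0.
Definition exactd M (d : {linear M -> M}) := forall x, d x = 0 -> exists y, d y = x.
Definition chain E Y (dE : {linear E -> E}) (dY : {linear Y -> Y})
  (f : {linear E -> Y}) := forall x, f (dE x) = dY (f x).
(* Complexes are totalized to modules with a differential, and chain maps are not
   required to be homogeneous; gradings enter only through the perturbation
   lemmas below. *)
Definition nullh E Y (dE : {linear E -> E}) (dY : {linear Y -> Y}) :=
  forall f : {linear E -> Y}, chain dE dY f ->
  exists k : {linear E -> Y}, forall x, f x = dY (k x) + k (dE x).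
(** [e] stands for the operator (-1)^degree; it trades chain maps for anticommuting ones without
    mentioning degrees. *)
Definition signed M (d e : {linear M -> M}) :=
  (forall x, e (e x) = x) /\ forall x, d (e x) = - e (d x).

Record grading M (n : nat) (p : nat -> {linear M -> M}) : Prop := Grading {
  gr_id : forall i x, p i (p i x) = p i x;
  gr_orth : forall i j x, i != j -> p i (p j x) = 0;
  gr_sum : forall x, x = \sum_(i < n) p i x }.
Definition keeps M (p : nat -> {linear M -> M}) (d : {linear M -> M}) :=
  forall i x, d (p i x) = p i (d x).
Definition lowers M (p : nat -> {linear M -> M}) (d : {linear M -> M}) :=
  (forall i x, d (p i.+1 x) = p i (d x)) /\ forall x, d (p 0 x) = 0.

Lemma chain_sub_null E Y (dE : {linear E -> E}) (dY : {linear Y -> Y}) (f h : {linear E -> Y}) : sqz dE -> sqz dY ->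
  chain dE dY f -> chain dE dY (f \- ((dY \o h) \+ (h \o dE))).
Proof.
move=> E2 Y2 fc x /=; rewrite E2 (linear0 h) addr0 linearB linearD Y2 add0r.
by rewrite fc.
Qed.

Lemma null_sub E Y (dE : {linear E -> E}) (dY : {linear Y -> Y}) (f h : {linear E -> Y}) :
  (exists k : {linear E -> Y}, forall x,
     (f \- ((dY \o h) \+ (h \o dE))) x = dY (k x) + k (dE x)) ->
  exists k : {linear E -> Y}, forall x, f x = dY (k x) + k (dE x).
Proof.
move=> [k kE]; exists (k \+ h) => x; have := kE x; rewrite /= => /eqP.
by rewrite subr_eq => /eqP ->; rewrite /= linearD addrACA.
Qed.

Section Perturbation.
Variables (M : lmodType S) (n : nat) (p : nat -> {linear M -> M}).
Variables (d1 d2 d : {linear M -> M}).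
Hypotheses (gr : grading n p) (k1 : keeps p d1) (l2 : lowers p d2).
Hypotheses (dE : forall x, d x = d1 x + d2 x) (dd : sqz d).

Lemma gr_pp i j x : p i (p j x) = if i == j then p j x else 0.
Proof. by case: eqVneq => [->|ij]; rewrite ?(gr_id gr) ?(gr_orth gr). Qed.

Lemma p_d2 i j x : p i (d2 (p j x)) = if i.+1 == j then d2 (p j x) else 0.
Proof.
case: j => [|j]; first by rewrite (proj2 l2) linear0.
by rewrite (proj1 l2) gr_pp eqSS.
Qed.
Lemma p_d1 i j x : p i (d1 (p j x)) = if i == j then d1 (p j x) else 0.
Proof. by rewrite k1 gr_pp. Qed.

Lemma f_p0 Y (f : {linear M -> Y}) : (forall i x, (i < n)%N -> f (p i x) = 0) ->
  forall x, f x = 0.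
Proof.
move=> fp x; rewrite (gr_sum gr x) linear_sum big1 // => i _.
by rewrite fp.
Qed.

(** Filtration from the bottom. If [f] vanishes below degree m, then [f \o p m] is a chain map for
    [d1] alone, since [d2] leads into degree m - 1. The homotopy found for it makes [f] vanish in
    degree m and disturbs only higher degrees. *)
Lemma null_keeps Y (dY : {linear Y -> Y}) : sqz dY -> nullh d1 dY -> nullh d dY.
Proof.
move=> Y2 n1.
suff H j : forall m, (n - m <= j)%N -> forall f : {linear M -> Y}, chain d dY f ->
    (forall i x, (i < m)%N -> f (p i x) = 0) ->
    exists k : {linear M -> Y}, forall x, f x = dY (k x) + k (d x).
  by move=> f fc; apply: (H n 0) => //; rewrite subn0.
elim: j => [|j IHj] m nm f fc fp.
  exists \0 => x /=; rewrite linear0 addr0; apply: f_p0 => i y lt_in.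
  by apply: fp; apply: leq_trans lt_in _; rewrite -subn_eq0 -leqn0.
have [h hE] : exists h : {linear M -> Y}, forall x, f (p m x) = dY (h x) + h (d1 x).
  apply: (n1 (f \o p m)) => x /=.
  rewrite -fc dE linearD -k1; case: (m) fp => [|m'] fp.
    by rewrite (proj2 l2) linear0 addr0.
  by rewrite (proj1 l2) fp // addr0.
apply: (@null_sub _ _ _ _ _ (h \o p m)); apply: (IHj m.+1).
- by rewrite subnS; case: (n - m)%N nm.
- exact: chain_sub_null.
move=> i x; rewrite ltnS leq_eqVlt /= dE => /orP[/eqP->|im].
  rewrite (linearD (p m)) (linearD h) p_d1 eqxx p_d2 gtn_eqF // linear0 addr0.
  by rewrite -[in X in X - _](gr_id gr) hE !(gr_id gr) subrr.
rewrite fp // (linearD (p m)) (linearD h) p_d1 p_d2 gr_pp !gtn_eqF //; last exact: leqW.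
by rewrite !linear0 !addr0 subrr.
Qed.

(** Filtration from the top. If [f] vanishes above degree m, then in degree m it kills the cycles of
    [d2], which are boundaries; so it factors through [d2], and injectivity of [Y] extends the
    factor to a homotopy. *)
Lemma null_lowers Y (dY : {linear Y -> Y}) : sqz dY -> injective_module Y ->
  exactd d2 -> nullh d dY.
Proof.
move=> Y2 Yinj ex2.
suff H m : forall f : {linear M -> Y}, chain d dY f ->
    (forall i x, (m <= i)%N -> f (p i x) = 0) ->
    exists k : {linear M -> Y}, forall x, f x = dY (k x) + k (d x).
  move=> f fc; pose f' := f; have [k kE] : exists k : {linear M -> Y}, forall x,
      (f \o (p n \- p n)) x = dY (k x) + k (d x).
    by exists \0 => x /=; rewrite subrr !linear0 addr0.
  apply: (H n) => // i x ni.
  have -> : p i x = 0; last by rewrite linear0.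
  rewrite (gr_sum gr (p i x)) big1 // => j _; rewrite gr_pp.
  by case: eqP => // ji; move: ni; rewrite -ji leqNgt ltn_ord.
elim: m => [|m IHm] f fc fp.
  by exists \0 => x /=; rewrite linear0 addr0; apply: f_p0 => i y _; apply: fp.
have [h hE] : exists h : {linear M -> Y}, forall x, h (d2 (p m x)) = f (p m x).
  apply: (inj_fact (q := d2 \o p m) (f := f \o p m)) => // x /= z0.
  have [w wE] := ex2 _ z0.
  have wm : d2 (p m.+1 w) = p m x by rewrite (proj1 l2) wE (gr_id gr).
  have : f (d (p m.+1 w)) = 0 by rewrite fc fp // linear0.
  by rewrite dE linearD wm k1 fp // add0r.
(* In degree 0 nothing remains to be corrected: [d2] vanishes there, hence so does [f], and the zero
   homotopy serves. *)
have fm x : (m == 0)%N -> f (p m x) = 0.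
  by move=> /eqP m0; rewrite -hE {1}m0 (proj2 l2) linear0.
pose h' : {linear M -> Y} := if m is j.+1 then h \o p j else \0.
apply: (@null_sub _ _ _ _ _ h'); apply: IHm.
  exact: chain_sub_null.
move=> i x; rewrite {}/h'; case: m fp h hE fm => [|j] fp h hE fm.
  move=> _ /=; rewrite linear0 addr0 subr0.
  by case: i => [|i]; [apply: fm|apply: fp].
rewrite leq_eqVlt /= dE => /orP[/eqP <-|ji].
  rewrite (linearD (p j)) (linearD h) p_d1 p_d2 eqxx !gr_pp !ltn_eqF // !linear0 !add0r.
  by rewrite hE subrr.
rewrite fp // (linearD (p j)) (linearD h) p_d1 p_d2 gr_pp (ltn_eqF ji) !ltn_eqF ?(ltnW ji) //.
by rewrite !linear0 !addr0 subrr.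
Qed.

Lemma exact_keeps : exactd d1 -> exactd d.
Proof.
move=> ex1.
suff H m : forall z, d z = 0 -> (forall i, (m <= i)%N -> p i z = 0) ->
    exists y, d y = z.
  move=> z dz; apply: (H n z dz) => i ni.
  rewrite (gr_sum gr (p i z)) big1 // => j _; rewrite gr_pp.
  by case: eqP => // ji; move: ni; rewrite -ji leqNgt ltn_ord.
elim: m => [|m IHm] z dz pz.
  by exists 0; rewrite linear0 (gr_sum gr z) big1 // => i _; rewrite pz.
have [|w wE] := ex1 (p m z).
  have := congr1 (p m) dz; rewrite dE linearD linear0 -k1 -(proj1 l2) (pz m.+1) //.
  by rewrite linear0 addr0.
have wm : d1 (p m w) = p m z by rewrite k1 wE (gr_id gr).
have [|i mi|y yE] := IHm (z - d (p m w)).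
- by rewrite linearB dz dd subr0.
- rewrite linearB dE linearD p_d2 wm gr_pp.
  move: mi; rewrite leq_eqVlt => /orP[/eqP <-|mi].
    by rewrite eqxx gtn_eqF // addr0 subrr.
  by rewrite (pz i mi) !gtn_eqF ?(leqW mi) // addr0 subrr.
by exists (y + p m w); rewrite linearD yE subrK.
Qed.

Lemma exact_lowers : exactd d2 -> exactd d.
Proof.
move=> ex2.
suff H j : forall m, (n - m <= j)%N -> forall z, d z = 0 ->
    (forall i, (i < m)%N -> p i z = 0) -> exists y, d y = z.
  by move=> z dz; apply: (H n 0) => //; rewrite subn0.
elim: j => [|j IHj] m nm z dz pz.
  exists 0; rewrite linear0 (gr_sum gr z) big1 // => i _; apply: pz.
  by apply: leq_trans (ltn_ord i) _; rewrite -subn_eq0 -leqn0.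
have [|w wE] := ex2 (p m z).
  case: (m) pz => [|m'] pz; first by rewrite (proj2 l2).
  have := congr1 (p m') dz; rewrite dE linearD linear0 -k1 pz // linear0 add0r.
  by rewrite -(proj1 l2).
have wm : d2 (p m.+1 w) = p m z by rewrite (proj1 l2) wE (gr_id gr).
have [|||y yE] := IHj m.+1 _ (z - d (p m.+1 w)).
- by rewrite subnS; case: (n - m)%N nm.
- by rewrite linearB dz dd subr0.
- move=> i; rewrite ltnS leq_eqVlt linearB dE linearD p_d1 wm gr_pp.
  move=> /orP[/eqP ->|im].
    by rewrite eqxx ltn_eqF // add0r subrr.
  by rewrite (pz i im) !ltn_eqF ?(leqW im) // addr0 subrr.
by exists (y + p m.+1 w); rewrite linearD yE subrK.
Qed.
End Perturbation.

Lemma grading_p0 M n p : @grading M n p -> forall i x, (n <= i)%N -> p i x = 0.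
Proof.
move=> gr i x ni; rewrite (gr_sum gr (p i x)) big1 // => j _.
rewrite (gr_orth gr) //; apply: contraTneq ni => <-.
by rewrite -ltnNge ltn_ord.
Qed.

(** Composition with the sign operator turns [a] into a chain map. *)
Lemma antinull E Y (dE e : {linear E -> E}) (dY : {linear Y -> Y}) :
  signed dE e -> nullh dE dY ->
  forall a : {linear E -> Y}, (forall x, dY (a x) = - a (dE x)) ->
  exists l : {linear E -> Y}, forall x, a x = dY (l x) - l (dE x).
Proof.
move=> [ee de] nE a ad; have [|k kE] := nE (a \o e).
  by move=> x /=; rewrite ad de linearN opprK.
exists (k \o e) => x /=; have := kE (e x); rewrite /= ee => ->.
by rewrite de linearN.
Qed.

Section ShortExact.
Variables (A B C : lmodType S) (i : {linear A -> B}) (q : {linear B -> C}).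
Variables (dA : {linear A -> A}) (dB : {linear B -> B}) (dC : {linear C -> C}).
Hypotheses (iI : injective i) (qS : forall y, exists x, q x = y).
Hypothesis iq : forall x, q x = 0 <-> exists y, i y = x.
Hypotheses (ic : chain dA dB i) (qc : chain dB dC q).
Hypotheses (dA2 : sqz dA) (dB2 : sqz dB) (dC2 : sqz dC).

Lemma qi x : q (i x) = 0. Proof. by apply/iq; exists x. Qed.

Lemma exact_ext : exactd dA -> exactd dC -> exactd dB.
Proof.
move=> exA exC b db; have [|c cE] := exC (q b); first by rewrite -qc db linear0.
have [b' b'c] := qS c.
have /iq [a aE] : q (b - dB b') = 0 by rewrite linearB qc b'c cE subrr.
have [|a' a'E] := exA a.
  by apply: iI; rewrite ic aE linear0 linearB dB2 db subr0.
by exists (i a' + b'); rewrite linearD -ic a'E aE subrK.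
Qed.

Lemma exact_sub : exactd dB -> exactd dC -> exactd dA.
Proof.
move=> exB exC a da; have [|b bE] := exB (i a); first by rewrite -ic da linear0.
have [|c cE] := exC (q b); first by rewrite -qc bE qi.
have [b' b'c] := qS c.
have /iq [a' a'E] : q (b - dB b') = 0 by rewrite linearB qc b'c cE subrr.
by exists a'; apply: iI; rewrite ic a'E linearB dB2 subr0.
Qed.

Variables (Y : lmodType S) (dY : {linear Y -> Y}).
Hypotheses (Yinj : injective_module Y) (dY2 : sqz dY).

(** With [null_quot] and [null_sub3] this replaces the long exact sequence of Hom(-, Y), available
    because [Y] is injective: homotopies on [A] extend to [B], and what remains factors through
    [C]. *)
Lemma null_ext : nullh dA dY -> nullh dC dY -> nullh dB dY.
Proof.
move=> nA nC f fc; have [|k kE] := nA (f \o i); first by move=> x /=; rewrite ic fc.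
have [k' k'E] := Yinj k iI.
apply: (@null_sub _ _ _ _ _ k').
have [|f2 f2E] := @factor _ _ _ _ q (f \- ((dY \o k') \+ (k' \o dB))) qS.
  by move=> b /iq [a <-] /=; rewrite -ic !k'E -kE /= subrr.
have [|l lE] := nC f2.
  move=> c; have [b <-] := qS c; rewrite -qc !f2E.
  exact: (@chain_sub_null _ _ _ _ f k' dB2 dY2 fc b).
by exists (l \o q) => x; rewrite -f2E lE /= qc.
Qed.

(** A homotopy for [f \o q] restricts to an anticommuting map on [A]. Once that is written as a
    boundary and extended to [B], the corrected homotopy descends to [C]. *)
Lemma null_quot eA : signed dA eA -> nullh dB dY -> nullh dA dY -> nullh dC dY.
Proof.
move=> sA nB nA f fc; have [|h hE] := nB (f \o q); first by move=> x /=; rewrite qc fc.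
have [|l lE] := antinull sA nA (a := h \o i).
  move=> x /=; apply/eqP; rewrite -addr_eq0 ic -hE /=.
  by rewrite qi linear0.
have [l' l'E] := Yinj l iI.
have [|h3 h3E] := @factor _ _ _ _ q (h \- ((dY \o l') \- (l' \o dB))) qS.
  by move=> b /iq [a <-] /=; rewrite -ic !l'E -lE /= subrr.
exists h3 => c; have [b <-] := qS c; rewrite -qc !h3E /= dB2.
have := hE b; rewrite /= => ->.
by rewrite (linear0 l') subr0 !(linearB dY) dY2 sub0r opprK addrACA subrr addr0.
Qed.

(** A linear extension [g] fails to be a chain map by an anticommuting map on [C]; a homotopy for
    the latter corrects [g]. *)
Lemma chain_extend eC : signed dC eC -> nullh dC dY ->
  forall f : {linear A -> Y}, chain dA dY f ->
  exists F : {linear B -> Y}, chain dB dY F /\ forall a, F (i a) = f a.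
Proof.
move=> sC nC f fc; have [g gE] := Yinj f iI.
have [|u uE] := @factor _ _ _ _ q ((dY \o g) \- (g \o dB)) qS.
  by move=> b /iq [a <-] /=; rewrite -ic !gE fc subrr.
have [|h hE] := antinull sC nC (a := u).
  move=> c; have [b <-] := qS c; rewrite -qc !uE /= dB2 linear0 subr0.
  by rewrite linearB dY2 sub0r.
exists (g \- (h \o q)); split=> [b|a] /=; last by rewrite qi linear0 subr0 gE.
have := uE b; rewrite hE /= => H.
rewrite qc linearB; move/eqP: H; rewrite subr_eq => /eqP ->.
by rewrite opprD opprB addrA [dY _ + _]addrC subrK.
Qed.

Lemma null_sub3 eC : signed dC eC -> nullh dB dY -> nullh dC dY -> nullh dA dY.
Proof.
move=> sC nB nC f /(chain_extend sC nC) [F [Fc Fi]].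
have [l lE] := nB F Fc; exists (l \o i) => a.
by rewrite /= ic -Fi lE.
Qed.
End ShortExact.

Lemma null_iso A B Y (dA : {linear A -> A}) (dB : {linear B -> B})
  (dY : {linear Y -> Y}) (g : {linear A -> B}) : injective g ->
  (forall y, exists x, g x = y) -> chain dA dB g -> nullh dB dY -> nullh dA dY.
Proof.
move=> gI gs gc nB f fc; have [h [gh hg]] := lin_inv gI gs.
have [|k kE] := nB (f \o h).
  by move=> b /=; rewrite -fc; congr (f _); apply: gI; rewrite gc !hg.
by exists (k \o g) => x; have := kE (g x); rewrite /= gh => ->; rewrite gc.
Qed.
End DiffModules.

(** * Hom functors and evaluation maps *)

Section HomPre.
Variables (S : comNzRingType) (L M N : lmodType S).
Fact hpre_linear (f : {linear L -> M}) :
  linear (fun h : hom M N => hom_comp h (f : hom L M)).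
Proof. by move=> a h k; apply: homP. Qed.
Definition hpre (f : {linear L -> M}) : {linear hom M N -> hom L N} :=
  lin_of (hpre_linear f).
Lemma hpreE f h x : hpre f h x = h (f x). Proof. by []. Qed.
End HomPre.

Section Dom.
Variables (R S : comNzRingType) (phi : {rmorphism R -> S}) (I : lmodType R).
Variables (B B' : lmodType S) (u : {linear B -> B'}).
Definition dom_comp (g : hom_dom phi B' I) : hom_dom phi B I :=
  (g : {linear restr phi B' -> I}) \o restr_map phi u.
Fact dom_map_linear : linear dom_comp.
Proof.
move=> a g h; apply: homP => x; congr (g _ + _).
by rewrite -[RHS]/(u (a *: (x : B))) linearZ.
Qed.
Definition dom_map : {linear hom_dom phi B' I -> hom_dom phi B I} :=
  lin_of dom_map_linear.
Lemma dom_mapE g x : (dom_map g : hom _ _) x = (g : hom _ _) (u x). Proof. by []. Qed.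
End Dom.

Section Cod.
Variables (R S : comNzRingType) (phi : {rmorphism R -> S}) (P : lmodType R).
Variables (B B' : lmodType S) (u : {linear B -> B'}).
Definition cod_comp (g : hom_cod phi P B) : hom_cod phi P B' :=
  restr_map phi u \o (g : {linear P -> restr phi B}).
Fact cod_map_linear : linear cod_comp.
Proof. by move=> a g h; apply: homP => x; apply: (linearP u a). Qed.
Definition cod_map : {linear hom_cod phi P B -> hom_cod phi P B'} :=
  lin_of cod_map_linear.
Lemma cod_mapE g x : (cod_map g : hom _ _) x = u ((g : hom _ _) x). Proof. by []. Qed.
End Cod.

Section WattsDom.
Variables (R S : comNzRingType) (phi : {rmorphism R -> S}).
Variables (Q : lmodType S) (I : lmodType R).
Hypotheses (nS : noeth S) (Iinj : injective_module I).
Local Notation id1 := (idfun : {rmorphism S -> S}).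
Local Notation V := (hom_dom phi Q I).
Local Notation Phi M := (hom_dom phi (hom M Q) I).

Fact ev_at_linear (M : lmodType S) (m : M) : linear (fun f : hom M Q => f m).
Proof. by []. Qed.
Definition ev_at (M : lmodType S) (m : M) : {linear hom M Q -> Q} :=
  lin_of (ev_at_linear m).

Fact wdom_key (M : lmodType S) : {w : {linear tens M V -> Phi M} |
  forall m v, w (pt id1 m v) = dom_map phi I (ev_at m) v}.
Proof.
apply: cid; apply: (@tens_rec _ _ id1 M V (Phi M) (fun m v => dom_map phi I (ev_at m) v)).
- move=> m m' v; apply: homP => f.
  rewrite -[RHS]/((v : hom _ _) (f m) + (v : hom _ _) (f m')) dom_mapE /= linearD.
  exact: linearD.
- by move=> m v v'; rewrite linearD.
- move=> r m v; rewrite linearZ; apply: homP => f.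
  rewrite dom_mapE -[RHS]/((v : hom _ _) ((r *: f) m)).
  by rewrite /= linearZ.
- move=> a m v; apply: homP => f; rewrite dom_mapE.
  by rewrite -[RHS]/((v : hom _ _) ((a *: f) m)) /= linearZ.
Qed.
Definition wdom M := sval (wdom_key M).
Lemma wdomE (M : lmodType S) (m : M) (v : V) (f : hom M Q) :
  (wdom M (pt id1 m v) : hom _ _) f = (v : hom _ _) (f m).
Proof. by rewrite (svalP (wdom_key M)). Qed.

Definition mdom (M N : lmodType S) (f : {linear M -> N}) : {linear Phi M -> Phi N} :=
  dom_map phi I (hpre Q f).

Lemma hom_fact (M N : lmodType S) (f : {linear M -> N}) (h : hom M Q)
  : (forall y, exists x, f x = y) -> (forall x, f x = 0 -> h x = 0) ->
  exists k : hom N Q, hpre Q f k = h.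
Proof.
move=> fs fh; have [k kE] := @factor _ _ _ _ f (h : {linear M -> Q}) fs fh.
by exists k; apply: homP => x; rewrite hpreE kE.
Qed.

Lemma restr_inj_fact (A B : lmodType S) (q : {linear A -> B}) (g : hom_dom phi A I) :
  (forall a, q a = 0 -> (g : hom _ _) a = 0) ->
  exists h : hom_dom phi B I, dom_map phi I q h = g.
Proof.
move=> qg; have [h hE] := inj_fact (q := restr_map phi q)
  (f := (g : {linear restr phi A -> I})) Iinj qg.
by exists h; apply: homP => x; apply: hE.
Qed.

Lemma mdom_exact (L M N : lmodType S) (f : {linear L -> M}) (g : {linear M -> N}) :
  (forall y, exists x, g x = y) -> (forall x, g x = 0 <-> exists y, f y = x) ->
  (forall y, exists x, mdom g x = y) /\
  (forall x, mdom g x = 0 -> exists y, mdom f y = x).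
Proof.
move=> gs gf; split=> [y|x gx].
  apply: restr_inj_fact => h h0.
  suff -> : h = 0 by apply: (linear0 (y : {linear _ -> _})).
  apply: homP => z; have [w <-] := gs z.
  exact: (congr1 (fun k : hom M Q => k w) h0).
apply: restr_inj_fact => h h0.
have [|k <-] := hom_fact (f := g) (h := h) gs.
  move=> z /gf [w <-]; exact: (congr1 (fun k : hom L Q => k w) h0).
exact: (congr1 (fun t : Phi N => (t : hom _ _) k) gx).
Qed.

Fact wdom_watts : (forall M : lmodType S, fgen M ->
    (forall y, exists x, wdom M x = y) /\ (forall x, wdom M x = 0 -> x = 0)) /\
  ((forall (A B : lmodType S) (f : {linear A -> B}), injective f ->
     injective (mdom f)) -> flat_module V).
Proof.
apply: (@watts_flat S V (fun M => Phi M) mdom wdom) => //.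
- move=> A B C f g h fg x; apply: homP => k; rewrite !dom_mapE; congr ((x : hom _ _) _).
  by apply: homP => a; rewrite !hpreE fg.
- move=> A B f g h a fg x; apply: homP => k; rewrite dom_mapE.
  have -> : hpre Q h k = hpre Q f (a *: k) + hpre Q g k.
    by apply: homP => z; rewrite hpreE fg linearD linearZ.
  exact: (linearD (x : {linear _ -> _})).
- by move=> A x; apply: homP => k; rewrite dom_mapE; congr ((x : hom _ _) _); apply: homP.
- exact: mdom_exact.
- move=> A B f m v; apply: homP => h; rewrite dom_mapE !wdomE //.
- move=> y.
  have kex (z : Q) : exists k : hom S^o Q, forall a, k a = a *: z.
    have [|k kE] := @linear_ex S S^o Q (fun a => a *: z); last by exists k.
    by move=> a b c; rewrite scalerDl -scalerA.
  have [k kE] := choice kex.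
  have [|c cE] := @linear_ex S Q (hom S^o Q) k.
    move=> a u v; apply: homP => b.
    rewrite -[RHS]/(a *: k u b + k v b) !kE scalerDr !scalerA.
    by congr (_ + _); rewrite [b * a]mulrC.
  exists (dom_map phi I c y); apply: homP => f; rewrite wdomE dom_mapE.
  congr ((y : hom _ _) _); apply: homP => b; rewrite cE kE -linearZ; congr (f _).
  by rewrite -[LHS]/(b * 1) mulr1.
- move=> v v0; apply: homP => z.
  have [|k kE] := @linear_ex S S^o Q (fun a => a *: z).
    by move=> a b c; rewrite scalerDl -scalerA.
  have := congr1 (fun t : Phi S^o => (t : hom _ _) k) v0.
  by rewrite wdomE kE scale1r.
Qed.

Lemma wdom_bij (M : lmodType S) : fgen M ->
  (forall y, exists x, wdom M x = y) /\ (forall x, wdom M x = 0 -> x = 0).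
Proof. exact: (proj1 wdom_watts). Qed.

(** Under homomorphism evaluation, tensoring with [V] becomes Hom_R(Hom_S(-, Q), I), which preserves
    injections when [Q] and [I] are injective. *)
Lemma dom_flat : injective_module Q -> flat_module V.
Proof.
move=> Qinj; apply: (proj2 wdom_watts) => A B f fI; apply: inj0 => x fx.
apply: homP => h; have [k kE] := Qinj _ _ f (h : {linear A -> Q}) fI.
have -> : h = hpre Q f (k : hom B Q) by apply: homP => a; rewrite hpreE kE.
exact: (congr1 (fun t : Phi B => (t : hom _ _) (k : hom B Q)) fx).
Qed.
End WattsDom.

Section WattsCod.
Variables (R S : comNzRingType) (phi : {rmorphism R -> S}).
Variables (F : lmodType S) (P : lmodType R).
Hypotheses (nS : noeth S) (Pproj : projective_module P).
Local Notation id1 := (idfun : {rmorphism S -> S}).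
Local Notation V := (hom_cod phi P F).
Local Notation Phi M := (hom_cod phi P (tens M F)).

Fact ptl_linear (M : lmodType S) (m : M) : linear (fun x : F => pt id1 m x).
Proof.
move=> a x y; rewrite ptDr; congr (_ + _).
by rewrite ptZ -[a *: m]/(id1 a *: m) pt_bal.
Qed.
Definition ptl (M : lmodType S) (m : M) : {linear F -> tens M F} :=
  lin_of (ptl_linear m).

(** Tensor evaluation M (x) Hom_R(P, F) -> Hom_R(P, M (x) F); projectivity of [P] makes its target
    right exact in [M]. *)
Fact wcod_key (M : lmodType S) : {w : {linear tens M V -> Phi M} |
  forall m v, w (pt id1 m v) = cod_map phi P (ptl m) v}.
Proof.
apply: cid; apply: (@tens_rec _ _ id1 M V (Phi M) (fun m v => cod_map phi P (ptl m) v)).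
- by move=> m m' v; apply: homP => p; apply: ptDl.
- by move=> m v v'; rewrite linearD.
- by move=> r m v; apply: homP => p; apply: pt_bal.
- by move=> a m v; apply: homP => p; rewrite -[LHS]/(pt _ _ _) -ptZ.
Qed.
Definition wcod M := sval (wcod_key M).
Lemma wcodE (M : lmodType S) (m : M) (v : V) (p : P) :
  (wcod M (pt id1 m v) : hom _ _) p = pt id1 m ((v : hom _ _) p).
Proof. by rewrite (svalP (wcod_key M)). Qed.

Definition mcod (M N : lmodType S) (f : {linear M -> N}) : {linear Phi M -> Phi N} :=
  cod_map phi P (tmap id1 f (idfun : {linear F -> F})).

(** Projectivity is applied to the corestriction of [f] to its image, into which [g] maps. *)
Lemma proj_lift (A B : lmodType S) (f : {linear A -> B}) (g : hom_cod phi P B) :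
  (forall p, exists a, f a = (g : hom _ _) p) ->
  exists h : hom_cod phi P A, cod_map phi P f h = g.
Proof.
move=> fg.
have [|f' f'E] := @corestr _ _ _ f (sm_im f); first by move=> a; exists a.
have [g' g'E] := choice (fun p => incl_ex (fg p : sm_im f ((g : hom _ _) p))).
have [|k kE] := @linear_ex R P (restr phi (subm (sm_im f))) g'.
  move=> a x y; apply: (@incl_inj _ _ (sm_im f)).
  apply: etrans (g'E _) _; apply: etrans (linearP (g : {linear _ -> _}) a x y) _.
  have := linearP (incl (sm_im f)) (phi a) (g' x) (g' y).
  by rewrite !g'E => h; apply: (esym h).
have [y|h hE] := @Pproj _ _ (restr_map phi f') k.
  have [a fa] := inclP (y : subm (sm_im f)); exists a.
  by apply: (@incl_inj _ _ (sm_im f)); rewrite -[X in incl _ X = _]/(f' a) f'E.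
exists h; apply: homP => p; rewrite cod_mapE.
have := congr1 (incl (sm_im f)) (hE p).
by rewrite -[X in incl _ X = _]/(f' _) f'E kE g'E.
Qed.

Lemma mcod_exact (L M N : lmodType S) (f : {linear L -> M}) (g : {linear M -> N}) :
  (forall y, exists x, g x = y) -> (forall x, g x = 0 <-> exists y, f y = x) ->
  (forall y, exists x, mcod g x = y) /\
  (forall x, mcod g x = 0 -> exists y, mcod f y = x).
Proof.
move=> gs gf; split=> [y|x gx].
  by apply: proj_lift => p; apply: tmap_surj => // z; exists z.
apply: proj_lift => p; apply: (tens_exactl gs) => [z /gf //|].
exact: (congr1 (fun t : Phi N => (t : hom _ _) p) gx).
Qed.

Fact wcod_watts : (forall M : lmodType S, fgen M ->
    (forall y, exists x, wcod M x = y) /\ (forall x, wcod M x = 0 -> x = 0)) /\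
  ((forall (A B : lmodType S) (f : {linear A -> B}), injective f ->
     injective (mcod f)) -> flat_module V).
Proof.
have [||||c cE] := @tens_rec S S id1 S^o F F (fun a x => a *: x).
- by move=> *; rewrite scalerDl.
- by move=> *; rewrite scalerDr.
- by move=> a m n; rewrite scalerA mulrC.
- by move=> a m n; rewrite scalerA.
have cK z : pt id1 (1 : S^o) (c z) = z.
  elim/pt_ind: z => [|a x z IHz]; first by rewrite linear0 pt0r.
  rewrite linearD ptDr IHz cE; congr (_ + _).
  by rewrite -pt_bal -[id1 a *: _]/(a * 1) mulr1.
apply: (@watts_flat S V (fun M => Phi M) mcod wcod) => //.
- move=> A B C f g h fg x; apply: homP => p; rewrite !cod_mapE.
  exact: tmap_comp.
- move=> A B f g h a fg x; apply: homP => p.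
  rewrite -[RHS]/(a *: tmap id1 f idfun ((x : hom _ _) p) +
    tmap id1 g idfun ((x : hom _ _) p)) cod_mapE.
  have E := @tens_ext _ _ id1 A F _ (tmap id1 h idfun)
    ((a \*: tmap id1 f (idfun : {linear F -> F})) \+ tmap id1 g (idfun : {linear F -> F})).
  apply: E => m n /=; rewrite !tmapE fg ptDl.
  by rewrite ptZ.
- by move=> A x; apply: homP => p; rewrite cod_mapE; apply: tmap_id.
- exact: mcod_exact.
- by move=> A B f m v; apply: homP => p; rewrite cod_mapE !wcodE tmapE.
- move=> y; exists (cod_map phi P c y); apply: homP => p.
  by rewrite wcodE cod_mapE cK.
- move=> v v0; apply: homP => p.
  have := congr1 (fun t : Phi S^o => c ((t : hom _ _) p)) v0.
  by rewrite wcodE cE scale1r => ->; apply: linear0.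
Qed.
Lemma wcod_bij (M : lmodType S) : fgen M ->
  (forall y, exists x, wcod M x = y) /\ (forall x, wcod M x = 0 -> x = 0).
Proof. exact: (proj1 wcod_watts). Qed.

Lemma cod_flat : flat_module F -> flat_module V.
Proof.
move=> Fflat; apply: (proj2 wcod_watts) => A B f fI x y xy.
apply: homP => p; apply: (flatl (phi := id1) Fflat fI).
exact: (congr1 (fun t : Phi B => (t : hom _ _) p) xy).
Qed.
End WattsCod.

(** * Bounded complexes as graded differential modules *)

Section Graded.
Variable S : comNzRingType.

(** A bounded complex, totalized: [gp k] projects to degree k for k below [gn], [gd] lowers the
    degree by one, and [ge] acts as (-1)^k in degree k. *)
Record gdm := Gdm {
  gm :> lmodType S;
  gd : {linear gm -> gm};
  ge : {linear gm -> gm};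
  gn : nat;
  gp : nat -> {linear gm -> gm};
  gsq : sqz gd;
  ggr : grading gn gp;
  glo : lowers gp gd;
  ges : forall i x, ge (gp i x) = (-1) ^+ i *: gp i x }.

Section Props.
Variable D : gdm.
Implicit Types x : D.

Lemma gpp i j x : gp D i (gp D j x) = if i == j then gp D j x else 0.
Proof. exact: gr_pp (ggr D) i j x. Qed.

Lemma geE x : ge D x = \sum_(i < gn D) (-1) ^+ i *: gp D i x.
Proof.
by rewrite [in LHS](gr_sum (ggr D) x) linear_sum; apply: eq_bigr => i _; rewrite ges.
Qed.

Lemma gp_ext (x y : D) : (forall i, gp D i x = gp D i y) -> x = y.
Proof.
move=> h; rewrite (gr_sum (ggr D) x) (gr_sum (ggr D) y).
by apply: eq_bigr => i _.
Qed.

Lemma lin_gp_ext (Y : lmodType S) (f g : {linear D -> Y}) :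
  (forall i x, f (gp D i x) = g (gp D i x)) -> forall x, f x = g x.
Proof.
move=> h x; rewrite (gr_sum (ggr D) x) !linear_sum; by apply: eq_bigr.
Qed.

Lemma gke : keeps (gp D) (ge D).
Proof.
move=> i; apply: (@lin_gp_ext _ (ge D \o gp D i) (gp D i \o ge D)) => j x /=.
rewrite gpp ges linearZ /= gpp.
by case: eqP => _; rewrite ?linear0 ?scaler0 // ges.
Qed.

Lemma gsg : signed (gd D) (ge D).
Proof.
split.
  apply: (@lin_gp_ext _ (ge D \o ge D) idfun) => i x /=.
  by rewrite ges linearZ /= ges scalerA -exprMn mulrNN mulr1 expr1n scale1r.
apply: (@lin_gp_ext _ (gd D \o ge D) (\- (ge D \o gd D))) => i x /=.
rewrite ges linearZ /=; case: i => [|i]; first by rewrite (proj2 (glo D)) scaler0 (linear0 (ge D)) oppr0.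
by rewrite (proj1 (glo D)) ges exprS mulN1r scaleNr.
Qed.
End Props.

Fact flip_sq (D : gdm) : sqz (ge D \o gd D).
Proof. by move=> x /=; rewrite (proj2 (gsg D)) gsq linear0 oppr0 linear0. Qed.
Fact flip_lo (D : gdm) : lowers (gp D) (ge D \o gd D).
Proof.
split=> [i x|x] /=; first by rewrite (proj1 (glo D)) gke.
by rewrite (proj2 (glo D)) linear0.
Qed.
(* With the differential e d, evaluation annihilates the total differential of
   flip D (x) Hom(D, T); see [ev_tot]. *)
Definition flip (D : gdm) : gdm :=
  @Gdm D (ge D \o gd D) (ge D) (gn D) (gp D) (@flip_sq D) (ggr D) (@flip_lo D) (@ges D).

Definition gmor (A B : gdm) (f : {linear A -> B}) :=
  [/\ chain (gd A) (gd B) f, chain (ge A) (ge B) f & forall k, chain (gp A k) (gp B k) f].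

Lemma gmor_flip (A B : gdm) (f : {linear A -> B}) :
  gmor f -> @gmor (flip A) (flip B) f.
Proof.
by move=> [fd fe fp]; split=> // x; rewrite -[LHS]/(f (ge A (gd A x))) fe fd.
Qed.

Lemma exact_flip (D : gdm) : exactd (gd D) -> exactd (gd (flip D)).
Proof.
move=> ex x; rewrite -[gd _ x]/(ge D (gd D x)) => h.
have [|y yE] := ex (- ge D x).
  rewrite linearN (proj2 (gsg D)) opprK; exact: h.
exists (- y); rewrite -[LHS]/(ge D (gd D (- y))) linearN yE opprK.
exact: (proj1 (gsg D)).
Qed.

Lemma restr_lin (M : lmodType S) (P : submodule M) (f : {linear M -> M}) :
  (forall x, P x -> P (f x)) ->
  exists g : {linear subm P -> subm P}, forall x, incl P (g x) = f (incl P x).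
Proof. by move=> Pf; apply: (@corestr _ _ _ (f \o incl P)) => x /=; apply/Pf/inclP. Qed.

Lemma quot_lin (M : lmodType S) (P : submodule M) (f : {linear M -> M}) :
  (forall x, P x -> P (f x)) ->
  exists g : {linear quot P -> quot P}, forall x, g (proj P x) = proj P (f x).
Proof.
move=> Pf; apply: (@factor _ _ _ _ (proj P) (proj P \o f)); first exact: proj_surj.
by move=> x /proj0 Px /=; apply/proj0/Pf.
Qed.

Section SubQuot.
Variables (D : gdm) (P : submodule D).
Hypotheses (Pd : forall x, P x -> P (gd D x)) (Pp : forall k x, P x -> P (gp D k x)).

Lemma Pe x : P x -> P (ge D x).
Proof. by move=> Px; rewrite geE; apply: sm_sum => i _ _; apply/smZ/Pp. Qed.

Lemma gdm_sub : exists (N : gdm) (i : {linear N -> D}),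
  [/\ injective i, forall x, P x <-> exists y, i y = x & gmor i].
Proof.
have [d' dE] := restr_lin Pd; have [e' eE] := restr_lin Pe.
have [p' pE] := choice (fun k => restr_lin (Pp k)).
have I := @incl_inj _ _ P.
have sq : sqz d' by move=> x; apply: I; rewrite !dE gsq linear0.
have gr : grading (gn D) p'.
  split=> [i x|i j x ij|x]; apply: I.
  - by rewrite !pE (gr_id (ggr D)).
  - by rewrite !pE (gr_orth (ggr D)) // linear0.
  - rewrite linear_sum [LHS](gr_sum (ggr D)).
    by apply: eq_bigr => i _; rewrite pE.
have lo : lowers p' d'.
  split=> [i x|x]; apply: I; first by rewrite dE !pE dE (proj1 (glo D)).
  by rewrite dE pE (proj2 (glo D)) linear0.
have es i x : e' (p' i x) = (-1) ^+ i *: p' i x.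
  by apply: I; rewrite eE linearZ pE ges.
exists (@Gdm _ d' e' _ p' sq gr lo es), (incl P); split=> //.
  by move=> x; split=> [/incl_ex //|[y <-]]; apply: inclP.
Qed.

Lemma gdm_quot : exists (C : gdm) (q : {linear D -> C}),
  [/\ forall y, exists x, q x = y, forall x, q x = 0 <-> P x & gmor q].
Proof.
have [d' dE] := quot_lin Pd; have [e' eE] := quot_lin Pe.
have [p' pE] := choice (fun k => quot_lin (Pp k)).
have L := @proj_surj _ _ P.
have sq : sqz d' by move=> y; have [x <-] := L y; rewrite !dE gsq linear0.
have gr : grading (gn D) p'.
  split=> [i y|i j y ij|y]; have [x <-] := L y.
  - by rewrite !pE (gr_id (ggr D)).
  - by rewrite !pE (gr_orth (ggr D)) // linear0.
  - rewrite [in LHS](gr_sum (ggr D) x) linear_sum.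
    by apply: eq_bigr => i _; rewrite pE.
have lo : lowers p' d'.
  split=> [i y|y]; have [x <-] := L y; first by rewrite !(pE, dE) (proj1 (glo D)).
  by rewrite pE dE (proj2 (glo D)) linear0.
have es i y : e' (p' i y) = (-1) ^+ i *: p' i y.
  by have [x <-] := L y; rewrite pE eE ges linearZ.
exists (@Gdm _ d' e' _ p' sq gr lo es), (proj P); split=> //.
  by move=> x; apply: proj0.
by split=> [x|x|k x] /=; rewrite ?dE ?eE ?pE.
Qed.
End SubQuot.

Section SubModel.
Variable D : gdm.
Hypothesis nS : noeth S.
Hypothesis fgH : forall k, exists zs : seq D,
  (forall z, z \in zs -> gd D z = 0 /\ gp D k z = z) /\
  forall x, gd D x = 0 -> gp D k x = x -> exists y, spn zs (x - gd D y).

Let homog k (l : seq D) := forall z, z \in l -> gp D k z = z.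
(** What degree k + 1 must provide for N to have the homology of D: generators mapped into the
    previous span, primitives for the boundaries lying in it, and representatives of all homology
    classes. *)
Let good k (l l' : seq D) := [/\ homog k.+1 l',
  forall z, z \in l' -> spn l (gd D z),
  forall x, spn l x -> (exists y, gd D y = x) -> exists z, spn l' z /\ gd D z = x &
  forall x, gd D x = 0 -> gp D k.+1 x = x -> exists y, spn l' (x - gd D y)].

Lemma spn_homog k l : homog k l -> forall x, spn l x -> gp D k x = x.
Proof.
move=> hl x; have : forall a (u v : D), gp D k u = u -> gp D k v = v ->
    gp D k (a *: u + v) = a *: u + v by move=> a u v Hu Hv; rewrite linearP Hu Hv.
move=> PP; exact: (@spn_min _ _ l (@Submodule S D (fun x => gp D k x = x) (linear0 _) PP) hl).
Qed.

Lemma spn_d (l l' : seq D) : (forall z, z \in l' -> spn l (gd D z)) ->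
  forall x, spn l' x -> spn l (gd D x).
Proof.
move=> h x; have h0 : spn l (gd D 0) by rewrite linear0; apply: sm0.
have PP a (u v : D) : spn l (gd D u) -> spn l (gd D v) -> spn l (gd D (a *: u + v)).
  by move=> Hu Hv; rewrite linearP; apply: smP.
exact: (@spn_min _ _ l' (@Submodule S D (fun x => spn l (gd D x)) h0 PP) h).
Qed.

(** The boundaries within [spn l] are finitely generated because [S] is noetherian; primitives of
    their generators are joined to generators [zs] of the homology. *)
Lemma next_gens k l : homog k l -> exists l', good k l l'.
Proof.
move=> hl; have [t [tP Pt]] :=
  @noeth_sub S D l (sm_cap (spn l) (sm_im (gd D))) nS (fun x h => proj1 h).
have [|ys [ysP ysE]] := @spn_lift _ _ _ (gd D) (sm_ker (gp D k.+1 \- idfun)) t.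
  move=> y /tP [ly [x xy]]; exists (gp D k.+1 x); split.
    by rewrite /= (gr_id (ggr D)) subrr.
  by rewrite (proj1 (glo D)) xy; apply: (spn_homog hl).
have [zs [zsP zsE]] := fgH k.+1.
exists (ys ++ zs); split.
- move=> z; rewrite mem_cat => /orP[/ysP /= /eqP|/zsP [] //].
  by rewrite subr_eq0 => /eqP.
- move=> z; rewrite mem_cat => /orP[zys|/zsP [-> _]]; last exact: sm0.
  by have /tP [] : gd D z \in t by rewrite -ysE map_f.
- move=> x lx imx; have : spn t x by apply: Pt.
  rewrite -ysE => /spn_map [z [sz zx]]; exists z; split=> //.
  by apply: (@spn_sub _ _ ys) => // u; rewrite mem_cat => ->.
- move=> x dx px; have [y sy] := zsE x dx px; exists y.
  by apply: (@spn_sub _ _ zs) => // u; rewrite mem_cat orbC => ->.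
Qed.

Lemma gens_ex : exists L : nat -> seq D, [/\ forall k, homog k (L k),
  forall k, good k (L k) (L k.+1) &
  forall x, gd D x = 0 -> gp D 0 x = x -> exists y, spn (L 0) (x - gd D y)].
Proof.
pose st := {kl : nat * seq D | homog kl.1 kl.2}.
have [zs [zsP zsE]] := fgH 0.
have h0 : homog (0%N, zs).1 (0%N, zs).2 by move=> z /= zz; case: (zsP z zz).
have stepP (x : st) : exists y : st, (sval y).1 = (sval x).1.+1 /\
    good (sval x).1 (sval x).2 (sval y).2.
  case: x => [[k l] hl] /=; have [l' gl'] := next_gens hl.
  have hl' : homog (k.+1, l').1 (k.+1, l').2 by case: gl'.
  by exists (exist _ (k.+1, l') hl').
have [step stepE] := choice stepP.
pose s0 : st := exist _ (0%N, zs) h0.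
have idx k : (sval (iter k step s0)).1 = k.
  by elim: k => //= k IHk; rewrite (proj1 (stepE _)) IHk.
exists (fun k => (sval (iter k step s0)).2); split=> [k|k|x].
- by have := svalP (iter k step s0); rewrite idx.
- by have := proj2 (stepE (iter k step s0)); rewrite idx.
- exact: zsE.
Qed.

Lemma sub_model : exists (N C : gdm) (i : {linear N -> D}) (q : {linear D -> C}),
  [/\ injective i, forall y, exists x, q x = y, forall x, q x = 0 <-> exists y, i y = x,
     gmor i /\ gmor q & fgen N /\ exactd (gd C)].
Proof.
have [L [hL gL L0]] := gens_ex.
have P0 : forall k, spn (L k) (gp D k 0) by move=> k; rewrite linear0; apply: sm0.
have PP a (x y : D) : (forall k, spn (L k) (gp D k x)) ->
    (forall k, spn (L k) (gp D k y)) -> forall k, spn (L k) (gp D k (a *: x + y)).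
  by move=> hx hy k; rewrite linearP; apply: smP.
pose P := @Submodule S D (fun x => forall k, spn (L k) (gp D k x)) P0 PP.
have Pd x : P x -> P (gd D x).
  move=> Px k; rewrite -(proj1 (glo D)).
  by apply: (@spn_d (L k) (L k.+1)); [case: (gL k)|apply: Px].
have Pp j x : P x -> P (gp D j x).
  move=> Px k; rewrite gpp; case: eqP => [<-|_]; [exact: Px|exact: sm0].
have PL k x : spn (L k) x -> P x.
  move=> sx j; rewrite -(spn_homog (hL k) sx) gpp; case: eqP => [->|_].
    by rewrite (spn_homog (hL k) sx).
  exact: sm0.
have [N [i [iI iP im]]] := gdm_sub Pd Pp.
have [C [q [qs qP qm]]] := gdm_quot Pd Pp.
exists N, C, i, q; split=> //.
- by move=> x; split=> [/qP /iP|/iP /qP].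
- split.
    have [|t [_ tE]] := @spn_lift _ _ _ i (sm_top N) (flatten [seq L k | k <- iota 0 (gn D)]).
      move=> y /flattenP [l /mapP [k _ ->] yk].
      by have /iP [x <-] : P y; [apply: (PL k); apply: spn_mem|exists x].
    exists t => x; have Px : P (i x) by apply/iP; exists x.
    suff /spn_map [z [tz /iI <-]] : spn (map i t) (i x) by [].
    rewrite tE (gr_sum (ggr D) (i x)); apply: sm_sum => k _ _.
    apply: (@spn_sub _ _ (L k)) (Px k) => u uk.
    apply/flattenP; exists (L k) => //; apply/mapP; exists (k : nat) => //.
    by rewrite mem_iota ltn_ord.
move=> c dc; have [x xc] := qs c.
have Pdx : P (gd D x) by apply/qP; case: qm => qd _ _; rewrite qd xc.
(* Modulo boundaries each component of [x] lies in the subcomplex: its differential is a boundary in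
   there, hence the differential of some [z] in there, and the remaining cycle is homologous to one
   in there. *)
have comp k : exists z y, spn (L k) z /\ gp D k x = z + gd D y.
  case: k => [|k].
    have [|y sy] := L0 (gp D 0 x) (proj2 (glo D) x); first exact: (gr_id (ggr D)).
    by exists (gp D 0 x - gd D y), y; rewrite subrK.
  have [_ _ im4 cyc] := gL k.
  have [||z [sz dz]] := im4 (gd D (gp D k.+1 x)).
  - by rewrite (proj1 (glo D)); apply: Pdx.
  - by exists (gp D k.+1 x).
  have [||y sy] := cyc (gp D k.+1 x - z).
  - by rewrite linearB dz subrr.
  - by rewrite linearB (gr_id (ggr D)) (spn_homog (hL k.+1) sz).
  exists (gp D k.+1 x - z - gd D y + z), y; split; first exact: smD.
  by rewrite addrAC subrK subrK.
have [z zE] := choice comp; have [y yE] := choice zE.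
exists (q (\sum_(k < gn D) y k)); case: qm => qd _ _; rewrite -qd -xc.
apply/eqP; rewrite eq_sym -subr_eq0 -linearB; apply/eqP/qP.
rewrite (gr_sum (ggr D) x) linear_sum -sumrB; apply: sm_sum => k _ _.
have [sz ->] := yE k; rewrite addrK; exact: PL sz.
Qed.
End SubModel.
End Graded.

(** * Total complexes of tensor products and duals *)

Section Misc.
Variable S : comNzRingType.
Local Notation id1 := (idfun : {rmorphism S -> S}).
Implicit Types M N T X Y : lmodType S.

(** The case d1 = 0 of [null_lowers]. Only the source is bounded; the target is any injective module
    with a square-zero endomorphism. *)
Lemma null_graded_exact (C : gdm S) Y (dY : {linear Y -> Y}) : sqz dY ->
  injective_module Y -> exactd (gd C) -> nullh (gd C) dY.
Proof.
move=> Y2 Yinj ex; apply: (null_lowers (d1 := \0) (ggr C) _ (glo C)) => //.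
- by move=> i x /=; rewrite linear0.
- by move=> x /=; rewrite add0r.
- exact: gsq.
Qed.

(** The case d1 = 0 of [null_keeps]: it suffices to treat the module [D] with zero differential. *)
Lemma null_plain (D : gdm S) Y (dY : {linear Y -> Y}) : sqz dY ->
  (forall g : {linear D -> Y}, (forall x, dY (g x) = 0) ->
     exists h : {linear D -> Y}, forall x, g x = dY (h x)) -> nullh (gd D) dY.
Proof.
move=> Y2 ex; apply: (null_keeps (d1 := \0) (ggr D) _ (glo D)) => //.
- by move=> i x /=; rewrite linear0.
- by move=> x /=; rewrite add0r.
- exact: gsq.
move=> g gc; have [|h hE] := ex g; first by move=> x; rewrite -gc /= linear0.
by exists h => x; rewrite /= linear0 addr0.
Qed.

Lemma inj_pair M N : injective_module M -> injective_module N ->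
  injective_module (M * N)%type.
Proof.
move=> Mi Ni A B f g fI.
have [h hE] := Mi _ _ f (fst \o g) fI.
have [k kE] := Ni _ _ f (snd \o g) fI.
have [|l lE] := @linear_ex S B (M * N)%type (fun b => (h b, k b)).
  by move=> a x y; rewrite !linearP.
by exists l => x; rewrite lE hE kE -surjective_pairing.
Qed.

Fact ttot_key (E : gdm S) X (dX : {linear X -> X}) :
  {f : {linear tens E X -> tens E X} |
   forall z, f z = tmap id1 (gd E) idfun z + tmap id1 (ge E) dX z}.
Proof. by exists (tmap id1 (gd E) idfun \+ tmap id1 (ge E) dX). Qed.
(** The usual differential d (x) 1 + (-1)^degree (x) d; the sign needs a grading on the left factor
    only, so [X] carries none. *)
Definition ttot (E : gdm S) X (dX : {linear X -> X}) := sval (ttot_key E dX).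
Lemma ttot_def (E : gdm S) X (dX : {linear X -> X}) z :
  ttot E dX z = tmap id1 (gd E) idfun z + tmap id1 (ge E) dX z.
Proof. exact: (svalP (ttot_key E dX)). Qed.
Lemma ttotE (E : gdm S) X (dX : {linear X -> X}) m x :
  ttot E dX (pt id1 m x) = pt id1 (gd E m) x + pt id1 (ge E m) (dX x).
Proof. by rewrite ttot_def !tmapE. Qed.

Lemma ttot_sq (E : gdm S) X (dX : {linear X -> X}) : sqz dX -> sqz (ttot E dX).
Proof.
move=> X2; apply: (@tens_ext _ _ id1 E X _ (ttot E dX \o ttot E dX) \0) => m x /=.
rewrite ttotE linearD !ttotE gsq X2 pt0l pt0r add0r addr0.
by rewrite (proj2 (gsg E)) ptNl subrr.
Qed.

Lemma tmap_grading (E : gdm S) X :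
  grading (gn E) (fun k => tmap id1 (gp E k) (idfun : {linear X -> X})).
Proof.
split=> [i z|i j z ij|z].
- by apply: tmap_comp => // m; rewrite (gr_id (ggr E)).
- rewrite (tmap_comp (h := \0) (k := idfun)) => [|m|//]; last first.
    by rewrite (gr_orth (ggr E)).
  by elim/pt_ind: z => [|m x z IHz]; rewrite ?linear0 // linearD IHz tmapE pt0l addr0.
elim/pt_ind: z => [|m x z IHz].
  by rewrite big1 // => i _; rewrite linear0.
rewrite [in LHS]IHz [in LHS](gr_sum (ggr E) m) pt_suml -big_split.
by apply: eq_bigr => i _; rewrite linearD tmapE.
Qed.

Lemma tmap_gradingr (G : lmodType S) n (p : nat -> {linear G -> G}) X :
  grading n p -> grading n (fun k => tmap id1 (idfun : {linear X -> X}) (p k)).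
Proof.
move=> gr; split=> [i z|i j z ij|z].
- by apply: tmap_comp => // m; rewrite (gr_id gr).
- rewrite (tmap_comp (h := idfun) (k := \0)) => [|//|m]; last first.
    by rewrite (gr_orth gr).
  by elim/pt_ind: z => [|m x z IHz]; rewrite ?linear0 // linearD IHz tmapE pt0r addr0.
elim/pt_ind: z => [|m x z IHz].
  by rewrite big1 // => i _; rewrite linear0.
rewrite [in LHS]IHz [in LHS](gr_sum gr x) pt_sumr -big_split.
by apply: eq_bigr => i _; rewrite linearD tmapE.
Qed.

Section TotGrading.
Variables (E : gdm S) (X : lmodType S) (dX : {linear X -> X}).
Let p k := tmap id1 (gp E k) (idfun : {linear X -> X}).

Lemma ttot_keeps : keeps p (tmap id1 (ge E) dX).
Proof.
move=> k z; rewrite /p.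
rewrite (tmap_comp (h := ge E \o gp E k) (k := dX)) //.
by rewrite (tmap_comp (h := ge E \o gp E k) (k := dX)) // => m /=; rewrite gke.
Qed.
Lemma ttot_lowers : lowers p (tmap id1 (gd E) idfun).
Proof.
split=> [k z|z]; rewrite /p.
  rewrite (tmap_comp (h := gd E \o gp E k.+1) (k := idfun)) //.
  rewrite (tmap_comp (h := gd E \o gp E k.+1) (k := idfun)) // => m /=.
  by rewrite (proj1 (glo E)).
rewrite (tmap_comp (h := \0) (k := idfun)) => [|m|//]; last exact: (proj2 (glo E)).
by elim/pt_ind: z => [|m x z IHz]; rewrite ?linear0 // linearD IHz tmapE pt0l addr0.
Qed.
End TotGrading.

Lemma ttot_exact (C : gdm S) X (dX : {linear X -> X}) : sqz dX ->
  flat_module X -> exactd (gd C) -> exactd (ttot C dX).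
Proof.
move=> X2 Xflat exC.
apply: (exact_lowers (d := ttot C dX) (tmap_grading C X) (ttot_keeps dX) (ttot_lowers C X)).
- by move=> z; rewrite ttot_def addrC.
- exact: ttot_sq.
by move=> z; apply: flat_exact.
Qed.

Lemma ttot_null (C : gdm S) X (dX : {linear X -> X}) Y (dY : {linear Y -> Y}) :
  sqz dX -> flat_module X -> exactd (gd C) -> sqz dY -> injective_module Y ->
  nullh (ttot C dX) dY.
Proof.
move=> X2 Xflat exC Y2 Yinj.
apply: (null_lowers (d := ttot C dX) (tmap_grading C X) (ttot_keeps dX) (ttot_lowers C X)) => //.
- by move=> z; rewrite ttot_def addrC.
- exact: ttot_sq.
by move=> z; apply: flat_exact.
Qed.

Lemma ttot_chain (A B : gdm S) (f : {linear A -> B}) X (dX : {linear X -> X}) :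
  gmor f -> chain (ttot A dX) (ttot B dX) (tmap id1 f idfun).
Proof.
move=> [fd fe _]; apply: (@tens_ext _ _ id1 A X _
  (tmap id1 f idfun \o ttot A dX) (ttot B dX \o tmap id1 f idfun)) => m x /=.
by rewrite ttotE linearD !tmapE ttotE fd fe.
Qed.

Section TensorShort.
Variables (A B C : lmodType S) (i : {linear A -> B}) (q : {linear B -> C}).
Hypotheses (iI : injective i) (qS : forall y, exists x, q x = y).
Hypothesis iq : forall x, q x = 0 <-> exists y, i y = x.
Variable X : lmodType S.
Hypothesis Xflat : flat_module X.
Lemma tens_short : [/\ injective (tmap id1 i (idfun : {linear X -> X})),
  (forall y, exists x, tmap id1 q (idfun : {linear X -> X}) x = y) &
  forall x, tmap id1 q (idfun : {linear X -> X}) x = 0 <->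
    exists y, tmap id1 i (idfun : {linear X -> X}) y = x].
Proof.
split; first exact: flatl.
  by move=> y; apply: tmap_surj => // z; exists z.
move=> x; split=> [|[y <-]].
  by apply: tens_exactl => // z /iq.
rewrite (tmap_comp (h := \0) (k := idfun)) => [|m|//]; last by apply/iq; exists m.
by elim/pt_ind: y => [|m z y IHy]; rewrite ?linear0 // linearD IHy tmapE pt0l addr0.
Qed.
End TensorShort.

Lemma tens_swap_ex (A B C : lmodType S) :
  exists f : {linear tens (tens A B) C -> tens (tens A C) B},
  forall a b c, f (pt id1 (pt id1 a b) c) = pt id1 (pt id1 a c) b.
Proof.
have ptr_ex c : exists f : {linear A -> tens A C}, forall a, f a = pt id1 a c.
  by apply: linear_ex => r a b; rewrite ptDl ptZ.
have [g gE] := choice ptr_ex.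
have [||||f fE] := @tens_rec _ _ id1 (tens A B) C (tens (tens A C) B)
    (fun z c => tmap id1 (g c) idfun z).
- by move=> z z' c; rewrite linearD.
- move=> z c c'; apply: (@tens_ext _ _ id1 A B _ (tmap id1 (g (c + c')) idfun)
    (tmap id1 (g c) idfun \+ tmap id1 (g c') idfun)) => a b /=.
  by rewrite !tmapE !gE ptDr ptDl.
- move=> r z c; rewrite linearZ.
  apply: (@tens_ext _ _ id1 A B _ (r \*: tmap id1 (g c) idfun)
    (tmap id1 (g (r *: c)) idfun)) => a b /=.
  rewrite !tmapE !gE ptZ; congr pt; rewrite ptZ.
  by rewrite -[r *: a]/(id1 r *: a) pt_bal.
- by move=> r z c; rewrite linearZ.
by exists f => a b c; rewrite fE tmapE gE.
Qed.

Section Dual.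
Variables (K T : lmodType S) (dK : {linear K -> K}) (n : nat)
  (p : nat -> {linear K -> K}).
Hypotheses (gr : grading n p) (lo : lowers p dK).
Local Notation H := (hom_dom id1 K T).

(** Dualizing reverses degrees: degree k is dual to degree n - 1 - k. The guard matters because
    truncated subtraction would repeat degree 0 for every k from [n] on. *)
Definition dual_p k : {linear H -> H} :=
  dom_map id1 T (if (k < n)%N then p (n - k.+1) else \0).

Lemma dual_grading : grading n dual_p.
Proof.
split=> [i g|i j g ij|g]; apply: homP => x; rewrite /dual_p.
- by rewrite !dom_mapE; case: ifP => _ /=; rewrite ?(gr_id gr).
- rewrite !dom_mapE.
  have u0 : (if (j < n)%N then p (n - j.+1) else \0 : {linear K -> K})
     ((if (i < n)%N then p (n - i.+1) else \0 : {linear K -> K}) x) = 0.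
    case: ifP => jn; case: ifP => i_n; rewrite ?linear0 //=.
    rewrite (gr_orth gr) //; apply: contraNneq ij => h; apply/eqP.
    by move: h jn i_n; lia.
  by rewrite u0; apply: (linear0 (g : {linear _ -> _})).
have -> : (\sum_(i < n) dom_map id1 T (if (i < n)%N then p (n - i.+1) else \0) g : hom _ _) x
  = \sum_(i < n) (g : hom _ _) (p (n - i.+1) x).
  rewrite (big_morph (fun h : H => (h : hom _ _) x) (id1 := 0) (op1 := +%R)) //.
  by apply: eq_bigr => i _; rewrite dom_mapE ltn_ord.
rewrite [in LHS](gr_sum gr x) (reindex_inj rev_ord_inj) /=.
exact: (linear_sum (g : {linear restr id1 K -> T})).
Qed.

Lemma dual_lowers : lowers dual_p (dom_map id1 T dK).
Proof.
split=> [k g|g]; apply: homP => x; rewrite /dual_p !dom_mapE; last first.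
  case: ifP => n0 /=; last exact: (linear0 (g : {linear _ -> _})).
  rewrite -(proj1 lo) subnSK // subn0 (grading_p0 gr) // linear0.
  exact: (linear0 (g : {linear _ -> _})).
have [kn|kn] := boolP (k.+1 < n)%N.
  by rewrite (ltnW kn) -(proj1 lo) ?subnSK.
case: ifP => kn' /=; last by rewrite (linear0 dK).
have -> : (n - k.+1 = 0)%N by move: kn; lia.
by rewrite (proj2 lo).
Qed.

Lemma dual_null Y (dY : {linear Y -> Y}) : injective_module T -> sqz dK -> exactd dK ->
  sqz dY -> injective_module Y -> nullh (dom_map id1 T dK) dY.
Proof.
move=> Tinj K2 exK Y2 Yinj.
apply: (null_lowers (d1 := \0) dual_grading _ dual_lowers) => //.
- by move=> i x; apply: (esym (linear0 (dual_p i))).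
- by move=> x /=; rewrite add0r.
- move=> g; apply: homP => x; rewrite !dom_mapE K2.
  exact: (linear0 (g : {linear _ -> _})).
move=> g g0; apply: (restr_inj_fact Tinj) => x /exK [y <-].
exact: (congr1 (fun t : H => (t : hom _ _) y) g0).
Qed.
End Dual.
End Misc.

(** * The complex Hom(N, D) and the cone of the homothety *)

Section HomGrading.
Variable S : comNzRingType.
Variables (N D : gdm S) (i : {linear N -> D}).
Hypothesis im : gmor i.
Local Notation H := (hom N D).
Let c := gn N.
(** Projection of [D] onto degree m - c, zero for m below c. The shift by [c], the number of degrees
    of [N], makes the degrees of maps N -> D nonnegative. *)
Let sp m : {linear D -> D} := if (m < c)%N then (\0 : {linear D -> D}) else gp D (m - c).

Lemma sp_sp m m' x : sp m (sp m' x) = if m == m' then sp m' x else 0.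
Proof.
rewrite /sp; case: (ltnP m' c) => h'; first by rewrite linear0 if_same.
case: (ltnP m c) => h; first by rewrite (_ : (m == m') = false) //; apply/eqP; lia.
by rewrite gpp (_ : (m - c == m' - c)%N = (m == m')) //; apply/eqP/eqP; lia.
Qed.

Lemma sp_d m x : gd D (sp m.+1 x) = sp m (gd D x).
Proof.
rewrite /sp; case: (ltnP m.+1 c) => h; first by rewrite (ltnW h) linear0.
case: (ltnP m c) => h'.
  have -> : (m.+1 - c = 0)%N by lia.
  by rewrite (proj2 (glo D)).
have -> : (m.+1 - c = (m - c).+1)%N by lia.
by rewrite (proj1 (glo D)).
Qed.

Lemma homD (f g : H) x : (f + g : H) x = f x + g x. Proof. by []. Qed.
Lemma homZ a (f : H) x : (a *: f : H) x = a *: f x. Proof. by []. Qed.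
Lemma hom_sum (I : finType) (F : I -> H) x : (\sum_j F j : H) x = \sum_j F j x.
Proof. exact: (big_morph (fun h : H => h x) (fun _ _ => erefl) erefl). Qed.

Lemma pH_ex k : exists f : {linear H -> H}, forall (h : H) x,
  (f h : H) x = \sum_(j < c) sp (j + k) (h (gp N j x)).
Proof.
have gex (h : H) : exists g : H, forall x, g x = \sum_(j < c) sp (j + k) (h (gp N j x)).
  have [|g gE] := @linear_ex S N D (fun x => \sum_(j < c) sp (j + k) (h (gp N j x))).
    move=> a x y; rewrite scaler_sumr -big_split; apply: eq_bigr => j _.
    by rewrite !linearP.
  by exists g.
have [g gE] := choice gex.
have [|f fE] := @linear_ex S H H g; last by exists f => h x; rewrite fE gE.
move=> a h h'; apply: homP => x; rewrite homD homZ !gE scaler_sumr -big_split.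
by apply: eq_bigr => j _; rewrite homD homZ linearP.
Qed.

(** The sign of the usual Hom differential depends on the degree of [h]. Composing with the sign
    operator e of [N] avoids this: because e d e = - d, the operator h |-> (d h - h d) e squares to
    zero. *)
Lemma dH_ex : exists f : {linear H -> H}, forall (h : H) x,
  (f h : H) x = gd D (h (ge N x)) - h (gd N (ge N x)).
Proof.
have gex (h : H) : exists g : H, forall x, g x = gd D (h (ge N x)) - h (gd N (ge N x)).
  have [|g gE] := @linear_ex S N D (fun x => gd D (h (ge N x)) - h (gd N (ge N x))).
    move=> a x y; rewrite (linearP (ge N)) (linearP h) (linearP (gd D)) (linearP (gd N)).
    by rewrite (linearP h) scalerBr opprD addrACA.
  by exists g.
have [g gE] := choice gex.
have [|f fE] := @linear_ex S H H g; last by exists f => h x; rewrite fE gE.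
move=> a h h'; apply: homP => x; rewrite homD homZ !gE !homD !homZ linearP.
by rewrite scalerBr opprD addrACA.
Qed.

Variables (pH : nat -> {linear H -> H}) (dH : {linear H -> H}).
Hypothesis pHE : forall k (h : H) x,
  (pH k h : H) x = \sum_(j < c) sp (j + k) (h (gp N j x)).
Hypothesis dHE : forall (h : H) x,
  (dH h : H) x = gd D (h (ge N x)) - h (gd N (ge N x)).
Let inc : H := i.

Lemma pH_pH k k' h : pH k (pH k' h) = if k == k' then pH k' h else 0.
Proof.
apply: homP => x; rewrite pHE.
transitivity (\sum_(j < c) sp (j + k) (sp (j + k') (h (gp N j x)))).
  apply: eq_bigr => j _; rewrite pHE (bigD1 j) //= big1 => [|j' jj'].
    by rewrite addr0 (gr_id (ggr N)).
  by rewrite gpp (_ : (j' == j :> nat) = false) ?linear0 //; apply/negbTE.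
case: eqP => [->|kk'].
  by rewrite pHE; apply: eq_bigr => j _; rewrite sp_sp eqxx.
by rewrite big1 // => j _; rewrite sp_sp eqn_add2l; case: eqP.
Qed.

Lemma pH_sum n (h : H) : (c + gn D <= n)%N -> \sum_(k < n) pH k h = h.
Proof.
move=> cn; apply: homP => x; rewrite hom_sum.
under eq_bigr => k _ do rewrite pHE.
rewrite exchange_big [in RHS](gr_sum (ggr N) x) linear_sum.
apply: eq_bigr => j _; set y := h _.
apply: gp_ext => m; rewrite linear_sum.
have spE k : gp D m (sp (j + k) y) = if (j + k == m + c)%N then gp D m y else 0.
  rewrite /sp; case: (ltnP (j + k) c) => h1.
    by rewrite linear0 (_ : (_ == _) = false) //; apply/eqP; lia.
  rewrite gpp (_ : (m == j + k - c)%N = (j + k == m + c)%N); last by apply/eqP/eqP; lia.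
  by case: eqP => // e; congr (gp D _ _); lia.
have jc := ltn_ord j; case: (ltnP m (gn D)) => mn.
  have lt : (m + c - j < n)%N by rewrite /c in jc *; lia.
  rewrite (bigD1 (Ordinal lt)) //= spE (_ : (_ == _) = true); last by apply/eqP; rewrite /c in jc *; lia.
  rewrite big1 ?addr0 // => k /eqP kk; rewrite spE; case: eqP => // e.
  by case: kk; apply: val_inj => /=; lia.
rewrite big1; first by rewrite (grading_p0 (ggr D)).
by move=> k _; rewrite spE (grading_p0 (ggr D) _ mn) if_same.
Qed.

Lemma pH_lo k h : dH (pH k.+1 h) = pH k (dH h).
Proof.
apply: homP => x; rewrite dHE !pHE linear_sum.
under [RHS]eq_bigr => j _ do rewrite dHE linearB.
rewrite sumrB; congr (_ - _).
  by apply: eq_bigr => j _; rewrite addnS sp_d gke.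
set y := ge N x.
have E (a : nat -> D) : a 0%N = 0 -> a c = 0 -> \sum_(j < c) a j.+1 = \sum_(j < c) a j.
  move=> a0 ac; have := big_ord_recr (op := +%R) c (fun j : 'I_c.+1 => a j).
  have := big_ord_recl (op := +%R) (idx := 0) c (fun j : 'I_c.+1 => a j) => /= ->.
  by rewrite a0 ac add0r addr0.
transitivity (\sum_(j < c) sp (j + k) (h (gd N (gp N j y)))); last first.
  by apply: eq_bigr => j _; rewrite gke.
rewrite -(E (fun j => sp (j + k) (h (gd N (gp N j y))))) /=.
- by apply: eq_bigr => j _; rewrite addSnnS (proj1 (glo N)).
- by rewrite (proj2 (glo N)) !linear0.
- by rewrite (grading_p0 (ggr N)) // !linear0.
Qed.

Lemma pH_lo0 h : dH (pH 0 h) = 0.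
Proof.
suff -> : pH 0 h = 0 by rewrite linear0.
by apply: homP => x; rewrite pHE big1 // => j _; rewrite addn0 /sp ltn_ord.
Qed.

Lemma pH_inc k : pH k inc = if k == c then inc else 0.
Proof.
have [_ _ ip] := im; apply: homP => x; rewrite pHE.
have spi j : inc (gp N j x) = sp (j + c) (inc x).
  by rewrite /sp ltnNge leq_addl /= addnK; apply: ip.
under eq_bigr => j _ do rewrite spi sp_sp.
under eq_bigr => j _ do rewrite eqn_add2l.
case: eqP => _; last by rewrite big1.
rewrite [in RHS](gr_sum (ggr N) x) linear_sum.
by apply: eq_bigr => j _; rewrite spi.
Qed.

Lemma dH_inc : dH inc = 0.
Proof. by have [ic _ _] := im; apply: homP => x; rewrite dHE -ic subrr. Qed.

(** The cone of S -> Hom(N, D), s |-> s i. The inclusion sits in degree [c] by [pH_inc], so [S] is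
    placed in degree c + 1, and c + gn D + 2 degrees hold both summands even when [gn D] is 0. *)
Lemma hom_grading_ex : exists (n : nat) (p : nat -> {linear (H * S^o)%type -> (H * S^o)%type})
   (dK : {linear (H * S^o)%type -> (H * S^o)%type}),
  [/\ grading n p, lowers p dK & forall (f : H) (s : S), dK (f, s) = (dH f + s *: inc, 0)].
Proof.
have [|dK dKE] := @linear_ex S (H * S^o)%type (H * S^o)%type (fun z : H * S => (dH z.1 + z.2 *: inc, 0)).
  move=> a [f s] [g t]; congr (_, _); last by rewrite -[RHS]/(a * 0 + 0) mulr0 addr0.
  rewrite -[LHS]/(dH (a *: f + g) + (a * (s : S) + (t : S) : S) *: inc).
  rewrite -[RHS]/(a *: (dH f + (s : S) *: inc) + (dH g + (t : S) *: inc)).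
  by rewrite linearP scalerDr addrACA scalerA -scalerDl.
have pex k : exists p : {linear (H * S^o)%type -> (H * S^o)%type},
    forall z, p z = (pH k z.1, if k == c.+1 then z.2 else 0).
  apply: linear_ex => a [f s] [g t]; congr (_, _); first by rewrite linearP.
  by case: ifP => // _; rewrite -[RHS]/(a * 0 + 0) mulr0 addr0.
have [p pE] := choice pex.
exists (c + gn D).+2, p, dK; split; last by move=> f s; rewrite dKE.
  split=> [k [f s]|k k' [f s] kk'|[f s]].
  - by rewrite !pE /= pH_pH eqxx; case: eqP.
  - rewrite !pE /= pH_pH (negPf kk'); congr (_, _).
    by case: eqP => // kc; case: eqP => // k'c; move/eqP: kk'; rewrite kc k'c.
  - apply: injective_projections; rewrite ?raddf_sum /=.
      under eq_bigr => k _ do rewrite pE.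
      by rewrite pH_sum //; lia.
    under eq_bigr => k _ do rewrite pE /=.
    have lt : (c.+1 < (c + gn D).+2)%N by lia.
    rewrite (bigD1 (Ordinal lt)) //= eqxx big1 ?addr0 // => k /eqP kk.
    by case: eqP => // e; case: kk; apply: val_inj.
split=> [k [f s]|[f s]]; rewrite !dKE ?pE /=; last first.
  by rewrite pH_lo0 scale0r addr0.
rewrite if_same pH_lo linearD linearZ pH_inc eqSS; congr (_ + _, _).
case: eqP => // _; rewrite scale0r; exact: (esym (scaler0 _ (s : S))).
Qed.
End HomGrading.

(** * The evaluation on an injective module and its splitting *)

Section EvDom.
Variables (S : comNzRingType) (A T : lmodType S).
Local Notation id1 := (idfun : {rmorphism S -> S}).
Local Notation G := (hom_dom id1 A T).
Lemma evd_ex : exists f : {linear tens A G -> T},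
  forall x (g : G), f (pt id1 x g) = (g : hom _ _) x.
Proof.
apply: (@tens_rec _ _ id1 A G T (fun x g => (g : hom _ _) x)) => //.
- by move=> x y g; apply: (linearD (g : {linear _ -> _})).
- by move=> a x g; apply: (linearZ_LR (g : {linear restr id1 A -> T}) a x).
Qed.
Definition evd := projT1 (cid evd_ex).
Lemma evdE x (g : G) : evd (pt id1 x g) = (g : hom _ _) x.
Proof. exact: (projT2 (cid evd_ex)). Qed.
End EvDom.

Section Core.
Variables (S : comNzRingType) (D : gdm S).
Local Notation id1 := (idfun : {rmorphism S -> S}).
Implicit Types Y : lmodType S.
Hypothesis nS : noeth S.
Hypothesis Dinj : injective_module D.
Hypothesis H1 : forall F : {linear D -> D}, chain (gd D) (gd D) F ->
  exists (s : S) (k : {linear D -> D}), forall x, F x = s *: x + (gd D (k x) + k (gd D x)).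
Hypothesis H2 : forall (s : S) (k : {linear D -> D}),
  (forall x, s *: x = gd D (k x) + k (gd D x)) -> s = 0.

Variables (N C : gdm S) (i : {linear N -> D}) (q : {linear D -> C}).
Hypotheses (iI : injective i) (qS : forall y, exists x, q x = y).
Hypothesis iq : forall x, q x = 0 <-> exists y, i y = x.
Hypotheses (im : gmor i) (qm : gmor q) (fgN : fgen N) (exC : exactd (gd C)).

Let ic : chain (gd N) (gd D) i. Proof. by case: im. Qed.
Let qc : chain (gd D) (gd C) q. Proof. by case: qm. Qed.
Let nC Y (dY : {linear Y -> Y}) : sqz dY -> injective_module Y -> nullh (gd C) dY.
Proof. by move=> Y2 Yi; apply: null_graded_exact. Qed.

(** A chain map N -> D extends to D, because C is exact and D injective; [H1] applies to the
    extension. *)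
Lemma H1N (f : {linear N -> D}) : chain (gd N) (gd D) f ->
  exists (s : S) (k : {linear N -> D}), forall x,
    f x = s *: i x + (gd D (k x) + k (gd N x)).
Proof.
move=> fc; have [F [Fc FE]] := chain_extend iI qS iq ic qc (@gsq _ D)
  Dinj (@gsq _ D) (gsg C) (nC (@gsq _ D) Dinj) fc.
have [s [k kE]] := H1 Fc; exists s, (k \o i) => x.
by rewrite -FE kE /= ic.
Qed.

(** The homotopy extends to D by injectivity, and the defect lives on C, where it is null-homotopic;
    then [H2] applies. *)
Lemma H2N (s : S) (k : {linear N -> D}) :
  (forall x, s *: i x = gd D (k x) + k (gd N x)) -> s = 0.
Proof.
move=> kE; have [k' k'E] := Dinj k iI.
have F2 : sqz (gd D) := @gsq _ D.
have [|F FE] := @factor _ _ _ _ q ((s \*: idfun) \- ((gd D \o k') \+ (k' \o gd D))) qS.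
  by move=> b /iq [a <-] /=; rewrite -ic !k'E kE subrr.
have [|l lE] := nC (@gsq _ D) Dinj (f := F).
  move=> c; have [b <-] := qS c; rewrite -qc !FE.
  apply: (@chain_sub_null _ _ _ _ _ (s \*: idfun) k' F2 F2) => x /=.
  by rewrite linearZ.
apply: (H2 (k := (l \o q) \+ k')) => x.
have := lE (q x); rewrite FE /= => /eqP; rewrite subr_eq => /eqP ->.
by rewrite qc [X in _ = X + _]linearD addrACA.
Qed.

Section ClaimA.
Variable T : lmodType S.
Hypothesis Tinj : injective_module T.
Local Notation G := (hom_dom id1 D T).
Let dG : {linear G -> G} := dom_map id1 T (gd D).
Local Notation K := (hom N D * S^o)%type.

Lemma dG2 : sqz dG.
Proof.
move=> g; apply: homP => x; rewrite !dom_mapE gsq.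
exact: (linear0 (g : {linear _ -> _})).
Qed.
Lemma Gflat : flat_module G. Proof. exact: dom_flat. Qed.

Lemma ev_tot m : evd D T (ttot (flip D) dG m) = 0.
Proof.
move: m; apply: (@tens_ext _ _ id1 D G _ (evd D T \o ttot (flip D) dG) \0) => x g.
rewrite /= ttotE linearD !evdE dom_mapE -[ge (flip D) x]/(ge D x).
rewrite -[gd (flip D) x]/(ge D (gd D x)) (proj2 (gsg D)).
have E y : (g : hom _ _) (- y) = - (g : hom _ _) y.
  exact: (linearN (g : {linear restr id1 D -> T}) y).
by rewrite E subrr.
Qed.

(** [H1N] and [H2N] together say that the cone of S -> Hom(N, D) is exact, and [dual_null] treats
    its dual. *)
Lemma K_null Y (dY : {linear Y -> Y}) (dH : {linear hom N D -> hom N D})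
  (dK : {linear K -> K}) n (p : nat -> {linear K -> K}) :
  (forall (h : hom N D) x,
    (dH h : hom N D) x = gd D (h (ge N x)) - h (gd N (ge N x))) ->
  grading n p -> lowers p dK ->
  (forall (f : hom N D) (s : S), dK (f, s) = (dH f + s *: (i : hom N D), 0)) ->
  sqz dY -> injective_module Y -> nullh (dom_map id1 T dK) dY.
Proof.
move=> dHE gr lo dKE Y2 Yinj; apply: (dual_null gr lo) => //.
  move=> [f s]; rewrite !dKE scale0r addr0; congr (_, _).
  have -> : dH (dH f + (s : S) *: (i : hom N D)) = dH (dH f).
    have e0 x : (dH (i : hom N D) : hom N D) x = 0 by rewrite (dH_inc im dHE).
    by apply: homP => x; rewrite linearD linearZ homD homZ e0 scaler0 addr0.
  have ede y : ge N (gd N (ge N y)) = - gd N y.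
    by rewrite (proj2 (gsg N)) linearN (proj1 (gsg N)).
  apply: homP => x; rewrite !dHE (proj1 (gsg N)) linearB gsq sub0r ede.
  rewrite (linearN (gd N)) gsq oppr0 (linear0 f) subr0 (linearN f) (linearN (gd D)).
  by rewrite opprK addNr.
move=> [f s]; rewrite dKE => /(congr1 fst) eq1.
have eqx x : gd D (f (ge N x)) - f (gd N (ge N x)) = - (s *: i x).
  have := congr1 (fun h : hom N D => h x) eq1; rewrite homD homZ dHE.
  by move/eqP; rewrite addr_eq0 => /eqP.
have s0 : s = 0.
  apply: (H2N (k := \- (f \o ge N))) => x /=.
  rewrite linearN -[s *: _]opprK -eqx opprB addrC; congr (_ + _).
  by rewrite (proj2 (gsg N)) linearN.
rewrite s0 in eqx *.
have [|s' [k kE]] := H1N (f := f).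
  move=> x; have := eqx (ge N x); rewrite (proj1 (gsg N)) scale0r oppr0 => /eqP.
  by rewrite subr_eq0 => /eqP.
exists ((k \o ge N : hom N D), s' : S^o); rewrite dKE; congr (_, _).
apply: homP => x; rewrite homD homZ dHE kE /= (proj1 (gsg N)).
by rewrite (proj2 (gsg N)) linearN (proj1 (gsg N)) linearN opprK addrC.
Qed.

(** The cone of the evaluation D (x) G -> T, with zero differential on [T]. *)
Let dC : {linear (T * tens D G)%type -> (T * tens D G)%type} :=
  lin_of (fun a x y => congr2 pair (linearP (evd D T) a x.2 y.2)
    (linearP (ttot (flip D) dG) a x.2 y.2) :
    (evd D T (a *: x + y).2, ttot (flip D) dG (a *: x + y).2) =
    a *: (evd D T x.2, ttot (flip D) dG x.2) + (evd D T y.2, ttot (flip D) dG y.2)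
    :> (T * tens D G)%type).

(** Since N is finitely generated, homomorphism evaluation identifies N (x) Hom(D, T) with
    Hom(Hom(N, D), T). Together with T = Hom(S, T) this identifies the cone over N with the dual of
    [K]. *)
Lemma A_null Y (dY : {linear Y -> Y}) (dA : {linear (T * tens N G)%type -> (T * tens N G)%type}) :
  (forall t m, dA (t, m) = (evd D T (tmap id1 i idfun m), ttot (flip N) dG m)) ->
  sqz dY -> injective_module Y -> nullh dA dY.
Proof.
move=> dAE Y2 Yinj.
have [pH pHE] := choice (@pH_ex _ N D).
have [dH dHE] := dH_ex N D.
have [n [p [dK [gr lo dKE]]]] := hom_grading_ex im pHE dHE.
pose w := wdom id1 D T N.
have [wS wI] := @wdom_bij S S id1 D T nS Tinj N fgN.
have psi_ex (z : T * tens N G) : exists g : hom_dom id1 K T,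
    forall (f : hom N D) (s : S), (g : hom _ _) (f, s) = (w z.2 : hom _ _) f + s *: z.1.
  have [|g gE] := @linear_ex S (restr id1 K) T
      (fun k => (w z.2 : hom _ _) k.1 + (k.2 : S) *: z.1).
    move=> a x y; rewrite -[(a *: x + y).1]/(a *: x.1 + y.1).
    rewrite -[(a *: x + y).2]/(a * (x.2 : S) + (y.2 : S)) scalerDl scalerDr scalerA addrACA.
    by congr (_ + _); apply: (linearP (w z.2 : {linear restr id1 (hom N D) -> T}) a x.1 y.1).
  by exists g => f s; rewrite gE.
have [psi psiE] := choice psi_ex.
have [|Psi PsiE] := @linear_ex S (T * tens N G)%type (hom_dom id1 K T) psi.
  move=> a z y; apply: homP => -[f s].
  rewrite psiE -[RHS]/((psi z : hom _ _) (a *: f, a * s) + (psi y : hom _ _) (f, s)) !psiE.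
  rewrite -[(a *: z + y).2]/(a *: z.2 + y.2) -[(a *: z + y).1]/(a *: z.1 + y.1).
  by rewrite linearP scalerDr scalerA [s * a]mulrC addrACA.
have {}PsiE t m (f : hom N D) (s : S) :
    (Psi (t, m) : hom _ _) (f, s) = (w m : hom _ _) f + s *: t.
  by rewrite PsiE psiE.
have wtot m (f : hom N D) : (w (ttot (flip N) dG m) : hom _ _) f = (w m : hom _ _) (dH f).
  elim/pt_ind: m => [|x g m IHm]; first by rewrite !linear0.
  rewrite !linearD -[LHS]/((w (ttot (flip N) dG (pt id1 x g)) : hom _ _) f +
     (w (ttot (flip N) dG m) : hom _ _) f) IHm; congr (_ + _).
  rewrite ttotE linearD -[LHS]/((w (pt id1 (gd (flip N) x) g) : hom _ _) f +
     (w (pt id1 (ge (flip N) x) (dG g)) : hom _ _) f) !wdomE dom_mapE dHE.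
  rewrite -[gd (flip N) x]/(ge N (gd N x)) -[ge (flip N) x]/(ge N x).
  rewrite (proj2 (gsg N)) linearN opprK addrC.
  exact: (esym (linearD (g : {linear restr id1 D -> T}) _ _)).
have wev m : evd D T (tmap id1 i idfun m) = (w m : hom _ _) (i : hom N D).
  elim/pt_ind: m => [|x g m IHm]; first by rewrite !linear0.
  rewrite !linearD tmapE evdE -[RHS]/((w (pt id1 x g) : hom _ _) (i : hom N D) +
     (w m : hom _ _) (i : hom N D)) IHm; congr (_ + _).
  by rewrite /w wdomE.
apply: (null_iso (g := Psi) _ _ _ (K_null dHE gr lo dKE Y2 Yinj)).
- apply: inj0 => -[t m] h.
  have t0 : t = 0.
    have := congr1 (fun g : hom_dom id1 K T => (g : hom _ _) (0, 1 : S)) h.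
    rewrite PsiE scale1r (linear0 (w m : {linear restr id1 (hom N D) -> T})) add0r.
    exact.
  suff -> : m = 0 by rewrite t0.
  apply: wI; apply: homP => f.
  have := congr1 (fun g : hom_dom id1 K T => (g : hom _ _) (f, 0 : S)) h.
  by rewrite PsiE scale0r addr0.
- move=> g.
  have [|v vE] := @linear_ex S (restr id1 (hom N D)) T (fun f => (g : hom _ _) (f, 0)).
    move=> a f f'; rewrite -(linearP (g : {linear restr id1 K -> T}) a (f, 0) (f', 0)).
    congr ((g : hom _ _) (_, _)); apply: (esym _).
    by rewrite -[LHS]/(a * 0 + 0) mulr0 addr0.
  have [m mE] := wS (v : hom_dom id1 (hom N D) T).
  exists ((g : hom _ _) (0, 1), m); apply: homP => -[f s].
  rewrite PsiE /w mE vE addrC.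
  apply: etrans (esym (linearP (g : {linear restr id1 K -> T}) s (0, 1) (f, 0))) _.
  congr ((g : hom _ _) _); congr (_, _).
    by rewrite -[LHS]/((s : S) *: (0 : hom N D) + f) scaler0 add0r.
  by rewrite -[LHS]/((s : S) * 1 + 0) addr0 mulr1.
- move=> [t m]; apply: homP => -[f s].
  rewrite dAE dom_mapE dKE !PsiE wtot wev scale0r addr0.
  rewrite (linearD (w m : {linear restr id1 (hom N D) -> T})); congr (_ + _).
  exact: (esym (linearZ_LR (w m : {linear restr id1 (hom N D) -> T}) s (i : hom N D))).
Qed.

(* The cone of the evaluation is contractible: its restriction to N is dual to
   Hom(N, D) x S, and the rest is (D / N) (x) G. This is the only place where the
   homothety isomorphism is used. *)
Lemma section_ev : exists s : {linear T -> tens D G},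
  (forall t, ttot (flip D) dG (s t) = 0) /\ forall t, evd D T (s t) = t.
Proof.
have DGinj : injective_module (tens D G) by apply: inj_tens_flat => //; apply: Gflat.
have Ci := inj_pair Tinj DGinj.
have tot2 : sqz (ttot (flip D) dG) by apply/ttot_sq/dG2.
have [|dA dAE] := @linear_ex S (T * tens N G)%type (T * tens N G)%type
   (fun z => (evd D T (tmap id1 i idfun z.2), ttot (flip N) dG z.2)).
  move=> a x y; rewrite -[(a *: x + y).2]/(a *: x.2 + y.2).
  by congr (_, _); rewrite !linearP.
have dC2 : sqz dC.
  by move=> [t m]; rewrite /dC /= ev_tot tot2.
have [j_inj q_surj jq] := tens_short iI qS iq Gflat.
have [|j jE] := @linear_ex S (T * tens N G)%type (T * tens D G)%type
   (fun z => (z.1, tmap id1 i idfun z.2)).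
  move=> a x y; rewrite -[(a *: x + y).2]/(a *: x.2 + y.2).
  by congr (_, _); rewrite !linearP.
have nCC : nullh dC dC.
  apply: (@null_ext _ _ _ (tens C G) j (tmap id1 q idfun \o snd) dA dC
     (ttot (flip C) dG)) => //.
  - move=> [t m] [t' m']; rewrite !jE => -[-> /j_inj ->] //.
  - by move=> y; have [x xy] := q_surj y; exists (0, x).
  - move=> [t m] /=; rewrite jq; split=> [[y <-]|[[t' m']]].
      by exists (t, y); rewrite jE.
    by rewrite jE => -[_ <-]; exists m'.
  - move=> [t m]; rewrite dAE !jE /=; congr (_, _).
    exact: (@ttot_chain _ (flip N) (flip D) i _ dG (gmor_flip im) m).
  - by move=> [t m] /=; apply: (@ttot_chain _ (flip D) (flip C) q _ dG (gmor_flip qm) m).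
  - exact: (A_null (fun t m => dAE (t, m)) dC2 Ci).
  - apply: (@ttot_null _ (flip C) G dG _ dC dG2 Gflat (exact_flip exC) dC2 Ci).
(* A contraction of the cone: since (t, 0) is a cycle, it is the boundary of [k (t, 0)], so the
   second component of the latter is a cycle that evaluates to t. *)
have [|k kE] := nCC idfun; first by [].
have [|s sE] := @linear_ex S T (tens D G) (fun t => (k (t, 0)).2).
  move=> a x y; have -> : (a *: x + y, 0) = a *: (x, 0) + (y, 0) :> (T * tens D G)%type.
    by congr (_, _); rewrite -[RHS]/(a *: (0 : tens D G) + 0) scaler0 addr0.
  by rewrite linearP.
have E t : dC (k (t, 0)) = (t, 0).
  have d0 : dC (t, 0) = 0.
    exact: (congr2 pair (linear0 (evd D T)) (linear0 (ttot (flip D) dG))).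
  by have := kE (t, 0); rewrite d0 linear0 addr0 => <-.
exists s; split=> t; rewrite sE.
  exact: (congr1 snd (E t)).
exact: (congr1 fst (E t)).
Qed.
End ClaimA.
End Core.

(** * Exactness of tensor products with injective modules *)

Section TensorExact.
Variables (S : comNzRingType) (D : gdm S).
Local Notation id1 := (idfun : {rmorphism S -> S}).
Variables (X J : lmodType S) (dX : {linear X -> X}).
Hypotheses (X2 : sqz dX) (Dinj : injective_module D).
Hypotheses (nS : noeth S) (Jinj : injective_module J).
Local Notation G := (hom_dom id1 D J).
Let dG : {linear G -> G} := dom_map id1 J (gd D).
Let eG : {linear G -> G} := dom_map id1 J (ge D).
Let D' := flip D.

Hypothesis exDX : exactd (ttot D' dX).

(** Conjugation by the sign operator exchanges this differential with the total one, up to sign. It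
    occurs in [W_exact1] on the components of [G] where [eG] is -1. *)
Lemma ttot_neg_exact : exactd (tmap id1 (gd D') idfun \- tmap id1 (ge D) dX).
Proof.
pose e := tmap id1 (ge D) (idfun : {linear X -> X}).
have ee z : e (e z) = z.
  rewrite /e (tmap_comp (h := idfun) (k := idfun)) => [|m|//].
    exact: tmap_id.
  exact: (proj1 (gsg D)).
have ed z : ttot D' dX (e z) = - e ((tmap id1 (gd D') idfun \- tmap id1 (ge D) dX) z).
  move: z; apply: (@tens_ext _ _ id1 D X _ (ttot D' dX \o e)
    (\- (e \o (tmap id1 (gd D') idfun \- tmap id1 (ge D) dX)))) => m x.
  rewrite /= /e !tmapE ttotE linearB !tmapE /= opprB addrC.
  by rewrite (proj2 (gsg D)) linearN ptNl.
move=> z dz; have [|y yE] := exDX (x := e z); first by rewrite ed dz linear0 oppr0.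
exists (- e y); apply: (can_inj ee); apply: oppr_inj.
by rewrite -ed linearN linearN ee yE.
Qed.

Let W := tens (tens D X) G.
(** The signs are those of the order D, G, X, in which the ungraded [X] comes last. *)
Let d1 : {linear W -> W} :=
  tmap id1 (tmap id1 (gd D') idfun) idfun \+ tmap id1 (tmap id1 (ge D) dX) eG.
Let d2 : {linear W -> W} := tmap id1 (tmap id1 (ge D) idfun) dG.
Let p k := tmap id1 (idfun : {linear tens D X -> tens D X}) (dual_p J (gn D) (gp D) k).

Let grG : grading (gn D) (dual_p J (gn D) (gp D)) := dual_grading J (ggr D).
Let grW : grading (gn D) p := tmap_gradingr (tens D X) grG.

Lemma dual_e k (g : G) : eG (dual_p J (gn D) (gp D) k g) =
  (-1) ^+ (gn D - k.+1) *: dual_p J (gn D) (gp D) k g.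
Proof.
apply: homP => x; rewrite /eG /dual_p !dom_mapE.
rewrite -[RHS]/((g : hom _ _) ((if (k < gn D)%N then gp D (gn D - k.+1) else \0)
   ((-1) ^+ (gn D - k.+1) *: (x : D)))).
case: ifP => kn /=; last by [].
by congr ((g : hom _ _) _); rewrite -gke ges linearZ.
Qed.

Lemma W_keeps : keeps p d1.
Proof.
move=> k z; rewrite /d1 /p /=; rewrite [in RHS]linearD; congr (_ + _).
  rewrite (tmap_comp (h := tmap id1 (gd D') idfun) (k := dual_p J (gn D) (gp D) k)) //.
  by rewrite (tmap_comp (h := tmap id1 (gd D') idfun) (k := dual_p J (gn D) (gp D) k)).
rewrite (tmap_comp (h := tmap id1 (ge D) dX) (k := eG \o dual_p J (gn D) (gp D) k)) //.
rewrite (tmap_comp (h := tmap id1 (ge D) dX) (k := eG \o dual_p J (gn D) (gp D) k)) // => g.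
apply: homP => x; pose q := if (k < gn D)%N then gp D (gn D - k.+1) else \0.
rewrite -[LHS]/((g : hom _ _) (ge D (q x))) -[RHS]/((g : hom _ _) (q (ge D x))).
congr ((g : hom _ _) _); rewrite /q; case: ifP => _; first exact: gke.
exact: linear0.
Qed.

Lemma W_lowers : lowers p d2.
Proof.
have [l1 l2] := dual_lowers J (ggr D) (glo D).
split=> [k z|z]; rewrite /d2 /p.
  rewrite (tmap_comp (h := tmap id1 (ge D) idfun)
    (k := dG \o dual_p J (gn D) (gp D) k.+1)) //.
  rewrite (tmap_comp (h := tmap id1 (ge D) idfun)
    (k := dG \o dual_p J (gn D) (gp D) k.+1)) // => g.
  by rewrite -[LHS]l1.
rewrite (tmap_comp (h := tmap id1 (ge D) idfun) (k := \0)) => [|//|g].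
  by elim/pt_ind: z => [|m x z IHz]; rewrite ?linear0 // linearD IHz tmapE pt0r addr0.
exact: l2.
Qed.

(** On each homogeneous component of [G] the operator [eG] is a sign, so [d1] is there a
    differential of D (x) X, exact for either sign, tensored with the flat [G]. *)
Lemma W_exact1 : exactd d1.
Proof.
have Gfl : flat_module G by apply: dom_flat.
move=> z dz.
suff H k : exists y, d1 y = p k z.
  have [y yE] := choice H; exists (\sum_(k < gn D) y k).
  by rewrite linear_sum [RHS](gr_sum grW); apply: eq_bigr => k _.
have eGp (y : W) : tmap id1 (tmap id1 (ge D) dX) eG (p k y) =
   (-1) ^+ (gn D - k.+1) *: tmap id1 (tmap id1 (ge D) dX) idfun (p k y).
  elim/pt_ind: y => [|m g y IHy]; first by rewrite (linear0 (p k)) !(linear0 (tmap _ _ _)); exact: (esym (scaler0 _ _)).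
  rewrite (linearD (p k)) !(linearD (tmap _ _ _)) IHy; apply: etrans (esym (scalerDr _ _ _)); congr (_ + _).
  rewrite /p !tmapE dual_e /= -[_ *: dual_p _ _ _ _ g]/(id1 _ *: dual_p J (gn D) (gp D) k g).
  by rewrite -pt_bal ptZ.
have dpz : d1 (p k z) = 0 by rewrite W_keeps dz linear0.
have [g [gE gex]] : exists g : {linear tens D X -> tens D X},
   (forall y, d1 (p k y) = tmap id1 g idfun (p k y)) /\ exactd g.
  case E: (odd (gn D - k.+1)).
    exists (tmap id1 (gd D') idfun \- tmap id1 (ge D) dX); split; last exact: ttot_neg_exact.
    move=> y; rewrite /d1 /= eGp -signr_odd E expr1 scaleN1r.
    elim/pt_ind: (p k y) => [|m g u IHu]; first by rewrite !linear0 ?oppr0 ?addr0.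
    by rewrite !linearD -IHu !tmapE /= ptBl addrACA.
  exists (ttot D' dX); split=> // y; rewrite /d1 /= eGp -signr_odd E expr0 scale1r.
  elim/pt_ind: (p k y) => [|m g u IHu]; first by rewrite !linear0 addr0.
  by rewrite !linearD -IHu !tmapE ttot_def /= ptDl addrACA.
have [|w wE] := @flat_exact _ _ id1 G _ _ _ g g Gfl gex (p k z); first by rewrite -gE.
exists (p k w); rewrite gE.
have -> : tmap id1 g idfun (p k w) = p k (tmap id1 g idfun w).
  rewrite /p (tmap_comp (h := g) (k := dual_p J (gn D) (gp D) k)) //.
  by rewrite (tmap_comp (h := g) (k := dual_p J (gn D) (gp D) k)).
by rewrite wE (gr_id grW).
Qed.

Let d : {linear W -> W} := d1 \+ d2.
Lemma d_pt m x g : d (pt id1 (pt id1 m x) g) =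
  pt id1 (pt id1 (gd D' m) x) g + pt id1 (pt id1 (ge D m) (dX x)) (eG g) +
  pt id1 (pt id1 (ge D m) x) (dG g).
Proof. by rewrite /d /d1 /d2 /= !tmapE. Qed.

Lemma W_ext (V : lmodType S) (f g : {linear W -> V}) :
  (forall m x h, f (pt id1 (pt id1 m x) h) = g (pt id1 (pt id1 m x) h)) -> f =1 g.
Proof.
move=> fg; apply: tens_ext => z h; elim/pt_ind: z => [|m x z IHz].
  by rewrite pt0l !linear0.
by rewrite ptDl !linearD fg IHz.
Qed.

Lemma W_sq : sqz d.
Proof.
have G2 g : dG (dG g) = 0.
  by apply: homP => x; rewrite !dom_mapE gsq; apply: (linear0 (g : {linear _ -> _})).
have Gde g : dG (eG g) = - eG (dG g).
  apply: homP => x; rewrite -[RHS]/(- (eG (dG g) : hom _ _) x) !dom_mapE.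
  have := proj2 (gsg D) x => E.
  by rewrite E (linearN (g : {linear restr id1 D -> J})) opprK.
apply: (@W_ext _ (d \o d) \0) => m x g.
rewrite -[LHS]/(d (d _)) -[RHS]/(0 : W).
rewrite d_pt !linearD !d_pt gsq X2 G2 -![ge D' _]/(ge D _).
have de : gd D' (ge D m) = - ge D (gd D' m) by exact: (proj2 (gsg D')).
rewrite de Gde !(pt0l, pt0r) !add0r !addr0 !ptNl ptNr.
rewrite (proj1 (gsg D)) addrACA.
set A := pt id1 (pt id1 (ge D (gd D' m)) (dX x)) (eG g).
set B := pt id1 (pt id1 (ge D (gd D' m)) x) (dG g).
set E := pt id1 (pt id1 m (dX x)) _.
by rewrite addrK addrNK subrr.
Qed.

Lemma W_exact : exactd d.
Proof.
by apply: (exact_keeps grW W_keeps W_lowers _ W_sq W_exact1) => z.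
Qed.

(** A retraction at the level of cycles: the section carries cycles of J (x) X to cycles of [W],
    which is exact, and the evaluation is a chain map back. *)
Lemma tens_inj_exact : (exists s : {linear J -> tens D G},
  (forall t, ttot (flip D) dG (s t) = 0) /\ forall t, evd D J (s t) = t) ->
  exactd (tmap id1 (idfun : {linear J -> J}) dX).
Proof.
move=> [s [st es]] z dz.
have [sw swE] := tens_swap_ex D G X; have [sw' sw'E] := tens_swap_ex D X G.
pose si : {linear tens J X -> W} := sw \o tmap id1 s (idfun : {linear X -> X}).
pose eM := tmap id1 (ge D) eG.
have dsw y : d (sw y) = sw (tmap id1 (ttot D' dG) idfun y + tmap id1 eM dX y).
  elim/pt_ind: y => [|a x y IHy]; first by rewrite !linear0 addr0 linear0.
  rewrite !linearD IHy (linearD sw) [RHS]addrACA; congr (_ + _); rewrite -linearD.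
  elim/pt_ind: a => [|m g a IHa]; first by rewrite !(pt0l, linear0) addr0 linear0.
  rewrite ptDl !linearD IHa (linearD sw) [RHS]addrACA; congr (_ + _).
  by rewrite swE d_pt !tmapE ttotE ptDl !linearD !swE addrAC.
have dsi : d (si z) = 0.
  rewrite -[si z]/(sw (tmap id1 s idfun z)) dsw.
  have -> : tmap id1 (ttot D' dG) (idfun : {linear X -> X}) (tmap id1 s idfun z) = 0.
    rewrite (tmap_comp (h := \0) (k := idfun)) //.
    by elim/pt_ind: (z) => [|m x y IHy]; rewrite ?linear0 // linearD IHy tmapE pt0l addr0.
  have -> : tmap id1 eM dX (tmap id1 s idfun z) =
      tmap id1 (eM \o s) idfun (tmap id1 idfun dX z).
    rewrite (tmap_comp (h := eM \o s) (k := dX)) //.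
    by rewrite (tmap_comp (h := eM \o s) (k := dX)).
  by rewrite dz linear0 addr0 linear0.
have [y yE] := W_exact dsi.
pose ev : {linear W -> tens J X} := tmap id1 (evd D J) idfun \o sw'.
have evE m x g : ev (pt id1 (pt id1 m x) g) = pt id1 ((g : hom _ _) m) x.
  by rewrite /ev /= sw'E tmapE evdE.
have evd_ w : ev (d w) = tmap id1 idfun dX (ev w).
  move: w; apply: (@W_ext _ (ev \o d) (tmap id1 idfun dX \o ev)) => m x g.
  rewrite -[LHS]/(ev (d _)) -[RHS]/(tmap id1 idfun dX (ev _)).
  rewrite d_pt !linearD !evE tmapE !dom_mapE (proj1 (gsg D)).
  have -> : (g : hom _ _) (gd D (ge D m)) = - (g : hom _ _) (gd D' m).
    by rewrite (proj2 (gsg D)); apply: (linearN (g : {linear restr id1 D -> J})).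
  by rewrite addrAC ptNl subrr add0r.
have evsi w : ev (si w) = w.
  elim/pt_ind: w => [|m x w IHw]; first by rewrite (linear0 si) (linear0 ev).
  rewrite (linearD si) (linearD ev) IHw -[si (pt _ _ _)]/(sw (tmap id1 s idfun (pt id1 m x))).
  rewrite tmapE; congr (_ + _); rewrite -[in RHS](es m).
  elim/pt_ind: (s m) => [|a g u IHu]; first by rewrite pt0l (linear0 sw) (linear0 ev) (linear0 (evd D J)) pt0l.
  by rewrite ptDl (linearD sw) (linearD ev) (linearD (evd D J)) IHu swE evE ptDl evdE.
by exists (ev y); rewrite -evd_ yE evsi.
Qed.
End TensorExact.

Section TensorCore.
Variables (S : comNzRingType) (D : gdm S).
Hypotheses (nS : noeth S) (Dinj : injective_module D).
Hypothesis H1 : forall F : {linear D -> D}, chain (gd D) (gd D) F ->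
  exists (s : S) (k : {linear D -> D}), forall x, F x = s *: x + (gd D (k x) + k (gd D x)).
Hypothesis H2 : forall (s : S) (k : {linear D -> D}),
  (forall x, s *: x = gd D (k x) + k (gd D x)) -> s = 0.
Variables (N C : gdm S) (i : {linear N -> D}) (q : {linear D -> C}).
Hypotheses (iI : injective i) (qS : forall y, exists x, q x = y).
Hypothesis iq : forall x, q x = 0 <-> exists y, i y = x.
Hypotheses (im : gmor i) (qm : gmor q) (fgN : fgen N) (exC : exactd (gd C)).

(** Exactness over N gives exactness over D, since C (x) X is exact by flatness of [X]. *)
Lemma tens_exact_model (X J : lmodType S) (dX : {linear X -> X}) :
  sqz dX -> flat_module X -> exactd (ttot (flip N) dX) -> injective_module J ->
  exactd (tmap (idfun : {rmorphism S -> S}) (idfun : {linear J -> J}) dX).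
Proof.
move=> X2 Xfl exN Jinj; apply: (@tens_inj_exact _ D) => //.
  have [jI qS' jq] := tens_short iI qS iq Xfl.
  have ic := @ttot_chain _ (flip N) (flip D) i _ dX (gmor_flip im).
  have qc := @ttot_chain _ (flip D) (flip C) q _ dX (gmor_flip qm).
  refine (exact_ext jI qS' jq ic qc _ exN _); first exact: (@ttot_sq _ (flip D) X dX X2).
  exact: (@ttot_exact _ (flip C) X dX X2 Xfl (exact_flip exC)).
exact: (section_ev nS Dinj H1 H2 iI qS iq im qm fgN exC Jinj).
Qed.
End TensorCore.

Lemma zmod_shuffle (V : zmodType) (a b p p' r r' : V) :
  a - b = (p - p') - (r - r') -> a - (p - r) = b - (p' - r').
Proof.
move=> /eqP; rewrite subr_eq => /eqP ->; rewrite addrAC [_ + b]addrC -addrA.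
by congr (b + _); rewrite !opprB [X in _ + X]addrA subrK addrC addrA subrK.
Qed.

(** * Torsion and localization of injective modules *)

Section TorsionNull.
Variable S : comNzRingType.
Local Notation id1 := (idfun : {rmorphism S -> S}).
Hypothesis nS : noeth S.

(** The vanishing of a derived limit: on finitely supported sequences the map (x_n) |-> (x_n - T
    x_(n-1)) is injective, so the functional given by the sum of the l_n x_n extends along it to the
    whole product. *)
Lemma telescope_ext (A I : lmodType S) (T : {linear A -> A})
  (l : nat -> {linear A -> I}) : injective_module I ->
  exists l' : nat -> {linear A -> I}, forall n x, l' n x - l' n.+1 (T x) = l n x.
Proof.
move=> Iinj; pose P := prodm (fun _ : nat => A).
pose rel (z : (P * I)%type) := exists m (x : nat -> A),
  (forall n, z.1 n = x n - (if n is n'.+1 then T (x n') else 0)) /\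
  forall k, (m <= k)%N -> x k = 0 /\ z.2 = \sum_(n < k) l n (x n).
have rel0 : rel 0.
  exists 0%N, (fun=> 0); split=> [n|k _].
    by case: n => [|n]; rewrite ?(linear0 T) subr0.
  by split=> //; rewrite big1 // => n _; rewrite linear0.
have relP a z w : rel z -> rel w -> rel (a *: z + w).
  move=> [m [x [xz xm]]] [m' [y [yw ym]]]; exists (m + m')%N, (fun n => a *: x n + y n).
  split=> [n|k mk].
    rewrite -[(a *: z + w).1 n]/(a *: z.1 n + w.1 n) xz yw.
    case: n => [|n]; first by rewrite !subr0.
    by rewrite linearP scalerBr opprD addrACA.
  have [xk zE] : x k = 0 /\ z.2 = \sum_(n < k) l n (x n) by apply: xm; lia.
  have [yk wE] : y k = 0 /\ w.2 = \sum_(n < k) l n (y n) by apply: ym; lia.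
  split; first by rewrite xk yk scaler0 addr0.
  rewrite -[LHS]/(a *: z.2 + w.2) zE wE scaler_sumr -big_split.
  by apply: eq_bigr => n _; rewrite linearP.
have [|F FE] := @inj_ext _ _ _ (Submodule rel0 relP) Iinj.
  move=> b [m [x [x0 xm]]].
  have {}x0 n : x n = 0.
    elim: n => [|n IHn]; first by have := x0 0%N; rewrite subr0.
    by have := x0 n.+1; rewrite IHn linear0 subr0.
  have [_ bE] := xm m (leqnn m); rewrite -[b]/((0 : P, b).2) bE.
  by rewrite big1 // => n _; rewrite x0 linear0.
exists (fun n => F \o inj_at (fun=> A) n) => n x /=; rewrite -linearB.
apply: FE; exists n.+1, (inj_at (fun=> A) n x); split=> [j|k nk].
  rewrite -[LHS]/(inj_at (fun=> A) n x j - inj_at (fun=> A) n.+1 (T x) j).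
  congr (_ - _); case: j => [|j]; first by rewrite inj_at_out.
  have [->|nj] := eqVneq n j; first by rewrite !inj_at_in.
  by rewrite !inj_at_out ?linear0 ?eqSS.
split; first by rewrite inj_at_out //; lia.
rewrite (bigD1 (Ordinal nk)) //= inj_at_in big1 ?addr0 // => j jn.
by rewrite inj_at_out ?linear0 // eq_sym.
Qed.

(** Let c^m kill the c-torsion of S. Then c^(m+1) s |-> c^m s x is well defined on an ideal, and its
    extension sends 1 to an element y with c^(m+1) y = c^m x. *)
Lemma tors_div (c : S) (E : lmodType S) (x : E) : injective_module E ->
  exists y, tors c E (x - c *: y).
Proof.
move=> Einj; have [bs [bsT Tbs]] := nS (tors c S^o).
have [m mbs] : exists m, forall s, s \in bs -> c ^+ m *: s = 0.
  elim: (bs) bsT => [|b l IHl] h; first by exists 0%N.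
  have [|m ml] := IHl; first by move=> s sl; apply: h; rewrite inE sl orbT.
  have [n nb] := h b (mem_head _ _); exists (n + m)%N => s; rewrite inE.
  move=> /orP[/eqP->|/ml sm]; [apply: tors_le nb|apply: tors_le sm]; lia.
have mT s : tors c S^o s -> c ^+ m *: s = 0.
  by move=> /Tbs; apply: (@spn_min _ _ bs (sm_ker (c ^+ m \*: (idfun : {linear S^o -> S^o})))).
have [|f fE] := @linear_ex S S^o E (fun s => (s : S) *: (c ^+ m *: x)).
  by move=> a s t; rewrite -[a *: s + t]/((a * (s : S) + t) : S) scalerDl -[(a * _) *: _]scalerA.
have [|g gE] := @inj_fact _ _ _ _ (c ^+ m.+1 \*: (idfun : {linear S^o -> S^o})) f Einj.
  move=> s s0; rewrite fE scalerA mulrC -scalerA -[_ *: x]/(_ : E).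
  have /mT : tors c S^o s by exists m.+1.
  by rewrite scalerA => E0; rewrite -[c ^+ m * s]/(c ^+ m *: (s : S^o)) E0 scale0r.
exists (g 1), m; have := gE 1; rewrite fE scale1r /= linearZ => E1.
by rewrite scalerBr scalerA -exprSr -E1 subrr.
Qed.

Section OneElement.
Variables (D : gdm S) (c : S).
Hypothesis Dinj : injective_module D.
Variables (C : gdm S) (q : {linear D -> C}).
Hypotheses (qS : forall y, exists x, q x = y) (q0 : forall x, q x = 0 <-> tors c D x).
Hypothesis qm : gmor q.

Lemma tors_quot_inj (u : C) : c *: u = 0 -> u = 0.
Proof.
have [x <-] := qS u; rewrite -linearZ_LR => /q0 [n nx]; apply/q0; exists n.+1.
by rewrite exprSr -scalerA.
Qed.

Lemma tors_quot_surj (u : C) : exists v, c *: v = u.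
Proof.
have [x <-] := qS u; have [y /q0 yE] := tors_div c x Dinj; exists (q y).
by apply/esym/eqP; rewrite -subr_eq0 -linearZ_LR -linearB yE.
Qed.

(* C is the colimit of D -c-> D -c-> ..., so homotopies on D are corrected along
   the telescope. *)
Lemma tors_quot_null (Y : lmodType S) (dY : {linear Y -> Y}) : sqz dY ->
  injective_module Y -> nullh (gd D) dY -> nullh (gd C) dY.
Proof.
move=> Y2 Yinj nD f fc; have [qd _ _] := qm.
have cI : injective (c \*: (idfun : {linear C -> C})).
  by apply: inj0 => u /= /tors_quot_inj.
have [g [gl' gr']] := lin_inv cI tors_quot_surj.
have gl u : g (c *: u) = u by exact: gl'.
have gr u : c *: g u = u by exact: gr'.
have gd_ u : g (gd C u) = gd C (g u).
  by apply: cI; rewrite /= gr -linearZ_LR gr.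
have F_ex n : exists h : {linear D -> Y}, forall x,
    f (iter n g (q x)) = dY (h x) + h (gd D x).
  have [|F FE] := @linear_ex S D Y (fun x => f (iter n g (q x))).
    move=> a x y; have -> : iter n g (q (a *: x + y)) = a *: iter n g (q x) + iter n g (q y).
      by elim: n => [|n IHn]; [apply: linearP|rewrite !iterS IHn linearP].
    by rewrite linearP.
  have [|h hE] := nD F; last by exists h => x; rewrite -FE.
  move=> x; rewrite !FE -fc; congr (f _).
  by elim: n {F FE} => [|n IHn]; [apply: qd|rewrite !iterS IHn gd_].
have [h hE] := choice F_ex.
have a_ex n : exists l : {linear D -> Y}, forall x,
    h n x - h n.+1 (c *: x) = dY (l x) - l (gd D x).
  apply: (antinull (gsg D) nD (a := h n \- (h n.+1 \o (c \*: idfun)))) => x /=.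
  rewrite linearB opprB; apply/eqP; rewrite subr_eq addrAC -subr_eq opprK addrC.
  rewrite -linearZ_LR -hE -(hE n.+1) iterSr linearZ_LR gl eqxx //.
have [l lE] := choice a_ex.
have [l' l'E] := telescope_ext (c \*: (idfun : {linear D -> D})) l Yinj.
(* The corrected homotopies satisfy k_n = k_(n+1) c, so [k 0] kills the c-torsion and descends to
   [C]. *)
pose k n : {linear D -> Y} := h n \- ((dY \o l' n) \- (l' n \o gd D)).
have kS n x : k n x = k n.+1 (c *: x).
  have := lE n x; rewrite -!l'E (linearB dY) /= => E0.
  by rewrite /k /= (linearZ_LR (gd D)); apply: zmod_shuffle.
have k0 x : q x = 0 -> k 0%N x = 0.
  move=> /q0 [n nx]; suff -> : k 0%N x = k n (c ^+ n *: x) by rewrite nx linear0.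
  elim: (n) => [|m ->]; first by rewrite scale1r.
  by rewrite kS scalerA -exprS.
have [K KE] := factor qS k0.
exists K => u; have [x <-] := qS u; rewrite -qd !KE.
by rewrite -[q x]/(iter 0 g (q x)) hE /k /= gsq (linear0 (l' 0%N)) subr0 !(linearB dY) Y2 sub0r opprK [RHS]addrACA addrN addr0.
Qed.

(** [c] acts injectively on [C], hence on C (x) G by flatness, so torsion of D (x) G dies there. *)
Lemma tors_tens_lift (G : lmodType S) (z : tens D G) n : flat_module G ->
  c ^+ n *: z = 0 -> tmap id1 q (idfun : {linear G -> G}) z = 0.
Proof.
move=> Gfl cz; have cI : injective (c \*: (idfun : {linear C -> C})).
  by apply: inj0 => u /= /tors_quot_inj.
have I := flatl (phi := id1) Gfl cI.
have cE (u : tens C G) : tmap id1 (c \*: (idfun : {linear C -> C})) (idfun : {linear G -> G}) u = c *: u.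
  elim/pt_ind: u => [|m g u IHu]; first by rewrite linear0 scaler0.
  by rewrite linearD IHu scalerDr tmapE /= ptZ.
have : c ^+ n *: tmap id1 q (idfun : {linear G -> G}) z = 0.
  by rewrite -linearZ_LR cz linear0.
elim: n {cz} => [|n IHn]; first by rewrite scale1r.
rewrite exprS -scalerA -cE => E0; apply: IHn; apply: I; rewrite E0.
exact: esym (linear0 _).
Qed.
End OneElement.

(** [V] is the c-torsion subcomplex; D / V is settled by [tors_quot_null], and [null_sub3] leads
    back to [V]. *)
Lemma tors_gdm (D : gdm S) (c : S) (Y : lmodType S) (dY : {linear Y -> Y}) :
  injective_module D -> sqz dY -> injective_module Y -> nullh (gd D) dY ->
  exists (V : gdm S) (i : {linear V -> D}),
  [/\ injective_module V, injective i /\ gmor i, nullh (gd V) dY,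
     forall x, (exists y, i y = x) <-> tors c D x &
     forall (G : lmodType S) (z : tens D G) n, flat_module G -> c ^+ n *: z = 0 ->
       exists y, tmap id1 i (idfun : {linear G -> G}) y = z].
Proof.
move=> Dinj Y2 Yinj nD.
have st (f : {linear D -> D}) x : tors c D x -> tors c D (f x).
  by move=> [n nx]; exists n; rewrite -linearZ_LR nx linear0.
have [V [i [iI iP im]]] := gdm_sub (st (gd D)) (fun k => st (gp D k)).
have [C [q [qS q0 qm]]] := gdm_quot (st (gd D)) (fun k => st (gp D k)).
have iq x : q x = 0 <-> exists y, i y = x by split=> [/q0/iP|/iP/q0].
have [ic _ _] := im; have [qc _ _] := qm.
exists V, i; split=> //.
- have [|j jE] := @corestr _ _ _ i (tors c D); first by move=> a; apply/iP; exists a.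
  have jI : injective j by move=> a b ab; apply: iI; rewrite -!jE ab.
  have [|r [rl _]] := lin_inv jI.
    move=> b; have /iP [a aE] := inclP b; exists a.
    by apply: (@incl_inj _ _ (tors c D)); rewrite jE.
  by apply: (inj_retract (i := j) (r := r)) => //; apply: inj_tors.
- have nC := tors_quot_null Dinj qS q0 qm Y2 Yinj nD.
  exact: (null_sub3 iI qS iq ic qc (@gsq _ D) Yinj Y2 (gsg C) nD nC).
- by move=> x; split=> /iP.
move=> G z n Gfl cz; have [_ _ jq] := tens_short iI qS iq Gfl.
apply/jq; exact: (tors_tens_lift qS q0 Gfl cz).
Qed.

Lemma tors_list (D : gdm S) (cs : seq S) (Y : lmodType S) (dY : {linear Y -> Y}) :
  injective_module D -> sqz dY -> injective_module Y -> nullh (gd D) dY ->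
  exists (V : gdm S) (i : {linear V -> D}),
  [/\ injective_module V, injective i /\ gmor i, nullh (gd V) dY,
     forall x, (exists y, i y = x) <-> (forall c, c \in cs -> tors c D x) &
     forall (G : lmodType S) (z : tens D G), flat_module G ->
       (forall c, c \in cs -> tors c (tens D G) z) ->
       exists y, tmap id1 i (idfun : {linear G -> G}) y = z].
Proof.
move=> Dinj Y2 Yinj nD; elim: cs => [|c cs [V [i [Vinj [iI im] nV iP iT]]]].
  exists D, idfun; split=> //.
  - by split.
  - by move=> x; split=> // _; exists x.
  - by move=> G z _ _; exists z; apply: tmap_id.
have [V' [j [V'inj [jI jm] nV' jP jT]]] := tors_gdm c Vinj Y2 Yinj nV.
exists V', (i \o j); split=> //.
- split; first by move=> a b /iI/jI.
  case: im jm => id_ ie ip [jd je jp].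
  by split=> [x|x|k x] /=; rewrite ?jd ?je ?jp ?id_ ?ie ?ip.
- move=> x; split.
    move=> [y <-] b; rewrite inE => /orP[/eqP->|bcs] /=.
      have /jP [n nE] : exists y', j y' = j y by exists y.
      by exists n; rewrite -linearZ_LR nE linear0.
    by move: b bcs; apply/iP; exists (j y).
  move=> h; have /iP [y yx] : forall b, b \in cs -> tors b D x.
    by move=> b bcs; apply: h; rewrite inE bcs orbT.
  have /jP [w wy] : tors c V y.
    have [n nx] := h c (mem_head _ _); exists n; apply: iI.
    by rewrite linearZ_LR yx nx linear0.
  by exists w; rewrite /= wy.
move=> G z Gfl h.
have [|y yz] := iT G z Gfl; first by move=> b bcs; apply: h; rewrite inE bcs orbT.
have [n nz] := h c (mem_head _ _).
have [|w wy] := jT G y n Gfl.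
  apply: (flatl (phi := id1) Gfl iI); rewrite linearZ_LR yz nz.
  exact: esym (linear0 _).
exists w; rewrite -yz -wy; symmetry; apply: tmap_comp => //.
Qed.
End TorsionNull.

(** * Tensoring a module concentrated at a prime with a flat module *)

Section PrimeTensor.
Variable S : comNzRingType.
Local Notation id1 := (idfun : {rmorphism S -> S}).

(** Either c occurs at least e times in the word and c^e kills u, or more than n letters differ from
    c and induction applies to them. *)
Lemma word_nilp (cs : seq S) (U : lmodType S) (u : U) :
  (forall c, c \in cs -> tors c U u) ->
  exists n, forall w : seq S, {subset w <= cs} -> (n <= size w)%N ->
    (\prod_(c <- w) c) *: u = 0.
Proof.
elim: cs => [|c cs IHcs] h.
  by exists 1%N => -[|a w] // /(_ a (mem_head _ _)).
have [|n nE] := IHcs; first by move=> b bcs; apply: h; rewrite inE bcs orbT.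
have [e eE] := h c (mem_head _ _); exists (n + e)%N => w wc sw.
have prodE : \prod_(a <- w) a =
    \prod_(a <- [seq a <- w | a != c]) a * c ^+ count_mem c w.
  rewrite (bigID (fun a => a == c)) /= mulrC; congr (_ * _).
    by rewrite big_filter.
  rewrite (eq_bigr (fun=> c)) => [|a /eqP //].
  by rewrite big_const_seq iter_mulr_1.
rewrite prodE; have [le_e|lt_e] := leqP e (count_mem c w).
  by rewrite -scalerA (tors_le le_e eE) scaler0.
rewrite mulrC -scalerA nE ?scaler0 // => [a|].
  by rewrite mem_filter => /andP[ac /wc]; rewrite inE (negPf ac).
rewrite size_filter; have := count_predC (pred1 c) w.
rewrite -[count (predC _) w]/(count (fun a => a != c) w) => E.
by move: sw lt_e; rewrite -E; lia.
Qed.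

Variables (p : submodule S^o) (cs : seq S).
Hypotheses (pcs : forall c : S, c \in cs -> p c) (csp : forall x, p x -> @spn S S^o cs x).
Hypothesis p1 : ~ p 1.
Hypothesis pM : forall a b : S, p (a * b) -> p a \/ p b.

(* Gaussian elimination modulo the prime p. *)
Lemma elim_zero (U : lmodType S) : (forall s (u : U), ~ p s -> s *: u = 0 -> u = 0) ->
  forall k l (c : 'I_k -> 'I_l -> S) (u : 'I_k -> U),
  (forall a : 'I_k -> S, (forall j, p (\sum_i a i * c i j)) -> forall i, p (a i)) ->
  (forall j, \sum_i c i j *: u i = 0) -> forall i, u i = 0.
Proof.
move=> Uinj; elim=> [|k IHk] l c u ind cu; first by case.
have [j nj] : exists j, ~ p (c ord0 j).
  apply: contrapT => no; apply: p1.
  have := ind (fun i => (i == ord0)%:R) _ ord0; rewrite eqxx; apply => j.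
  rewrite big_ord_recl big1 => [|i _]; last by rewrite mul0r.
  by rewrite mul1r addr0; apply: contrapT => nj; apply: no; exists j.
pose s := c ord0 j; pose lf := lift (@ord0 k).
have u0 j' : \sum_i c (lf i) j' *: u (lf i) = - (c ord0 j' *: u ord0).
  by apply/eqP; rewrite -addr_eq0 addrC; apply/eqP; rewrite -[RHS](cu j') big_ord_recl.
have ui i : u (lf i) = 0.
  apply: (IHk l (fun i j' => s * c (lf i) j' - c (lf i) j * c ord0 j')
    (fun i => u (lf i))) i => [a ha i|j'].
    pose a' i := if unlift ord0 i is Some i' then s * a i'
                 else - \sum_i' a i' * c (lf i') j.
    have a'l i' : a' (lf i') = s * a i' by rewrite /a' /lf liftK.
    have a'0 : a' ord0 = - \sum_i' a i' * c (lf i') j by rewrite /a' unlift_none.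
    have : p (a' (lf i)).
      apply: ind => j'; rewrite big_ord_recl a'0.
      rewrite [X in p X](_ : _ = \sum_i0 a i0 * (s * c (lf i0) j' - c (lf i0) j * c ord0 j')) //.
      rewrite mulNr mulr_suml -sumrN -big_split; apply: eq_bigr => i' _ /=.
      by rewrite -/(lf i') a'l; ring.
    by rewrite a'l => /pM [].
  under eq_bigr => i _ do rewrite scalerBl [c _ _ * c ord0 _]mulrC -!scalerA.
  by rewrite sumrB -!scaler_sumr !u0 !scalerN opprK !scalerA mulrC addNr.
move=> i; case: (unliftP ord0 i) => [i'|] ->; first exact: ui.
apply: (Uinj s) => //; apply/eqP; rewrite -oppr_eq0 -u0; apply/eqP.
by rewrite big1 // => i' _; rewrite ui scaler0.
Qed.

Variable G : lmodType S.
Definition pG_pred (h : G) := exists l : seq (S * G),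
  (forall q, q \in l -> q.1 \in cs) /\ h = \sum_(q <- l) q.1 *: q.2.
Fact pG0 : pG_pred 0. Proof. by exists [::]; rewrite big_nil. Qed.
Fact pGP a x y : pG_pred x -> pG_pred y -> pG_pred (a *: x + y).
Proof.
move=> [l [lc ->]] [l' [lc' ->]]; exists ([seq (q.1, a *: q.2) | q <- l] ++ l'); split.
  move=> q; rewrite mem_cat => /orP[/mapP[q' /lc q'l ->]|/lc'] //.
rewrite big_cat big_map scaler_sumr; congr (_ + _); apply: eq_bigr => q _ /=.
by rewrite !scalerA mulrC.
Qed.
(** As [cs] generates the ideal [p], this is the submodule p G. *)
Definition pG : submodule G := Submodule pG0 pGP.

Lemma pG_p (r : S) g : p r -> pG (r *: g).
Proof.
move=> /csp; have [|f fE] := @linear_ex S S^o G (fun s => (s : S) *: g).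
  by move=> a s t; rewrite -[a *: s + t]/((a * (s : S) + t) : S) scalerDl scalerA.
have P0 : pG (f 0) by rewrite linear0; apply: sm0.
have PP a x y : pG (f x) -> pG (f y) -> pG (f (a *: x + y)).
  by move=> h1 h2; rewrite linearP; apply: smP.
rewrite -(fE r) => rc; pose Q := @Submodule S S^o (fun x => pG (f x)) P0 PP.
refine (@spn_min S S^o cs Q _ r rc) => c cc; rewrite /= fE; exists [:: (c, g)]; rewrite big_seq1; split=> //.
by move=> q; rewrite inE => /eqP ->.
Qed.

(** Linear independence of the images in G (x) k(p) over the residue field k(p) of p, written
    without fractions. *)
Definition indep (A : set G) := forall l : seq G, uniq l -> (forall x, x \in l -> A x) ->
  forall a : G -> S, pG (\sum_(x <- l) a x *: x) -> forall x, x \in l -> p (a x).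

(** [X] is a basis of G (x) k(p); the [s] outside [p] are common denominators of coordinates. *)
Lemma max_indep : exists X, indep X /\ forall g, exists (s : S) (l : seq G) (a : G -> S),
  [/\ ~ p s, forall x, x \in l -> X x & pG (s *: g - \sum_(x <- l) a x *: x)].
Proof.
have [|F [A0 FA0] Find tot|X [Xind _ Xmax]] := @Zorn_from G indep set0.
- by move=> l _ l0 a _ x xl; have := l0 x xl.
- move=> l ul lF.
  suff [A FA lA] : exists2 A, F A & forall x, x \in l -> A x by apply: (Find A).
  elim: l {ul} lF => [|x l IHl] h; first by exists A0.
  have [|A FA lA] := IHl; first by move=> y yl; apply: h; rewrite inE yl orbT.
  have [B FB Bx] := h x (mem_head _ _).
  have [AB|BA] := tot A B FA FB.
    by exists B => // y; rewrite inE => /orP[/eqP->|/lA/AB].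
  by exists A => // y; rewrite inE => /orP[/eqP->|/lA//]; apply: BA.
exists X; split=> // g; have [Xg|nXg] := pselect (X g).
  exists 1, [:: g], (fun=> 1); split=> //; first by move=> x; rewrite inE => /eqP ->.
  by rewrite big_seq1 subrr; apply: sm0.
pose B : set G := [set x | X x \/ x = g]%classic.
have nB : ~ indep B.
  by move=> /Xmax BX; apply/nXg/BX => [x Xx|]; [left|right].
apply: contrapT => no; apply: nB => l ul lB a aG.
have sub (x : G) : x \in l -> x != g -> X x.
  by move=> /lB [//|->]; rewrite eqxx.
have [gl|ngl] := boolP (g \in l); last first.
  by apply: Xind => // x xl; apply: sub => //; apply: contraNneq ngl => <-.
pose l' := [seq x <- l | x != g].
have sumE : \sum_(x <- l) a x *: x = a g *: g + \sum_(x <- l') a x *: x.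
  by rewrite (bigD1_seq g) //= big_filter.
have lX x : x \in l' -> X x by rewrite mem_filter => /andP[xg xl]; apply: sub.
have pag : p (a g).
  apply: contrapT => npa; apply: no; exists (a g), l', (\- a); split=> //.
  by rewrite /= -sumrN; under eq_bigr do rewrite scaleNr opprK; rewrite -sumE.
move=> x xl; have [->//|xg] := eqVneq x g.
apply: (Xind l' (filter_uniq _ ul) lX); last by rewrite mem_filter xg.
rewrite -[X in pG X](addKr (a g *: g)) -sumE; apply: smD => //.
exact/smN/pG_p.
Qed.

(* U (x) G is a direct sum of copies of U, indexed by a maximal subset of G that is
   independent modulo p G. *)
Lemma tmap_prime_null (U Y : lmodType S) (d : {linear U -> U}) (dY : {linear Y -> Y}) :
  (forall s (u : U), ~ p s -> s *: u = 0 -> u = 0) ->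
  (forall s (u : U), ~ p s -> exists v, s *: v = u) ->
  (forall c (u : U), c \in cs -> tors c U u) ->
  flat_module G -> nullh d dY ->
  nullh (tmap id1 d (idfun : {linear G -> G})) dY.
Proof.
move=> Uinj Usurj Ut Gfl nd f fc; have [X [Xind Xmax]] := max_indep.
have k_ex (x : G) : exists k : {linear U -> Y}, forall u,
    f (pt id1 u x) = dY (k u) + k (d u).
  have [|F FE] := @linear_ex S U Y (fun u => f (pt id1 u x)).
    by move=> a u v; rewrite ptDl -ptZ linearP.
  have [|k kE] := nd F; last by exists k => u; rewrite -FE.
  by move=> u; rewrite !FE -fc tmapE.
have [k kE] := choice k_ex.
(* [z.1] is expanded along [X], and [z.2] applies the homotopy [k x] to the coefficient at x. That
   this is the graph of a map amounts to existence and uniqueness of the expansion. *)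
pose rel (z : (tens U G * Y)%type) := exists (l : seq G) (u : G -> U),
  (forall x, x \in l -> X x) /\ forall l', uniq l' -> {subset l <= l'} ->
   z.1 = \sum_(x <- l') pt id1 (u x) x /\ z.2 = \sum_(x <- l') k x (u x).
have rel0 : rel 0.
  exists [::], (fun=> 0); split=> // l' _ _; split.
    by rewrite big1 // => x _; rewrite pt0l.
  by rewrite big1 // => x _; rewrite linear0.
have relP a z w : rel z -> rel w -> rel (a *: z + w).
  move=> [l [u [lX uz]]] [l' [v [lX' vw]]]; exists (l ++ l'), (fun x => a *: u x + v x).
  split=> [x|t ut st]; first by rewrite mem_cat => /orP[/lX|/lX'].
  have [|z1 z2] := uz t ut; first by move=> x xl; apply: st; rewrite mem_cat xl.
  have [|w1 w2] := vw t ut; first by move=> x xl; apply: st; rewrite mem_cat xl orbT.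
  rewrite -[(a *: z + w).1]/(a *: z.1 + w.1) -[(a *: z + w).2]/(a *: z.2 + w.2).
  rewrite z1 z2 w1 w2 !scaler_sumr -!big_split; split; apply: eq_bigr => x _.
    by rewrite /= ptDl ptZ.
  by rewrite /= linearP.
pose R := Submodule rel0 relP.
have relX u x : X x -> rel (pt id1 u x, k x u).
  move=> Xx; exists [:: x], (fun y => if y == x then u else 0); split.
    by move=> y; rewrite inE => /eqP ->.
  move=> l' ul sl; have xl : x \in l' by apply: sl; rewrite mem_head.
  split; rewrite (bigD1_seq x) //= eqxx big1 ?addr0 // => y /negPf ->.
    exact: pt0l.
  exact: linear0.
have dom0 : exists y, R (0, y) by exists 0.
have domP a z w : (exists y, R (z, y)) -> (exists y, R (w, y)) ->
   exists y, R (a *: z + w, y).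
  by move=> [y Ry] [y' Ry']; exists (a *: y + y'); apply: (smP a Ry Ry').
pose W := @Submodule S (tens U G) (fun z => exists y, R (z, y)) dom0 domP.
(* Induction on the nilpotency of u. With u = s v, the element s g lies in the span of [X] up to p
   G, and generators of p moved to the left factor lower the nilpotency. *)
have gen n : forall u g, (forall w : seq S, {subset w <= cs} -> (n <= size w)%N ->
    (\prod_(c <- w) c) *: u = 0) -> W (pt id1 u g).
  elim: n => [|n IHn] u g un.
    have -> : u = 0 by rewrite -(un [::]) ?big_nil ?scale1r.
    by rewrite pt0l; apply: sm0.
  have [s [l [a [nps lX [t [tc tE]]]]]] := Xmax g.
  have [v vu] := Usurj s u nps.
  have vn (w : seq S) : {subset w <= cs} -> (n.+1 <= size w)%N -> (\prod_(c <- w) c) *: v = 0.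
    by move=> wc ws; apply: (Uinj s) => //; rewrite scalerA mulrC -scalerA vu un.
  have -> : pt id1 u g = pt id1 v (s *: g) by rewrite -pt_bal vu.
  move/eqP: tE; rewrite subr_eq => /eqP ->; rewrite ptDr !pt_sumr; apply: smD.
    apply: sm_sum => q ql _; rewrite -[q.1 *: q.2]/(id1 q.1 *: q.2) -pt_bal.
    apply: IHn => w wc sw; rewrite scalerA mulrC.
    have := vn (q.1 :: w); rewrite big_cons; apply=> //.
    by move=> b; rewrite inE => /orP[/eqP->|/wc //]; apply: tc.
  apply: sm_sum => x xl _; rewrite -pt_bal; exists (k x (a x *: v)).
  by apply: relX; apply: lX.
have [||K KE] := @lin_rel _ _ _ R.
- move=> z; suff : W z by [].
  elim/pt_ind: z => [|u g z IHz]; first exact: sm0.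
  apply: smD => //; have [|n un] := @word_nilp cs U u; first by move=> c; apply: Ut.
  exact: gen un.
- move=> y [l [u [lX uz]]]; have [|] := uz (undup l) (undup_uniq l).
    by move=> x; rewrite mem_undup.
  rewrite /= => z0 ->; apply: big1_seq => x /andP[_ xl].
  suff -> : u x = 0 by rewrite linear0.
  set t := undup l in z0 xl; pose k' := size t.
  have [|m [y' [c [xE cE]]]] := @flat_eq S S id1 G U k' (fun i => u (tnth (in_tuple t) i))
      (tnth (in_tuple t)) Gfl.
    by apply: etrans (esym z0); rewrite [RHS]big_tnth.
  have := elim_zero Uinj (c := c) (u := fun i => u (tnth (in_tuple t) i)) _ cE.
  move=> H; have /tnthP [i ->] : x \in in_tuple t by [].
  (* If a annihilates the matrix c modulo p, then the combination of the elements of [t] with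
     coefficients a lies in p G, and independence of [X] puts these coefficients into p. *)
  apply: H => a ha j.
  have tI : injective (tnth (in_tuple t)) by apply/tuple_uniqP; exact: undup_uniq.
  pose b (g : G) := if pselect (exists i, tnth (in_tuple t) i = g) is left e
     then a (projT1 (cid e)) else 0.
  have bE j' : b (tnth (in_tuple t) j') = a j'.
    rewrite /b; case: pselect => [e|[]]; last by exists j'.
    congr a; apply: tI; exact: projT2 (cid e).
  rewrite -bE; apply: (Xind t (undup_uniq l)); last exact: mem_tnth.
    by move=> g; rewrite mem_undup; apply: lX.
  rewrite big_tnth (eq_bigr (fun i => \sum_j (a i * c i j) *: y' j)) => [|i' _].
    rewrite exchange_big; apply: sm_sum => j' _ _; rewrite -scaler_suml.
    exact: pG_p.
  by rewrite bE {1}xE scaler_sumr; apply: eq_bigr => j' _; rewrite scalerA.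
exists K => z.
have Rd z1 y : R (z1, y) -> exists y', R (tmap id1 d (idfun : {linear G -> G}) z1, y') /\
    f z1 = dY y + y'.
  move=> [l [u [lX uz]]]; exists (\sum_(x <- undup l) k x (d (u x))).
  have [|/= -> ->] := uz (undup l) (undup_uniq l); first by move=> x; rewrite mem_undup.
  split; last by rewrite !linear_sum -big_split; apply: eq_bigr => x _.
  have -> : (tmap id1 d idfun (\sum_(x <- undup l) pt id1 (u x) x),
     \sum_(x <- undup l) k x (d (u x))) = \sum_(x <- undup l) (pt id1 (d (u x)) x, k x (d (u x))).
    rewrite linear_sum; elim: (undup l) => [|x t IHt]; first by rewrite !big_nil.
    by rewrite !big_cons -IHt tmapE.
  apply: (@sm_sum _ _ R) => x; rewrite mem_undup => xl _; apply: relX; exact: lX.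
have [y' [/KE -> ->]] : exists y', R (tmap id1 d (idfun : {linear G -> G}) z, y') /\
    f z = dY (K z) + y' by apply/Rd/KE.
by [].
Qed.
End PrimeTensor.

(** * Noetherian induction on injective modules *)

Section Good.
Variable S : comNzRingType.
Hypothesis nS : noeth S.
Local Notation id1 := (idfun : {rmorphism S -> S}).

Lemma torsD (a b : S) (T : lmodType S) (x : T) :
  tors a T x -> tors b T x -> tors (a + b) T x.
Proof.
move=> [n nx] [m mx]; exists (n + m)%N; rewrite exprDn scaler_suml big1 // => i _.
rewrite -scalerMnl; have [mi|im] := leqP m i.
  by rewrite -scalerA (tors_le mi mx) scaler0 mul0rn.
rewrite mulrC -scalerA (@tors_le _ a T n) ?scaler0 ?mul0rn //; lia.
Qed.

Lemma torsM (r a : S) (T : lmodType S) (x : T) : tors a T x -> tors (r * a) T x.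
Proof. by move=> [n nx]; exists n; rewrite exprMn -scalerA nx scaler0. Qed.

Section Adjoin.
Variables (a : submodule S^o) (x : S).
Definition adj_pred (c : S^o) := exists r : S, a ((c : S) - r * x).
Fact adj0 : adj_pred 0.
Proof. by exists 0; rewrite mul0r subr0; apply: sm0. Qed.
Fact adjP k c c' : adj_pred c -> adj_pred c' -> adj_pred (k *: c + c').
Proof.
move=> [r rc] [r' rc']; exists ((k : S) * r + r').
have -> : (k *: c + c' : S) - (k * r + r') * x =
    k *: ((c : S) - r * x : S^o) + ((c' : S) - r' * x : S^o).
  rewrite -[LHS]/((k * c + c' : S) - (k * r + r') * x).
  by rewrite -[RHS]/((k : S) * ((c : S) - r * x) + ((c' : S) - r' * x)); ring.
exact: smP.
Qed.
Definition adj : submodule S^o := Submodule adj0 adjP.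

Lemma adj_sub c : a c -> adj c.
Proof. by move=> ac; exists 0; rewrite mul0r subr0. Qed.
Lemma adj_mem : adj x.
Proof. by exists 1; rewrite mul1r subrr; apply: sm0. Qed.
Lemma adj_tors (T : lmodType S) (t : T) : (forall c, a c -> tors c T t) ->
  tors x T t -> forall c, adj c -> tors c T t.
Proof.
move=> aT xT c [r rc]; rewrite -[c](subrK (r * x)).
by apply: torsD; [apply: aT|apply: torsM].
Qed.
End Adjoin.

Lemma idem_of (T : lmodType S) (P : submodule T) : baer_in P ->
  exists e : {linear T -> T}, (forall t, P (e t)) /\ forall t, P t -> e t = t.
Proof.
move=> bP; have [r rE] := inj_split (baer_subm bP) (@incl_inj _ _ P).
exists (incl P \o r); split=> [t|t /incl_ex [x <-]] /=; first exact: inclP.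
by rewrite rE.
Qed.

Lemma idem_inj (T : lmodType S) (P : submodule T) (e : {linear T -> T}) :
  injective_module T -> (forall t, P (e t)) -> (forall t, P t -> e t = t) ->
  injective_module (subm P).
Proof.
move=> Tinj Pe eP; have [c cE] := corestr Pe.
apply: (inj_retract (i := incl P) (r := c)) => // x.
by apply: (@incl_inj _ _ P); rewrite cE eP //; apply: inclP.
Qed.

Variables (Y : lmodType S) (dY : {linear Y -> Y}).
Hypotheses (Y2 : sqz dY) (Yinj : injective_module Y).

(** Exactness of Hom(T, Y) for a module [T] without differential; by [null_plain] this settles the
    complexes with underlying module [T]. *)
Definition good (T : lmodType S) := forall f : {linear T -> Y},
  (forall x, dY (f x) = 0) -> exists k : {linear T -> Y}, forall x, f x = dY (k x).

Lemma goodE T : good T <-> nullh (\0 : {linear T -> T}) dY.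
Proof.
split=> h f fE.
  have [|k kE] := h f; first by move=> x; rewrite -fE /= linear0.
  by exists k => x; rewrite kE /= linear0 addr0.
have [|k kE] := h f; first by move=> x; rewrite fE /= linear0.
by exists k => x; rewrite kE /= linear0 addr0.
Qed.

Lemma good_ext (A B C : lmodType S) (i : {linear A -> B}) (q : {linear B -> C}) :
  injective i -> (forall y, exists x, q x = y) ->
  (forall x, q x = 0 <-> exists y, i y = x) -> good A -> good C -> good B.
Proof.
move=> iI qS iq /goodE gA /goodE gC; apply/goodE.
apply: (null_ext iI qS iq _ _ _ Yinj Y2 gA gC) => x //=; exact: linear0.
Qed.

Section Local.
Variable p : submodule S^o.
Hypothesis p1 : ~ p 1.
Hypothesis pM : forall a b : S, p (a * b) -> p a \/ p b.
Hypothesis IH : forall (s : S) (T : lmodType S), ~ p s -> injective_module T ->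
  (forall c, p c -> forall t, tors c T t) -> (forall t, tors s T t) -> good T.

(* Zorn's lemma on graphs of partial solutions whose domain is injective. *)
Lemma good_local (T : lmodType S) : injective_module T ->
  (forall c, p c -> forall t, tors c T t) ->
  (forall t : T, exists s : S, ~ p s /\ s *: t = 0) -> good T.
Proof.
move=> Tinj pT sT f fd.
pose dom (R : submodule (T * Y)%type) t := exists y, R (t, y).
pose okR (R : submodule (T * Y)%type) :=
  [/\ univ R, forall t y, R (t, y) -> f t = dY y & baer_in (dom R)].
pose ok (A : set (T * Y)%type) := exists2 R, okR R & A = smem R.
pose R0 := @Submodule S (T * Y)%type (fun z => z = 0) erefl
  (fun a x y (hx : x = 0) (hy : y = 0) => etrans (congr2 (fun x y => a *: x + y) hx hy)
     (etrans (addr0 _) (scaler0 _ a))).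
have dom0 R : dom R 0 by exists 0; apply: (sm0 R).
have domP R a x y : dom R x -> dom R y -> dom R (a *: x + y).
  by move=> [u Ru] [v Rv]; exists (a *: u + v); apply: (smP a Ru Rv).
pose smd R := Submodule (dom0 R) (@domP R).
have [|F [A1 FA1] Fok tot|_ [[R [Ru Rf Rb] ->] _ Rmax]] := @Zorn_from _ ok (smem R0).
- exists R0 => //; split.
  + by move=> y /(congr1 snd).
  + by move=> t y /= E; rewrite (congr1 fst E : t = 0) (congr1 snd E : y = 0) !linear0.
  + move=> B uB BP; exists 0; split; first by exists 0.
    by move=> r y /BP [z /(congr1 fst) /= ->]; rewrite scaler0.
- pose un z := exists A, F A /\ A z.
  have un0 : un 0 by exists A1; split=> //; have [R _ ->] := Fok _ FA1; apply: sm0.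
  have unP a x y : un x -> un y -> un (a *: x + y).
    move=> [A [FA Ax]] [B [FB By]]; have [AB|BA] := tot A B FA FB.
      exists B; split=> //; have [R _ E] := Fok _ FB.
      by move: (AB _ Ax) By; rewrite E; apply: smP.
    exists A; split=> //; have [R _ E] := Fok _ FA.
    by move: Ax (BA _ By); rewrite E; apply: smP.
  exists (Submodule un0 unP); last first.
    by apply/seteqP; split=> [z [A FA Az]|z [A [FA Az]]]; exists A.
  split.
  + move=> y [A [FA Ay]]; have [R [Ru _ _] E] := Fok _ FA.
    by apply: Ru; rewrite E in Ay.
  + move=> t y [A [FA Ay]]; have [R [_ Rf _] E] := Fok _ FA.
    by apply: Rf; rewrite E in Ay.
  + apply: (@baer_dir _ nS T {R : submodule (T * Y)%type | F (smem R)}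
       (fun R => smd (projT1 R))).
    * by have [R _ E] := Fok _ FA1; rewrite E in FA1; exists; exists R.
    * move=> [R FR] [R' FR'] /=; have [RR|RR] := tot _ _ FR FR'.
        exists (exist _ R' FR') => x /= [[y Ry]|//]; exists y; exact: RR.
      exists (exist _ R FR) => x /= [//|[y Ry]]; exists y; exact: RR.
    * move=> x; split=> [[y [A [FA Axy]]]|[[R FR] /= [y Ry]]].
        have [R _ E] := Fok _ FA; rewrite E in FA Axy.
        by exists (exist _ R FA), y.
      by exists y, (smem R).
    * move=> [R FR] /=; have [R' [_ _ R'b] E] := Fok _ FR.
      by rewrite -[X in baer_in X]/(dom R) /dom E.
have [e1 [e1W e1id]] := @idem_of T (smd R) Rb.
(* Maximality makes the complement [K] of the domain vanish: an element t of it is killed by some s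
   outside p, the s-torsion [Q] of [K] is injective and good by [IH], and the solution extends to
   the sum of the domain and [Q]. *)
have K0 t : e1 t = 0 -> t = 0.
  move=> et; have [s [ps st]] := sT t.
  pose K := sm_ker e1; pose Q := sm_cap K (tors s T).
  have Kinj : injective_module (subm K).
    apply: (@idem_inj T K (idfun \- e1)) => // x /=.
      by rewrite linearB [e1 (e1 x)]e1id ?subrr //; apply: e1W.
    by move=> ->; rewrite subr0.
  have [e' [e'T e'id]] := @idem_of _ (tors s (subm K)) (baer_tors nS Kinj).
  have [c1 c1E] : exists g : {linear T -> subm K}, forall a, incl K (g a) = a - e1 a.
    apply: (@corestr _ _ _ (idfun \- e1) K) => x /=.
    by rewrite linearB [e1 (e1 x)]e1id ?subrr //; apply: e1W.
  pose e2 : {linear T -> T} := incl K \o (e' \o c1).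
  have Qe2 x : Q (e2 x).
    split; first exact: inclP.
    by have [n nx] := e'T (c1 x); exists n; rewrite -[e2 x]/(incl K (e' (c1 x))) -(linearZ_LR (incl K)) nx linear0.
  have e2Q x : Q x -> e2 x = x.
    move=> [Kx [n nx]]; have E : incl K (c1 x) = x.
      by rewrite c1E (_ : e1 x = 0) ?subr0.
    rewrite /e2 /= e'id // ; exists n; apply: (@incl_inj _ _ K).
    by rewrite linearZ_LR E nx linear0.
  have e2W x : dom R x -> e2 x = 0.
    move=> Wx; rewrite /e2 /= (_ : c1 x = 0) ?linear0 //.
    by apply: (@incl_inj _ _ K); rewrite c1E e1id // subrr linear0.
  have e1Q x : Q x -> e1 x = 0 by case.
  have [c2 c2E] := corestr Qe2.
  have gQ : good (subm Q).
    apply: (IH ps (idem_inj Tinj Qe2 e2Q)) => [c pc x|x].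
      have [n nx] := pT c pc (incl Q x); exists n; apply: (@incl_inj _ _ Q).
      by rewrite linearZ_LR nx linear0.
    have [_ [n nx]] := inclP x; exists n; apply: (@incl_inj _ _ Q).
    by rewrite linearZ_LR nx linear0.
  have [|h hE] := gQ (f \o incl Q); first by move=> x /=; apply: fd.
  pose rel' (z : (T * Y)%type) := z.1 = e1 z.1 + e2 z.1 /\ R (e1 z.1, z.2 - h (c2 z.1)).
  have rel'0 : rel' 0.
    split; first by rewrite !linear0 addr0.
    rewrite -[(0 : T * Y).1]/(0 : T) -[(0 : T * Y).2]/(0 : Y).
    rewrite (linear0 e1) (linear0 c2) (linear0 h) subr0.
    exact: (sm0 R).
  have rel'P a x y : rel' x -> rel' y -> rel' (a *: x + y).
    move=> [x1 x2] [y1 y2]; rewrite /rel'.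
    rewrite -[(a *: x + y).1]/(a *: x.1 + y.1) -[(a *: x + y).2]/(a *: x.2 + y.2); split.
      by rewrite !linearP addrACA -scalerDr -x1 -y1.
    rewrite !linearP addrACA -scalerDr; exact: (smP a x2 y2).
  pose R' := Submodule rel'0 rel'P.
  have domR' x : dom R' x <-> x = e1 x + e2 x.
    split=> [[y []]|xE] //; have [y Ry] := e1W x.
    by exists (y + h (c2 x)); split=> //=; rewrite addrK.
  have okR' : okR R'.
    split.
    - by move=> y [_ /=]; rewrite (linear0 e1) (linear0 c2) (linear0 h) subr0 => /Ru.
    - move=> x y [/= xE Rx]; rewrite xE linearD (Rf _ _ Rx).
      have := hE (c2 x); rewrite /= c2E => ->.
      by rewrite -linearD subrK.
    - have e12 x : e1 (e1 x + e2 x) = e1 x /\ e2 (e1 x + e2 x) = e2 x.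
        have W1 : dom R (e1 x) := e1W x.
        by rewrite !linearD (e1id _ W1) (e1Q _ (Qe2 x)) (e2W _ W1) (e2Q _ (Qe2 x)) addr0 add0r.
      have := @subm_baer _ _ (smd R') (@idem_inj T (smd R') (e1 \+ e2) Tinj _ _).
      apply=> x /=; last by move=> /domR'.
      by apply/domR'; have [-> ->] := e12 x.
  have RR' : (smem R `<=` smem R')%classic.
    move=> [x y] Rxy; have Wx : dom R x by exists y.
    split; first by rewrite -[RHS]/(e1 x + e2 x) e1id // e2W // addr0.
    rewrite -[(x, y).1]/x -[(x, y).2]/y e1id // (_ : c2 x = 0) ?(linear0 h) ?subr0 //.
    by apply: (@incl_inj _ _ Q); rewrite c2E e2W // linear0.
  have Qt : Q t by split=> //; exists 1%N; rewrite expr1.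
  have Wt : dom R t.
    have [y Ry] : dom R' t by apply/domR'; rewrite et add0r e2Q.
    by exists y; apply: (Rmax _ _ RR' (t, y)) => //; exists R'.
  by rewrite -et e1id.
have [t|k kE] := @lin_rel S T Y R _ Ru.
  suff -> : t = e1 t by apply: e1W.
  apply/eqP; rewrite -subr_eq0; apply/eqP/K0.
  by rewrite linearB [e1 (e1 t)]e1id ?subrr //; apply: e1W.
by exists k => t; apply: Rf; apply/kE.
Qed.
End Local.
End Good.

(** * The prime step and the induction over ideals *)

Section GoodAll.
Variable S : comNzRingType.
Hypothesis nS : noeth S.
Local Notation id1 := (idfun : {rmorphism S -> S}).

Lemma inj_image (N V : lmodType S) (i : {linear N -> V}) (P : submodule V) :
  injective i -> (forall x, P x <-> exists y, i y = x) ->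
  injective_module (subm P) -> injective_module N.
Proof.
move=> iI iP Pinj; have [|j jE] := @corestr _ _ _ i P; first by move=> a; apply/iP; exists a.
have jI : injective j by move=> a b ab; apply: iI; rewrite -!jE ab.
have [|r [rl _]] := lin_inv jI.
  move=> b; have /iP [a aE] := inclP b; exists a.
  by apply: (@incl_inj _ _ P); rewrite jE.
exact: (inj_retract (i := j) (r := r)).
Qed.

Section PrimeLocal.
Variable p : submodule S^o.
Hypothesis p1 : ~ p 1.
Hypothesis pM : forall a b : S, p (a * b) -> p a \/ p b.
Variable E : lmodType S.

Definition ploc_pred (x : E) := exists s : S, ~ p s /\ s *: x = 0.
Fact ploc0 : ploc_pred 0. Proof. by exists 1; rewrite scaler0. Qed.
Fact plocP a x y : ploc_pred x -> ploc_pred y -> ploc_pred (a *: x + y).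
Proof.
move=> [s [ps sx]] [t [pt0 ty]]; exists (s * t); split; first by case/pM.
rewrite scalerDr scalerA (_ : s * t * a = t * a * s); last by ring.
by rewrite -!scalerA sx !scaler0 add0r ty scaler0.
Qed.
(** The kernel of the localization map of [E] at p. *)
Definition ploc : submodule E := Submodule ploc0 plocP.

Lemma prime_exp s n : ~ p s -> ~ p (s ^+ n).
Proof. by move=> ps; elim: n => [|n IHn] //; rewrite exprS => /pM []. Qed.

Lemma tors_ploc s x : ~ p s -> tors s E x -> ploc x.
Proof. by move=> ps [n nx]; exists (s ^+ n); split=> //; apply: prime_exp. Qed.

(** The union of the s-torsion parts for s outside p; it is directed because products of such s stay
    outside p. *)
Lemma ploc_baer : injective_module E -> baer_in ploc.
Proof.
move=> Einj; apply: (@baer_dir _ nS E {s : S | ~ p s} (fun s => tors (projT1 s) E)).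
- by exists; exists 1.
- move=> [s ps] [t pt0]; have pst : ~ p (s * t) by case/pM.
  exists (exist _ (s * t) pst) => x /= [|] [n nx]; exists n; rewrite exprMn.
    by rewrite mulrC -scalerA nx scaler0.
  by rewrite -scalerA nx scaler0.
- move=> x; split=> [[s [ps sx]]|[[s ps] /= sx]].
    by exists (exist _ s ps), 1%N; rewrite expr1.
  exact: tors_ploc sx.
- by move=> [s ps]; apply: baer_tors.
Qed.
End PrimeLocal.

Variables (Y : lmodType S) (dY : {linear Y -> Y}) (D : gdm S).
Hypotheses (Y2 : sqz dY) (Yinj : injective_module Y) (Dinj : injective_module D).
Hypothesis nD : nullh (gd (flip D)) dY.
Hypothesis sec : forall T : lmodType S, injective_module T ->
  exists s : {linear T -> tens D (hom_dom id1 D T)},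
  (forall t, ttot (flip D) (dom_map id1 T (gd D)) (s t) = 0) /\
  forall t, evd D T (s t) = t.

Section Prime.
Variable p : submodule S^o.
Hypothesis p1 : ~ p 1.
Hypothesis pM : forall a b : S, p (a * b) -> p a \/ p b.
Hypothesis IH : forall (s : S) (T : lmodType S), ~ p s -> injective_module T ->
  (forall c, p c -> forall t, tors c T t) -> (forall t, tors s T t) -> good dY T.

(* The splitting T -> D (x) G lands in the p-torsion part V (x) G and stays a
   splitting after passing to U = V localized at p. *)
Lemma good_prime_div (T : lmodType S) : injective_module T ->
  (forall c, p c -> forall t, tors c T t) ->
  (forall s (t : T), ~ p s -> s *: t = 0 -> t = 0) -> good dY T.
Proof.
move=> Tinj pT sT f fd; have [cs [csp pcs]] := nS p.
pose G := hom_dom id1 D T; pose dG : {linear G -> G} := dom_map id1 T (gd D).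
have Gfl : flat_module G by apply: Gflat.
have [s [s0 es]] := sec Tinj.
have [V [i [Vinj [iI im] nV iP iT]]] :=
  @tors_list S nS (flip D) cs Y dY Dinj Y2 Yinj nD.
have pV c : p c -> forall v, tors c V v.
  move=> pc v.
  have P0 : tors 0 V v by exists 1%N; rewrite expr1 scale0r.
  have PP a x y : tors x V v -> tors y V v -> tors ((a : S) * x + y) V v.
    by move=> hx hy; apply: torsD => //; apply: torsM.
  refine (@spn_min S S^o cs (@Submodule S S^o (fun x => tors x V v) P0 PP) _ c (pcs c pc)).
  move=> b bcs /=; have /iP /(_ b bcs) [n nx] : exists y, i y = i v by exists v.
  by exists n; apply: iI; rewrite linearZ_LR nx linear0.
pose P := ploc p1 pM V.
have st (g : {linear V -> V}) x : P x -> P (g x).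
  by move=> [a [pa ax]]; exists a; rewrite -linearZ_LR ax linear0.
have [N [j [jI jP jm]]] := gdm_sub (st (gd V)) (fun k => st (gp V k)).
have [U [q [qS q0 qm]]] := gdm_quot (st (gd V)) (fun k => st (gp V k)).
have jq x : q x = 0 <-> exists y, j y = x by split=> [/q0/jP|/jP/q0].
have Ninj : injective_module N.
  by apply: (inj_image jI jP); apply/baer_subm/ploc_baer.
have [jc _ _] := jm; have [qc _ _] := qm; have [ic ie _] := im.
(* [N], the kernel of localization at p, is covered by [good_local]; hence the quotient [U] inherits
   null-homotopies from [V]. *)
have nN : nullh (gd N) dY.
  suff gN : good dY N by apply: null_plain.
  apply: (good_local nS IH Ninj).
    move=> c pc x; have [n nx] := pV c pc (j x); exists n; apply: jI.
    by rewrite linearZ_LR nx linear0.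
  move=> x; have /jP [a [pa ax]] : exists y, j y = j x by exists x.
  by exists a; split=> //; apply: jI; rewrite linearZ_LR ax linear0.
have nU := null_quot jI qS jq jc qc (@gsq _ V) Yinj Y2 (gsg N) nV nN.
have nUG : nullh (tmap id1 (gd U) (idfun : {linear G -> G})) dY.
  apply: (@tmap_prime_null S p cs _ p1 pM) => //.
  - move=> a u pa; have [x <-] := qS u; rewrite -linearZ_LR => /q0 [b [pb bx]].
    apply/q0; exists (b * a); split; first by case/pM.
    by rewrite -scalerA.
  - move=> a u pa; have [x <-] := qS u; have [y yE] := tors_div nS a x Vinj.
    exists (q y); apply/esym/eqP; rewrite -subr_eq0 -linearZ_LR -linearB.
    by apply/eqP/q0; apply: (tors_ploc p1 pM pa yE).
  - move=> c u cc; have [x <-] := qS u; have [n nx] := pV c (csp c cc) x.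
    by exists n; rewrite -linearZ_LR nx linear0.
have nUt : nullh (ttot U dG) dY.
  have gr := tmap_gradingr U (dual_grading T (ggr D)).
  have [l1 l2] := dual_lowers T (ggr D) (glo D).
  apply: (null_keeps gr (d1 := tmap id1 (gd U) idfun) (d2 := tmap id1 (ge U) dG)) => //.
  - move=> k z; rewrite (tmap_comp (h := gd U) (k := dual_p T (gn D) (gp D) k)) //.
    by rewrite (tmap_comp (h := gd U) (k := dual_p T (gn D) (gp D) k)).
  - split=> [k z|z].
      rewrite (tmap_comp (h := ge U) (k := dG \o dual_p T (gn D) (gp D) k.+1)) //.
      rewrite (tmap_comp (h := ge U) (k := dG \o dual_p T (gn D) (gp D) k.+1)) // => g.
      by rewrite -[LHS]l1.
    rewrite (tmap_comp (h := ge U) (k := \0)) => [|//|g]; last exact: l2.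
    elim/pt_ind: z => [|m g z IHz]; first exact: linear0.
    by rewrite linearD IHz tmapE pt0r addr0.
  - exact: ttot_def.
  - exact/ttot_sq/dG2.
pose ti := tmap id1 i (idfun : {linear G -> G}).
have tiI : injective ti by apply: flatl.
have s1_ex t : exists y, ti y = s t.
  apply: iT => // c cc; have [n nx] := pT c (csp c cc) t; exists n.
  by rewrite -(linearZ_LR s) nx linear0.
have [s1' s1'E] := choice s1_ex.
have [|s1 s1E] := @linear_ex S T (tens V G) s1'.
  by move=> a x y; apply: tiI; rewrite [RHS]linearP !s1'E linearP.
have tis t : ti (s1 t) = s t by rewrite s1E.
pose tq := tmap id1 q (idfun : {linear G -> G}).
have [_ tqS tjq] := tens_short jI qS jq Gfl.
(* An element killed by a scalar outside p is evaluated to 0, since such scalars act injectively on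
   [T]; so the evaluation passes to U (x) G. *)
have [|ev evE] := @factor _ _ _ _ tq (evd D T \o ti) tqS.
  move=> z /tjq [y <-]; rewrite /=; elim/pt_ind: y => [|m g y IHy].
    by rewrite !linear0.
  rewrite !linearD IHy addr0 tmapE /ti tmapE evdE /=.
  have /jP [a [pa am]] : exists y', j y' = j m by exists m.
  apply: (sT a) => //.
  have <- := linearZ_LR (g : {linear restr id1 D -> T}) a (i (j m)).
  have -> : a *: (i (j m) : restr id1 D) = i (a *: j m) by rewrite linearZ_LR.
  by rewrite am linear0; apply: (linear0 (g : {linear restr id1 D -> T})).
have evt z : ev (ttot U dG z) = 0.
  have [y <-] := tqS z.
  have -> : ttot U dG (tq y) = tq (ttot V dG y) by rewrite (ttot_chain dG qm).
  rewrite evE /=; have -> : ti (ttot V dG y) = ttot (flip D) dG (ti y).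
    exact: (@ttot_chain _ V (flip D) i _ dG im).
  exact: ev_tot.
have [|k kE] := nUt (f \o ev).
  by move=> z; rewrite /= evt linear0 fd.
exists (k \o (tq \o s1)) => t; have := kE (tq (s1 t)); rewrite /= evE /= tis es => ->.
suff -> : ttot U dG (tq (s1 t)) = 0 by rewrite linear0 addr0.
have -> : ttot U dG (tq (s1 t)) = tq (ttot V dG (s1 t)) by rewrite (ttot_chain dG qm).
have -> : ttot V dG (s1 t) = 0; last exact: linear0.
apply: tiI; rewrite linear0 -(s0 t) -tis.
exact: (@ttot_chain _ V (flip D) i _ dG im).
Qed.

(** The elements killed by some s outside p are settled by [good_local]; on the quotient such s act
    injectively, and [good_prime_div] applies. *)
Lemma good_prime (T : lmodType S) : injective_module T ->
  (forall c, p c -> forall t, tors c T t) -> good dY T.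
Proof.
move=> Tinj pT; pose P := ploc p1 pM T.
have Pinj : injective_module (subm P) by apply/baer_subm/ploc_baer.
have iq x : proj P x = 0 <-> exists y, incl P y = x.
  by split=> [/proj0/incl_ex|[y <-]] //; apply/proj0/inclP.
have Qinj := inj_quot Pinj Tinj (@incl_inj _ _ P) (@proj_surj _ _ P) iq.
apply: (good_ext Y2 Yinj (@incl_inj _ _ P) (@proj_surj _ _ P) iq).
  apply: (good_local nS IH Pinj) => [c pc x|x].
    have [n nx] := pT c pc (incl P x); exists n; apply: (@incl_inj _ _ P).
    by rewrite linearZ_LR nx linear0.
  have [a [pa ax]] := inclP x; exists a; split=> //; apply: (@incl_inj _ _ P).
  by rewrite linearZ_LR ax linear0.
apply: good_prime_div => // [c pc u|a u pa].
  have [x <-] := @proj_surj _ _ P u; have [n nx] := pT c pc x.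
  by exists n; rewrite -linearZ_LR nx linear0.
have [x <-] := @proj_surj _ _ P u; rewrite -linearZ_LR => /proj0 [b [pb bx]].
apply/proj0; exists (b * a); split; first by case/pM.
by rewrite -scalerA.
Qed.
End Prime.

(** Induction on an ideal acting locally nilpotently on [T], from the zero ideal upwards. If p is
    neither prime nor the unit ideal, take x y in p with x and y outside p: the x-torsion of [T] and
    the quotient by it fall under the larger ideals p + (x) and p + (y). *)
Lemma good_all (T : lmodType S) : injective_module T -> good dY T.
Proof.
suff H (a : submodule S^o) : forall T : lmodType S, injective_module T ->
    (forall c, a c -> forall t, tors c T t) -> good dY T.
  move=> Tinj; pose z := @Submodule S S^o (fun c => c = 0) erefl
    (fun a x y (hx : x = 0) (hy : y = 0) => etrans (congr2 (fun x y => a *: x + y) hx hy)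
     (etrans (addr0 _) (scaler0 _ a))).
  by apply: (H z) => // c -> t; exists 1%N; rewrite expr1 scale0r.
move: a; apply: (noeth_ind nS) => p IHp {}T Tinj pT.
have IH (s : S) (T' : lmodType S) : ~ p s -> injective_module T' ->
    (forall c, p c -> forall t, tors c T' t) -> (forall t, tors s T' t) -> good dY T'.
  move=> ps T'inj pT' sT'; apply: (IHp (adj p s)) => //.
  - by move=> x; apply: adj_sub.
  - by exists s; split=> //; apply: adj_mem.
  - by move=> c pc t; apply: (adj_tors (a := p) (x := s)) => // b pb; apply: pT'.
have [p1|p1] := pselect (p 1).
  move=> f fd; exists \0 => t; have [n] := pT 1 p1 t.
  by rewrite expr1n scale1r => ->; rewrite !linear0.
have [pM|npM] := pselect (forall a b : S, p (a * b) -> p a \/ p b).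
  exact: (good_prime p1 pM).
have [x [y [pxy px py]]] : exists x y : S, [/\ p (x * y), ~ p x & ~ p y].
  apply: contrapT => no; apply: npM => a b pab; apply: contrapT => /not_orP [pa pb].
  by apply: no; exists a, b.
pose P := tors x T.
have Pinj : injective_module (subm P) by apply: inj_tors.
have iq u : proj P u = 0 <-> exists v, incl P v = u.
  by split=> [/proj0/incl_ex|[v <-]] //; apply/proj0/inclP.
have Qinj := inj_quot Pinj Tinj (@incl_inj _ _ P) (@proj_surj _ _ P) iq.
apply: (good_ext Y2 Yinj (@incl_inj _ _ P) (@proj_surj _ _ P) iq).
  apply: (IH x) => // [c pc t|t].
    have [n nx] := pT c pc (incl P t); exists n; apply: (@incl_inj _ _ P).
    by rewrite linearZ_LR nx linear0.
  have [n nx] := inclP t; exists n; apply: (@incl_inj _ _ P).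
  by rewrite linearZ_LR nx linear0.
apply: (IH y) => // [c pc u|u]; have [t <-] := @proj_surj _ _ P u.
  by have [n nx] := pT c pc t; exists n; rewrite -linearZ_LR nx linear0.
have [n nx] := pT _ pxy t; exists n; rewrite -linearZ_LR; apply/proj0; exists n.
by rewrite scalerA -exprMn.
Qed.
End GoodAll.

(** * Complexes as products with homogeneous maps *)

Section ProductModule.
Variable S : comNzRingType.
Implicit Types X Y Z E : complex S.

(** A product, so that injectivity of the terms passes to the total module. *)
Definition PP X : lmodType S := prodm (fun i : int => X i).
Definition sgl X i : {linear X i -> PP X} := inj_at (fun i => X i) i.
Definition cmp X j : {linear PP X -> X j} := comp_at (fun i => X i) j.
Definition sg (n : int) : S := (-1) ^+ absz n.

Fact dP_key X : {f : {linear PP X -> PP X} |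
  forall x j, f x j = diff X (j + 1) j (x (j + 1))}.
Proof.
apply: cid; have [g gE] := @prodm_lin S int (fun i => X i) (PP X)
  (fun j => diff X (j + 1) j \o cmp X (j + 1)).
by exists g => x j; rewrite gE /= /cmp comp_atE.
Qed.
Definition dP X : {linear PP X -> PP X} := sval (dP_key X).
Lemma dPE X (x : PP X) j : dP X x j = diff X (j + 1) j (x (j + 1)).
Proof. exact: (svalP (dP_key X)). Qed.

Lemma dP_sq X : sqz (dP X).
Proof. by move=> x; apply: prodmP => j; rewrite !dPE diff_diff. Qed.

Lemma sgl_in X i (x : X i) : sgl X i x i = x. Proof. exact: inj_at_in. Qed.
Lemma sgl_out X i (x : X i) j : i != j -> sgl X i x j = 0.
Proof. exact: inj_at_out. Qed.

Lemma dP_sgl X i (x : X i) : dP X (sgl X i x) = sgl X (i - 1) (diff X i (i - 1) x).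
Proof.
apply: prodmP => j; rewrite dPE; have [e|ne] := eqVneq i (j + 1).
  by subst i; rewrite addrK !sgl_in.
rewrite !sgl_out ?linear0 //; apply: contraNneq ne => <-.
by rewrite subrK.
Qed.

Section Maps.
Variables X Y : complex S.
Implicit Types u v w : {linear PP X -> PP Y}.

(* deg n: the j-th component of u x depends only on the (j - n)-th one of x. *)
Definition deg (n : int) u := forall x j, x (j - n) = 0 -> u x j = 0.
Definition cyc (n : int) u := forall x, dP Y (u x) = sg n *: u (dP X x).
(** Boundaries of degree n in the Hom complex: the sign is that of d w - (-1)^(n+1) w d. *)
Definition hty (n : int) u := exists w, deg (n + 1) w /\
  forall x, u x = dP Y (w x) + sg n *: w (dP X x).

Lemma deg_at n u x j : deg n u -> u x j = u (sgl X (j - n) (x (j - n))) j.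
Proof.
move=> du; apply/eqP; rewrite -subr_eq0; apply/eqP.
rewrite -[LHS]/((u x - u (sgl X (j - n) (x (j - n)))) j) -linearB.
by apply: du; rewrite -[LHS]/(x (j - n) - sgl X (j - n) (x (j - n)) (j - n)) sgl_in subrr.
Qed.

Lemma ghom_of n u : deg n u -> exists f : ghom X Y n,
  forall i j x, f i j x = u (sgl X i x) j.
Proof.
move=> du; have sh i j : j != i + n ->
    (cmp Y j \o (u \o sgl X i) : hom (X i) (Y j)) = 0.
  move=> ij; apply: homP => x; rewrite /= /cmp comp_atE du // sgl_out //.
  by apply: contraNneq ij => ->; rewrite subrK.
by exists (GHom sh) => i j x; rewrite /= /cmp comp_atE.
Qed.

Lemma map_of n (f : ghom X Y n) : exists u, deg n u /\
  forall x j, u x j = f (j - n) j (x (j - n)).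
Proof.
have [g gE] := @prodm_lin S int (fun i => Y i) (PP X)
  (fun j => (f (j - n) j : {linear _ -> _}) \o cmp X (j - n)).
exists g; split=> [x j xj|x j]; rewrite gE /= /cmp comp_atE // xj.
exact: (linear0 (f (j - n) j : {linear _ -> _})).
Qed.

Lemma ghom_diffE n (f : ghom X Y (n + 1)) i j x : ghom_diff X Y (n + 1) n f i j x =
  diff Y (j + 1) j (f i (j + 1) x) - sg (n + 1) *: f (i - 1) j (diff X i (i - 1) x).
Proof. by rewrite /= /ghom_diff_map eqxx. Qed.

Lemma sgS n : sg (n + 1) = - sg n. Proof. exact: sign_succ. Qed.
Lemma sg_sq n : sg n * sg n = 1.
Proof. by rewrite -exprMn mulrNN mulr1 expr1n. Qed.

Section Corr.
Variables (n : int) (u : {linear PP X -> PP Y}) (f : ghom X Y n).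
Hypotheses (du : deg n u) (fE : forall i j x, f i j x = u (sgl X i x) j).

Lemma cyc_ghom : cyc n u -> is_cycle (X := hom_complex X Y) (i := n) f.
Proof.
move=> uc; apply: ghomP => i j x; rewrite -[X in gmap X]/(ghom_diff X Y n (n - 1) f).
rewrite /= /ghom_diff_map subrK eqxx /= !fE -dP_sgl.
have := congr1 (fun z : PP Y => z j) (uc (sgl X i x)); rewrite dPE => ->.
exact: subrr.
Qed.

Lemma bound_hty : is_boundary (X := hom_complex X Y) (i := n) f -> hty n u.
Proof.
move=> [g gE]; have [w [dw wE]] := map_of g; exists w; split=> // x.
apply: prodmP => j; rewrite (deg_at _ _ du) -fE -gE [LHS]ghom_diffE.
rewrite -[RHS]/(dP Y (w x) j + sg n *: w (dP X x) j) dPE !wE dPE sgS scaleNr opprK.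
have -> : j + 1 - (n + 1) = j - n by ring.
have -> : j - (n + 1) + 1 = j - n by ring.
by have -> : j - (n + 1) = j - n - 1 by ring.
Qed.

Lemma hty_bound : hty n u -> is_boundary (X := hom_complex X Y) (i := n) f.
Proof.
move=> [w [dw wE]]; have [g gE] := ghom_of dw; exists g.
apply: ghomP => i j x; rewrite [LHS]ghom_diffE !gE fE wE -dP_sgl sgS scaleNr opprK.
by rewrite -[RHS]/(dP Y (w (sgl X i x)) j + sg n *: w (dP X (sgl X i x)) j) dPE.
Qed.
End Corr.
End Maps.

Lemma kinj E Y n (u : {linear PP E -> PP Y}) : semi_injective Y -> exact_complex E ->
  deg n u -> cyc n u -> hty n u.
Proof.
move=> [_ Yk] Ex du uc; have [f fE] := ghom_of du.
apply: (bound_hty du fE); apply: (Yk E Ex); exact: cyc_ghom fE uc.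
Qed.

Lemma eta_map X Y (eta : ghom X Y 0) : chain_map eta ->
  exists e : {linear PP X -> PP Y}, [/\ deg 0 e, cyc 0 e,
    forall x j, e x j = eta j j (x j) &
    forall i j x, eta i j x = e (sgl X i x) j].
Proof.
move=> ec; have [e [de eE]] := map_of eta.
have eE' x j : e x j = eta j j (x j) by rewrite eE subr0.
exists e; split=> //.
  move=> x; apply: prodmP => j; rewrite /sg expr0 scale1r dPE !eE' dPE.
  exact: esym (ec _ _ _).
move=> i j x; rewrite eE'; have [<-|ij] := eqVneq i j; first by rewrite sgl_in.
rewrite sgl_out // gmap_shape ?addr0 1?eq_sym //.
by rewrite (linear0 (eta j j : {linear _ -> _})).
Qed.

Lemma cyc0 X Y (e : {linear PP X -> PP Y}) : cyc 0 e -> forall x, dP Y (e x) = e (dP X x).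
Proof. by move=> ec x; rewrite ec /sg expr0 scale1r. Qed.

Section HtyOps.
Variables X Y : complex S.
Implicit Types u v : {linear PP X -> PP Y}.

Lemma hty_lin n a u v (w : {linear PP X -> PP Y}) : hty n u -> hty n v ->
  (forall x, w x = a *: u x + v x) -> hty n w.
Proof.
move=> [h [dh hE]] [k [dk kE]] wE; exists ((a \*: h) \+ k); split=> [x j xj|x].
  by rewrite -[LHS]/(a *: h x j + k x j) dh // dk // scaler0 addr0.
rewrite wE hE kE /= linearP !scalerDr addrACA !scalerA.
by congr (_ + (_ + _)); rewrite mulrC.
Qed.

Lemma hty_post Z n u (t : {linear PP Y -> PP Z}) (w : {linear PP X -> PP Z}) :
  deg 0 t -> cyc 0 t -> hty n u -> (forall x, w x = t (u x)) -> hty n w.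
Proof.
move=> dt /cyc0 tc [h [dh hE]] wE; exists (t \o h); split=> [x j xj|x].
  by apply: dt; rewrite subr0; apply: dh.
by rewrite wE hE linearD linearZ_LR tc.
Qed.

Lemma hty_pre Z n u (t : {linear PP Z -> PP X}) (w : {linear PP Z -> PP Y}) :
  deg n t -> cyc n t -> hty 0 u -> (forall x, w x = u (t x)) -> hty n w.
Proof.
move=> dt tc [h [dh hE]] wE; exists (h \o t); split=> [x j xj|x] /=.
  by apply: dh; apply: dt; rewrite -addrA -opprD [0 + 1 + n]addrC add0r.
by rewrite wE hE tc /sg expr0 scale1r linearZ_LR.
Qed.

End HtyOps.
End ProductModule.

(** * Mapping cones of quasi-isomorphisms *)

Section Cone.
Variable S : comNzRingType.
Variables (X Y : complex S) (eta : ghom X Y 0).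
Hypothesis qeta : quasi_iso eta.

Definition cone_mod (i : int) : lmodType S := (X (i - 1) * Y i)%type.
Fact cone_key i j : {f : {linear cone_mod i -> cone_mod j} | forall z,
  f z = (- diff X (i - 1) (j - 1) z.1, diff Y i j z.2 + eta (i - 1) j z.1)}.
Proof.
apply/cid/linear_ex => a x y; congr (_, _).
  by rewrite -[(a *: x + y).1]/(a *: x.1 + y.1) linearP opprD -scalerN.
rewrite -[(a *: x + y).1]/(a *: x.1 + y.1) -[(a *: x + y).2]/(a *: x.2 + y.2).
by rewrite !linearP addrACA -scalerDr.
Qed.
Definition cone_diff i j := sval (cone_key i j).
Lemma cone_diffE i j z :
  cone_diff i j z = (- diff X (i - 1) (j - 1) z.1, diff Y i j z.2 + eta (i - 1) j z.1).
Proof. exact: (svalP (cone_key i j)). Qed.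

Lemma eta_out i j x : j != i -> eta i j x = 0.
Proof. by move=> ij; rewrite gmap_shape // addr0. Qed.

Fact cone_shape i j : i != j + 1 -> forall x, cone_diff i j x = 0.
Proof.
move=> ij x; rewrite cone_diffE (diff_shape X) ?(diff_shape Y) // ?eta_out.
- by rewrite oppr0 add0r.
- by apply: contraNneq ij => ->; rewrite subrK.
- by apply: contraNneq ij => /(congr1 (+%R 1)); lia.
Qed.

Fact cone_sq i j k x : cone_diff j k (cone_diff i j x) = 0.
Proof.
rewrite !cone_diffE /= (linearN (diff X _ _)) opprK diff_diff (linearD (diff Y _ _)) diff_diff add0r.
rewrite (linearN (eta _ _ : {linear _ -> _})).
suff -> : diff Y j k (eta (i - 1) j x.1) = eta (j - 1) k (diff X (i - 1) (j - 1) x.1).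
  by rewrite subrr.
have [c _] := qeta; have [jE|jE] := eqVneq j (i - 1); last first.
  rewrite eta_out // linear0 (diff_shape X) ?linear0 //.
  by rewrite subrK eq_sym.
have [kE|kE] := eqVneq k (j - 1); last first.
  rewrite [RHS]eta_out // (diff_shape Y) //.
  by apply: contraNneq kE => ->; rewrite addrK.
by subst j; subst k; rewrite c.
Qed.
Definition cone : complex S := Complex cone_shape cone_sq.

Lemma is_boundE (E : complex S) i j (x : E i) : j = i + 1 ->
  is_boundary x <-> exists y, diff E j i y = x.
Proof. by move=> ->. Qed.

Lemma cone_exact : exact_complex cone.
Proof.
have [c q] := qeta; move=> i z zc; have := zc; rewrite /is_cycle /= cone_diffE => E.
have d1 : diff X (i - 1) (i - 1 - 1) z.1 = 0.
  by have := congr1 fst E => /= /eqP; rewrite oppr_eq0 => /eqP.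
have d2 : diff Y i (i - 1) z.2 + eta (i - 1) (i - 1) z.1 = 0 := congr1 snd E.
have i1 : i = i - 1 + 1 by rewrite subrK.
have [x xE] : exists x : X i, diff X i (i - 1) x = - z.1.
  have : is_boundary z.1.
    apply: (proj1 (q (i - 1))) d1 _; apply/(is_boundE _ i1); exists (- z.2).
    rewrite linearN; apply/esym/eqP; rewrite -subr_eq0 opprK; apply/eqP.
    by apply: etrans (addrC _ _) d2.
  by move/(is_boundE _ i1) => [y yE]; exists (- y); rewrite linearN yE.
have [|x0 [x0c [y yE]]] := proj2 (q i) (z.2 - eta i i x).
  by rewrite /is_cycle linearB -c xE linearN opprK d2.
have H k : k = i -> exists x1 : X k, diff X k (i - 1) x1 = - z.1 /\
    eta k i x1 = eta i i x + eta i i x0.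
  move=> ->; exists (x + x0); split; last by rewrite linearD.
  by rewrite linearD xE x0c addr0.
have [|x1 [dx1 ex1]] := H (i + 1 - 1); first by rewrite addrK.
exists (x1, y); rewrite /= cone_diffE /= dx1 ex1 opprK yE [z in RHS]surjective_pairing.
by congr (_, _); rewrite [eta i i x + _]addrC addrA !subrK.
Qed.

(** Transport along equal indices: the first component of the cone in degree i + 1 lies in X (i + 1
    - 1), which equals X i only propositionally. *)
Fact ecast_key i k (e : i = k) : {f : {linear X i -> X k} |
  forall e' : k = i, forall x : X k, f (eq_rect k (fun k => X k) x i e') = x}.
Proof.
subst k; exists idfun => e' x /=; by rewrite (eq_axiomK e').
Qed.
Definition ecast i k (e : i = k) := sval (ecast_key e).
Lemma ecast_at (x : PP X) i k (e : i = k) : ecast e (x i) = x k.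
Proof. by subst k; apply: (svalP (ecast_key (erefl i)) erefl). Qed.
Lemma ecast_cone (z : PP cone) i j (e : i - 1 = j - 1) : i = j -> ecast e (z i).1 = (z j).1.
Proof.
by move=> ij; subst i; have := svalP (ecast_key e) (esym e) (z j).1; rewrite (eq_axiomK (esym e)).
Qed.

Fact inX_key : {f : {linear PP X -> PP cone} | forall x i, f x i = (x (i - 1), 0)}.
Proof.
apply: cid; have [|f fE] := @linear_ex S (PP X) (PP cone)
    (fun x => (fun i => (x (i - 1), 0)) : PP cone); last by exists f => x i; rewrite fE.
move=> a x y; apply: prodmP => i.
rewrite -[RHS]/(a *: x (i - 1) + y (i - 1), a *: (0 : Y i) + 0).
by rewrite scaler0 addr0.
Qed.
Definition inX := sval inX_key.
Lemma inXE x i : inX x i = (x (i - 1), 0). Proof. exact: (svalP inX_key). Qed.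

Fact inY_key : {f : {linear PP Y -> PP cone} | forall y i, f y i = (0, y i)}.
Proof.
apply: cid; have [|f fE] := @linear_ex S (PP Y) (PP cone)
    (fun y => (fun i => (0, y i)) : PP cone); last by exists f => x i; rewrite fE.
move=> a x y; apply: prodmP => i.
rewrite -[RHS]/(a *: (0 : X (i - 1)) + 0, a *: x i + y i).
by rewrite scaler0 addr0.
Qed.
Definition inY := sval inY_key.
Lemma inYE y i : inY y i = (0, y i). Proof. exact: (svalP inY_key). Qed.

Fact prY_key : {f : {linear PP cone -> PP Y} | forall z i, f z i = (z i).2}.
Proof.
apply: cid; have [|f fE] := @linear_ex S (PP cone) (PP Y)
    (fun z => (fun i => (z i).2) : PP Y); last by exists f => x i; rewrite fE.
by move=> a x y; apply: prodmP.
Qed.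
Definition prY := sval prY_key.
Lemma prYE z i : prY z i = (z i).2. Proof. exact: (svalP prY_key). Qed.

Fact prX_key : {f : {linear PP cone -> PP X} |
  forall z i, f z i = ecast (addrK 1 i) (z (i + 1)).1}.
Proof.
apply: cid; have [|f fE] := @linear_ex S (PP cone) (PP X)
    (fun z => (fun i => ecast (addrK 1 i) (z (i + 1)).1) : PP X); last by exists f => x i; rewrite fE.
move=> a x y; apply: prodmP => i.
rewrite -[RHS]/(a *: ecast (addrK 1 i) (x (i + 1)).1 + ecast (addrK 1 i) (y (i + 1)).1).
exact: linearP.
Qed.
Definition prX := sval prX_key.
Lemma prXE z i : prX z i = ecast (addrK 1 i) (z (i + 1)).1.
Proof. exact: (svalP prX_key). Qed.

Lemma prX_in x : prX (inX x) = x.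
Proof. by apply: prodmP => i; rewrite prXE inXE ecast_at. Qed.
Lemma prX_inY y : prX (inY y) = 0.
Proof. by apply: prodmP => i; rewrite prXE inYE linear0. Qed.
Lemma prY_in y : prY (inY y) = y.
Proof. by apply: prodmP => i; rewrite prYE inYE. Qed.
Lemma prY_inX x : prY (inX x) = 0.
Proof. by apply: prodmP => i; rewrite prYE inXE. Qed.
Lemma cone_split z : z = inX (prX z) + inY (prY z).
Proof.
apply: prodmP => i; rewrite -[RHS]/(inX (prX z) i + inY (prY z) i) inXE inYE prYE prXE.
rewrite (@ecast_cone z (i - 1 + 1) i) ?subrK // [LHS]surjective_pairing.
by congr (_, _); rewrite ?addr0 ?add0r.
Qed.

Variable e : {linear PP X -> PP Y}.
Hypothesis eE : forall x j, e x j = eta j j (x j).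

Lemma d_inY y : dP cone (inY y) = inY (dP Y y).
Proof.
apply: prodmP => i; rewrite dPE !inYE /= cone_diffE /= (linear0 (diff X _ _)) oppr0.
by rewrite (linear0 (eta _ _ : {linear _ -> _})) addr0 dPE.
Qed.
Lemma d_inX x : dP cone (inX x) = inY (e x) - inX (dP X x).
Proof.
apply: prodmP => i; rewrite -[RHS]/(inY (e x) i - inX (dP X x) i) !dPE inYE !inXE.
rewrite /= cone_diffE /= (linear0 (diff Y _ _)) add0r dPE eE.
rewrite -[RHS]/(0 - diff X (i - 1 + 1) (i - 1) (x (i - 1 + 1)), eta i i (x i) - 0).
by rewrite sub0r subr0 addrK subrK.
Qed.

Lemma prX_d z : prX (dP cone z) = - dP X (prX z).
Proof.
rewrite {1}(cone_split z) linearD d_inX d_inY (linearD prX) (linearB prX).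
by rewrite !prX_inY prX_in sub0r addr0.
Qed.
Lemma prY_d z : prY (dP cone z) = e (prX z) + dP Y (prY z).
Proof.
rewrite {1}(cone_split z) linearD d_inX d_inY (linearD prY) (linearB prY).
by rewrite !prY_in prY_inX subr0.
Qed.

Section Target.
Variable Z : complex S.
Hypothesis Zk : semi_injective Z.

(** [g \o prX] is a cycle of degree -1 on the exact cone, hence null-homotopic. Up to sign, the
    homotopy restricted to Y is the extension of g, and restricted to X it is the homotopy comparing
    the two. *)
Lemma cone_lift (g : {linear PP X -> PP Z}) : deg 0 g -> cyc 0 g ->
  exists g' : {linear PP Y -> PP Z}, [/\ deg 0 g', cyc 0 g' &
    hty 0 ((g' \o e) \- g)].
Proof.
move=> dg /cyc0 gc; have sg1 : sg S (-1) = -1 by rewrite /sg expr1.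
have [||v [dv vE]] := @kinj S cone Z (-1) (g \o prX) Zk cone_exact.
- move=> z j; rewrite opprK => zj /=; apply: dg; rewrite subr0 prXE zj.
  exact: linear0.
- by move=> z; rewrite /= prX_d linearN gc sg1 scaleN1r opprK.
rewrite addNr in dv.
have vY y : dP Z (v (inY y)) = v (inY (dP Y y)).
  have := vE (inY y); rewrite /= prX_inY linear0 sg1 scaleN1r d_inY => /esym/eqP.
  by rewrite subr_eq0 => /eqP.
exists (\- (v \o inY)); split.
- move=> y j yj; rewrite -[LHS]/(- (v (inY y) j)) dv ?oppr0 // inYE yj; congr (_, _).
- by move=> y; rewrite /= /sg expr0 scale1r linearN vY.
- exists (\- (v \o inX)); split=> [x j xj|x].
    rewrite -[LHS]/(- (v (inX x) j)) dv ?oppr0 // inXE subr0; congr (_, _).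
    by move: xj; rewrite add0r.
  have := vE (inX x); rewrite /= prX_in sg1 scaleN1r d_inX linearB => ->.
  by rewrite /sg expr0 scale1r (linearN (dP Z)) opprB !addrA addNr add0r addrC.
Qed.

(** [g] on Y and its null-homotopy on X assemble to a cycle on the cone; a null-homotopy of that
    cycle restricts to one of [g]. *)
Lemma cone_inj n (g : {linear PP Y -> PP Z}) : deg n g -> cyc n g ->
  hty n (g \o e) -> hty n g.
Proof.
move=> dg gc [w [dw wE]].
have uE : exists u : {linear PP cone -> PP Z}, forall z,
  u z = g (prY z) + sg S n *: w (prX z) by exists ((g \o prY) \+ (sg S n \*: (w \o prX))).
have [u {}uE] := uE.
have uX x : u (inX x) = sg S n *: w x by rewrite uE prY_inX prX_in linear0 add0r.
have uY y : u (inY y) = g y by rewrite uE prY_in prX_inY linear0 scaler0 addr0.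
have [||v [dv vE]] := @kinj S cone Z n u Zk cone_exact.
- move=> z j zj; rewrite uE -[LHS]/(g (prY z) j + sg S n *: w (prX z) j).
  rewrite dg ?prYE ?zj // add0r dw ?scaler0 // prXE.
  have zj' : z (j - (n + 1) + 1) = 0 by rewrite (_ : j - (n + 1) + 1 = j - n) //; ring.
  by rewrite zj' linear0.
- move=> z; rewrite !uE prX_d prY_d (linearD g) (linearD (dP Z)) gc (linearZ_LR (dP Z)).
  have := wE (prX z); rewrite /= => ->; rewrite (linearN w) scalerN -scalerDr.
  congr (_ *: _).
  by rewrite [RHS]addrAC addrK addrC.
exists (v \o inY); split=> [y j yj|y] /=.
  by apply: dv; rewrite inYE yj.
by rewrite -uY vE d_inY.
Qed.
End Target.
End Cone.

(** * Transfer of the homothety isomorphism to the bounded resolution *)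

Section Transfer.
Variable S : comNzRingType.

Lemma deg_l (A B C : complex S) n (t : {linear PP B -> PP C}) (u : {linear PP A -> PP B}) :
  deg 0 t -> deg n u -> deg n (t \o u).
Proof. by move=> dt du x j xj; apply: dt; rewrite subr0; apply: du. Qed.
Lemma deg_r (A B C : complex S) n (t : {linear PP A -> PP B}) (u : {linear PP B -> PP C}) :
  deg 0 t -> deg n u -> deg n (u \o t).
Proof. by move=> dt du x j xj; apply: du; apply: dt; rewrite subr0. Qed.
Lemma cyc_l (A B C : complex S) n (t : {linear PP B -> PP C}) (u : {linear PP A -> PP B}) :
  cyc 0 t -> cyc n u -> cyc n (t \o u).
Proof. by move=> /cyc0 tc uc x; rewrite /= tc uc linearZ_LR. Qed.
Lemma cyc_r (A B C : complex S) n (t : {linear PP A -> PP B}) (u : {linear PP B -> PP C}) :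
  cyc 0 t -> cyc n u -> cyc n (u \o t).
Proof. by move=> /cyc0 tc uc x; rewrite /= uc tc. Qed.
Lemma deg_sub (A B : complex S) n (u v : {linear PP A -> PP B}) a : (n = 0 \/ a = 0) ->
  deg n u -> deg 0 v -> deg n (u \- (a \*: v)).
Proof.
move=> na du dv x j xj; rewrite -[LHS]/(u x j - a *: v x j) du // sub0r.
case: na xj => [->|->] xj; last by rewrite scale0r oppr0.
by rewrite dv // scaler0 oppr0.
Qed.
Lemma cyc_sub (A B : complex S) n (u v : {linear PP A -> PP B}) a : (n = 0 \/ a = 0) ->
  cyc n u -> cyc 0 v -> cyc n (u \- (a \*: v)).
Proof.
move=> na uc vc x; rewrite /= (linearB (dP B)) uc (linearZ_LR (dP B)) vc scalerBr.
case: na => [->|->]; last by rewrite !scale0r scaler0.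
by rewrite /sg expr0 !scale1r.
Qed.
Lemma hty_scale (A B : complex S) n (u : {linear PP A -> PP B}) a : (n = 0 \/ a = 0) ->
  hty 0 u -> hty n (a \*: u).
Proof.
case=> [->|->] hu.
  have h0 : hty 0 (\0 : {linear PP A -> PP B}).
    by exists \0; split=> // x; rewrite /= linear0 scaler0 addr0.
  by apply: (hty_lin (a := a) hu h0) => x; rewrite /= addr0.
exists \0; split=> // x.
by rewrite /= scale0r linear0 scaler0 addr0.
Qed.

(** [w1] is the homogeneous part of degree n of [w]; it replaces homotopies without degree by
    homogeneous ones. *)
Lemma map_comp1 (A B : complex S) (w : {linear PP A -> PP B}) n :
  exists w1 : {linear PP A -> PP B}, deg n w1 /\
    forall x j, w1 x j = w (sgl A (j - n) (x (j - n))) j.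
Proof.
have [g gE] := @prodm_lin S int (fun i => B i) (PP A)
  (fun j => cmp B j \o (w \o (sgl A (j - n) \o cmp A (j - n)))).
exists g; split=> [x j xj|x j]; rewrite gE /= /cmp !comp_atE //.
by rewrite xj !linear0.
Qed.

Variables (X Y Y' : complex S) (eta : ghom X Y 0) (eta' : ghom X Y' 0).
Hypotheses (rY : semi_injective_resolution eta) (rY' : semi_injective_resolution eta').
Hypothesis exX : forall n, n != 0 -> exact_at (hom_complex X Y') n.
Hypothesis cycX : forall f : hom_complex X Y' 0, is_cycle f ->
  exists r : S, is_boundary (f - r *: (eta' : hom_complex X Y' 0)).
Hypothesis bdX : forall r : S, is_boundary (r *: (eta' : hom_complex X Y' 0)) -> r = 0.

(** Finite injective dimension and the homothety condition each bring their own resolution of X; [t]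
    and [t'] compare them. *)
Lemma lifts_ex : exists (e : {linear PP X -> PP Y}) (e' : {linear PP X -> PP Y'})
    (t : {linear PP Y -> PP Y'}) (t' : {linear PP Y' -> PP Y}),
  [/\ [/\ deg 0 e, cyc 0 e, deg 0 t, cyc 0 t & deg 0 e'],
     forall i j x, eta' i j x = e' (sgl X i x) j,
     forall n g, deg n g -> cyc n g -> hty n (g \o e) ->
       @hty S Y Y' n g,
     hty 0 ((t \o e) \- e') &
     [/\ deg 0 t', cyc 0 t' & hty 0 ((t' \o t) \- idfun)]].
Proof.
have [Yk qY] := rY; have [Y'k qY'] := rY'.
have [e [de ec eE eE2]] := eta_map (proj1 qY).
have [e' [de' ec' eE' eE2']] := eta_map (proj1 qY').
have [t [dt tc ht]] := cone_lift qY eE Y'k de' ec'.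
have [t' [dt' tc' ht']] := cone_lift qY' eE' Yk de ec.
exists e, e', t, t'; split=> //.
  by move=> n g; apply: (cone_inj qY eE Y'k).
have d1 : deg 0 (idfun : {linear PP Y -> PP Y}) by move=> x j; rewrite subr0.
have c1 : cyc 0 (idfun : {linear PP Y -> PP Y}).
  by move=> x; rewrite /sg expr0 scale1r.
split=> //; apply: (cone_inj qY eE Yk).
- move=> x j xj; rewrite -[LHS]/((t' \o t) x j - x j) (deg_l dt' dt) // sub0r.
  by rewrite [X in - X]d1 // oppr0.
- by move=> x; rewrite /sg expr0 scale1r /= (linearB (dP Y)) (cyc0 tc') (cyc0 tc).
have h1 : hty 0 (t' \o ((t \o e) \- e')) by apply: (hty_post dt' tc' ht).
by apply: (hty_lin (a := 1) h1 ht') => x; rewrite scale1r /= linearB addrA subrK.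
Qed.

(** Composed with [e] and [t], the map becomes a cycle of Hom(X, Y'), whose homology is known;
    [cone_inj] then removes [e], and [t'] removes [t]. *)
Lemma transfer_gen n (f : {linear PP Y -> PP Y}) :
  deg n f -> cyc n f -> exists s : S, (n = 0 \/ s = 0) /\ hty n (f \- (s \*: idfun)).
Proof.
move=> df fc; have [e [e' [t [t' [[de ec dt tc de'] e'E inj ht [dt' tc' h1]]]]]] := lifts_ex.
pose u : {linear PP X -> PP Y'} := t \o (f \o e).
have du : deg n u by apply/deg_l/deg_r.
have uc : cyc n u by apply/cyc_l/cyc_r.
have [s [ns hs]] : exists s : S, (n = 0 \/ s = 0) /\ hty n (u \- (s \*: e')).
  have [g gE] := ghom_of du; have gc := cyc_ghom gE uc.
  have [n0|n0] := eqVneq n 0; last first.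
    exists 0; split; first by right.
    have := bound_hty du gE (exX n0 gc) => hu.
    apply: (hty_lin (a := 1) hu (hty_scale _ ht)) => [|x]; first by right.
    by rewrite /= !scale0r subr0 addr0 scale1r.
  subst n; have [s bs] := cycX gc; exists s; split; first by left.
  apply: (bound_hty _ _ bs); first by apply: deg_sub => //; left.
  by move=> i j x; rewrite -[LHS]/(g i j x - s *: eta' i j x) gE e'E.
exists s; split=> //.
have h2 : hty n ((t \o f) \- (s \*: t)).
  apply: inj.
  - by apply: deg_sub => //; apply: deg_l.
  - by apply: cyc_sub => //; apply: cyc_l.
  apply: (hty_lin (a := -1) (hty_scale ns ht) hs) => x.
  by rewrite scaleN1r /= scalerBr opprB [RHS]addrC addrA subrK.
have h3 : hty n (t' \o ((t \o f) \- (s \*: t))) by apply: (hty_post dt' tc' h2).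
have h4 : hty n (((t' \o t) \- idfun) \o f) by apply: (hty_pre df fc h1).
have h5 := hty_scale ns h1.
have h6 : hty n ((t' \o ((t \o f) \- (s \*: t))) \- (((t' \o t) \- idfun) \o f)).
  by apply: (hty_lin (a := -1) h4 h3) => x; rewrite scaleN1r /= addrC.
apply: (hty_lin (a := 1) h6 h5) => x.
rewrite scale1r /= (linearB t') (linearZ_LR t') scalerBr opprB.
by rewrite [X in _ = X + _]addrC [X in _ = X + _]addrA subrK addrA subrK.
Qed.

Lemma transfer_inj (s : S) (k : {linear PP Y -> PP Y}) :
  (forall x, s *: x = dP Y (k x) + k (dP Y x)) -> s = 0.
Proof.
move=> kE; have [e [e' [t [t' [[de ec dt tc de'] e'E _ [w0 [_ w0E]] _]]]]] := lifts_ex.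
pose w : {linear PP X -> PP Y'} := (t \o (k \o e)) \- (s \*: w0).
have wE x : s *: e' x = dP Y' (w x) + w (dP X x).
  have := w0E x; rewrite /sg expr0 scale1r /= => /eqP; rewrite subr_eq => /eqP tE.
  have -> : s *: e' x = t (s *: e x) - s *: (dP Y' (w0 x) + w0 (dP X x)).
    by rewrite linearZ_LR tE scalerDr addrC addKr.
  rewrite kE (linearD t) -(cyc0 tc) (cyc0 ec) /w /= (linearB (dP Y')) (linearZ_LR (dP Y')).
  by rewrite scalerDr opprD addrACA.
(* The homotopy may have parts of every degree, but only the part of degree 1 contributes to the
   degree 0 map s e'. *)
have [w1 [dw1 w1E]] := map_comp1 w 1.
apply: bdX.
have ds : deg 0 (s \*: e').
  by move=> x j xj; rewrite -[LHS]/(s *: e' x j) de' // scaler0.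
have fE i j (x : X i) : (s *: (eta' : hom_complex X Y' 0) : ghom X Y' 0) i j x = (s \*: e') (sgl X i x) j.
  by rewrite -[LHS]/(s *: eta' i j x) e'E.
apply: (hty_bound fE); exists w1; split; first by rewrite add0r.
move=> x; apply: prodmP => j; rewrite /sg expr0 scale1r (deg_at _ _ ds) subr0 /= wE.
rewrite -[LHS]/(dP Y' (w (sgl X j (x j))) j + w (dP X (sgl X j (x j))) j).
rewrite -[RHS]/(dP Y' (w1 x) j + w1 (dP X x) j) !dPE !w1E addrK; congr (_ + _).
by rewrite dP_sgl dPE subrK.
Qed.
End Transfer.

(** * Truncation to a bounded complex of injectives *)

Section Bounded.
Variable S : comNzRingType.

Lemma coord_ex (A B : complex S) (f : forall j : int, {linear PP A -> B j}) :
  exists g : {linear PP A -> PP B}, forall x j, g x j = f j x.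
Proof. exact: prodm_lin. Qed.

Variables (Y : complex S) (M n0 : nat).
Hypothesis Yinj : semi_injective Y.
Hypothesis exY : forall i : int, M%:Z < i -> exact_at Y i.
Hypothesis Y0 : forall i : int, i < - n0%:Z -> is_zero (Y i).

(* Q is the exact subcomplex of Y above degree M; a contraction of Q extends to H,
   and d H + H d projects Y onto Q. *)
Section Truncation.
Definition q_pred i (y : Y i) := (i < M%:Z -> y = 0) /\ (i = M%:Z -> is_boundary y).
Fact q0 i : q_pred (0 : Y i).
Proof. by split=> // _; exists 0; rewrite linear0. Qed.
Fact qP i a (x y : Y i) : q_pred x -> q_pred y -> q_pred (a *: x + y).
Proof.
move=> [x0 xM] [y0 yM]; split=> h; first by rewrite x0 // y0 // scaler0 addr0.
have [u uE] := xM h; have [v vE] := yM h; exists (a *: u + v).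
by rewrite linearP uE vE.
Qed.
Definition qs i : submodule (Y i) := Submodule (@q0 i) (@qP i).

Lemma qs_diff i j (y : Y i) : qs i y -> qs j (diff Y i j y).
Proof.
move=> [y0 yM]; have [ij|ij] := eqVneq i (j + 1); last first.
  by rewrite diff_shape //; apply: sm0.
split=> jM; last by subst i; exists y.
have [iM|iM] := eqVneq i M%:Z; last first.
  by rewrite y0 ?linear0 //; lia.
by move: iM => /yM [u <-]; apply: diff_diff.
Qed.

Fact Q_key i j : {f : {linear subm (qs i) -> subm (qs j)} |
  forall x, incl (qs j) (f x) = diff Y i j (incl (qs i) x)}.
Proof.
apply: cid; apply: (@corestr _ _ _ (diff Y i j \o incl (qs i))) => x /=.
exact/qs_diff/inclP.
Qed.
Definition Qd i j := sval (Q_key i j).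
Lemma QdE i j x : incl (qs j) (Qd i j x) = diff Y i j (incl (qs i) x).
Proof. exact: (svalP (Q_key i j)). Qed.
Fact Q_shape i j : i != j + 1 -> forall x, Qd i j x = 0.
Proof. by move=> ij x; apply: (@incl_inj _ _ (qs j)); rewrite QdE diff_shape // linear0. Qed.
Fact Q_sq i j k x : Qd j k (Qd i j x) = 0.
Proof. by apply: (@incl_inj _ _ (qs k)); rewrite !QdE diff_diff linear0. Qed.
Definition Q : complex S :=
  @Complex S (fun i => subm (qs i)) Qd Q_shape Q_sq.

Lemma Q_exact : exact_complex Q.
Proof.
move=> i x; rewrite /is_cycle /= => xc; have [x0 xM] := inclP x.
have dx : diff Y i (i - 1) (incl (qs i) x) = 0 by rewrite -QdE xc linear0.
have lift (y : Y (i + 1)) : M%:Z <= i -> diff Y (i + 1) i y = incl (qs i) x ->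
    is_boundary (X := Q) (i := i) x.
  move=> Mi yE; have [|z zE] := @incl_ex _ _ (qs (i + 1)) y.
    by split=> h; exfalso; move: h Mi; lia.
  by exists z; apply: (@incl_inj _ _ (qs i)); rewrite QdE zE.
have [iM|Mi] := boolP (i < M%:Z).
  exists 0; rewrite linear0; apply: (@incl_inj _ _ (qs i)).
  by rewrite x0 // linear0.
have [iM|iM] := eqVneq i M%:Z; first by have [y yE] := xM iM; apply: (lift y) => //; lia.
have [|y yE] := exY _ dx; first by lia.
by apply: lift yE; lia.
Qed.

Lemma retraction_ex : exists H : {linear PP Y -> PP Y},
  let r y := dP Y (H y) + H (dP Y y) in
  [/\ forall y j, y (j - 1) = 0 -> H y j = 0,
      forall y, r (r y) = r y & forall y j, M%:Z < j -> r y j = y j].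
Proof.
have [iQ iQE] := @coord_ex Q Y (fun j => incl (qs j) \o cmp Q j).
have {}iQE x j : iQ x j = incl (qs j) (x j) by rewrite iQE /= /cmp comp_atE.
have dQ x : dP Y (iQ x) = iQ (dP Q x).
  by apply: prodmP => j; rewrite dPE !iQE dPE [RHS]QdE.
have [||h [dh hE]] := @kinj S Q Y 0 iQ Yinj Q_exact.
- by move=> x j; rewrite subr0 iQE => ->; rewrite linear0.
- by move=> x; rewrite /sg expr0 scale1r dQ.
rewrite add0r in dh.
(* Below degree M the terms of [Q] are zero; extending by zero there keeps the values of [r] inside
   [Q]. *)
have g_ex (ij : int * int) : exists g : {linear Y ij.1 -> Y ij.2},
    (forall x, g (incl (qs ij.1) x) = h (sgl Q ij.1 x) ij.2) /\
    (ij.1 < M%:Z -> forall y, g y = 0).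
  case: ij => i j /=; have [iM|iM] := boolP (i < M%:Z).
    exists \0; split=> // x; suff -> : x = 0 by rewrite !linear0.
    by apply: (@incl_inj _ _ (qs i)); rewrite linear0; have [x0 _] := inclP x; apply: x0.
  have [g gE] := Yinj.1 j _ _ _ (cmp Y j \o (h \o sgl Q i)) (@incl_inj _ _ (qs i)).
  by exists g; split=> // x; rewrite gE /= /cmp comp_atE.
pose g ij := projT1 (cid (g_ex ij)).
have gE ij : (forall x, g ij (incl (qs ij.1) x) = h (sgl Q ij.1 x) ij.2) /\
    (ij.1 < M%:Z -> forall y, g ij y = 0) by exact: projT2 (cid (g_ex ij)).
have [H HE] := @coord_ex Y Y (fun j => g (j - 1, j) \o cmp Y (j - 1)).
have {}HE y j : H y j = g (j - 1, j) (y (j - 1)) by rewrite HE /= /cmp comp_atE.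
have Hi x : H (iQ x) = h x.
  apply: prodmP => j; rewrite HE iQE (proj1 (gE (j - 1, j))) /=.
  by rewrite [RHS](deg_at _ _ dh).
exists H; move=> r.
have ri x : r (iQ x) = iQ x.
  by rewrite /r dQ !Hi hE /sg expr0 scale1r.
have lift z : (forall j, qs j (z j)) -> exists x, iQ x = z.
  move=> zq; exists (fun j => sm_lift (qs j) (z j)); apply: prodmP => j.
  by rewrite iQE sm_liftE.
have Hlow y j : j <= M%:Z -> H y j = 0.
  by move=> jM; rewrite HE (proj2 (gE (j - 1, j))) //=; lia.
have rq y j : qs j (r y j).
  rewrite -[r y j]/(dP Y (H y) j + H (dP Y y) j) dPE; split=> jM.
    by rewrite !Hlow ?linear0 ?addr0 //; lia.
  by exists (H y (j + 1)); rewrite (Hlow (dP Y y) j) ?addr0 //; lia.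
split=> [y j yj|y|y j Mj].
- by rewrite HE yj linear0.
- by have [x xE] := lift (r y) (rq y); rewrite -xE ri.
(* [r] acts degree by degree, and above degree M the terms of [Q] and [Y] agree, so [r] is the
   identity there. *)
have dr : r (sgl Y j (y j)) j = r y j.
  rewrite -[LHS]/(dP Y (H (sgl Y j (y j))) j + H (dP Y (sgl Y j (y j))) j).
  rewrite -[RHS]/(dP Y (H y) j + H (dP Y y) j) !dPE !HE.
  have e1 : sgl Y j (y j) (j + 1 - 1) = y (j + 1 - 1) by rewrite addrK sgl_in.
  have e2 : dP Y (sgl Y j (y j)) (j - 1) = dP Y y (j - 1) by rewrite !dPE subrK sgl_in.
  by rewrite e1 e2.
have [x xE] : exists x, iQ x = sgl Y j (y j).
  apply: lift => i; have [<-|ij] := eqVneq j i; last by rewrite sgl_out //; apply: sm0.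
  by rewrite sgl_in; split=> hj; exfalso; move: hj Mj; lia.
by rewrite -dr -xE ri xE sgl_in.
Qed.
End Truncation.

(** Degree 0 of the model is the lowest possible degree -n0 of [Y]. *)
Definition idx (k : nat) : int := k%:Z - n0%:Z.
Let L := (M + n0).+1.

Lemma idx_in j : ~ (exists k : 'I_L, j = idx k) -> M%:Z < j \/ j < - n0%:Z.
Proof.
move=> h; have [Mj|jM] := boolP (M%:Z < j); [by left|right].
have [//|nj] := boolP (j < - n0%:Z); exfalso; apply: h.
have kL : (absz (j + n0%:Z)%R < L)%N by rewrite /L; lia.
by exists (Ordinal kL); rewrite /idx /=; lia.
Qed.

Lemma deg0_sgl (u : {linear PP Y -> PP Y}) i y : deg 0 u ->
  u (sgl Y i (y i)) = sgl Y i (u y i).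
Proof.
move=> du; apply: prodmP => j; have [<-|ij] := eqVneq i j.
  by rewrite sgl_in [RHS](deg_at _ _ du) subr0.
by rewrite sgl_out // du // subr0 sgl_out.
Qed.

(** D is the kernel of the idempotent d H + H d: a complement of [Q], injective as a retract of a
    product of injectives, and homotopy equivalent to [Y] through [H]. *)
Lemma bounded_model : exists (D : gdm S) (i : {linear D -> PP Y}) (p : {linear PP Y -> D})
    (H : {linear PP Y -> PP Y}),
  [/\ [/\ gn D = L, injective i & injective_module D],
      [/\ forall x, p (i x) = x, forall y, i (p y) = y - (dP Y (H y) + H (dP Y y)),
          forall x, i (gd D x) = dP Y (i x) & forall y, p (dP Y y) = gd D (p y)],
      (forall k x, i (gp D k x) = sgl Y (idx k) (i x (idx k))),
      (forall j y, i (p (sgl Y j (y j))) = sgl Y j (i (p y) j)) &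
      forall x j, ~ (exists k : 'I_L, j = idx k) -> i x j = 0].
Proof.
have [H [dH rr rM]] := retraction_ex.
pose r : {linear PP Y -> PP Y} := (dP Y \o H) \+ (H \o dP Y).
have rd y : r (dP Y y) = dP Y (r y).
  by rewrite /r /= dP_sq linear0 addr0 linearD dP_sq add0r.
have dr : deg 0 r.
  move=> y j; rewrite subr0 => yj; rewrite -[LHS]/(dP Y (H y) j + H (dP Y y) j) dPE.
  rewrite !dH ?linear0 ?addr0 ?addrK // dPE subrK yj linear0 //.
have rE y : r (r y) = r y by apply: rr.
pose K := sm_ker r; pose i := incl K.
have [p pE] : exists p : {linear PP Y -> subm K}, forall y, i (p y) = y - r y.
  by apply: (@corestr _ _ _ (idfun \- r) K) => y; change (r (y - r y) = 0); rewrite linearB rE subrr.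
have iI : injective i by apply: incl_inj.
have ri x : r (i x) = 0 by exact: (inclP x).
have pi x : p (i x) = x by apply: iI; rewrite pE ri subr0.
have i0 x j : ~ (exists k : 'I_L, j = idx k) -> i x j = 0.
  move=> /idx_in [Mj|nj]; last exact: Y0.
  by rewrite -(rM _ _ Mj) -[RHS]/((0 : PP Y) j) -(ri x).
have [d' dE] := @restr_lin _ _ K (dP Y) (fun x (h : r x = 0) => etrans (rd x) (etrans (congr1 (dP Y) h) (linear0 _))).
have Kc k (x : PP Y) : K x -> K (sgl Y (idx k) (x (idx k))).
  move=> rx; change (r (sgl Y (idx k) (x (idx k))) = 0).
  by rewrite deg0_sgl // (rx : r x = 0); apply: linear0.
have p_ex k : exists g : {linear subm K -> subm K}, forall x,
    i (g x) = sgl Y (idx k) (i x (idx k)).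
  have [|g gE] := @restr_lin _ _ K (sgl Y (idx k) \o cmp Y (idx k)).
    move=> x /Kc h; change (K (sgl Y (idx k) (cmp Y (idx k) x))).
    rewrite /cmp comp_atE; exact: h.
  by exists g => x; rewrite gE /= /cmp comp_atE.
have [p' p'E] := choice p_ex.
have [e eE] := @coord_ex Y Y (fun j => sg S (j + n0%:Z) \*: cmp Y j).
have {}eE y j : e y j = sg S (j + n0%:Z) *: y j by rewrite eE /= /cmp comp_atE.
have [e' e'E] : exists g : {linear subm K -> subm K}, forall x, i (g x) = e (i x).
  apply: restr_lin => x rx; change (r (e x) = 0); apply: prodmP => j.
  rewrite (deg_at _ _ dr) subr0 eE linearZ_LR linearZ_LR -[LHS]/(_ *: r (sgl Y j (x j)) j).
  by rewrite deg0_sgl // (rx : r x = 0) linear0 scaler0.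
have iD : injective_module (subm K).
  apply: (inj_retract (i := i) (r := p)) => //; apply: prodm_inj; exact: Yinj.1.
have sq : sqz d' by move=> x; apply: iI; rewrite !dE dP_sq linear0.
have gr : grading L p'.
  split=> [k x|k l x kl|x]; apply: iI.
  - by rewrite !p'E sgl_in.
  - rewrite !p'E sgl_out ?linear0 //; apply: contraNneq kl; rewrite /idx => E.
    by apply/eqP; lia.
  rewrite linear_sum; apply: prodmP => j.
  have -> : (\sum_(k < L) i (p' k x)) j = \sum_(k < L) sgl Y (idx k) (i x (idx k)) j.
    have cE z : cmp Y j z = z j by exact: comp_atE.
    by rewrite -cE linear_sum; apply: eq_bigr => k _; rewrite cE p'E.
  have [[k ->]|h] := pselect (exists k : 'I_L, j = idx k).
    rewrite (bigD1 k) //= sgl_in big1 ?addr0 // => l lk; rewrite sgl_out //.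
    by apply: contraNneq lk; rewrite /idx => E; apply/eqP/val_inj => /=; lia.
  rewrite [LHS]i0 // big1 // => k _; rewrite sgl_out //.
  by apply/eqP => E; apply: h; exists k.
have lo : lowers p' d'.
  split=> [k x|x]; apply: iI.
    rewrite dE !p'E dE dP_sgl dPE.
    have -> : idx k + 1 = idx k.+1 by rewrite /idx; lia.
    by have -> : idx k.+1 - 1 = idx k by rewrite /idx; lia.
  rewrite dE p'E dP_sgl (_ : diff _ _ _ _ = 0) ?linear0 //.
  by apply: Y0; rewrite /idx; lia.
have es k x : e' (p' k x) = (-1) ^+ k *: p' k x.
  apply: iI; rewrite e'E linearZ_LR p'E; apply: prodmP => j.
  rewrite eE -[RHS]/((-1) ^+ k *: sgl Y (idx k) (i x (idx k)) j).
  have [<-|jk] := eqVneq (idx k) j; last by rewrite sgl_out // !scaler0.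
  by rewrite /sg /idx subrK.
exists (@Gdm S (subm K) d' e' L p' sq gr lo es), i, p, H; split=> //.
- by split=> // y; apply: iI; rewrite [RHS]dE !pE linearB rd.
- by move=> j y; rewrite !pE deg0_sgl // -linearB.
Qed.
End Bounded.

(** * Endomorphisms and homology of the bounded model *)

Section CoreModel.
Variables (S : comNzRingType) (Y : complex S) (M n0 : nat).
Hypothesis T1 : forall n (f : {linear PP Y -> PP Y}), deg n f -> cyc n f ->
  exists s : S, (n = 0 \/ s = 0) /\ hty n (f \- (s \*: idfun)).
Hypothesis T2 : forall (s : S) (k : {linear PP Y -> PP Y}),
  (forall x, s *: x = dP Y (k x) + k (dP Y x)) -> s = 0.
Local Notation L := (M + n0).+1.
Local Notation idx := (idx n0).

Lemma sign_map : exists e : {linear PP Y -> PP Y},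
  [/\ deg 0 e, forall x, e (e x) = x & forall x, dP Y (e x) = - e (dP Y x)].
Proof.
have [e eE] := @coord_ex S Y Y (fun j => sg S j \*: cmp Y j).
have {}eE y j : e y j = sg S j *: y j by rewrite eE /= /cmp comp_atE.
exists e; split.
- by move=> x j; rewrite subr0 eE => ->; rewrite scaler0.
- by move=> x; apply: prodmP => j; rewrite !eE scalerA sg_sq scale1r.
- move=> x; apply: prodmP => j; rewrite -[RHS]/(- (e (dP Y x) j)) dPE !eE dPE.
  by rewrite linearZ_LR sgS scaleNr.
Qed.

(** [W] commutes with the differential without the sign that degree n demands. For odd n the sign
    operator supplies it, and the scalar is then 0 because n is not 0. *)
Lemma homog_homotopy n (W : {linear PP Y -> PP Y}) : deg n W ->
  (forall x, dP Y (W x) = W (dP Y x)) ->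
  exists (s : S) (k : {linear PP Y -> PP Y}),
    forall x, W x = s *: x + (dP Y (k x) + k (dP Y x)).
Proof.
move=> dW Wd; have [e [de ee ed]] := sign_map.
case On: (odd (absz n)).
  have sn : sg S n = -1 by rewrite /sg -signr_odd On expr1.
  have [||s [ns [w [_ wE]]]] := @T1 n (W \o e).
  - exact: deg_r.
  - by move=> x /=; rewrite Wd ed linearN sn scaleN1r.
  have s0 : s = 0 by case: ns => // n0'; rewrite n0' in On.
  exists 0, (w \o e) => x; have := wE (e x).
  rewrite /= s0 ee !scale0r subr0 sn scaleN1r ed linearN opprK => ->.
  by rewrite add0r.
have sn : sg S n = 1 by rewrite /sg -signr_odd On expr0.
have [||s [_ [w [_ wE]]]] := @T1 n W => //.
  by move=> x; rewrite sn scale1r.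
exists s, w => x; have := wE x; rewrite /= sn scale1r => <-.
by rewrite addrC subrK.
Qed.

(** A map supported in L consecutive degrees has homogeneous parts only in degrees from -L to L,
    hence 2 L + 1 summands. *)
Lemma band_sum (F : {linear PP Y -> PP Y}) y j :
  (forall i, ~ (exists k : 'I_L, i = idx k) -> F (sgl Y i (y i)) = 0) ->
  (~ (exists k : 'I_L, j = idx k) -> forall x, F x j = 0) ->
  F y j = \sum_(k < L) F (sgl Y (idx k) (y (idx k))) j ->
  F y j = \sum_(t < (L + L).+1)
    F (sgl Y (j - (t%:Z - L%:Z)) (y (j - (t%:Z - L%:Z)))) j.
Proof.
move=> F0 Fj ->; have [[l jl]|nj] := pselect (exists k : 'I_L, j = idx k); last first.
  by rewrite !big1 // => *; apply: Fj.
pose G i := F (sgl Y i (y i)) j.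
rewrite -[LHS]/(\sum_(k < L) G (idx k)).
rewrite -[RHS]/(\sum_(t < (L + L).+1) G (j - (t%:Z - L%:Z))).
have GE i : G i = \sum_(k < L) (if i == idx k then G (idx k) else 0).
  have [[k ->]|ni] := pselect (exists k : 'I_L, i = idx k).
    rewrite (bigD1 k) //= eqxx big1 ?addr0 // => k' k'k; case: eqP => // E.
    by exfalso; move/eqP: k'k; apply; apply: val_inj; move: E; rewrite /idx /=; lia.
  rewrite /G F0 // big1 // => k _; case: eqP => // E.
  by exfalso; apply: ni; exists k.
under [RHS]eq_bigr => t _ do rewrite GE.
rewrite exchange_big; apply: eq_bigr => k _ /=.
have tL : (l + L - k < (L + L).+1)%N by move: (ltn_ord l) (ltn_ord k); lia.
rewrite (bigD1 (Ordinal tL)) //= big1 => [|t tt].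
  rewrite addr0 ifT //; apply/eqP; rewrite jl /idx.
  by move: (ltn_ord l) (ltn_ord k); lia.
case: eqP => // E; exfalso; move/eqP: tt; apply; apply: val_inj => /=.
by move: E (ltn_ord l) (ltn_ord k); rewrite jl /idx; lia.
Qed.

(** Homotopy classes are known for homogeneous maps; boundedness makes [F] a finite sum of
    homogeneous parts, each homotopic to a scalar. *)
Lemma band_homotopy (F : {linear PP Y -> PP Y}) :
  (forall x, dP Y (F x) = F (dP Y x)) ->
  (forall y i, ~ (exists k : 'I_L, i = idx k) -> F (sgl Y i (y i)) = 0) ->
  (forall j, ~ (exists k : 'I_L, j = idx k) -> forall x, F x j = 0) ->
  (forall y, F y = \sum_(k < L) F (sgl Y (idx k) (y (idx k)))) ->
  exists (s : S) (k : {linear PP Y -> PP Y}),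
    forall x, F x = s *: x + (dP Y (k x) + k (dP Y x)).
Proof.
move=> Fd F0 Fj Fs; have cE j z : cmp Y j z = z j by exact: comp_atE.
have [W WE] := choice (map_comp1 F).
have Wd n x : dP Y (W n x) = W n (dP Y x).
  have [_ wE] := WE n; apply: prodmP => j; rewrite dPE !wE.
  rewrite -[LHS](dPE (F (sgl Y (j + 1 - n) (x (j + 1 - n))))) Fd dP_sgl dPE.
  have -> : j + 1 - n = j - n + 1 by ring.
  by rewrite addrK.
have [s sE] := choice (fun n => homog_homotopy (proj1 (WE n)) (Wd n)).
have [k kE] := choice sE.
pose c (t : 'I_(L + L).+1) : int := t%:Z - L%:Z.
have [|K KE] := @linear_ex S (PP Y) (PP Y) (fun y => \sum_t k (c t) y).
  move=> a x y; rewrite scaler_sumr -big_split; apply: eq_bigr => t _.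
  by rewrite linearP.
exists (\sum_t s (c t)), K => y.
have -> : F y = \sum_t W (c t) y.
  apply: prodmP => j; rewrite -[RHS]cE linear_sum.
  rewrite (@band_sum F y j) //.
  - by apply: eq_bigr => t _; rewrite cE (proj2 (WE (c t))).
  - exact: F0.
  - exact: Fj.
  - by rewrite {1}Fs -cE linear_sum; apply: eq_bigr => i _; rewrite cE.
rewrite !KE linear_sum scaler_suml -!big_split; apply: eq_bigr => t _.
exact: kE.
Qed.

Variables (D : gdm S) (i : {linear D -> PP Y}) (p : {linear PP Y -> D}).
Variable H : {linear PP Y -> PP Y}.
Hypotheses (gnD : gn D = L) (iI : injective i) (pi : forall x, p (i x) = x).
Hypothesis ip : forall y, i (p y) = y - (dP Y (H y) + H (dP Y y)).
Hypotheses (id_ : forall x, i (gd D x) = dP Y (i x)) (pd : forall y, p (dP Y y) = gd D (p y)).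
Hypothesis igp : forall k x, i (gp D k x) = sgl Y (idx k) (i x (idx k)).
Hypothesis ips : forall j y, i (p (sgl Y j (y j))) = sgl Y j (i (p y) j).
Hypothesis i0 : forall x j, ~ (exists k : 'I_L, j = idx k) -> i x j = 0.

Lemma model_H1 (F : {linear D -> D}) : chain (gd D) (gd D) F ->
  exists (s : S) (k : {linear D -> D}), forall x, F x = s *: x + (gd D (k x) + k (gd D x)).
Proof.
move=> Fc; have [||||s [k kE]] := @band_homotopy (i \o (F \o p)).
- by move=> x /=; rewrite -id_ -Fc pd.
- move=> y j nj /=; have -> : p (sgl Y j (y j)) = 0; last by rewrite !linear0.
  by apply: iI; rewrite ips i0 // !linear0.
- by move=> j nj x /=; apply: i0.
- move=> y; have := gr_sum (ggr D) (p y); rewrite gnD => E.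
  rewrite -[LHS]/(i (F (p y))) {1}E !linear_sum; apply: eq_bigr => k _.
  by congr (i (F _)); apply: iI; rewrite igp ips.
exists s, (p \o (k \o i)) => x; have := congr1 p (kE (i x)); rewrite /= !pi => ->.
by rewrite linearP linearD pi pd id_.
Qed.

Lemma model_H2 (s : S) (k : {linear D -> D}) :
  (forall x, s *: x = gd D (k x) + k (gd D x)) -> s = 0.
Proof.
move=> kE; apply: (T2 (k := (i \o (k \o p)) \+ (s \*: H))) => y.
have E : s *: i (p y) = dP Y (i (k (p y))) + i (k (p (dP Y y))).
  by rewrite -linearZ_LR kE linearD id_ pd.
rewrite /= (linearD (dP Y)) (linearZ_LR (dP Y)) addrACA -E -scalerDr -scalerDr.
by rewrite ip subrK.
Qed.

Lemma model_fgH : fg_homology Y -> forall k, exists zs : seq D,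
  (forall z, z \in zs -> gd D z = 0 /\ gp D k z = z) /\
  forall x, gd D x = 0 -> gp D k x = x -> exists y, spn zs (x - gd D y).
Proof.
move=> fg k; have [s [sc sE]] := fg (idx k).
pose ps (u : Y (idx k)) := p (sgl Y (idx k) u).
have ipsE u : i (ps u) = sgl Y (idx k) (i (ps u) (idx k)).
  by have := ips (idx k) (sgl Y (idx k) u); rewrite sgl_in.
exists [seq ps u | u <- s]; split.
  move=> z /mapP [u us ->]; split.
    by rewrite /ps -pd dP_sgl (sc u us : diff _ _ _ _ = 0) !linear0.
  by apply: iI; rewrite igp -ipsE.
move=> x dx kx; pose xi := i x (idx k).
have ix : i x = sgl Y (idx k) xi by rewrite -{1}kx igp.
have xic : is_cycle xi.
  have := congr1 (fun z : PP Y => z (idx k - 1)) (id_ x).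
  by rewrite dx linear0 ix dP_sgl sgl_in /is_cycle => <-.
have [c [eta etaE]] := sE xi xic.
exists (p (sgl Y (idx k + 1) eta)).
have -> : x - gd D (p (sgl Y (idx k + 1) eta)) = \sum_(m < size s) c m *: ps s`_m.
  rewrite -pd dP_sgl addrK etaE -{1}(pi x) ix -linearB -linearB opprB addrC subrK.
  rewrite !linear_sum; apply: eq_bigr => m _; rewrite /ps.
  by rewrite !linearZ_LR.
apply: sm_sum => m _ _; apply: smZ; apply: spn_mem; apply: map_f.
exact: mem_nth.
Qed.
End CoreModel.

Section CoreExists.
Variables (S : comNzRingType) (X : complex S).
Lemma eta_bound (Y : complex S) (eta : ghom X Y 0) j (x : X j) : chain_map eta ->
  is_boundary x -> is_boundary (eta j j x).
Proof. by move=> c [y <-]; exists (eta (j + 1) (j + 1) y); rewrite c. Qed.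

Lemma core_ex : dualizing X -> exists D : gdm S,
  [/\ injective_module D,
      forall F : {linear D -> D}, chain (gd D) (gd D) F -> exists (s : S) (k : {linear D -> D}),
        forall x, F x = s *: x + (gd D (k x) + k (gd D x)),
      forall (s : S) (k : {linear D -> D}),
        (forall x, s *: x = gd D (k x) + k (gd D x)) -> s = 0 &
      forall k, exists zs : seq D,
        (forall z, z \in zs -> gd D z = 0 /\ gp D k z = z) /\
        forall x, gd D x = 0 -> gp D k x = x -> exists y, spn zs (x - gd D y)].
Proof.
move=> [[M exX] fgX [Y [eta [rY [n0 Y0]]]] [Y' [eta' [rY' h1 h2 h3]]]].
have [Yk [c q]] := rY.
have exY (i : int) : M%:Z < i -> exact_at Y i.
  move=> Mi y yc; have [x [xc [y' yE]]] := proj2 (q i) y yc.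
  have [|x' x'E] := eta_bound c (x := x); first by apply: exX => //; lia.
  by exists (y' + x'); rewrite linearD yE x'E subrK.
have fgY : fg_homology Y.
  move=> i; have [s [sc sE]] := fgX i; exists [seq eta i i u | u <- s]; split.
    move=> z /mapP [u /sc us ->]; rewrite /is_cycle -c us.
    exact: (linear0 (eta (i - 1) (i - 1) : {linear _ -> _})).
  move=> y yc; have [x [xc [y' yE]]] := proj2 (q i) y yc.
  have [a bx] := sE x xc; exists a; have [x' x'E] := eta_bound c bx.
  exists (y' + x'); rewrite linearD yE x'E size_map.
  rewrite (linearB (eta i i : {linear _ -> _})) addrA subrK; congr (_ - _).
  rewrite (linear_sum (eta i i : {linear _ -> _})); apply: eq_bigr => m _.
  by rewrite (linearZ_LR (eta i i : {linear _ -> _})) (nth_map 0).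
have T1 := transfer_gen rY rY' h1 h2.
have T2 := transfer_inj rY rY' h3.
have [D [i [p [H [[g iI iD] [pi ip id_ pd] igp ips i0]]]]] := bounded_model Yk exY Y0.
exists D; split=> //.
- exact: (model_H1 T1 g iI pi id_ pd igp ips i0).
- exact: (model_H2 T2 ip id_ pd).
- exact: (model_fgH iI pi id_ pd igp ips fgY).
Qed.
End CoreExists.

(** * Transport of Gorenstein properties *)

Section Retracts.
Variable S : comNzRingType.
Local Notation id1 := (idfun : {rmorphism S -> S}).

(** [X] is a total module, product or direct sum, with each term of [G] as a retract: a cycle is
    pushed into [X], bounded there, and its primitive projected back. *)
Lemma tens_retract (G : complex S) (X J : lmodType S) (dX : {linear X -> X})
  (s : forall i, {linear G i -> X}) (r : forall i, {linear X -> G i}) :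
  (forall i x, r i (s i x) = x) ->
  (forall i x, dX (s i x) = s (i - 1) (diff G i (i - 1) x)) ->
  (forall i x, r i (dX x) = diff G (i + 1) i (r (i + 1) x)) ->
  exactd (tmap id1 (idfun : {linear J -> J}) dX) ->
  exact_complex (tens_module_complex J G).
Proof.
move=> rs ds rd ex i z zc0.
have zc : tmap id1 (idfun : {linear J -> J}) (diff G i (i - 1)) z = 0.
  by rewrite -[LHS]tens_mapE; exact: zc0.
have [|y yE] := ex (tmap id1 idfun (s i) z).
  rewrite (tmap_comp (h := idfun) (k := s (i - 1) \o diff G i (i - 1))) //.
  rewrite -(@tmap_comp S S id1 J J J _ _ _ idfun (diff G i (i - 1)) idfun (s (i - 1))) //.
  by rewrite zc linear0.
exists (tmap id1 idfun (r (i + 1)) y).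
change (tens_map id1 J (diff G (i + 1) i) (tmap id1 idfun (r (i + 1)) y) = z).
rewrite tens_mapE.
rewrite (tmap_comp (h := idfun) (k := r i \o dX)) => [|//|x]; last by rewrite /= rd.
rewrite -(@tmap_comp S S id1 J J J _ _ _ idfun dX idfun (r i)) // yE.
rewrite (tmap_comp (h := idfun) (k := idfun)) //; exact: tmap_id.
Qed.
End Retracts.

(** * Totally acyclic complexes of injectives: statements (a) and (c) *)

Section Final.
Variables (R S : comNzRingType) (phi : {rmorphism R -> S}).
Local Notation id1 := (idfun : {rmorphism S -> S}).
Hypothesis nS : noeth S.
Variable D : gdm S.
Hypothesis Dinj : injective_module D.
Hypothesis H1 : forall F : {linear D -> D}, chain (gd D) (gd D) F ->
  exists (s : S) (k : {linear D -> D}), forall x, F x = s *: x + (gd D (k x) + k (gd D x)).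
Hypothesis H2 : forall (s : S) (k : {linear D -> D}),
  (forall x, s *: x = gd D (k x) + k (gd D x)) -> s = 0.
Variables (N C : gdm S) (i : {linear N -> D}) (q : {linear D -> C}).
Hypotheses (iI : injective i) (qS : forall y, exists x, q x = y).
Hypothesis iq : forall x, q x = 0 <-> exists y, i y = x.
Hypotheses (im : gmor i) (qm : gmor q) (fgN : fgen N) (exC : exactd (gd C)).

Section GorensteinInjective.
Variable I : complex S.
Hypothesis Iinj : forall j, injective_module (I j).
Hypothesis Ihom : forall J : lmodType S, injective_module J ->
  exact_complex (hom_module_complex J I).

Lemma PP_inj : injective_module (PP I). Proof. exact: prodm_inj. Qed.

Lemma PP_hom_exact (J : lmodType S) (g : {linear J -> PP I}) : injective_module J ->
  (forall x, dP I (g x) = 0) -> exists h : {linear J -> PP I}, forall x, g x = dP I (h x).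
Proof.
move=> Jinj gd0; have cE j z : cmp I j z = z j by exact: comp_atE.
have h_ex j : exists h : {linear J -> I j}, forall x, diff I j (j - 1) (h x) = g x (j - 1).
  have e : j = j - 1 + 1 by rewrite subrK.
  have bd : is_boundary (X := hom_module_complex J I) (i := j - 1)
      (cmp I (j - 1) \o g : hom J (I (j - 1))).
    apply: (Ihom Jinj); apply: homP => x; rewrite /= cE.
    have := congr1 (fun z : PP I => z (j - 1 - 1)) (gd0 x); rewrite dPE.
    by rewrite subrK.
  have [h hE] := (is_boundE _ e).1 bd.
  exists (h : {linear J -> I j}) => x; have := congr1 (fun f : hom J (I (j - 1)) => f x) hE.
  by rewrite /= cE.
pose h j := projT1 (cid (h_ex j)).
have hE j x : diff I j (j - 1) (h j x) = g x (j - 1) by exact: (projT2 (cid (h_ex j)) x).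
have [k kE] := @prodm_lin S int (fun i => I i) J h.
exists k => x; apply: prodmP => j; rewrite dPE kE.
by have := hE (j + 1) x; rewrite addrK.
Qed.

Lemma null_PP (E : gdm S) : injective_module E -> nullh (gd E) (dP I).
Proof.
move=> Einj; apply: null_plain; first exact: dP_sq.
by move=> g gd0; apply: PP_hom_exact.
Qed.

Lemma null_N_PP : nullh (gd N) (dP I).
Proof.
have [ic _ _] := im; have [qc _ _] := qm.
have nC : nullh (gd C) (dP I).
  by apply: null_graded_exact => //; [apply: dP_sq|apply: PP_inj].
exact: (null_sub3 iI qS iq ic qc (@gsq _ D) PP_inj (@dP_sq _ I) (gsg C) (null_PP Dinj) nC).
Qed.

Lemma null_N_PP_flip : nullh (gd (flip N)) (dP I).
Proof.
have [ic _ _] := gmor_flip im; have [qc _ _] := gmor_flip qm.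
have nC : nullh (gd (flip C)) (dP I).
  by apply: null_graded_exact; [apply: dP_sq|apply: PP_inj|apply: exact_flip].
exact: (null_sub3 (A := flip N) (B := flip D) (C := flip C) iI qS iq ic qc (@gsq _ (flip D))
  PP_inj (@dP_sq _ I) (gsg (flip C)) (@null_PP (flip D) Dinj) nC).
Qed.

Section FlatTensor.
Variable F : lmodType R.
Hypothesis Ffl : flat_module F.
Let Y : lmodType S := tensor phi (PP I) F.
Let dY : {linear Y -> Y} := tmap phi (dP I) (idfun : {linear F -> F}).

Lemma dY_sq : sqz dY.
Proof.
move=> z; rewrite /dY (tmap_comp (h := \0) (k := idfun)) // => [|m]; last exact: dP_sq.
by elim/pt_ind: z => [|m x z IHz]; rewrite ?linear0 // linearD IHz tmapE pt0l addr0.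
Qed.
Lemma Y_inj : injective_module Y.
Proof. by apply: inj_tens_flat => //; apply: PP_inj. Qed.

(** [flat_factor] decomposes a chain map into PP I (x) F as a finite sum of chain maps into [PP I],
    each null-homotopic. *)
Lemma null_N_Y : nullh (gd (flip N)) dY.
Proof.
move=> f fc; have [l [y [g [fE gc]]]] := flat_factor nS Ffl fgN fc.
have [k kE] := choice (fun j => null_N_PP_flip (gc j)).
have [|K KE] := @linear_ex S N Y (fun n => \sum_j pt phi (k j n) (y j)).
  move=> a m n; rewrite scaler_sumr -big_split; apply: eq_bigr => j _.
  by rewrite linearP ptDl ptZ.
exists K => n; rewrite fE !KE linear_sum -big_split; apply: eq_bigr => j _.
by rewrite kE ptDl /dY /= tmapE.
Qed.

Lemma null_D_Y : nullh (gd (flip D)) dY.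
Proof.
have [ic _ _] := gmor_flip im; have [qc _ _] := gmor_flip qm.
have nC : nullh (gd (flip C)) dY.
  by apply: null_graded_exact; [apply: dY_sq|apply: Y_inj|apply: exact_flip].
exact: (null_ext (A := flip N) (B := flip D) (C := flip C) iI qS iq ic qc (@gsq _ (flip D))
  Y_inj dY_sq null_N_Y nC).
Qed.

Lemma good_Y (T : lmodType S) : injective_module T -> good dY T.
Proof.
apply: (good_all nS dY_sq Y_inj Dinj null_D_Y) => J Jinj.
exact: (section_ev nS Dinj H1 H2 iI qS iq im qm fgN exC Jinj).
Qed.

Fact tensF_shape a b : a != b + 1 ->
  forall z, tmap phi (diff I a b) (idfun : {linear F -> F}) z = 0.
Proof.
move=> ab z; elim/pt_ind: z => [|m x z IHz]; first exact: linear0.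
by rewrite linearD IHz tmapE diff_shape // pt0l addr0.
Qed.
Fact tensF_sq a b c z : tmap phi (diff I b c) (idfun : {linear F -> F})
  (tmap phi (diff I a b) idfun z) = 0.
Proof.
elim/pt_ind: z => [|m x z IHz]; first by rewrite !linear0.
by rewrite !linearD IHz !tmapE diff_diff pt0l addr0.
Qed.
Definition tensF : complex S := @Complex S (fun a => tensor phi (I a) F)
  (fun a b => tmap phi (diff I a b) idfun) tensF_shape tensF_sq.

(** Each I a (x) F is a retract of PP I (x) F, so primitives found over the whole product can be
    projected to one degree. *)
Lemma tensF_hom (J : lmodType S) : injective_module J ->
  exact_complex (hom_module_complex J tensF).
Proof.
move=> Jinj a g; rewrite /is_cycle => /(congr1 (fun f : hom _ _ => (f : _ -> _))) gc0.
have gc x : tmap phi (diff I a (a - 1)) (idfun : {linear F -> F}) ((g : hom _ _) x) = 0.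
  by have := congr1 (fun f => f x) gc0.
have cE j z : cmp I j z = z j by exact: comp_atE.
pose f : {linear J -> Y} := tmap phi (sgl I a) idfun \o (g : {linear J -> tensF a}).
have [|k kE] := good_Y Jinj (f := f).
  move=> x; rewrite /dY /f /=.
  rewrite (tmap_comp (h := sgl I (a - 1) \o diff I a (a - 1)) (k := idfun)) // => [|m].
    rewrite -(@tmap_comp R S phi _ _ _ _ _ _ (diff I a (a - 1)) idfun (sgl I (a - 1)) idfun) //.
    by rewrite gc linear0.
  by rewrite /= dP_sgl.
exists ((tmap phi (cmp I (a + 1)) idfun \o k) : hom J (tensF (a + 1))).
apply: homP => x; change (tmap phi (diff I (a + 1) a) (idfun : {linear F -> F})
  (tmap phi (cmp I (a + 1)) idfun (k x)) = (g : hom _ _) x).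
rewrite (tmap_comp (h := cmp I a \o dP I) (k := idfun)) // => [|m]; last first.
  by rewrite /= !cE dPE.
rewrite -(@tmap_comp R S phi _ _ _ _ _ _ (dP I) idfun (cmp I a) idfun) //.
have <- : f x = tmap phi (dP I) idfun (k x) := kE x.
rewrite /f /= (tmap_comp (h := idfun) (k := idfun)) // => [|m]; first exact: tmap_id.
by rewrite cE sgl_in.
Qed.

Lemma gorenstein_injective_tensor (B : lmodType S) : exact_complex I ->
  is_kernel B (diff I 0 (-1)) -> gorenstein_injective (tensor phi B F).
Proof.
move=> Iex [u [uI uk]]; exists tensF; split.
- move=> a z zc; apply: (@flat_exact R S phi F _ _ _ (diff I (a + 1) a) (diff I a (a - 1)) Ffl _ z zc).
  by move=> x xc; apply: Iex.
- by move=> a; apply: inj_tens_flat.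
- exists (tmap phi u idfun); split; first exact: flatl.
  move=> z; split.
    by apply: (flat_exact Ffl) => x /uk.
  move=> [y <-]; elim/pt_ind: y => [|m x y IHy]; first by rewrite !linear0.
  rewrite !linearD IHy addr0 tmapE /= tmapE.
  have -> : diff I 0 (-1) (u m) = 0 by apply/uk; exists m.
  exact: pt0l.
- exact: tensF_hom.
Qed.
End FlatTensor.

Section InjectiveHom.
Variable E : lmodType R.
Hypothesis Einj : injective_module E.
Let X : lmodType S := hom_dom phi (PP I) E.
Let dX : {linear X -> X} := dom_map phi E (dP I).

Lemma dX_sq : sqz dX.
Proof.
move=> g; apply: homP => x; rewrite /dX !dom_mapE dP_sq.
exact: (linear0 (g : {linear restr phi (PP I) -> E})).
Qed.
Lemma X_flat : flat_module X. Proof. by apply: dom_flat => //; apply: PP_inj. Qed.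

(** Homomorphism evaluation turns N (x) Hom(PP I, E) into the E-dual of Hom(N, PP I), which is exact
    by [null_N_PP]. *)
Lemma ttot_N_dom : exactd (ttot (flip N) dX).
Proof.
have [|dl dlE] := @linear_ex S (hom N (PP I)) (hom N (PP I))
   (fun f => (f \o (ge N \o gd N) \+ (dP I \o (f \o ge N)) : {linear N -> PP I}) : hom N (PP I)).
  move=> a f g; apply: homP => x.
  change ((a *: f (ge N (gd N x)) + g (ge N (gd N x))) + dP I (a *: f (ge N x) + g (ge N x)) =
    a *: (f (ge N (gd N x)) + dP I (f (ge N x))) + (g (ge N (gd N x)) + dP I (g (ge N x)))).
  by rewrite (linearP (dP I)) scalerDr addrACA.
have {}dlE (f : hom N (PP I)) x :
    (dl f : hom _ _) x = f (ge N (gd N x)) + dP I (f (ge N x)) by rewrite dlE.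
have dl_ex : forall f, dl f = 0 -> exists h, dl h = f.
  move=> f f0; have f0x x : f (ge N (gd N x)) + dP I (f (ge N x)) = 0.
    by rewrite -dlE f0.
  have [|l lE] := antinull (gsg N) null_N_PP (a := f \o ge N).
    move=> x /=; apply/eqP; rewrite -addr_eq0 addrC; apply/eqP; exact: f0x.
  exists (l : hom N (PP I)); apply: homP => x; rewrite dlE.
  have := lE (ge N x); rewrite /= (proj1 (gsg N)) => ->.
  by rewrite (proj2 (gsg N)) linearN opprK addrC.
pose w := wdom phi (PP I) E N.
have [wS wI] := @wdom_bij R S phi (PP I) E nS Einj N fgN.
have wt m (f : hom N (PP I)) : (w (ttot (flip N) dX m) : hom _ _) f = (w m : hom _ _) (dl f).
  elim/pt_ind: m => [|x g m IHm]; first by rewrite !linear0.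
  rewrite !linearD -[LHS]/((w (ttot (flip N) dX (pt id1 x g)) : hom _ _) f +
     (w (ttot (flip N) dX m) : hom _ _) f) IHm; congr (_ + _).
  rewrite ttotE linearD -[LHS]/((w (pt id1 (gd (flip N) x) g) : hom _ _) f +
     (w (pt id1 (ge (flip N) x) (dX g)) : hom _ _) f) !wdomE dom_mapE dlE.
  exact: (esym (linearD (g : {linear restr phi (PP I) -> E}) _ _)).
move=> z zc; have [|h hE] := @restr_inj_fact R S phi E Einj _ _ dl (w z).
  move=> f /dl_ex [g <-]; rewrite -wt zc /w linear0.
  by [].
have [y yE] := wS h; exists y; apply/eqP; rewrite -subr_eq0; apply/eqP/wI.
apply: homP => f; rewrite linearB -[LHS]/((w (ttot (flip N) dX y) : hom _ _) f -
  (w z : hom _ _) f) wt -hE dom_mapE /w yE.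
exact: subrr.
Qed.

(** Hom(-, E) reverses arrows; negating the index restores homological grading and turns the kernel
    at I 0 into the cokernel in degree 0. *)
Definition domE : int -> lmodType S := fun a => hom_dom phi (I (- a)) E.
Definition domEd a b : {linear domE a -> domE b} := dom_map phi E (diff I (- b) (- a)).
Fact domE_shape a b : a != b + 1 -> forall g, domEd a b g = 0.
Proof.
move=> ab g; apply: homP => x; rewrite /domEd dom_mapE diff_shape.
  exact: (linear0 (g : {linear restr phi (I (- a)) -> E})).
by apply: contraNneq ab => /(congr1 -%R); rewrite opprK => ->; apply/eqP; ring.
Qed.
Fact domE_sq a b c g : domEd b c (domEd a b g) = 0.
Proof.
apply: homP => x; rewrite /domEd !dom_mapE diff_diff.
exact: (linear0 (g : {linear restr phi (I (- a)) -> E})).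
Qed.
Definition domC : complex S := Complex domE_shape domE_sq.

Lemma domC_tens (J : lmodType S) : injective_module J ->
  exact_complex (tens_module_complex J domC).
Proof.
move=> Jinj; have cE j z : cmp I j z = z j by exact: comp_atE.
apply: (@tens_retract S domC X J dX (fun a => dom_map phi E (cmp I (- a)))
  (fun a => dom_map phi E (sgl I (- a)))).
- move=> a g; apply: homP => x; rewrite !dom_mapE cE sgl_in //.
- move=> a g; apply: homP => x.
  change ((g : hom _ _) (cmp I (- a) (dP I x)) =
    (g : hom _ _) (diff I (- (a - 1)) (- a) (cmp I (- (a - 1)) x))).
  rewrite !cE dPE; have -> : - (a - 1) = - a + 1 by ring.
  by [].
- move=> a g; apply: homP => x.
  change ((g : hom _ _) (dP I (sgl I (- a) x)) =
    (g : hom _ _) (sgl I (- (a + 1)) (diff I (- a) (- (a + 1)) x))).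
  rewrite dP_sgl; have -> : - a - 1 = - (a + 1) by ring.
  by [].
apply: (tens_exact_model nS Dinj H1 H2 iI qS iq im qm fgN exC dX_sq X_flat _ Jinj).
exact: ttot_N_dom.
Qed.

Lemma gorenstein_flat_dom (B : lmodType S) : exact_complex I ->
  is_kernel B (diff I 0 (-1)) -> gorenstein_flat (hom_dom phi B E).
Proof.
move=> Iex [u [uI uk]]; exists domC; split.
- move=> a g gc.
  have g0 (x : I (- a)) : diff I (- a) (- (a + 1)) x = 0 -> (g : hom _ _) x = 0.
    have -> : - (a + 1) = - a - 1 by ring.
    move=> /Iex [y yE]; have := congr1 (fun f : domE (a - 1) => f : _ -> _) gc.
    rewrite /= /domEd => g0.
    have {}g0 z : (g : hom _ _) (diff I (- (a - 1)) (- a) z) = 0.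
      by have := congr1 (fun f => f z) g0.
    have e1 : - (a - 1) = - a + 1 by ring.
    by move: g0; rewrite e1 => g0; rewrite -yE g0.
  have [h hE] := @restr_inj_fact R S phi E Einj _ _ (diff I (- a) (- (a + 1))) g g0.
  by exists h.
- by move=> a; apply: dom_flat.
- have u0 x : u x = 0 -> x = 0 by move=> ux; apply: uI; rewrite ux linear0.
  exists (dom_map phi E u : {linear domE 0 -> hom_dom phi B E}); split.
    move=> g; have [|h hE] := @restr_inj_fact R S phi E Einj _ _ u g; last by exists h.
    by move=> a /u0 ->; apply: (linear0 (g : {linear restr phi B -> E})).
  move=> g; split.
    move=> gu; have [|h hE] := @restr_inj_fact R S phi E Einj (I 0) (I (- 1)) (diff I 0 (- 1)) g; last by exists h.
    move=> x /uk [b <-]; have := congr1 (fun f : hom_dom phi B E => (f : hom _ _) b) gu.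
    by rewrite dom_mapE.
  move=> [h <-]; apply: homP => b.
  have ub : diff I 0 (-1) (u b) = 0 by apply/uk; exists b.
  rewrite -[LHS]/((h : hom _ _) (diff I 0 (-1) (u b))) ub.
  exact: (linear0 (h : {linear restr phi (I (- 1)) -> E})).
- exact: domC_tens.
Qed.
End InjectiveHom.
End GorensteinInjective.
End Final.

(** * Gorenstein flatness of Hom from a projective module *)

Section CodFlat.
Variables (R S : comNzRingType) (phi : {rmorphism R -> S}).
Local Notation id1 := (idfun : {rmorphism S -> S}).
Hypothesis nS : noeth S.
Variable D : gdm S.
Hypothesis Dinj : injective_module D.
Hypothesis H1 : forall F : {linear D -> D}, chain (gd D) (gd D) F ->
  exists (s : S) (k : {linear D -> D}), forall x, F x = s *: x + (gd D (k x) + k (gd D x)).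
Hypothesis H2 : forall (s : S) (k : {linear D -> D}),
  (forall x, s *: x = gd D (k x) + k (gd D x)) -> s = 0.
Variables (N C : gdm S) (i : {linear N -> D}) (q : {linear D -> C}).
Hypotheses (iI : injective i) (qS : forall y, exists x, q x = y).
Hypothesis iq : forall x, q x = 0 <-> exists y, i y = x.
Hypotheses (im : gmor i) (qm : gmor q) (fgN : fgen N) (exC : exactd (gd C)).

Variable F : complex S.
Hypothesis Ffl : forall j, flat_module (F j).
Hypothesis Ften : forall J : lmodType S, injective_module J ->
  exact_complex (tens_module_complex J F).
(** A direct sum, because it commutes with tensoring by an arbitrary [J]; flatness passes to it by
    [ds_flat]. *)
Let DS : lmodType S := dsum (fun j : int => F j).
Let inc j : {linear F j -> DS} := ds_in (fun j : int => F j) j.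
Let prj j : {linear DS -> F j} := ds_pr (fun j : int => F j) j.

Lemma dS_ex : exists d : {linear DS -> DS}, forall z j,
  prj j (d z) = diff F (j + 1) j (prj (j + 1) z).
Proof.
have [|g gE] := @ds_map S int (fun j : int => F j) DS (fun j => diff F (j + 1) j \o prj (j + 1)).
  move=> z; have [s sE] := ds_fin z; exists [seq j - 1 | j <- s] => j js /=.
  rewrite /prj sE ?linear0 //; apply: contraNN js => js; apply/mapP.
  by exists (j + 1); rewrite ?addrK.
by exists g => z j; apply: gE.
Qed.
Definition dS : {linear DS -> DS} := projT1 (cid dS_ex).
Lemma dSE z j : prj j (dS z) = diff F (j + 1) j (prj (j + 1) z).
Proof. exact: (projT2 (cid dS_ex)). Qed.

Lemma prj_in j x : prj j (inc j x) = x. Proof. exact: ds_pr_in. Qed.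
Lemma prj_out j k x : j != k -> prj k (inc j x) = 0. Proof. exact: ds_pr_out. Qed.
Lemma dS_sq : sqz dS.
Proof.
move=> z; apply: ds_ext => j; rewrite -[LHS]/(prj j (dS (dS z))) !dSE diff_diff.
exact: esym (linear0 _).
Qed.
Lemma dS_in j x : dS (inc j x) = inc (j - 1) (diff F j (j - 1) x).
Proof.
apply: ds_ext => k; rewrite -[LHS]/(prj k (dS (inc j x))) dSE.
rewrite -[RHS]/(prj k (inc (j - 1) _)).
have [e|ne] := eqVneq j (k + 1); first by subst j; rewrite addrK !prj_in.
rewrite !prj_out ?linear0 //; apply: contraNneq ne => <-.
by rewrite subrK.
Qed.
Lemma DS_flat : flat_module DS. Proof. exact: ds_flat. Qed.

Lemma DS_tens (J : lmodType S) : injective_module J ->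
  exactd (tmap id1 (idfun : {linear J -> J}) dS).
Proof.
move=> Jinj z dz; have [s sE] := ds_tensr z.
have w_ex j : exists w : tens J (F (j + 1)),
   tmap id1 idfun (diff F (j + 1) j) w = tmap id1 (idfun : {linear J -> J}) (prj j) z.
  have [|w wE] := @Ften J Jinj j (tmap id1 (idfun : {linear J -> J}) (prj j) z).
    change (tens_map id1 J (diff F j (j - 1)) (tmap id1 idfun (prj j) z) = 0); rewrite tens_mapE.
    rewrite (tmap_comp (h := idfun) (k := prj (j - 1) \o dS)) // => [|x].
      rewrite -(@tmap_comp S S id1 J J J _ _ _ idfun dS idfun (prj (j - 1))) //.
      by rewrite dz linear0.
    by rewrite /= dSE subrK.
  by exists w; rewrite -wE; apply: esym; apply: tens_mapE.
have [w wE] : exists w : forall j, tens J (F (j + 1)), forall j,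
   tmap id1 idfun (diff F (j + 1) j) (w j) = tmap id1 (idfun : {linear J -> J}) (prj j) z.
  by exists (fun j => projT1 (cid (w_ex j))) => j; exact: projT2 (cid (w_ex j)).
exists (\sum_(j <- undup s) tmap id1 idfun (inc (j + 1)) (w j)).
rewrite linear_sum [RHS](sE (undup s)) ?undup_uniq //; last first.
  by move=> j; rewrite mem_undup.
apply: eq_bigr => j _; rewrite -[ds_pr _ j]/(prj j) -wE.
rewrite (tmap_comp (h := idfun) (k := inc j \o diff F (j + 1) j)) // => [|x].
  by rewrite (tmap_comp (h := idfun) (k := inc j \o diff F (j + 1) j)).
by rewrite /= dS_in addrK.
Qed.

(** [D] is injective, so tensoring [dS] with it stays exact; filtering by the degree of [D] brings
    in its differential. *)
Lemma ttot_D_DS : exactd (ttot (flip D) dS).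
Proof.
have gr := tmap_grading (flip D) DS.
apply: (exact_keeps gr (@ttot_keeps _ (flip D) DS dS) (@ttot_lowers _ (flip D) DS)) => //.
- by move=> z; rewrite ttot_def addrC.
- exact: (@ttot_sq _ (flip D) DS dS dS_sq).
move=> z dz; have ee x : ge D (ge D x) = x by exact: (proj1 (gsg D)).
have [|y yE] := DS_tens Dinj (x := tmap id1 (ge D) (idfun : {linear DS -> DS}) z).
  by rewrite (tmap_comp (h := ge D) (k := dS)).
exists y; rewrite -[ge (flip D)]/(ge D).
rewrite -(@tmap_comp S S id1 _ _ _ _ _ _ idfun dS (ge D) idfun) // yE.
by rewrite (tmap_comp (h := idfun) (k := idfun)) //; apply: tmap_id.
Qed.

Lemma ttot_N_DS : exactd (ttot (flip N) dS).
Proof.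
have [jI qS' jq] := tens_short iI qS iq DS_flat.
have ic := @ttot_chain _ (flip N) (flip D) i _ dS (gmor_flip im).
have qc := @ttot_chain _ (flip D) (flip C) q _ dS (gmor_flip qm).
refine (exact_sub jI qS' jq ic qc _ ttot_D_DS _); first exact: (@ttot_sq _ (flip D) DS dS dS_sq).
exact: (@ttot_exact _ (flip C) DS dS dS_sq DS_flat (exact_flip exC)).
Qed.

Variable P : lmodType R.
Hypothesis Pproj : projective_module P.
Let X : lmodType S := hom_cod phi P DS.
Let dX : {linear X -> X} := cod_map phi P dS.

Lemma dXc_sq : sqz dX.
Proof. by move=> g; apply: homP => x; rewrite /dX !cod_mapE dS_sq. Qed.
Lemma Xc_flat : flat_module X. Proof. by apply: cod_flat => //; apply: DS_flat. Qed.

Lemma cod_exact (A B E : lmodType S) (f : {linear A -> B}) (g : {linear B -> E})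
  (h : hom_cod phi P B) : (forall x, g x = 0 -> exists y, f y = x) ->
  cod_map phi P g h = 0 -> exists k : hom_cod phi P A, cod_map phi P f k = h.
Proof.
move=> fg gh; apply: proj_lift => // x; apply: fg.
by have := congr1 (fun u : hom_cod phi P E => (u : hom _ _) x) gh; rewrite cod_mapE.
Qed.

(** Tensor evaluation identifies N (x) Hom(P, DS) with Hom(P, N (x) DS), and projectivity of [P]
    preserves exactness. *)
Lemma ttot_N_cod : exactd (ttot (flip N) dX).
Proof.
pose w := wcod phi DS P N.
have [wS wI] := @wcod_bij R S phi DS P nS Pproj N fgN.
have wt z : w (ttot (flip N) dX z) = cod_map phi P (ttot (flip N) dS) (w z).
  elim/pt_ind: z => [|m g z IHz]; first by rewrite !linear0.
  rewrite !linearD IHz; congr (_ + _); apply: homP => x.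
  rewrite ttotE linearD cod_mapE.
  rewrite -[LHS]/((w (pt id1 (gd (flip N) m) g) : hom _ _) x +
     (w (pt id1 (ge (flip N) m) (dX g)) : hom _ _) x) /w !wcodE.
  by rewrite [RHS]ttotE.
move=> z zc; have [|k kE] := @cod_exact _ _ _ (ttot (flip N) dS) (ttot (flip N) dS) (w z) ttot_N_DS.
  by rewrite -wt zc linear0.
have [y yE] := wS k; exists y; apply/eqP; rewrite -subr_eq0; apply/eqP/wI.
by rewrite linearB -/w wt /w yE kE subrr.
Qed.

Fact codF_shape a b : a != b + 1 -> forall g, cod_map phi P (diff F a b) g = 0.
Proof. by move=> ab g; apply: homP => x; rewrite cod_mapE diff_shape. Qed.
Fact codF_sq a b c g : cod_map phi P (diff F b c) (cod_map phi P (diff F a b) g) = 0.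
Proof. by apply: homP => x; rewrite !cod_mapE diff_diff. Qed.
Definition codF : complex S := @Complex S (fun a => hom_cod phi P (F a))
  (fun a b => cod_map phi P (diff F a b)) codF_shape codF_sq.

Lemma codF_tens (J : lmodType S) : injective_module J ->
  exact_complex (tens_module_complex J codF).
Proof.
move=> Jinj; apply: (@tens_retract S codF X J dX (fun a => cod_map phi P (inc a))
  (fun a => cod_map phi P (prj a))).
- by move=> a g; apply: homP => x; rewrite !cod_mapE prj_in.
- move=> a g; apply: homP => x.
  change (dS (inc a ((g : hom _ _) x)) = inc (a - 1) (diff F a (a - 1) ((g : hom _ _) x))).
  exact: dS_in.
- move=> a g; apply: homP => x.
  change (prj a (dS ((g : hom _ _) x)) = diff F (a + 1) a (prj (a + 1) ((g : hom _ _) x))).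
  exact: dSE.
apply: (tens_exact_model nS Dinj H1 H2 iI qS iq im qm fgN exC dXc_sq Xc_flat _ Jinj).
exact: ttot_N_cod.
Qed.

Lemma gorenstein_flat_cod (A : lmodType S) : exact_complex F ->
  is_cokernel A (diff F 1 0) -> gorenstein_flat (hom_cod phi P A).
Proof.
move=> Fex [p [pS pk]]; exists codF; split.
- move=> a g gc; apply: (cod_exact (g := diff F a (a - 1))) => //.
  by move=> x xc; apply: Fex.
- by move=> a; apply: cod_flat.
- exists (cod_map phi P p); split.
    by move=> g; apply: proj_lift => // x; apply: pS.
  move=> g; split.
    by apply: cod_exact => x /pk.
  move=> [h <-]; apply: homP => x.
  change (p (diff F 1 0 ((h : hom _ _) x)) = 0).
  by apply/pk; exists ((h : hom _ _) x).
- exact: codF_tens.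
Qed.
End CodFlat.

Theorem mainTheorem2 (R S : comNzRingType) (phi : {rmorphism R -> S})
    (fd_phi : finite_flat_dimension (restr phi S^o))
    (noeth_S : noetherian S)
    (dualizing_S : exists D : complex S, dualizing D) :
  (forall (B : lmodType S) (F : lmodType R),
      gorenstein_injective B -> flat_module F ->
      gorenstein_injective (tensor phi B F)) /\
  (forall (P : lmodType R) (A : lmodType S),
      projective_module P -> gorenstein_flat A ->
      gorenstein_flat (hom_cod phi P A)) /\
  (forall (B : lmodType S) (I : lmodType R),
      gorenstein_injective B -> injective_module I ->
      gorenstein_flat (hom_dom phi B I)).
Proof.
have nS := noetherianE noeth_S.
have [X /core_ex [D [Dinj H1 H2 fgH]]] := dualizing_S.
have [N [C [i [q [iI qS iq [im qm] [fgN exC]]]]]] := sub_model nS fgH.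
split; last split.
- move=> B F [I [Iex Iinj Iker Ihom]] Ffl.
  exact: (gorenstein_injective_tensor phi nS Dinj H1 H2 iI qS iq im qm fgN exC
    Iinj Ihom Ffl Iex Iker).
- move=> P A Pproj [F [Fex Ffl Fcok Ften]].
  exact: (gorenstein_flat_cod phi nS Dinj H1 H2 iI qS iq im qm fgN exC
    Ffl Ften Pproj Fex Fcok).
- move=> B E [I [Iex Iinj Iker Ihom]] Einj.
  exact: (gorenstein_flat_dom phi nS Dinj H1 H2 iI qS iq im qm fgN exC
    Iinj Ihom Einj Iex Iker).
Qed.
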